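(* Let $\mathbb{X}=G/K$ be a rank one Riemannian symmetric space of non-compact type and let $a>1$. Let $s>\frac12$ and let $f\in H^s(\mathbb{X})$ be a radial function with compact support. Let $u(x,t)=S_tf(x)$ be the solution of the fractional Schrödinger equation $i\,\partial_t u=\Delta^{a/2}u$ on $\mathbb{X}\times\mathbb{R}$ with $u(x,0)=f(x)$, that is, $$u(x,t)=S_tf(x)=c\int_0^\infty \widehat f(\lambda)\,e^{it(\lambda^2+\rho^2)^{a/2}}\,\phi_\lambda(x)\,|c(\lambda)|^{-2}\,d\lambda .$$ Then $\lim_{t\to 0}u(x,t)=f(x)$ for almost every $x\in\mathbb{X}$.
   Context: $G$ is a connected noncompact semisimple Lie group with finite center and real rank one, with Lie algebra $\mathfrak g$, Cartan involution $\theta$, Cartan decomposition $\mathfrak g=\mathfrak k\oplus\mathfrak p$, maximal compact subgroup $K=\exp\mathfrak k$, and $\mathbb{X}=G/K$, with base point $o=eK$. $\mathfrak a$ is a maximal abelian subspace of $\mathfrak p$ (so $\dim\mathfrak a=1$). The nonzero roots are $\{\pm\alpha\}$ or $\{\pm\alpha,\pm2\alpha\}$, with $\mathfrak g_\beta=\{X\in\mathfrak g:[H,X]=\beta(H)X\ \forall H\in\mathfrak a\}$, $m_1=\dim\mathfrak g_\alpha$, $m_2=\dim\mathfrak g_{2\alpha}$ (possibly $0$), $\mathfrak n=\mathfrak g_\alpha\oplus\mathfrak g_{2\alpha}$, $N=\exp\mathfrak n$. $H_0\in\mathfrak a$ is the element with $\alpha(H_0)=1$, and $a_t=\exp(tH_0)$,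 $A=\{a_t:t\in\mathbb{R}\}$. Identify $\mathfrak a^*$ and $\mathfrak a^*_{\mathbb{C}}$ with $\mathbb{R}$ and $\mathbb{C}$ via $z\mapsto z\alpha$, and $\mathfrak a$ with $\mathbb{R}$ via $t\mapsto tH_0$. Put $\rho=\frac12(m_1+2m_2)$ and $n=\dim\mathbb{X}=m_1+m_2+1$. Functions on $\mathbb{X}$ are right $K$-invariant functions on $G$; radial functions are the $K$-biinvariant functions on $G$. The measure on $\mathbb{X}$ is the $G$-invariant Riemannian measure; in polar coordinates $G=K\overline{A^+}K$ ($\overline{A^+}=\{a_t:t\ge0\}$) the Haar measure is $\int_G f\,dg=C\int_K\int_0^\infty\int_K f(k_1a_tk_2)D(t)\,dk_1\,dt\,dk_2$, $D(t)=(\sinh t)^{m_1}(\sinh 2t)^{m_2}$. $\Delta$ is the Laplace–Beltrami operator of $\mathbb{X}$, the metric being normalized so that $H_0$ has norm $1$. The Iwasawa decomposition is $g=k(g)\exp(H(g))\,n(g)\in KAN$. For $\lambda\in\mathbb{C}$ the spherical function is $\phi_\lambda(x)=\int_K e^{-(i\lambda+\rho)H(x^{-1}k)}\,dk$; it is the radial function with $\Delta\phi_\lambda=-(\lambda^2+\rho^2)\phi_\lambda$ and $\phi_\lambda(o)=1$. The spherical Fourier transform of a suitable radial function $f$ is $\widehat f(\lambda)=\int_{\mathbb{X}}f(x)\phi_\lambda(x)\,dx$, $\lambda\in\mathbb{R}$. $c(\lambda)$ is the Harish-Chandra $\mathbf c$-function, i.e. the meromorphic function with $c(\lambda)=\lim_{t\to\infty}e^{(\rho-i\lambda)t}\phi_\lambda(a_t)$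 for $\operatorname{Im}\lambda<0$. The constant $c>0$ in front of the integral is the one in the inversion formula $f(x)=c\int_0^\infty\widehat f(\lambda)\phi_\lambda(x)|c(\lambda)|^{-2}d\lambda$, valid for smooth compactly supported radial $f$. Sobolev space: for $s\in\mathbb{R}$, $H^s(\mathbb{X})$ is the image of $L^2(\mathbb{X})$ under $(-\Delta)^{-s/2}$, with norm $\|f\|_{H^s}=\|(-\Delta)^{s/2}f\|_{L^2}$; for radial $f$, up to a normalizing constant, $\|f\|_{H^s}^2=\int_0^\infty(\lambda^2+\rho^2)^s|\widehat f(\lambda)|^2|c(\lambda)|^{-2}\,d\lambda$. *)

(* Defs.v *)
From HB Require Import structures.
From mathcomp Require Import all_boot all_order all_algebra.
From mathcomp Require Import all_classical all_reals all_analysis.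
From mathcomp Require Import measurable_realfun complex.

Set Implicit Arguments.
Unset Strict Implicit.
Unset Printing Implicit Defensive.

Import Order.TTheory GRing.Theory Num.Theory.
Import numFieldNormedType.Exports.

Local Open Scope classical_set_scope.
Local Open Scope ring_scope.

HB.mixin Record isTopGroup G of Group G & PointedTopological G := {
  mulg_continuous : continuous (fun p : G * G => (p.1 * p.2)%g);
  invg_continuous : continuous (fun x : G => (x^-1)%g)
}.

#[short(type="topGroupType")]
HB.structure Definition TopGroup :=
  {G of Group G & PointedTopological G & isTopGroup G}.

(* Finite-dimensional normed spaces; the norm only serves to fix the topology,
   which does not depend on it. *)
#[short(type="normedVectType")]
HB.structure Definition NormedVector (R : numFieldType) :=
  {V of Vector R V & NormedModule R V}.

(* Of class C^k on the open set U. *)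
Fixpoint Ck_on (R : realType) (V W : normedModType R) (k : nat) (U : set V)
    (f : V -> W) : Prop :=
  {in U, continuous f} /\
  if k is j.+1 then
    forall v, {in U, forall x, derivable f x v} /\ Ck_on j U ('D_v f)
  else True.

Definition smooth_near (R : realType) (V W : normedModType R) (x : V)
    (f : V -> W) : Prop :=
  exists U, open_nbhs x U /\ forall k, Ck_on k U f.

Record is_lie_bracket (R : realType) (g : vectType R) (br : g -> g -> g)
    : Prop := IsLieBracket {
  lie_linearl : forall Y, linear (br^~ Y);
  lie_linearr : forall X, linear (br X);
  lie_alternating : forall X, br X X = 0;
  lie_jacobi : forall X Y Z, br X (br Y Z) + br Y (br Z X) + br Z (br X Y) = 0
}.

(* The topological group G is a Lie group with Lie algebra (g, br) and
   exponential map ex: ex is a chart at the identity which is a one-parameter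
   group along each line, multiplication is smooth in this chart, and the
   bracket is the antisymmetrised mixed second derivative at the origin of
   (X, Y) |-> log (exp X exp Y). *)
Record is_lie_exp (R : realType) (G : topGroupType) (g : normedVectType R)
    (br : g -> g -> g) (ex : g -> G) : Prop := IsLieExp {
  lie_exp_line : forall (s t : R) X,
    ex ((s + t) *: X) = (ex (s *: X) * ex (t *: X))%g;
  lie_exp_chart : exists U : set g, [/\ open_nbhs 0 U, {in U &, injective ex},
    {in U, continuous ex} & forall V, V `<=` U -> open V -> open (ex @` V)];
  lie_exp_mul : exists m : g * g -> g,
    [/\ m (0, 0) = 0, smooth_near (0, 0) m,
        \forall p \near nbhs ((0, 0) : g * g), ex (m p) = (ex p.1 * ex p.2)%g
      & forall X Y, br X Y = 'D_((X, 0) : g * g) ('D_((0, Y) : g * g) m) (0, 0)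
                           - 'D_((Y, 0) : g * g) ('D_((0, X) : g * g) m) (0, 0)]
}.

Section LieAlgebra.
Variables (R : realType) (g : vectType R) (br : g -> g -> g).

Definition ad (X : g) : 'End(g) := linfun (br X).

Definition killing (X Y : g) : R := \tr (passmx.mxof (vbasis {:g}) (vbasis {:g}) (ad X \o ad Y)%VF).

Definition semisimple_lie : Prop :=
  forall X, (forall Y, killing X Y = 0) -> X = 0.

Definition is_cartan_involution (theta : 'End(g)) : Prop :=
  [/\ forall X, theta (theta X) = X,
      forall X Y, theta (br X Y) = br (theta X) (theta Y)
    & forall X, X != 0 -> killing X (theta X) < 0].

Definition abelian_in (p a : {vspace g}) : Prop :=
  (a <= p)%VS /\ {in a &, forall X Y, br X Y = 0}.

Definition maximal_abelian_in (p a : {vspace g}) : Prop :=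
  abelian_in p a /\ forall b, abelian_in p b -> (a <= b)%VS -> b = a.

End LieAlgebra.

(* The data of a rank one Riemannian symmetric space G/K of noncompact type.
   As dim a = 1, the root z alpha is identified with the scalar z, and its root
   space is the eigenspace of ad H0 for the eigenvalue z, where alpha(H0) = 1. *)
Record rankOneSpace (R : realType) := RankOneSpace {
  isom_group :> topGroupType;
  lie_alg : normedVectType R;
  bracket : lie_alg -> lie_alg -> lie_alg;
  lie_exp : lie_alg -> isom_group;
  cartan_inv : 'End(lie_alg);
  flat : {vspace lie_alg};
  H0 : lie_alg;
  group_hausdorff : hausdorff_space isom_group;
  group_connected : connected [set: isom_group];
  group_noncompact : ~ compact [set: isom_group];
  bracket_lie : is_lie_bracket bracket;
  lie_expP : is_lie_exp bracket lie_exp;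
  semisimpleP : semisimple_lie bracket;
  finite_center :
    finite_set [set z : isom_group | forall x : isom_group, (z * x = x * z)%g];
  cartan_invP : is_cartan_involution bracket cartan_inv;
  flat_maximal :
    maximal_abelian_in bracket (passmx.leigenspace cartan_inv (- 1)) flat;
  rank_one : \dim flat = 1%N;
  H0_flat : H0 \in flat;
  alpha_root : passmx.leigenvalue (ad bracket H0) 1;
  restricted_roots : forall z : R, z != 0 -> passmx.leigenvalue (ad bracket H0) z ->
    z \in [:: 1; - 1; 2; - 2]
}.

Definition Borel (G : ptopologicalType) := g_sigma_algebraType (@open G).

(* Num.ClosedField structure on R[i], through which the topology and the
   complex derivative of the library are available. *)
Definition Cplx (R : realType) : numClosedFieldType := R[i].

Section ComplexAnalysis.
Variable R : realType.
Implicit Types z : Cplx R.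

Definition ofR (x : R) : Cplx R := Complex x 0.
Definition ImUnit : Cplx R := Complex 0 1.
Definition re z : R := complex.Re z.
Definition im z : R := complex.Im z.
Definition cabs z : R := Normc.normc z.

Definition cexp z : Cplx R :=
  Complex (expR (re z) * cos (im z)) (expR (re z) * sin (im z)).

Definition cintegral d (T : measurableType d) (mu : {measure set T -> \bar R})
    (D : set T) (f : T -> Cplx R) : Cplx R :=
  Complex (\int[mu]_(x in D) re (f x)) (\int[mu]_(x in D) im (f x)).

(* Values at poles, and at removable singularities, are arbitrary. *)
Definition meromorphic (h : Cplx R -> Cplx R) : Prop :=
  forall z : Cplx R, exists (n : nat) (h1 : Cplx R -> Cplx R),
    (\forall w \near z, derivable h1 w 1) /\
    (\forall w \near z^', h w = h1 w / (w - z) ^+ n).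

End ComplexAnalysis.

Section RankOneAnalysis.
Variables (R : realType) (X : rankOneSpace R).
Local Notation C := (Cplx R).
Local Notation G := (isom_group X).
Local Notation leb := (@lebesgue_measure R).

Definition maxK : set G :=
  @lie_exp R X @` [set Y | Y \in passmx.leigenspace (@cartan_inv R X) 1].

Definition a_ (t : R) : G := lie_exp (t *: H0 X).

Definition root_space (z : R) : {vspace lie_alg X} :=
  passmx.leigenspace (ad (@bracket R X) (H0 X)) z.

Definition unipN : set G :=
  @lie_exp R X @` [set Y | Y \in (root_space 1 + root_space 2)%VS].

Definition m1 : nat := \dim (root_space 1).
Definition m2 : nat := \dim (root_space 2).
Definition rho : R := (m1%:R + 2 * m2%:R) / 2.

(* The A-component of x in G = KAN: the t such that x lies in K a_t N. *)
Definition iwasawaH (x : G) : R :=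
  xget 0 [set t | exists k n, [/\ maxK k, unipN n & x = (k * a_ t * n)%g]].

Definition sinh (t : R) : R := (expR t - expR (- t)) / 2.
Definition D (t : R) : R := sinh t ^+ m1 * sinh (2 * t) ^+ m2.

(* dk, as a Borel measure on G carried by K. *)
Definition is_haar_K (kap : {measure set (Borel G) -> \bar R}) : Prop :=
  [/\ kap maxK = 1%E, kap (~` maxK) = 0%E
    & forall (k : G) (A : set (Borel G)), maxK k -> measurable A ->
        kap [set (k * x)%g | x in (A : set G)] = kap A].

(* dx: the G-invariant measure of G/K, viewed on right K-invariant functions on
   G. Its normalization is left free, as it cancels out between the spherical
   transform and the constant of the inversion formula. *)
Definition is_invariant_measure (kap mu : {measure set (Borel G) -> \bar R})
    : Prop :=
  (forall (x : G) (A : set (Borel G)), measurable A ->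
     mu [set (x * y)%g | y in (A : set G)] = mu A) /\
  exists2 c : R, 0 < c &
    forall f : Borel G -> \bar R, measurable_fun setT f ->
      (forall x, 0 <= f x)%E ->
      (\int[mu]_x f x =
       c%:E * \int[kap]_(k1 in maxK) \int[leb]_(t in `[0%R, +oo[)
         \int[kap]_(k2 in maxK) (f (k1 * a_ t * k2)%g * (D t)%:E))%E.

Definition radial (f : G -> C) : Prop :=
  forall k1 k2 x, maxK k1 -> maxK k2 -> f (k1 * x * k2)%g = f x.

Definition compactly_supported (f : G -> C) : Prop :=
  exists2 A : set G, compact A & forall x, ~ A x -> f x = 0.

Definition smooth_fun (f : G -> C) : Prop :=
  forall x : G,
    smooth_near 0 (fun Y : lie_alg X => re (f (x * lie_exp Y)%g)) /\
    smooth_near 0 (fun Y : lie_alg X => im (f (x * lie_exp Y)%g)).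

Definition square_integrable (mu : {measure set (Borel G) -> \bar R})
    (f : G -> C) : Prop :=
  [/\ measurable_fun setT (fun x : Borel G => re (f x)),
      measurable_fun setT (fun x : Borel G => im (f x))
    & (\int[mu]_x ((cabs (f x)) ^+ 2)%:E < +oo)%E].

Section Spherical.
Variable kap : {measure set (Borel G) -> \bar R}.

Definition sph (l : C) (x : G) : C :=
  cintegral kap maxK
    (fun k : Borel G =>
       cexp (- (ImUnit R * l + ofR rho) * ofR (iwasawaH (x^-1 * (k : G))%g))).

Definition sph_transform (mu : {measure set (Borel G) -> \bar R})
    (f : G -> C) (l : R) : C :=
  cintegral mu setT (fun x : Borel G => f x * sph (ofR l) x).

Definition is_c_function (cfun : C -> C) : Prop :=
  meromorphic cfun /\
  forall l : C, im l < 0 ->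
    (fun t : R => cexp ((ofR rho - ImUnit R * l) * ofR t) * sph l (a_ t))
      @ +oo --> cfun l.

Variables (mu : {measure set (Borel G) -> \bar R}) (cfun : C -> C).

Definition is_inversion_constant (c : R) : Prop :=
  0 < c /\
  forall f, smooth_fun f -> compactly_supported f -> radial f ->
    forall x, f x = ofR c * cintegral leb `[0, +oo[
      (fun l => sph_transform mu f l * sph (ofR l) x
                * ofR (cabs (cfun (ofR l)) ^- 2)).

(* Radial elements of H^s for s >= 0, where H^s is contained in L^2; the norm is
   the one given by the Plancherel theorem. The L^2 function f is represented by
   a Borel function, whose transform is meant for f integrable, e.g. of compact
   support. *)
Definition radial_sobolev (s : R) (f : G -> C) : Prop :=
  [/\ radial f, square_integrable mu f
    & (\int[leb]_(l in `[0%R, +oo[)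
         ((l ^+ 2 + rho ^+ 2) `^ s * cabs (sph_transform mu f l) ^+ 2
          * cabs (cfun (ofR l)) ^- 2)%:E < +oo)%E].

Definition schrodinger (a c : R) (f : G -> C) (t : R) (x : G) : C :=
  ofR c * cintegral leb `[0, +oo[
    (fun l => sph_transform mu f l
              * cexp (ImUnit R * ofR (t * (l ^+ 2 + rho ^+ 2) `^ (a / 2)))
              * sph (ofR l) x * ofR (cabs (cfun (ofR l)) ^- 2)).

End Spherical.
End RankOneAnalysis.

(* Main.v *)
Require Import Defs.
From HB Require Import structures.
From mathcomp Require Import all_boot all_order all_algebra.
From mathcomp Require Import all_classical all_reals all_analysis.
From mathcomp Require Import measurable_realfun complex.
From mathcomp Require Import ring lra.

Set Implicit Arguments.
Unset Strict Implicit.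
Unset Printing Implicit Defensive.

Import Order.TTheory GRing.Theory Num.Theory.
Import numFieldNormedType.Exports.

Local Open Scope classical_set_scope.
Local Open Scope ring_scope.

(** No asymptotics of spherical functions or of the c-function are needed.

    In the coordinate t of K a_t K the spherical function phi_l is a real
    solution of u'' + p u' = - (l^2 + rho^2) u with p >= 0, obtained by
    differentiating the integral over K under the integral sign; its energy
    u'^2 + (l^2 + rho^2) u^2 decreases, so |phi_l| <= 1. The inversion formula
    on smooth radial functions of compact support of the form F (tau x), with
    tau x the squared Hilbert-Schmidt norm of Ad x, yields by Fubini the
    Plancherel identity for such functions. Applied to two bumps of width of
    order 1/L near a_t and a_(t + h), h of order 1/L, whose transforms recover
    phi_l (a_t) for L <= l <= 2 L, it gives
      int_L^(2L) phi_l(a_t)^2 |c(l)|^-2 dl <= C L,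
    locally uniformly in t > 0, and hence
      int (l^2 + rho^2)^-s phi_l(a_t)^2 |c(l)|^-2 dl < oo  for s > 1/2.
    For f in H^s the integrand of the inversion formula is then absolutely
    integrable, uniformly on compact sets of t > 0, by Cauchy-Schwarz. Its
    integral equals f almost everywhere, as both have the same integrals against
    test functions, and dominated convergence gives the limit at time 0. *)

(** * Differential calculus in finite dimension *)

(** The group is accessible only through its exponential chart, and [K], the image under exp of the
    fixed space of theta, is not a subgroup by definition. Stability under products is a
    shortest-path argument, closedness follows from it, and compactness is read off from the support
    of a nonzero radial f. The polar decomposition is extracted from the integration formula for the
    invariant measure: an open set missing K A K would be null, whereas nonempty open sets are not.
    The Iwasawa decomposition of x then comes from minimising tau over x A N. The A-component is the
    growth of one highest root vector under Ad, which makes it smooth and turns the radial equation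
    into a trace identity over the (-1)-eigenspace of theta, with rotation terms that vanish in the
    mean over K. Test functions are smooth functions of tau rather than of t, because it is tau that
    is smooth on the whole group. *)

Section FiniteDimension.
Variables (R : realType) (V : normedVectType R).

Definition bas (i : 'I_(\dim {:V})) : V := (vbasis {:V})`_i.
Definition crd (i : 'I_(\dim {:V})) (v : V) : R := coord (vbasis {:V}) i v.

Lemma crdE (v : V) : v = \sum_i crd i v *: bas i.
Proof. exact/coord_vbasis/memvf. Qed.

Lemma crd_linear i : linear (crd i).
Proof. by move=> k u v; rewrite /crd linearP. Qed.

HB.instance Definition _ i :=
  GRing.isLinear.Build R V R *:%R (crd i) (crd_linear i).

Lemma crdD i u v : crd i (u + v) = crd i u + crd i v. Proof. exact: linearD. Qed.
Lemma crdN i u : crd i (- u) = - crd i u. Proof. exact: linearN. Qed.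
Lemma crdZ i k u : crd i (k *: u) = k * crd i u. Proof. exact: linearZ. Qed.
Lemma crd0 i : crd i 0 = 0. Proof. exact: linear0. Qed.

Lemma crd_sum (x : 'I_(\dim {:V}) -> R) i : crd i (\sum_j x j *: bas j) = x i.
Proof. by rewrite /crd coord_sum_free// (basis_free (vbasisP _)). Qed.

Lemma crd_inj (u v : V) : (forall i, crd i u = crd i v) -> u = v.
Proof. by move=> uv; rewrite (crdE u) (crdE v); apply: eq_bigr => i _; rewrite uv. Qed.

Let n := \dim {:V}.
Definition of_row (x : 'rV[R]_n) : V := \sum_i x 0 i *: bas i.

Lemma of_row_continuous : continuous of_row.
Proof.
rewrite /of_row; apply: continuous_big => [|i _ x]; first exact: add_continuous.
exact: (cvgZr_tmp (@coord_continuous R 1 n 0 i x)).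
Qed.

Lemma row_entry_norm (x : 'rV[R]_n) i : `|x 0 i| <= `|x|.
Proof.
rewrite [leRHS]/Num.Def.normr /= mx_normrE.
by apply/bigmax_geP; right; exists (ord0, i).
Qed.

(** Equivalence of norms: [|of_row x|] is continuous and nonzero on the compact unit sphere of row
    vectors, hence bounded below there, and homogeneity does the rest. *)
Lemma of_row_lower : exists2 c, 0 < c & forall x, c * `|x| <= `|of_row x|.
Proof.
pose S := [set x : 'rV[R]_n | `|x| = 1].
(* The sphere is empty only in dimension 0, where every constant works. *)
have [S0|S0] := pselect (S !=set0); last first.
  exists 1 => // x; have [->|x0] := eqVneq x 0; first by rewrite normr0 mulr0.
  exfalso; apply: S0; exists (`|x|^-1 *: x) => /=.
  by rewrite /S /= normrZ ger0_norm ?invr_ge0// mulVf ?normr_eq0.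
have cS : compact S.
  apply: bounded_closed_compact.
    by exists 1; split => // y y1 x /= ->; exact: ltW.
  have /= := @closed_comp _ _ (fun x : 'rV[R]_n => `|x| : R) [set r | r = 1].
  by apply => [x _|]; [exact: norm_continuous|exact: closed_eq].
have cf : {within S, continuous (fun x => `|of_row x|)}.
  apply: continuous_subspaceT => x.
  by apply: continuous_comp; [exact: of_row_continuous|exact: norm_continuous].
have [c /[!inE] Sc minc] := compact_EVT_min S0 cS cf.
exists `|of_row c|.
  rewrite normr_gt0; apply/eqP => c0.
  have : c = 0.
    apply/rowP => i; rewrite mxE -(crd_sum (fun i => c 0 i)).
    by rewrite -/(of_row c) c0 linear0.
  by move=> c00; move: Sc; rewrite /S /= c00 normr0 => /esym/eqP; rewrite oner_eq0.
move=> x; have [->|x0] := eqVneq x 0; first by rewrite normr0 mulr0.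
have xS : `|x|^-1 *: x \in S.
  by rewrite inE /S /= normrZ ger0_norm ?invr_ge0// mulVf ?normr_eq0.
have := minc _ xS.
have -> : of_row (`|x|^-1 *: x) = `|x|^-1 *: of_row x.
  by rewrite scaler_sumr; apply: eq_bigr => i _; rewrite mxE scalerA.
rewrite normrZ ger0_norm ?invr_ge0//.
by rewrite [leRHS]mulrC ler_pdivlMr// normr_gt0.
Qed.

(** The lower bound on [of_row] read backwards. It makes the coordinate functionals continuous, so
    that vector-valued statements reduce to real-valued ones. *)
Lemma crd_bound : exists2 C, 0 < C & forall i (v : V), `|crd i v| <= C * `|v|.
Proof.
have [c c0 cP] := of_row_lower.
exists c^-1; first by rewrite invr_gt0.
move=> i v; rewrite -ler_pdivrMl ?invr_gt0// invrK.
have vE : of_row (\row_j crd j v) = v.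
  by rewrite [RHS]crdE; apply: eq_bigr => j _; rewrite mxE.
rewrite -[X in _ <= `|X|]vE; apply: le_trans (cP _).
rewrite ler_pM2l//; apply: le_trans (row_entry_norm _ i).
by rewrite mxE.
Qed.

Lemma linear_bounded (W : normedModType R) (f : {linear V -> W}) :
  exists2 C, 0 < C & forall v, `|f v| <= C * `|v|.
Proof.
have [C C0 CP] := crd_bound.
exists (C * \sum_i `|f (bas i)| + 1).
  by rewrite ltr_wpDl// mulr_ge0 ?(ltW C0)// sumr_ge0.
move=> v; rewrite mulrDl mul1r (le_trans _ (_ : C * (\sum_i `|f (bas i)|) * `|v| <= _)) ?lerDl//.
rewrite {1}(crdE v) linear_sum mulrAC mulr_sumr.
apply: le_trans (ler_norm_sum _ _ _) _; apply: ler_sum => i _.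
by rewrite linearZ normrZ ler_wpM2r.
Qed.

Lemma linear_continuous_fd (W : normedModType R) (f : {linear V -> W}) :
  continuous f.
Proof.
have [C C0 CP] := linear_bounded f.
move=> x; apply/cvgrPdist_lt => e e0; near=> y.
rewrite -linearB (le_lt_trans (CP _))// -ltr_pdivlMl//.
by near: y; apply: cvgr_dist_lt; rewrite ?mulr_gt0 ?invr_gt0.
Unshelve. all: by end_near. Qed.

Lemma closed_bounded_compact (A : set V) (M : R) :
  closed A -> (forall v, A v -> `|v| <= M) -> compact A.
Proof.
move=> cA bA.
have [C C0 CP] := crd_bound.
have -> : A = of_row @` (of_row @^-1` A).
  apply/seteqP; split => [v Av|v [x /= Ax <-]//].
  have vE : of_row (\row_j crd j v) = v.
    by rewrite [RHS]crdE; apply: eq_bigr => j _; rewrite mxE.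
  by exists (\row_j crd j v); rewrite /= vE.
apply: continuous_compact; first exact/continuous_subspaceT/of_row_continuous.
apply: bounded_closed_compact; last first.
  by apply: preimage_closed => // x _; exact: of_row_continuous.
have [c c0 cP] := of_row_lower.
exists (c^-1 * M); split; first exact: num_real.
move=> y yM x /= /bA xM; apply: le_trans (ltW yM).
by rewrite ler_pdivlMl// (le_trans (cP _)).
Qed.

Lemma norm_le_crd (v : V) : `|v| <= \sum_i `|crd i v| * `|bas i|.
Proof.
rewrite {1}(crdE v); apply: le_trans (ler_norm_sum _ _ _) _.
by apply: ler_sum => i _; rewrite normrZ.
Qed.

End FiniteDimension.

(** Vector identities are checked coordinatewise, in the ring of scalars. *)
Ltac vec := apply: crd_inj => ?; rewrite !(crdD, crdN, crdZ, crd0); ring.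

(** * Directional derivatives *)

Section DirectionalDerivative.
Variables (R : realType) (V W : normedModType R).
Implicit Types (f : V -> W) (x v : V).

Lemma is_derive_line f x v (t : R) (w : W) : is_derive (t *: v + x) v f w ->
  is_derive t 1 (fun s => f (s *: v + x)) w.
Proof.
move=> [df <-].
have E : (fun h => h^-1 *: (((fun s => f (s *: v + x)) \o shift t) (h *: 1) -
    f (t *: v + x))) = (fun h => h^-1 *: ((f \o shift (t *: v + x)) (h *: v) -
    f (t *: v + x))).
  by apply/funext => h /=; rewrite scalerDl addrA [h *: 1]mulr1.
by split; rewrite /derivable /derive E.
Qed.

Lemma is_derive_line0 f x v (w : W) : 
  is_derive (0 : R) 1 (fun s => f (s *: v + x)) w -> is_derive x v f w.
Proof.
move=> [df <-].
have E : (fun h => h^-1 *: (((fun s => f (s *: v + x)) \o shift (0:R)) (h *: 1) -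
    f (0 *: v + x))) = (fun h => h^-1 *: ((f \o shift x) (h *: v) - f x)).
  by apply/funext => h /=; rewrite addr0 [h *: 1]mulr1 scale0r add0r.
by move: df; rewrite /derivable E => df; split; rewrite // /derive E.
Qed.

Lemma is_derive_cvgP f x v (w : W) : is_derive x v f w <->
  (fun h => h^-1 *: (f (h *: v + x) - f x)) @ 0^' --> w.
Proof.
split=> [[df <-]|cf]; first exact: df.
by split; [apply/cvg_ex; exists w|exact: cvg_lim].
Qed.

Lemma is_derive_uniq f x v (w w' : W) : is_derive x v f w -> is_derive x v f w' -> w = w'.
Proof. by move=> [_ <-] [_ <-]. Qed.

Lemma is_derive_dirZ f x v (w : W) (k : R) : is_derive x v f w -> is_derive x (k *: v) f (k *: w).
Proof.
(* For k = 0 the substitution h -> h k leaves the punctured neighbourhood of 0, so this case is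
   separate. *)
move=> dw; have [->|k0] := eqVneq k 0; first by rewrite !scale0r; exact: is_derive0.
apply/is_derive_cvgP.
have -> : (fun h => h^-1 *: (f (h *: (k *: v) + x) - f x)) =
  (fun h => k *: ((fun h => h^-1 *: (f (h *: v + x) - f x)) (h * k))).
  apply/funext => h /=; rewrite !scalerA.
  have [->|h0] := eqVneq h 0; first by rewrite !mul0r !scale0r add0r subrr !scaler0.
  by rewrite invfM mulrCA mulfV// mulr1.
apply: cvgZl_tmp; move/is_derive_cvgP : dw => dw.
pose g := fun h : R => h^-1 *: (f (h *: v + x) - f x).
apply: (@cvg_comp _ _ _ (fun h : R => h * k) g _ 0^' _ _ dw).
move=> A; rewrite /fmap /= => -[e /= e0 eA]; exists (e / `|k|).
  by rewrite /= divr_gt0// normr_gt0.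
move=> y /=; rewrite sub0r normrN => yk y0; apply: eA => /=.
  by rewrite sub0r normrN normrM -ltr_pdivlMr// normr_gt0.
by rewrite mulf_neq0.
Qed.

End DirectionalDerivative.

Lemma mvt_line (R : realType) (V : normedModType R) (f : V -> R) (x v : V) :
  (forall t : R, 0 <= t <= 1 -> derivable f (t *: v + x) v) ->
  exists2 t : R, 0 <= t <= 1 & f (v + x) - f x = 'D_v f (t *: v + x).
Proof.
move=> df.
have dl (t : R) : 0 <= t <= 1 -> is_derive t 1 (fun s : R => f (s *: v + x)) ('D_v f (t *: v + x)).
  by move=> /df ?; apply: is_derive_line; exact: derivableP.
have [|||t t01] := @MVT R (fun s : R => f (s *: v + x)) (fun t => 'D_v f (t *: v + x)) 0 1.
- exact: ltr01.
- by move=> t; rewrite in_itv /= => /andP[t0 t1]; apply: dl; rewrite !ltW.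
- apply: derivable_within_continuous => t; rewrite in_itv /= => /dl.
  by case.
rewrite scale1r scale0r add0r subr0 mulr1 => E; exists t => //.
by move: t01; rewrite in_itv /= => /andP[/ltW -> /ltW ->].
Qed.

Section C1.
Variables (R : realType) (V : normedModType R) (U : set V).
Hypothesis oU : open U.

Lemma open_segment (x v : V) : U x -> exists2 e : R, 0 < e &
  forall h t : R, `|h| < e -> 0 <= t <= 1 -> U (t *: (h *: v) + x).
Proof.
move=> Ux; have /nbhs_ballP[e /= e0 eU] := open_nbhs_nbhs (conj oU Ux).
exists (e / (`|v| + 1)); first by rewrite divr_gt0// ltr_wpDl.
move=> h t; rewrite ltr_pdivlMr ?ltr_wpDl// => he /andP[t0 t1]; apply: eU.
rewrite -ball_normE /= opprD addrCA subrr addr0 normrN !normrZ (ger0_norm t0).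
apply: le_lt_trans he; rewrite (le_trans (ler_piMl _ t1))//.
by rewrite ler_wpM2l// lerDl.
Qed.

Lemma C1_addR (f : V -> R) (x u v : V) : U x ->
  (forall w y, U y -> derivable f y w) ->
  {for x, continuous ('D_v f)} ->
  is_derive x (u + v) f ('D_u f x + 'D_v f x).
Proof.
move=> Ux df cv; apply/is_derive_cvgP.
have /derivableP/is_derive_cvgP du := df u x Ux.
have -> : (fun h : R => h^-1 *: (f (h *: (u + v) + x) - f x)) =
  (fun h : R => h^-1 *: (f (h *: u + x) - f x)) +
  (fun h : R => h^-1 *: (f (h *: v + (h *: u + x)) - f (h *: u + x))).
  apply/funext => h; rewrite fctE -scalerDr; congr (_ *: _).
  by rewrite [RHS]addrC addrA subrK scalerDr addrA [h *: v + _]addrC.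
apply: cvgD; first by [].
apply/cvgrPdist_le => e e0.
move/cvgrPdist_le : cv => /(_ e e0) /nbhs_ballP[d /= d0 dP].
have /nbhs_ballP[d' /= d'0 dU] := open_nbhs_nbhs (conj oU Ux).
pose M := `|u| + `|v| + 1; have M0 : 0 < M by rewrite ltr_wpDl// addr_ge0.
near=> h.
have h0 : h != 0 by near: h; exact: nbhs_dnbhs_neq.
have hb (t : R) : 0 <= t <= 1 -> `|t *: (h *: v) + h *: u| < Num.min d d'.
  move=> /andP[t0 t1].
  apply: (@le_lt_trans _ _ (`|h| * M)).
    apply: le_trans (ler_normD _ _) _; rewrite !normrZ (ger0_norm t0) /M.
    have : t * (`|h| * `|v|) <= `|h| * `|v| by rewrite ler_piMl// mulr_ge0.
    have := normr_ge0 h; nra.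
  rewrite -ltr_pdivlMr//; near: h.
  by apply: dnbhs0_lt; rewrite divr_gt0// lt_min d0.
have hball (t : R) : 0 <= t <= 1 -> ball x (Num.min d d') (t *: (h *: v) + (h *: u + x)).
  move=> /hb tb; rewrite -ball_normE /= !addrA opprD [X in `|X|](_ : _ = - (t *: (h *: v) + h *: u)) ?normrN//.
  by rewrite addrCA subrr addr0.
have Ut (t : R) : 0 <= t <= 1 -> U (t *: (h *: v) + (h *: u + x)).
  by move=> t01; apply: dU; apply: le_ball (hball t t01); rewrite ge_min lexx orbT.
have [t t01 ->] := @mvt_line _ _ f (h *: u + x) (h *: v) (fun t t01 => df _ _ (Ut t t01)).
have [_ ->] := is_derive_dirZ h (derivableP (df v _ (Ut t t01))).
rewrite [_^-1 *: _]mulKf//; apply: dP.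
by apply: le_ball (hball t t01); rewrite ge_min lexx.
Unshelve. all: by end_near. Qed.

End C1.

(** * Functions of class C^k on an open set *)

Section Ck.
Variables (R : realType).
Implicit Types (V W : normedModType R).

Lemma Ck_on_is_derive V W k (U : set V) (f : V -> W) x v :
  Ck_on k.+1 U f -> U x -> is_derive x v f ('D_v f x).
Proof. by case=> _ /(_ v)[+ _] Ux => /(_ x (mem_set Ux)) /derivableP. Qed.

Lemma Ck_on_derive V W k (U : set V) (f : V -> W) v :
  Ck_on k.+1 U f -> Ck_on k U ('D_v f).
Proof. by case=> _ /(_ v)[]. Qed.

Lemma Ck_on_continuous V W k (U : set V) (f : V -> W) x :
  Ck_on k U f -> U x -> {for x, continuous f}.
Proof. by case: k => [|k] [cf _] Ux; apply: cf; rewrite inE. Qed.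

Lemma Ck_on_le V W k (U U' : set V) (f : V -> W) :
  U' `<=` U -> Ck_on k U f -> Ck_on k U' f.
Proof.
elim: k f => [|k IH] f UU' [cf df]; split.
- by move=> x /[!inE] /UU' Ux; apply: cf; rewrite inE.
- by [].
- by move=> x /[!inE] /UU' Ux; apply: cf; rewrite inE.
- move=> v; have [d1 d2] := df v; split; last exact: IH.
  by move=> x /[!inE] /UU' Ux; apply: d1; rewrite inE.
Qed.

Lemma Ck_onW V W k (U : set V) (f : V -> W) : Ck_on k.+1 U f -> Ck_on k U f.
Proof.
elim: k f => [|k IH] f [cf df]; split => // v.
by have [d1 d2] := df v; split => //; exact: IH.
Qed.

Lemma is_derive_near V W (f g : V -> W) (U : set V) x v w : open U -> U x ->
  (forall y, U y -> f y = g y) -> is_derive x v f w -> is_derive x v g w.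
Proof.
move=> oU Ux fg /is_derive_cvgP df; apply/is_derive_cvgP.
have [e e0 eP] := open_segment oU v Ux.
apply: cvg_trans df; apply: near_eq_cvg; near=> h.
rewrite (fg x Ux) fg//; have := eP h 1.
rewrite scale1r; apply; rewrite ?ler01 ?lexx//.
by near: h; exact: dnbhs0_lt.
Unshelve. all: by end_near. Qed.

Lemma Ck_on_eq V W k (U : set V) (f g : V -> W) : open U ->
  (forall y, U y -> f y = g y) -> Ck_on k U f -> Ck_on k U g.
Proof.
move=> oU; elim: k f g => [|k IH] f g fg [cf df]; split.
- move=> x /[!inE] Ux; rewrite /continuous_at -(fg x Ux).
  apply: cvg_trans (cf x (mem_set Ux)); apply: near_eq_cvg.
  by apply: filterS (open_nbhs_nbhs (conj oU Ux)) => y /fg ->.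
- by [].
- move=> x /[!inE] Ux; rewrite /continuous_at -(fg x Ux).
  apply: cvg_trans (cf x (mem_set Ux)); apply: near_eq_cvg.
  by apply: filterS (open_nbhs_nbhs (conj oU Ux)) => y /fg ->.
- move=> v; have [d1 d2] := df v.
  have dfg x : U x -> is_derive x v g ('D_v f x).
    move=> Ux; apply: (is_derive_near oU Ux fg).
    by apply: derivableP; apply: d1; rewrite inE.
  split; first by move=> x /[!inE] /dfg[].
  by apply: IH d2 => y /dfg[].
Qed.

Lemma is_derive_lin V W W' (f : V -> W) (L : {linear W -> W'}) x v w :
  continuous L -> is_derive x v f w -> is_derive x v (fun y => L (f y)) (L w).
Proof.
move=> cL /is_derive_cvgP df; apply/is_derive_cvgP.
have -> : (fun h : R => h^-1 *: (L (f (h *: v + x)) - L (f x))) =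
  L \o (fun h => h^-1 *: (f (h *: v + x) - f x)).
  by apply/funext => h /=; rewrite -linearB -linearZZ.
by apply: continuous_cvg => //; exact: cL.
Qed.

Lemma Ck_on_lin V W W' k (U : set V) (f : V -> W) (L : {linear W -> W'}) :
  open U -> continuous L -> Ck_on k U f -> Ck_on k U (fun y => L (f y)).
Proof.
move=> oU cL; elim: k f => [|k IH] f [cf df]; split.
- by move=> x xU; apply: continuous_comp; [exact: cf|exact: cL].
- by [].
- by move=> x xU; apply: continuous_comp; [exact: cf|exact: cL].
- move=> v; have [d1 d2] := df v.
  have dL x : U x -> is_derive x v (fun y => L (f y)) (L ('D_v f x)).
    by move=> Ux; apply: is_derive_lin => //; apply/derivableP/d1; rewrite inE.
  split; first by move=> x /[!inE] /dL[].
  by apply: Ck_on_eq (IH _ d2) => // y /dL[].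
Qed.

End Ck.

(** * Total differentiability from continuous directional derivatives *)

Section FrechetC1.
Variables (R : realType) (V : normedVectType R) (U : set V).
Hypothesis oU : open U.

Lemma C1_sumR (f : V -> R) x v : Ck_on 1 U f -> U x ->
  'D_v f x = \sum_j crd j v * 'D_(bas j) f x.
Proof.
move=> cf Ux; rewrite {1}(crdE v).
suff : forall (r : seq 'I_(\dim {:V})), is_derive x (\sum_(j <- r) crd j v *: bas j) f
    (\sum_(j <- r) crd j v * 'D_(bas j) f x).
  by move=> /(_ (index_enum _))[].
elim => [|j r IH]; first by rewrite !big_nil; exact: is_derive0.
have dj := is_derive_dirZ (crd j v) (Ck_on_is_derive (bas j) cf Ux).
rewrite !big_cons addrC [X in is_derive _ _ _ X]addrC -(derive_val (is_derive := IH)) -[crd j v * _]/(_ *: _) -(derive_val (is_derive := dj)).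
apply: (C1_addR oU) => //; first by move=> w y Uy; have [] := Ck_on_is_derive w cf Uy.
exact: Ck_on_continuous (Ck_on_derive _ cf) Ux.
Qed.

(** Uniformity in the direction v comes from the finitely many basis directions: the error is at
    most the sum of the |crd j v| times a common small bound, and |crd j v| <= C |v|. *)
Lemma C1_boundR (f : V -> R) x e : Ck_on 1 U f -> U x -> 0 < e ->
  \forall y \near x, forall v, `|'D_v f y - 'D_v f x| <= e * `|v|.
Proof.
move=> cf Ux e0; have [C C0 CP] := @crd_bound R V.
pose n := \dim {:V}.
(* Dividing by n + 1 rather than n covers dimension 0. *)
have e'0 : 0 < e / (C * (n%:R + 1)) by rewrite divr_gt0// mulr_gt0// ltr_wpDl.
have cD : \forall y \near x, forall j : 'I_n,
    `|'D_(bas j) f x - 'D_(bas j) f y| <= e / (C * (n%:R + 1)).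
  apply: filter_forall => j.
  by have /cvgrPdist_le/(_ _ e'0) := Ck_on_continuous (Ck_on_derive (bas j) cf) Ux.
near=> y => v.
have Uy : U y by near: y; exact: open_nbhs_nbhs.
rewrite !C1_sumR// -sumrB (le_trans (ler_norm_sum _ _ _))//.
apply: (@le_trans _ _ (\sum_(j < n) e / (n%:R + 1) * `|v|)).
  apply: ler_sum => j _; rewrite -mulrBr normrM.
  rewrite (_ : e / _ * _ = (C * `|v|) * (e / (C * (n%:R + 1)))); last first.
    by field; rewrite gt_eqF//= gt_eqF// ltr_wpDl.
  apply: ler_pM => //; rewrite distrC.
  by move: j; near: y.
rewrite sumr_const card_ord -[_ *+ n]mulr_natr -/n.
rewrite (_ : _ * _ = e * `|v| * (n%:R / (n%:R + 1))); last first.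
  by field; rewrite gt_eqF// ltr_wpDl.
by rewrite ler_piMr ?mulr_ge0// ?(ltW e0)// ler_pdivrMr ?ltr_wpDl// mul1r lerDl.
Unshelve. all: by end_near. Qed.

Lemma C1_lipR (f : V -> R) x : Ck_on 1 U f -> U x ->
  exists r L : R, [/\ 0 < r, 0 < L & forall y z, ball x r y -> ball x r z ->
    `|f y - f z| <= L * `|y - z|].
Proof.
move=> cf Ux; have [C C0 CP] := @crd_bound R V.
have /nbhs_ballP[r /= r0 rP] := C1_boundR cf Ux ltr01.
have /nbhs_ballP[r' /= r'0 rU] := open_nbhs_nbhs (conj oU Ux).
exists (Num.min r r'), (\sum_j C * `|'D_(bas j) f x| + 1); split.
- by rewrite lt_min r0.
- by rewrite ltr_wpDl// sumr_ge0// => j _; rewrite mulr_ge0// ltW.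
move=> y z yr zr.
have tr (t : R) : 0 <= t <= 1 -> ball x (Num.min r r') (t *: (y - z) + z).
  move=> /andP[t0 t1]; move: yr zr; rewrite -!ball_normE /= => yr zr.
  rewrite (_ : x - _ = t *: (x - y) + (1 - t) *: (x - z)); last first.
    by vec.
  apply: le_lt_trans (ler_normD _ _) _; rewrite !normrZ (ger0_norm t0) ger0_norm ?subr_ge0//.
  by have [->|t0'] := eqVneq t 0; [rewrite mul0r add0r subr0 mul1r|nra].
have [|t t01] := @mvt_line _ _ f z (y - z).
  move=> t t01; have [] := @Ck_on_is_derive _ _ _ _ U f (t *: (y - z) + z) (y - z) cf _ => //.
  by apply: rU; apply: le_ball (tr t t01); rewrite ge_min lexx orbT.
rewrite subrK => ->.
have /rP/(_ (y - z)) : ball x r (t *: (y - z) + z) by apply: le_ball (tr t t01); rewrite ge_min lexx.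
rewrite mul1r mulrDl mul1r => bd.
rewrite -[X in `|X|](subrK ('D_(y - z) f x)) addrC (le_trans (ler_normD _ _))// lerD//.
rewrite C1_sumR// (le_trans (ler_norm_sum _ _ _))// mulr_suml ler_sum// => j _.
by rewrite normrM mulrAC ler_wpM2r.
Qed.

Lemma C1_taylorR (f : V -> R) x e : Ck_on 1 U f -> U x -> 0 < e ->
  \forall v \near 0, `|f (v + x) - f x - 'D_v f x| <= e * `|v|.
Proof.
move=> cf Ux e0.
have /nbhs_ballP[r /= r0 rP] := C1_boundR cf Ux e0.
have /nbhs_ballP[r' /= r'0 rU] := open_nbhs_nbhs (conj oU Ux).
near=> v.
have tr (t : R) : 0 <= t <= 1 -> ball x (Num.min r r') (t *: v + x).
  move=> /andP[t0 t1]; rewrite -ball_normE /= opprD addrCA subrr addr0 normrN normrZ (ger0_norm t0).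
  apply: (@le_lt_trans _ _ `|v|); first by rewrite ler_piMl.
  by near: v; apply: nbhs0_lt; rewrite lt_min r0.
have [|t t01 ->] := @mvt_line _ _ f x v.
  move=> t t01; have [] := @Ck_on_is_derive _ _ _ _ U f (t *: v + x) v cf _ => //.
  by apply: rU; apply: le_ball (tr t t01); rewrite ge_min lexx orbT.
by apply: rP; apply: le_ball (tr t t01); rewrite ge_min lexx.
Unshelve. all: by end_near. Qed.

Variable W : normedVectType R.
Implicit Type f : V -> W.

Let Ck_crd f k i : Ck_on k U f -> Ck_on k U (fun y => crd i (f y)).
Proof. by move=> cf; apply: (@Ck_on_lin _ _ _ _ _ _ f (crd i)) => //; exact: linear_continuous_fd. Qed.

Lemma derive_crd f x v i : derivable f x v ->
  'D_v (fun y => crd i (f y)) x = crd i ('D_v f x).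
Proof.
move=> /derivableP df.
by have [] := @is_derive_lin _ _ _ _ f (crd i) x v _ (@linear_continuous_fd _ _ _ _) df.
Qed.

Let DCk f x v (cf : Ck_on 1 U f) (Ux : U x) : derivable f x v.
Proof. by have [] := Ck_on_is_derive v cf Ux. Qed.

Lemma C1_deriveD f x u v : Ck_on 1 U f -> U x ->
  'D_(u + v) f x = 'D_u f x + 'D_v f x.
Proof.
move=> cf Ux; apply/crd_inj => i; have d w := @DCk f x w cf Ux.
rewrite linearD /= -!derive_crd// !C1_sumR//; try exact: Ck_crd.
by rewrite -big_split/=; apply: eq_bigr => j _; rewrite linearD mulrDl.
Qed.

Lemma C1_deriveZ f x k v : Ck_on 1 U f -> U x ->
  'D_(k *: v) f x = k *: 'D_v f x.
Proof. by move=> cf Ux; have [] := is_derive_dirZ k (derivableP (@DCk f x v cf Ux)). Qed.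

Let B : R := \sum_i `|@bas R W i| + 1.
Let B0 : 0 < B. Proof. by rewrite ltr_wpDl// sumr_ge0. Qed.

Let norm_le_max (w : W) (c : R) : (forall i, `|crd i w| <= c) -> 0 <= c -> `|w| <= c * B.
Proof.
move=> wc c0; apply: (le_trans (norm_le_crd w)).
rewrite /B mulrDr mulr1 mulr_sumr ler_wpDr// ler_sum// => i _.
by rewrite ler_wpM2r.
Qed.

Lemma C1_lip f x : Ck_on 1 U f -> U x ->
  exists r L : R, [/\ 0 < r, 0 < L & forall y z, ball x r y -> ball x r z ->
    `|f y - f z| <= L * `|y - z|].
Proof.
move=> cf Ux.
have /choice[rL rLP] : forall i, exists rL : R * R, [/\ 0 < rL.1, 0 < rL.2 & forall y z,
    ball x rL.1 y -> ball x rL.1 z -> `|crd i (f y) - crd i (f z)| <= rL.2 * `|y - z|].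
  by move=> i; have [r [L H]] := C1_lipR (Ck_crd i cf) Ux; exists (r, L).
pose L := \sum_i (rL i).2 + 1; pose r := \big[Num.min/1]_i (rL i).1.
have L0 : 0 < L by rewrite ltr_wpDl// sumr_ge0// => i _; have [_ /ltW] := rLP i.
exists r, (L * B); split.
- rewrite /r; elim/big_ind : _ => // [a b a0 b0|i _]; first by rewrite lt_min a0.
  by have [] := rLP i.
- by rewrite mulr_gt0.
move=> y z yr zr; rewrite mulrAC; apply: norm_le_max => [i|]; last by rewrite mulr_ge0// ltW.
have [_ _ /(_ y z)] := rLP i; rewrite linearB/= => H.
apply: le_trans (H _ _) _.
- by apply: le_ball yr; exact: bigmin_le_cond.
- by apply: le_ball zr; exact: bigmin_le_cond.
rewrite ler_wpM2r// /L (bigD1 i)//= -addrA lerDl addr_ge0//.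
by rewrite sumr_ge0// => j _; have [_ /ltW] := rLP j.
Qed.

Lemma C1_taylor f x e : Ck_on 1 U f -> U x -> 0 < e ->
  \forall v \near 0, `|f (v + x) - f x - 'D_v f x| <= e * `|v|.
Proof.
move=> cf Ux e0; have eB : 0 < e / B by rewrite divr_gt0.
have H : \forall v \near 0, forall i, `|crd i (f (v + x)) - crd i (f x) - 'D_v (fun y => crd i (f y)) x| <= (e / B) * `|v|.
  by apply: filter_forall => i; exact: (C1_taylorR (Ck_crd i cf) Ux eB).
near=> v; rewrite -[e](@divfK _ B) ?gt_eqF// mulrAC.
apply: norm_le_max; last by rewrite mulr_ge0// ltW.
move=> i; rewrite !linearB/= -derive_crd; last exact: DCk.
by move: i; near: v.
Unshelve. all: by end_near. Qed.

End FrechetC1.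

(** * Symmetry of second derivatives *)

Section Schwarz.
Variables (R : realType) (V : normedModType R) (U : set V).
Hypothesis oU : open U.

Lemma is_derive_translate (f : V -> R) c x v w : is_derive (c + x) v f w ->
  is_derive x v (fun y => f (c + y)) w.
Proof.
move=> /is_derive_cvgP df; apply/is_derive_cvgP.
by under eq_fun do rewrite addrCA.
Qed.

(** The mean value theorem is applied twice: in direction u to the v-increment g of f, then in
    direction v to ['D_u f]. The quotient is symmetric in u and v, so its limit is also the other
    mixed derivative. *)
Lemma second_difference (f : V -> R) x u v : Ck_on 2 U f -> U x ->
  (fun h : R => h^-1 * (h^-1 * (f (h *: v + (h *: u + x)) - f (h *: u + x)
     - f (h *: v + x) + f x))) @ 0^' --> 'D_v ('D_u f) x.
Proof.
move=> cf Ux; apply/cvgrPdist_le => e e0.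
have /cvgrPdist_le/(_ _ e0)/nbhs_ballP[d /= d0 dP] :=
  Ck_on_continuous (Ck_on_derive v (Ck_on_derive u cf)) Ux.
have /nbhs_ballP[d' /= d'0 dU] := open_nbhs_nbhs (conj oU Ux).
pose M := `|u| + `|v| + 1; have M0 : 0 < M by rewrite ltr_wpDl// addr_ge0.
near=> h.
have h0 : h != 0 by near: h; exact: nbhs_dnbhs_neq.
have hb (s t : R) : 0 <= s <= 1 -> 0 <= t <= 1 ->
    ball x (Num.min d d') (t *: (h *: v) + (s *: (h *: u) + x)).
  move=> /andP[s0 s1] /andP[t0 t1]; rewrite -ball_normE /=.
  rewrite addrA opprD addrCA subrr addr0 normrN.
  apply: (@le_lt_trans _ _ (`|h| * M)).
    apply: le_trans (ler_normD _ _) _; rewrite !normrZ (ger0_norm t0) (ger0_norm s0) /M.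
    have : t * (`|h| * `|v|) <= `|h| * `|v| by rewrite ler_piMl// mulr_ge0.
    have : s * (`|h| * `|u|) <= `|h| * `|u| by rewrite ler_piMl// mulr_ge0.
    have := normr_ge0 h; nra.
  rewrite -ltr_pdivlMr//; near: h.
  by apply: dnbhs0_lt; rewrite divr_gt0// lt_min d0.
have hU (s t : R) : 0 <= s <= 1 -> 0 <= t <= 1 -> U (t *: (h *: v) + (s *: (h *: u) + x)).
  by move=> s01 t01; apply: dU; apply: le_ball (hb s t s01 t01); rewrite ge_min lexx orbT.
have I1 (t : R) : t = 1 -> 0 <= t <= 1 by move=> ->; rewrite ler01 lexx.
have I0 (t : R) : t = 0 -> 0 <= t <= 1 by move=> ->; rewrite ler01 lexx.
pose g y := f (h *: v + y) - f y.
have dg (s : R) : 0 <= s <= 1 -> is_derive (s *: (h *: u) + x) (h *: u) g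
    (h *: 'D_u f (h *: v + (s *: (h *: u) + x)) - h *: 'D_u f (s *: (h *: u) + x)).
  move=> s01; apply: is_deriveB.
    apply: is_derive_translate; apply: is_derive_dirZ.
    by apply: (Ck_on_is_derive _ cf); have := hU s 1 s01 (I1 _ erefl); rewrite scale1r.
  apply: is_derive_dirZ; apply: (Ck_on_is_derive _ cf).
  by have := hU s 0 s01 (I0 _ erefl); rewrite scale0r add0r.
have [|s s01 gE] := @mvt_line _ _ g x (h *: u); first by move=> s /dg[].
have -> : f (h *: v + (h *: u + x)) - f (h *: u + x) - f (h *: v + x) + f x =
   g (h *: u + x) - g x by rewrite /g; ring.
rewrite gE; have [_ ->] := dg s s01; rewrite -scalerBr [h^-1 * (h *: _)]mulKf//.
have [|t t01 ->] := @mvt_line _ _ ('D_u f) (s *: (h *: u) + x) (h *: v).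
  by move=> t t01; have [] := is_derive_dirZ h (Ck_on_is_derive v (Ck_on_derive u cf) (hU s t s01 t01)).
have [_ ->] := is_derive_dirZ h (Ck_on_is_derive v (Ck_on_derive u cf) (hU s t s01 t01)).
rewrite [_^-1 * _]mulKf//; apply: dP.
by apply: le_ball (hb s t s01 t01); rewrite ge_min lexx.
Unshelve. all: by end_near. Qed.

Lemma schwarzR (f : V -> R) x u v : Ck_on 2 U f -> U x ->
  'D_u ('D_v f) x = 'D_v ('D_u f) x.
Proof.
move=> cf Ux; have Huv := second_difference (u := u) (v := v) cf Ux.
have Hvu := second_difference (u := v) (v := u) cf Ux.
rewrite (_ : (fun h : R => _) = (fun h : R => h^-1 * (h^-1 *
    (f (h *: v + (h *: u + x)) - f (h *: u + x) - f (h *: v + x) + f x)))) in Hvu.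
  by rewrite -(cvg_lim (@Rhausdorff R) Hvu) -(cvg_lim (@Rhausdorff R) Huv).
apply/funext => h; congr (_ * (_ * _)).
by rewrite [h *: v + (_ + _)]addrCA; congr (_ + _); rewrite addrAC.
Qed.

End Schwarz.

Lemma schwarz (R : realType) (V : normedModType R) (W : normedVectType R)
    (U : set V) (f : V -> W) x u v : open U -> Ck_on 2 U f -> U x ->
  'D_u ('D_v f) x = 'D_v ('D_u f) x.
Proof.
move=> oU cf Ux; apply: crd_inj => i.
have cr k (g : V -> W) : Ck_on k U g -> Ck_on k U (fun y => crd i (g y)).
  by move=> cg; apply: (@Ck_on_lin _ _ _ _ _ _ g (crd i)) => //; exact: linear_continuous_fd.
have E w w' : crd i ('D_w ('D_w' f) x) = 'D_w ('D_w' (fun y => crd i (f y))) x.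
  have [_ <-] : is_derive x w ('D_w' (fun y => crd i (f y))) (crd i ('D_w ('D_w' f) x)).
    have /(is_derive_lin (@linear_continuous_fd _ _ _ (crd i))) :=
      Ck_on_is_derive w (Ck_on_derive w' cf) Ux.
    apply: is_derive_near oU Ux _ => y Uy.
    have [_ ->//] := is_derive_lin (@linear_continuous_fd _ _ _ (crd i)) (Ck_on_is_derive w' (Ck_onW cf) Uy).
  by [].
by rewrite !E (schwarzR oU _ _ (cr _ _ cf)).
Qed.

(** * Sums, products and compositions of smooth functions *)

Section SmoothFunctions.
Variables (R : realType).
Implicit Types (V : normedModType R).

(** The whole sequence of derivatives is the witness, so that closure properties amount to writing
    down a sequence. *)
Definition smooth1 (F : R -> R) := exists Fs : nat -> R -> R,
  Fs 0 = F /\ forall n (x : R), is_derive x 1 (Fs n) (Fs n.+1 x).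

Lemma Ck_on_cst V (W : normedModType R) k (U : set V) (c : W) : Ck_on k U (cst c).
Proof.
elim: k c => [|k IH] c; split.
- by move=> x _; exact: cst_continuous.
- by [].
- by move=> x _; exact: cst_continuous.
move=> v; split; first by move=> x _; exact: derivable_cst.
by rewrite (_ : 'D_v (cst c) = cst 0) //; apply/funext => x; rewrite derive_cst.
Qed.

Lemma Ck_onD V (W : normedModType R) k (U : set V) (f g : V -> W) : open U ->
  Ck_on k U f -> Ck_on k U g -> Ck_on k U (fun y => f y + g y).
Proof.
move=> oU; elim: k f g => [|k IH] f g cf cg.
  split => // x xU; apply: cvgD; [exact: cf.1|exact: cg.1].
split; first by move=> x xU; apply: cvgD; [exact: cf.1|exact: cg.1].
move=> v; have d x : U x -> is_derive x v (fun y => f y + g y) ('D_v f x + 'D_v g x).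
  move=> Ux; exact: (@is_deriveD _ _ _ f g x v _ _ (Ck_on_is_derive v cf Ux) (Ck_on_is_derive v cg Ux)).
split; first by move=> x /[!inE] /d[].
by apply: Ck_on_eq (IH _ _ (Ck_on_derive v cf) (Ck_on_derive v cg)) => // y /d[].
Qed.

Lemma Ck_onM V k (U : set V) (f g : V -> R) : open U ->
  Ck_on k U f -> Ck_on k U g -> Ck_on k U (fun y => f y * g y).
Proof.
move=> oU; elim: k f g => [|k IH] f g cf cg.
  split => // x xU; apply: cvgM; [exact: cf.1|exact: cg.1].
split; first by move=> x xU; apply: cvgM; [exact: cf.1|exact: cg.1].
move=> v; have d x : U x -> is_derive x v (fun y => f y * g y) (f x * 'D_v g x + 'D_v f x * g x).
  move=> Ux; apply: is_derive_eq.
    exact: (@is_deriveM _ _ f g x v _ _ (Ck_on_is_derive v cf Ux) (Ck_on_is_derive v cg Ux)).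
  by rewrite [X in _ + X]mulrC.
split; first by move=> x /[!inE] /d[].
have Dg := Ck_on_derive v cg; have Df := Ck_on_derive v cf.
by apply: Ck_on_eq (Ck_onD oU (IH _ _ (Ck_onW cf) Dg) (IH _ _ Df (Ck_onW cg))) => // y /d[].
Qed.

Lemma Ck_on_sum V (I : Type) (r : seq I) k (U : set V) (f : I -> V -> R) : open U ->
  (forall i, Ck_on k U (f i)) -> Ck_on k U (fun y => \sum_(i <- r) f i y).
Proof.
move=> oU cf; elim: r => [|i r IH].
  by under eq_fun do rewrite big_nil; exact: Ck_on_cst.
by under eq_fun do rewrite big_cons; exact: Ck_onD.
Qed.

Lemma is_derive_comp1 V (f : V -> R) (F : R -> R) x v (a b : R) :
  is_derive x v f a -> is_derive (f x) 1 F b -> is_derive x v (fun y => F (f y)) (b * a).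
Proof.
move=> df dF; apply: is_derive_line0.
have df' : is_derive (0 : R) 1 (fun s : R => f (s *: v + x)) a.
  by apply: is_derive_line; rewrite scale0r add0r.
have dF' : is_derive (f ((0:R) *: v + x)) 1 F b by rewrite scale0r add0r.
exact: (@is_derive1_comp _ F (fun s => f (s *: v + x)) _ _ _ dF' df').
Qed.

Lemma Ck_on_comp1 V k (U : set V) (f : V -> R) (F : R -> R) : open U ->
  smooth1 F -> Ck_on k U f -> Ck_on k U (fun y => F (f y)).
Proof.
move=> oU [Fs [<-{F} dF]] cf.
(* The chain rule replaces [Fs n] by [Fs n.+1], so the induction on k runs over all members of the
   sequence at once. *)
suff : forall n, Ck_on k U (fun y => Fs n (f y)) by exact.
move=> n.
have cF m : continuous (Fs m).
  by move=> x; apply/differentiable_continuous/derivable1_diffP; have [] := dF m x.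
elim: k n cf => [|k IH] n cf.
  by split => // x xU; apply: continuous_comp; [exact: cf.1|exact: cF].
split; first by move=> x xU; apply: continuous_comp; [exact: cf.1|exact: cF].
move=> v; have d x : U x -> is_derive x v (fun y => Fs n (f y)) (Fs n.+1 (f x) * 'D_v f x).
  by move=> Ux; exact: is_derive_comp1 (Ck_on_is_derive v cf Ux) (dF _ _).
split; first by move=> x /[!inE] /d[].
by apply: Ck_on_eq (Ck_onM oU (IH n.+1 (Ck_onW cf)) (Ck_on_derive v cf)) => // y /d[].
Qed.

Lemma Ck_on_affine V V' (W : normedModType R) k (U : set V) (f : V -> W)
    (A : {linear V' -> V}) (c : V) : continuous A -> open U ->
  Ck_on k U f -> Ck_on k [set y | U (A y + c)] (fun y => f (A y + c)).
Proof.
move=> cA oU.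
have ca : continuous (fun y => A y + c) by move=> y; apply: cvgD; [exact: cA|exact: cvg_cst].
have oU' : open [set y | U (A y + c)] by apply: open_comp oU => y _; exact: ca.
elim: k f => [|k IH] f cf.
  by split => // x /[!inE] xU; apply: continuous_comp; [exact: ca|apply: cf.1; rewrite inE].
split; first by move=> x /[!inE] xU; apply: continuous_comp; [exact: ca|apply: cf.1; rewrite inE].
move=> v; have d y : U (A y + c) -> is_derive y v (fun y => f (A y + c)) ('D_(A v) f (A y + c)).
  move=> Uy; have /is_derive_cvgP df := Ck_on_is_derive (A v) cf Uy.
  apply/is_derive_cvgP; apply: cvg_trans df; apply: near_eq_cvg; apply: nearW => h.
  have -> : A (h *: v + y) = h *: A v + A y by rewrite linearP.
  by rewrite addrA.
split; first by move=> x /[!inE] /d[].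
by apply: Ck_on_eq (IH _ (Ck_on_derive (A v) cf)) => // y /d[].
Qed.

End SmoothFunctions.

(** * The flat function exp (-1/x) *)

Section FlatFunction.
Variable R : realType.
Implicit Types (p : {poly R}) (x y : R).

(** From e^y = (e^(y/i))^i >= (y/i)^i one gets y^i e^(-y) <= i^i for each monomial of degree i >
    0. *)
Lemma poly_expRN_bounded p : exists2 C : R, 0 <= C &
  forall y, 0 <= y -> `|p.[y]| * expR (- y) <= C.
Proof.
pose c (i : 'I_(size p)) : R := `|p`_i| * (i%:R ^+ i + 1).
exists (\sum_i c i); first by apply: sumr_ge0 => i _; rewrite mulr_ge0// addr_ge0// exprn_ge0.
move=> y y0; rewrite horner_coef.
apply: (@le_trans _ _ ((\sum_(i < size p) `|p`_i * y ^+ i|) * expR (- y))).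
  by rewrite ler_wpM2r ?expR_ge0// ler_norm_sum.
rewrite mulr_suml ler_sum// => i _; rewrite normrM -mulrA ler_wpM2l//.
rewrite ger0_norm ?exprn_ge0// expRN ler_pdivrMr ?expR_gt0//.
case: (nat_of_ord i) => [|k].
  rewrite !expr0 mulrDl !mul1r; have := expR_gt0 y; have := @expR_ge1Dx R y; lra.
have k0 : (0 : R) < k.+1%:R by rewrite ltr0n.
rewrite mulrDl mul1r ler_wpDr ?expR_ge0//.
have -> : expR y = expR (y / k.+1%:R) ^+ k.+1.
  by rewrite -expRM_natl mulrC divfK// gt_eqF.
rewrite -exprMn ler_pXn2r// ?nnegrE ?mulr_ge0 ?expR_ge0// ?(ltW k0)//.
rewrite -ler_pdivrMl// mulrC; apply: le_trans (@expR_ge1Dx R _).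
by rewrite lerDr.
Qed.

(** The family p(1/x) e^(-1/x), extended by 0, is closed under differentiation; this is why a
    polynomial is carried along. *)
Definition flatP p x : R := if 0 < x then p.[x^-1] * expR (- x^-1) else 0.

Lemma flatP_quadratic p : exists2 C : R, 0 <= C & forall x, `|flatP p x| <= C * x ^+ 2.
Proof.
have [C C0 CP] := poly_expRN_bounded ('X ^+ 2 * p).
exists C => // x; rewrite /flatP; case: ifPn => x0; last by rewrite normr0 mulr_ge0// sqr_ge0.
have := CP x^-1; rewrite invr_ge0 (ltW x0) => /(_ isT).
rewrite hornerM hornerXn normrM => H.
rewrite -ler_pdivrMr ?exprn_gt0//; apply: le_trans H.
rewrite normrM (ger0_norm (expR_ge0 _)) (ger0_norm (sqr_ge0 _)) exprVn.
by rewrite [leLHS]mulrC mulrA.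
Qed.

Lemma is_derive_flatP p x :
  is_derive x 1 (flatP p) (flatP ('X ^+ 2 * (p - p^`())) x).
Proof.
have [x0|x0|->] := ltgtP x 0.
- rewrite {2}/flatP ltNge (ltW x0)/=.
  have o : open [set y : R | y < 0] by exact: open_lt.
  apply: (is_derive_near o (f := cst 0)) => // y /= y0.
  by rewrite /flatP ltNge (ltW y0).
- rewrite {2}/flatP x0.
  have o : open [set y : R | 0 < y] by exact: open_gt.
  apply: (is_derive_near o (f := (horner p \o GRing.inv) * (expR \o (-%R \o GRing.inv)))) => //.
    by move=> y /= y0; rewrite /flatP y0.
  have xn0 : x != 0 by rewrite gt_eqF.
  have dV : is_derive x 1 (@GRing.inv R) (- x ^- 2).
    split; first exact: (@derivableV _ _ id).
    by rewrite (@deriveV _ _ id)//= derive_id /= [_ *: _]mulr1.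
  have dp : is_derive x^-1 1 (horner p) (p^`()).[x^-1] by exact: is_derive_poly.
  have d1 : is_derive x 1 (horner p \o GRing.inv) ((p^`()).[x^-1] * - x ^- 2).
    exact: is_derive1_comp.
  have dN : is_derive x 1 (-%R \o @GRing.inv R) (x ^- 2).
    by rewrite -[x ^- 2]opprK; apply: is_deriveN.
  have d2 : is_derive x 1 (expR \o (-%R \o GRing.inv)) (expR (- x^-1) * x ^- 2).
    apply: is_derive1_comp; exact: is_derive_expR.
  apply: is_derive_eq (is_deriveM d1 d2) _.
  rewrite /= !hornerE -exprVn -[_ *: _]/(_ * _) -[X in _ + X]/(_ * _).
  by ring.
(* At the origin the bound by C h^2 makes the difference quotient tend to 0. *)
- rewrite {2}/flatP ltxx; apply/is_derive_cvgP.
  have [C C0 CP] := flatP_quadratic p.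
  apply/cvgr0Pnorm_le => e e0; near=> h.
  rewrite [h *: 1]mulr1 addr0 {2}/flatP ltxx subr0 normrM.
  have h0 : h != 0 by near: h; exact: nbhs_dnbhs_neq.
  rewrite normfV ler_pdivrMl ?normr_gt0//; apply: le_trans (CP h) _.
  rewrite -[h ^+ 2]ger0_norm ?sqr_ge0// normrX expr2 mulrA mulrC ler_wpM2l//.
  have : `|h| < e / (C + 1) by near: h; apply: dnbhs0_lt; rewrite divr_gt0// ltr_wpDl.
  rewrite ltr_pdivlMr ?ltr_wpDl// => /ltW; apply: le_trans.
  by rewrite mulrC ler_wpM2l// lerDl.
Unshelve. all: by end_near. Qed.

Definition flatexp x : R := flatP 1 x.

Lemma smooth1_flatexp : smooth1 flatexp.
Proof.
exists (fun n => flatP (iter n (fun p => 'X ^+ 2 * (p - p^`())) 1)).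
by split => // n x; rewrite iterS; exact: is_derive_flatP.
Qed.

Lemma flatexpE x : 0 < x -> flatexp x = expR (- x^-1).
Proof. by move=> x0; rewrite /flatexp /flatP x0 hornerC mul1r. Qed.

Lemma flatexp0 x : x <= 0 -> flatexp x = 0.
Proof. by rewrite /flatexp /flatP leNgt; case: ifP. Qed.

End FlatFunction.

(** * Fubini's theorem for a bounded kernel *)

Section Integrals.
Variable R : realType.
Local Notation leb := (@lebesgue_measure R).
Implicit Types f g h : R -> R.

Definition int1 f := leb.-integrable [set: R] (EFin \o f).

Lemma int1_measurable f : int1 f -> measurable_fun [set: R] f.
Proof. by move=> /measurable_int /measurable_EFinP. Qed.

Lemma int1_le f g : measurable_fun [set: R] f -> int1 g -> (forall t, `|f t| <= `|g t|) -> int1 f.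
Proof.
move=> mf ig fg; apply: (le_integrable _ _ _ ig) => //; first exact/measurable_EFinP.
by move=> t _; rewrite /= lee_fin.
Qed.

Lemma int1D f g : int1 f -> int1 g -> int1 (fun t => f t + g t).
Proof. by move=> i j; exact: (integrableD _ i j). Qed.

Lemma int1B f g : int1 f -> int1 g -> int1 (fun t => f t - g t).
Proof. by move=> i j; exact: (integrableB _ i j). Qed.

Lemma int1Zl f (k : R) : int1 f -> int1 (fun t => k * f t).
Proof. by move=> i; exact: (integrableZl measurableT k i). Qed.

Lemma int1M f g : int1 f -> measurable_fun [set: R] g -> (forall t, `|g t| <= 1) -> int1 (fun t => f t * g t).
Proof.
move=> i mg g1; apply: (int1_le _ i); first exact: measurable_funM (int1_measurable i) mg.
by move=> t; rewrite normrM ler_piMr.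
Qed.

Lemma int1_norm f : int1 f -> int1 (fun t => `|f t|).
Proof. by move=> i; exact: (integrable_norm i). Qed.

Lemma int1_fin f : int1 f -> (\int[leb]_t (f t)%:E = (\int[leb]_t f t)%:E)%E.
Proof. by move=> i; rewrite fineK// integrable_fin_num. Qed.

Lemma int1_itv (a b : R) f : measurable_fun [set: R] f -> (exists M : R, forall t, a <= t <= b -> `|f t| <= M) ->
  (forall t, ~~ (a <= t <= b) -> f t = 0) -> int1 f.
Proof.
move=> mf [M fM] f0.
have -> : f = f \_ `[a, b].
  apply/funext => t; rewrite patchE mem_setE; case: ifP => //.
  by rewrite in_itv /= => /negbT/f0.
suff : leb.-integrable `[a, b] (EFin \o f).
  move=> h; have := (@integrable_mkcond _ _ _ leb `[a, b] (EFin \o f) (measurable_itv _)).1 h.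
  by rewrite /int1 (_ : (EFin \o f) \_ _ = EFin \o (f \_ `[a, b]))// restrict_EFin.
apply: measurable_bounded_integrable => //.
- by rewrite /= lebesgue_measure_itv; case: ifP => // _; rewrite -EFinB ltry.
- exact: measurable_funTS.
- exists M; split; first exact: num_real.
  move=> x Mx t /=; rewrite in_itv /= => /fM ft.
  exact: le_trans ft (ltW Mx).
Qed.

(** If the integral of |f| is infinite, so is that of the positive or of the negative part; the
    extended integral of f is then infinite, and its real value is 0 by convention. *)
Lemma Rintegral_neq0 f : measurable_fun [set: R] f -> \int[leb]_t f t != 0 -> int1 f.
Proof.
move=> mf; apply: contraNP => nf; rewrite /Rintegral.
have mE : measurable_fun [set: R] (EFin \o f) by exact/measurable_EFinP.
have : (\int[leb]_t `|(f t)%:E| = +oo)%E.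
  by apply/eqP; rewrite -leye_eq leNgt; apply/negP => h; apply: nf; apply/integrableP.
rewrite integralE.
have -> : (fun t => `|(f t)%:E|)%E = (fun t => (fun t => (f t)%:E)^\+ t + (fun t => (f t)%:E)^\- t)%E.
  by rewrite -fune_abse.
rewrite ge0_integralD//; last 2 first.
- exact: measurable_funepos.
- exact: measurable_funeneg.
have : (0 <= \int[leb]_t (fun t => (f t)%:E)^\+ t)%E by exact: integral_ge0.
have : (0 <= \int[leb]_t (fun t => (f t)%:E)^\- t)%E by exact: integral_ge0.
by case: (integral _ _ _) => [a| |]; case: (integral _ _ _) => [b| |].
Qed.

Lemma Rint_ge0_le f g : (forall t, 0 <= f t) -> (forall t, f t <= g t) -> measurable_fun [set: R] f -> int1 g ->
  int1 f /\ \int[leb]_t f t <= \int[leb]_t g t.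
Proof.
move=> f0 fg mf ig; have jf : int1 f.
  by apply: (int1_le mf ig) => t; rewrite !ger0_norm// (le_trans (f0 t)).
by split=> //; apply: le_Rintegral.
Qed.

Lemma Rintegral_lower f (a b k : R) : int1 f -> (forall t, 0 <= f t) -> a <= b ->
  (forall t, a <= t <= b -> k <= f t) -> k * (b - a) <= \int[leb]_t f t.
Proof.
move=> jf f0 ab kf.
have -> : k * (b - a) = \int[leb]_(t in `[a, b]) k.
  rewrite Rintegral_cst//= lebesgue_measure_itv /= lte_fin; case: ltP => //= ba.
  by rewrite (_ : b = a) ?subrr//; apply/eqP; rewrite eq_le ba ab.
apply: (@le_trans _ _ (\int[leb]_(t in `[a, b]) f t)).
  apply: le_Rintegral => //.
  - exact: (continuous_compact_integrable (@segment_compact _ a b) (continuous_subspaceT (fun=> cvg_cst _))).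
  - exact: (integrableS measurableT).
rewrite Rintegral_mkcond; apply: (Rint_ge0_le _ _ _ jf).2.
- by move=> t; rewrite patchE; case: ifP.
- by move=> t; rewrite patchE; case: ifP.
- apply/measurable_restrict => //; rewrite setTI; apply: measurable_funTS.
  exact: int1_measurable.
Qed.

(** Rational squares form a countable base, so open sets of the plane lie in the product
    sigma-algebra, the one in which Fubini's theorem is stated. *)
Lemma open_measurable2 (U : set (R * R)) : open U -> measurable U.
Proof.
move=> oU.
pose box (q : rat * rat * rat) : set (R * R) :=
  (ball (ratr q.1.1 : R) (ratr q.2 : R)) `*` (ball (ratr q.1.2 : R) (ratr q.2 : R)).
have -> : U = \bigcup_(q in [set q | box q `<=` U]) box q.
  apply/seteqP; split=> [[x y] Uxy|p [q qU]]; last exact: qU.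
  have /nbhs_ballP [e /= e0 eU] : nbhs (x, y) U by exact: open_nbhs_nbhs.
  have [r re] := @rat_in_itvoo R 0 (e / 2) (divr_gt0 e0 (ltr0n _ 2)).
  move: re; rewrite in_itv /= => /andP[r0 re].
  have [q1] := @rat_in_itvoo R (x - ratr r) (x + ratr r) ltac:(lra).
  have [q2] := @rat_in_itvoo R (y - ratr r) (y + ratr r) ltac:(lra).
  rewrite !in_itv /= => /andP[y1 y2] /andP[x1 x2].
  exists (q1, q2, r).
    move=> [x' y'] [] /=; rewrite /ball /= => hx hy; apply: eU; split => /=; rewrite /ball /=.
      by move: hx; rewrite !ltr_norml => /andP[? ?]; apply/andP; split; lra.
    by move: hy; rewrite !ltr_norml => /andP[? ?]; apply/andP; split; lra.
  by split; rewrite /box /ball /= ltr_norml; apply/andP; split; lra.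
rewrite bigcup_mkcond; apply: countable_bigcupT_measurable; first exact: countableP.
by move=> q; case: ifP => // _; apply: measurableX; exact: measurable_ball.
Qed.

Lemma continuous_measurable2 (k : R * R -> R) : continuous k -> measurable_fun [set: R * R] k.
Proof.
move=> ck; apply: (measurability (@RGenOpens.G R)); first exact: RGenOpens.measurableE.
move=> _ [_ [a [b ->] <-]]; rewrite setTI; apply: open_measurable2.
by move/continuousP: ck; apply; exact: interval_open.
Qed.

End Integrals.

Section Kernel.
Variables (R : realType) (K : R -> R -> R).
Local Notation leb := (@lebesgue_measure R).
Hypothesis K1 : forall l t, `|K l t| <= 1.
Hypothesis cK : continuous (fun p : R * R => K p.1 p.2).
Implicit Types A B : R -> R.

Let mK2 : measurable_fun [set: R * R] (fun p : R * R => K p.1 p.2) := continuous_measurable2 cK.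

Lemma kernel_continuousr l : continuous (K l).
Proof.
move=> t; apply: (@continuous_comp _ _ _ (fun t : R => (l, t)) (fun p : R * R => K p.1 p.2)); last exact: cK.
by apply: (@cvg_pair _ _ _ (nbhs t) (nbhs l) (nbhs t)); [exact: cvg_cst|exact: cvg_id].
Qed.

Lemma kernel_continuousl t : continuous (K ^~ t).
Proof.
move=> l; apply: (@continuous_comp _ _ _ (fun l : R => (l, t)) (fun p : R * R => K p.1 p.2)); last exact: cK.
by apply: (@cvg_pair _ _ _ (nbhs l) (nbhs l) (nbhs t)); [exact: cvg_id|exact: cvg_cst].
Qed.

Lemma kernel_measurabler l : measurable_fun [set: R] (K l).
Proof. apply: continuous_measurable_fun; exact: kernel_continuousr. Qed.

Lemma kernel_measurablel t : measurable_fun [set: R] (K ^~ t).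
Proof. apply: continuous_measurable_fun; exact: kernel_continuousl. Qed.

Definition tr B l := \int[leb]_t (B t * K l t).

Lemma int1_kernelr B l : int1 B -> int1 (fun t => B t * K l t).
Proof. by move=> iB; apply: int1M => //; exact: kernel_measurabler. Qed.

Lemma tr_continuous B : int1 B -> continuous (tr B).
Proof.
move=> iB l.
have := @continuity_under_integral R _ (measurableTypeR R) leb (fun l t => B t * K l t) setT measurableT (l - 1) (l + 1) _ _ (fun t => `|B t|) _ _.
apply; last by rewrite inE /= in_itv /=; apply/andP; split; lra.
- by move=> x _; exact: int1_kernelr.
- by apply: aeW => t _ x _; apply: cvgM; [exact: cvg_cst|exact: kernel_continuousl].
- exact: int1_norm.
- by move=> x _; apply: aeW => t _; rewrite normrM ler_piMr.
Qed.

Lemma tr_measurable B : int1 B -> measurable_fun [set: R] (tr B).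
Proof. by move=> iB; apply: continuous_measurable_fun; exact: (tr_continuous iB). Qed.

Lemma trD B B' l : int1 B -> int1 B' -> tr (fun t => B t + B' t) l = tr B l + tr B' l.
Proof.
move=> i i'; rewrite /tr -RintegralD//; [|exact: int1_kernelr..].
by apply: eq_Rintegral => t _; rewrite mulrDl.
Qed.

(** The bound on the l-integral is asked only where [B] is nonzero, because it will be available
    only for t in a compact part of the open half-line; elsewhere the integrand is 0. *)
Lemma fubini_kernel A B (M : R) : measurable_fun [set: R] A -> int1 B ->
  (forall t, B t != 0 -> (\int[leb]_l `|A l * K l t|%:E <= M%:E)%E) ->
  [/\ int1 (fun l => A l * tr B l), int1 (fun t => B t * \int[leb]_l (A l * K l t)) &
      \int[leb]_l (A l * tr B l) = \int[leb]_t (B t * \int[leb]_l (A l * K l t))].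
Proof.
move=> mA iB bM; have mB := int1_measurable iB.
pose F (p : R * R) : \bar R := (A p.1 * (B p.2 * K p.1 p.2))%:E.
have mF : measurable_fun [set: R * R] F.
  apply/measurable_EFinP; apply: measurable_funM; first exact: measurableT_comp mA measurable_fst.
  by apply: measurable_funM; first exact: measurableT_comp mB measurable_snd.
have iAK t : B t != 0 -> int1 (fun l => A l * K l t).
  move=> Bt; apply/integrableP; split.
    by apply/measurable_EFinP; apply: measurable_funM => //; exact: kernel_measurablel.
  by apply: le_lt_trans (bM _ Bt) _; rewrite ltry.
have E1 l : (\int[leb]_t F (l, t) = (A l * tr B l)%:E)%E.
  rewrite -RintegralZl//; last exact: int1_kernelr.
  by rewrite /F /= int1_fin//; apply: int1Zl; exact: int1_kernelr.
have E2 t : (\int[leb]_l F (l, t) = (B t * \int[leb]_l (A l * K l t))%:E)%E.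
  have [B0|Bt] := eqVneq (B t) 0.
    by rewrite B0 mul0r; apply: integral0_eq => l _; rewrite /F /= B0 mul0r mulr0.
  rewrite -RintegralZl//; last exact: iAK.
  rewrite /F /= -int1_fin; last by apply: int1Zl; exact: iAK.
  by apply: eq_integral => l _; rewrite mulrCA.
have iF : (leb \x leb)%E.-integrable setT F.
  apply: (@integrable21ltyP _ _ (measurableTypeR R) (measurableTypeR R) R leb leb F mF).2.
  apply: (@le_lt_trans _ _ (\int[leb]_t (M * `|B t|)%:E)%E); last first.
    by rewrite int1_fin ?ltry//; apply: int1Zl; exact: int1_norm.
  apply: ge0_le_integral => //.
  - by move=> t _; apply: integral_ge0.
  - apply: (@measurable_fun_fubini_tonelli_G _ _ (measurableTypeR R) (measurableTypeR R) R leb (fun p => `|F p|%E)) => //.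
    exact: measurableT_comp mF.
  - by apply/measurable_EFinP; apply: measurable_funM => //; exact: measurableT_comp mB.
  - move=> t _; have [B0|Bt] := eqVneq (B t) 0.
      rewrite B0 normr0 mulr0 le_eqVlt; apply/orP; left; apply/eqP.
      by apply: integral0_eq => l _; rewrite /F /= B0 mul0r mulr0 normr0.
    rewrite (_ : (fun l => `|F (l, t)|)%E = (fun l => (`|B t|%:E * `|A l * K l t|%:E)%E)); last first.
      by apply/funext => l; rewrite /F /= -EFinM -normrM mulrCA.
    rewrite ge0_integralZl//; last first.
      by apply/measurable_EFinP; apply: measurableT_comp => //; apply: measurable_funM => //; exact: kernel_measurablel.
    by rewrite mulrC EFinM lee_wpmul2l// ?lee_fin// bM.
have i1 : int1 (fun l => A l * tr B l).
  have h := @integrable_fubini_F _ _ (measurableTypeR R) (measurableTypeR R) R leb leb F iF.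
  rewrite /int1 (_ : EFin \o _ = fubini_F leb F); first exact: h.
  by apply/funext => l; rewrite /fubini_F E1.
have i2 : int1 (fun t => B t * \int[leb]_l (A l * K l t)).
  have mG : measurable_fun [set: R] (fun t => B t * \int[leb]_l (A l * K l t)).
    apply/measurable_EFinP; have h := @measurable_fubini_G _ _ (measurableTypeR R) (measurableTypeR R) R leb leb F iF.
    by apply: (eq_measurable_fun _ _ h) => t _; rewrite /fubini_G E2.
  apply: (int1_le mG (int1Zl M iB)) => t.
  have [B0|Bt] := eqVneq (B t) 0; first by rewrite B0 mul0r normr0.
  rewrite !normrM mulrC ler_wpM2r//.
  apply: (le_trans _ (ler_norm _)); apply: le_trans (le_normr_Rintegral _ (iAK _ Bt)) _ => //.
  by rewrite -lee_fin -int1_fin ?bM//; apply: int1_norm; exact: iAK.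
split; [exact: i1|exact: i2|]; apply: EFin_inj; rewrite -(int1_fin i1) -(int1_fin i2).
transitivity (\int[leb]_l \int[leb]_t F (l, t))%E; first by apply: eq_integral => l _; rewrite E1.
rewrite (@Fubini _ _ (measurableTypeR R) (measurableTypeR R) R leb leb F iF).
by apply: eq_integral => t _; rewrite E2.
Qed.

End Kernel.

(** * Products and affine substitutions of smooth functions of one variable *)

Section SmoothClosure.
Variable R : realType.
Implicit Types F G : R -> R.

Lemma smooth1_continuous F : smooth1 F -> continuous F.
Proof.
move=> [Fs [<- dF]] x; apply: differentiable_continuous; apply/derivable1_diffP.
by have := dF 0%N x; move=> [].
Qed.

Lemma smooth1D F G : smooth1 F -> smooth1 G -> smooth1 (fun y => F y + G y).
Proof.
move=> [Fs [<- dF]] [Gs [<- dG]]; exists (fun n y => Fs n y + Gs n y); split=> // n x.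
exact: is_deriveD (dF n x) (dG n x).
Qed.

Lemma smooth1_affine F (k b : R) : smooth1 F -> smooth1 (fun y => F (k * y + b)).
Proof.
move=> [Fs [<- dF]]; exists (fun n y => k ^+ n * Fs n (k * y + b)); split=> [|n x].
  by apply/funext => y; rewrite expr0 mul1r.
have da : is_derive x (1 : R) (fun y : R => k * y + b) k.
  by apply: is_derive_eq; rewrite addr0 /GRing.scale /= mulr1.
have h := is_deriveZ (k ^+ n) (@is_derive1_comp R (Fs n) (fun y : R => k * y + b) x _ _ (dF n _) da).
by apply: (is_derive_eq h); rewrite /GRing.scale /= exprSr; ring.
Qed.

Lemma smooth1M F G : smooth1 F -> smooth1 G -> smooth1 (fun y => F y * G y).
Proof.
move=> [Fs [<- dF]] [Gs [<- dG]].
(* Leibniz rule without binomial coefficients: each pair (i, j) of orders is listed with its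
   multiplicity. *)
pose L n := iter n (fun r => [seq (ij.1.+1, ij.2) | ij <- r] ++ [seq (ij.1, ij.2.+1) | ij <- r]) [:: (0, 0)%N].
exists (fun n y => \sum_(ij <- L n) Fs ij.1 y * Gs ij.2 y); split=> [|n x].
  by apply/funext => y; rewrite big_seq1.
rewrite /= big_cat !big_map /=; elim: (L n) => [|ij r IH].
  by rewrite (_ : (fun y => _) = cst 0); [rewrite !big_nil addr0; exact: is_derive_cst|apply/funext => y; rewrite big_nil].
rewrite (_ : (fun y => _) = (fun y => Fs ij.1 y * Gs ij.2 y + \sum_(j <- r) Fs j.1 y * Gs j.2 y)); last by apply/funext => y; rewrite big_cons.
by apply: (is_derive_eq (is_deriveD (is_deriveM (dF ij.1 x) (dG ij.2 x)) IH)); rewrite !big_cons /GRing.scale /=; ring.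
Qed.

End SmoothClosure.

Lemma lip_mvt (R : realType) (f f' : R -> R) (a b M : R) : (forall t : R, is_derive t 1 f (f' t)) -> a <= b ->
  (forall t, a <= t <= b -> `|f' t| <= M) -> `|f b - f a| <= M * (b - a).
Proof.
move=> df ab fM.
have [c cab ->] := @MVT_segment R f f' a b ab (fun x _ => df x) (continuous_subspaceT (fun x => differentiable_continuous ((derivable1_diffP _ _).1 (let: DeriveDef h _ := df x in h)))).
by rewrite normrM (ger0_norm (x := b - a)) ?subr_ge0// ler_wpM2r ?subr_ge0// fM.
Qed.

Section FlatBounds.
Variable R : realType.

Lemma flatexp_ge0 (x : R) : 0 <= flatexp x.
Proof. by have [x0|x0] := leP x 0; [rewrite flatexp0|rewrite flatexpE// expR_ge0]. Qed.

Lemma flatexp_le1 (x : R) : flatexp x <= 1.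
Proof.
have [x0|x0] := leP x 0; first by rewrite flatexp0.
by rewrite flatexpE// -expR0 ler_expR oppr_le0 invr_ge0 ltW.
Qed.

Lemma flatexp_le (x y : R) : x <= y -> flatexp x <= flatexp y.
Proof.
move=> xy; have [x0|x0] := leP x 0; first by rewrite flatexp0// flatexp_ge0.
by rewrite !flatexpE ?(lt_le_trans x0)// ler_expR lerN2 lef_pV2// posrE (lt_le_trans x0).
Qed.

Lemma flatexp_gt0 (x : R) : 0 < x -> 0 < flatexp x.
Proof. by move=> x0; rewrite flatexpE// expR_gt0. Qed.

End FlatBounds.

(** * Inversion for an abstract spherical transform on the half-line *)

Section HalfLine.
(** To be read with [psi l t] the spherical function at a_t, [psi1] and [psi2] its derivatives in t,
    [p] the logarithmic derivative of the density [D], [T t] the value of tau at a_t, and [w] a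
    positive multiple of |c(l)|^-2. *)
Variables (R : realType) (rho c s : R) (psi psi1 psi2 : R -> R -> R) (p D T w : R -> R).
Local Notation leb := (@lebesgue_measure R).
Hypothesis rho0 : 0 < rho.
Hypothesis c_gt0 : 0 < c.
Hypothesis s12 : 2^-1 < s.
Hypothesis dpsi : forall l t : R, is_derive t 1 (psi l) (psi1 l t).
Hypothesis dpsi1 : forall l t : R, is_derive t 1 (psi1 l) (psi2 l t).
Hypothesis ode : forall l t : R, 0 < t -> psi2 l t + p t * psi1 l t = - (l ^+ 2 + rho ^+ 2) * psi l t.
Hypothesis p_ge0 : forall t : R, 0 < t -> 0 <= p t.
Hypothesis p_le : forall a b : R, 0 < a -> exists P, forall t : R, a <= t <= b -> p t <= P.
Hypothesis psi_le1 : forall l t : R, 0 <= t -> `|psi l t| <= 1.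
Hypothesis psi1_le : forall l t : R, 0 <= t -> psi1 l t ^+ 2 <= l ^+ 2 + rho ^+ 2.
Hypothesis psi0 : forall l : R, psi l 0 = 1.
Hypothesis psi_lc : forall t : R, continuous (psi ^~ t).
Hypothesis D_continuous : continuous D.
Hypothesis D_gt0 : forall t : R, 0 < t -> 0 < D t.
Hypothesis D_ge0 : forall t : R, 0 <= t -> 0 <= D t.
Hypothesis D_le : forall t u : R, 0 <= t -> t <= u -> D t <= D u.
Hypothesis T_continuous : continuous T.
Hypothesis T_lt : forall t u : R, 0 <= t -> t < u -> T t < T u.
(** Only on intervals away from 0: in the application [T] is even, so its derivative vanishes at
    0. *)
Hypothesis T_lip : forall a b : R, 0 < a -> exists m M, [/\ 0 < m, 0 < M &
  forall t u : R, a <= t -> t <= u -> u <= b -> m * (u - t) <= T u - T t <= M * (u - t)].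
Hypothesis w_ge0 : forall l : R, 0 <= w l.
Hypothesis w_measurable : measurable_fun [set: R] w.

(* Integrals over the half-line are written as integrals over the line, the
   densities D and w being extended by zero. *)
Definition Dp t := if 0 <= t then D t else 0.
Definition wp l := if 0 <= l then w l else 0.
Definition kern (l t : R) := psi l `|t|.
Definition hat (h : R -> R) := tr kern (fun t => h t * Dp t).
(** Smoothness is required in the variable T t and not in t, since it is [F] of tau that is smooth
    on the group. *)
Definition test (F : R -> R) := smooth1 F /\ exists2 M, 0 < M & forall y, T M <= y -> F y = 0.

Hypothesis inversion : forall F, test F -> forall t : R, 0 <= t ->
  F (T t) = c * \int[leb]_l (hat (fun t => F (T t)) l * wp l * kern l t).

Lemma T_le (t u : R) : 0 <= t -> t <= u -> T t <= T u.
Proof. by move=> t0; rewrite le_eqVlt => /predU1P[->//|/(T_lt t0)/ltW]. Qed.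

Lemma wp_ge0 (l : R) : 0 <= wp l. Proof. by rewrite /wp; case: ifP. Qed.

Lemma Dp_ge0 (t : R) : 0 <= Dp t. Proof. by rewrite /Dp; case: ifP => // /D_ge0. Qed.

Lemma half_line_measurable (f : R -> R) : measurable_fun [set: R] f ->
  measurable_fun [set: R] (fun t => if 0 <= t then f t else 0).
Proof.
move=> mf; rewrite (_ : (fun t => _) = f \_ `[0, +oo[).
  by apply/measurable_restrict => //; rewrite setTI; exact: measurable_funTS.
by apply/funext => t; rewrite patchE mem_setE in_itv /= andbT.
Qed.

Lemma wp_measurable : measurable_fun [set: R] wp.
Proof. exact: half_line_measurable. Qed.

Lemma Dp_measurable : measurable_fun [set: R] Dp.
Proof. by apply: half_line_measurable; exact: continuous_measurable_fun. Qed.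

Lemma psi1_norm (l t : R) : 0 <= t -> `|psi1 l t| <= `|l| + rho.
Proof.
move=> t0; rewrite -(@ler_pXn2r _ 2) ?nnegrE ?addr_ge0 ?(ltW rho0)//.
rewrite real_normK ?num_real//; apply: le_trans (psi1_le l t0) _.
rewrite -(real_normK (num_real l)) sqrrD lerD2r lerDl.
by rewrite mulrn_wge0// mulr_ge0// ltW.
Qed.

Lemma psi_lip (l t u : R) : 0 <= t -> 0 <= u -> `|psi l t - psi l u| <= (`|l| + rho) * `|t - u|.
Proof.
wlog tu : t u / u <= t.
  by move=> W t0 u0; have [ut|/ltW tu] := leP u t; [exact: W|rewrite distrC (distrC t); exact: W].
move=> t0 u0; rewrite (ger0_norm (x := t - u)) ?subr_ge0//.
by apply: (lip_mvt (dpsi l) tu) => x /andP[ux _]; apply: psi1_norm; exact: le_trans ux.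
Qed.

Lemma kern_le1 (l t : R) : `|kern l t| <= 1. Proof. exact: psi_le1. Qed.

Lemma kern_continuous : continuous (fun p : R * R => kern p.1 p.2).
Proof.
move=> [l t]; apply/cvgrPdist_lt => /= e e0.
have A0 : 0 < `|l| + 1 + rho by rewrite ltr_wpDl// ltr_wpDl.
have h1 : \forall x \near l, `|psi l `|t| - psi x `|t| | < e / 2.
  by have /cvgrPdist_lt := @psi_lc `|t| l; apply; rewrite divr_gt0.
have h2 : \forall x \near l, `|l - x| < 1 by exact: (nbhsx_ballx l 1 ltr01).
have h3 : \forall x \near t, `|t - x| < e / 2 / (`|l| + 1 + rho).
  by apply: (nbhsx_ballx t _ _); rewrite !divr_gt0.
near=> q.
have q1 : `|l - q.1| < 1 by near: q; exact: (@cvg_fst _ _ (nbhs l) (nbhs t) _ _ h2).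
have q2 : `|t - q.2| < e / 2 / (`|l| + 1 + rho) by near: q; exact: (@cvg_snd _ _ (nbhs l) (nbhs t) _ _ h3).
have q3 : `|psi l `|t| - psi q.1 `|t| | < e / 2 by near: q; exact: (@cvg_fst _ _ (nbhs l) (nbhs t) _ _ h1).
rewrite /kern -(subrKA (psi q.1 `|t|)) (le_lt_trans (ler_normD _ _))// [e in _ < e]splitr ltrD//.
apply: le_lt_trans (psi_lip _ _ _) _ => //.
apply: (@le_lt_trans _ _ ((`|l| + 1 + rho) * `|t - q.2|)).
  apply: ler_pM => //; first by rewrite addr_ge0 ?(ltW rho0).
    by have := ler_distD l 0 q.1; rewrite !sub0r !normrN; lra.
  by rewrite (le_trans (ler_dist_dist _ _)).
by rewrite mulrC -ltr_pdivlMr.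
Unshelve. all: by end_near.
Qed.

Lemma kern_measurable (t : R) : measurable_fun [set: R] (kern ^~ t).
Proof. exact: (kernel_measurablel kern_continuous). Qed.

Lemma continuous_bounded (g : R -> R) (a b : R) : continuous g -> exists M : R, forall t, a <= t <= b -> `|g t| <= M.
Proof.
move=> cg; have [ab|ba] := leP a b; last by exists 0 => t /andP[ta tb]; have := le_lt_trans (le_trans ta tb) ba; rewrite ltxx.
have [u _ gu] := @EVT_max R (fun t => `|g t|) a b ab (continuous_subspaceT (fun x => continuous_comp (cg x) (@norm_continuous _ _ _))).
by exists `|g u| => t tab; apply: gu; rewrite in_itv.
Qed.

Lemma int1_Dp (g : R -> R) (M : R) : continuous g -> (forall t, M <= t -> g t = 0) -> int1 (fun t => g t * Dp t).
Proof.
move=> cg gM; apply: (@int1_itv _ 0 M).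
- by apply: measurable_funM; [exact: continuous_measurable_fun|exact: Dp_measurable].
- have [B gB] := @continuous_bounded (fun t => g t * D t) 0 M (fun x => cvgM (cg x) (@D_continuous x)).
  by exists B => t tM; rewrite /Dp; case/andP: (tM) => -> _; exact: gB.
- move=> t; rewrite negb_and -!ltNge /Dp => /orP[t0|/ltW/gM->]; last by rewrite mul0r.
  by rewrite leNgt t0 mulr0.
Qed.

Lemma test_continuous F : test F -> continuous (fun t => F (T t)).
Proof. by move=> [/smooth1_continuous cF _] t; apply: (@continuous_comp _ _ _ T F); [exact: T_continuous|exact: cF]. Qed.

Lemma test_int1 F : test F -> int1 (fun t => F (T t) * Dp t).
Proof.
move=> tF; have cF := test_continuous tF; case: tF => _ [M M0 FM].
by apply: (int1_Dp (M := M) cF) => t Mt; apply: FM; apply: T_le => //; exact: ltW.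
Qed.

Lemma hat_measurable h : int1 (fun t => h t * Dp t) -> measurable_fun [set: R] (hat h).
Proof. exact: (tr_measurable kern_le1 kern_continuous). Qed.

Lemma testD F G : test F -> test G -> test (fun y => F y + G y).
Proof.
move=> [sF [M M0 FM]] [sG [N N0 GN]]; split; first exact: smooth1D.
exists (Num.max M N); first by rewrite lt_max M0.
move=> y Ty; rewrite FM ?GN ?addr0//; apply: le_trans Ty; apply: T_le; rewrite ?(ltW M0) ?(ltW N0)// le_max lexx ?orbT//.
Qed.

(** As a function of t it is positive for t < d and 0 beyond: it corrects values at the origin and
    isolates low frequencies. *)
Lemma test_flat (d : R) : 0 < d -> test (fun y => flatexp (- 1 * y + T d)).
Proof.
move=> d0; split; first exact: smooth1_affine (smooth1_flatexp R).
by exists d => // y Ty; apply: flatexp0; lra.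
Qed.

(* The inversion formula is only known for the possibly diverging integral, whose
   value is then 0; a nonzero value at the origin rules this out. *)
Lemma test_hat_int1_neq0 F : test F -> F (T 0) != 0 -> int1 (fun l => hat (fun t => F (T t)) l * wp l).
Proof.
move=> tF; have iF := test_int1 tF; rewrite (inversion tF (lexx 0)) => h.
apply: Rintegral_neq0; first exact: measurable_funM (hat_measurable iF) wp_measurable.
apply: contra_neq h => h; rewrite -[RHS](mulr0 c); congr (_ * _); rewrite -[RHS]h; apply: eq_Rintegral => l _.
by rewrite /kern normr0 psi0 mulr1.
Qed.

(** When F vanishes at the origin, add a test function that does not, and subtract its transform
    afterwards. *)
Lemma test_hat_int1 F : test F -> int1 (fun l => hat (fun t => F (T t)) l * wp l).
Proof.
move=> tF; have [F0|] := eqVneq (F (T 0)) 0; last exact: test_hat_int1_neq0.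
have tG := test_flat ltr01; set G := (fun y => _) in tG.
have G0 : G (T 0) != 0.
  by rewrite gt_eqF// /G flatexpE ?expR_gt0//; have := T_lt (lexx 0) ltr01; lra.
have tS := testD tF tG; have S0 : F (T 0) + G (T 0) != 0 by rewrite F0 add0r.
have := int1B (test_hat_int1_neq0 tS S0) (test_hat_int1_neq0 tG G0).
have iF := test_int1 tF; have iG := test_int1 tG.
rewrite (_ : (fun l => _) = (fun l => hat (fun t => F (T t)) l * wp l))//; apply/funext => l.
rewrite -mulrBl; congr (_ * _).
rewrite (_ : hat _ l = hat (fun t => F (T t)) l + hat (fun t => G (T t)) l) ?addrK//.
rewrite /hat -(trD kern_le1 kern_continuous)//; congr (tr kern _ l).
by apply/funext => t; rewrite mulrDl.
Qed.

(** Integrate the inversion formula of F against h D and exchange the integrals, which is legitimate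
    as the transform of F times [wp] is integrable and |kern| <= 1. Only one of the two functions
    has to be a test function. *)
Lemma plancherel F h : test F -> int1 (fun t => h t * Dp t) ->
  int1 (fun l => hat (fun t => F (T t)) l * wp l * hat h l) /\
  c * \int[leb]_l (hat (fun t => F (T t)) l * wp l * hat h l) = \int[leb]_t (h t * Dp t * F (T t)).
Proof.
move=> tF ih; have iA := test_hat_int1 tF; set A := (fun l => _ * wp l) in iA *.
have [] := fubini_kernel kern_le1 kern_continuous (M := \int[leb]_l `|A l|) (int1_measurable iA) ih.
  move=> t _; rewrite -int1_fin; last exact: int1_norm.
  apply: ge0_le_integral => //.
  - apply/measurable_EFinP; apply: measurableT_comp => //; apply: measurable_funM (int1_measurable iA) _.
    exact: kern_measurable.
  - by apply/measurable_EFinP; apply: measurableT_comp => //; exact: int1_measurable.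
  - by move=> l _; rewrite lee_fin normrM ler_piMr// kern_le1.
move=> i1 i2 E; split; first exact: i1.
rewrite E -(RintegralZl _ measurableT i2); apply: eq_Rintegral => t _; rewrite /Dp; case: ifP => t0.
  by rewrite (inversion tF t0) mulrCA.
by rewrite mulr0 !mul0r mulr0.
Qed.

Lemma integral_le_Rint (E : set R) (f g : R -> R) : measurable E -> (forall l, E l -> 0 <= f l <= g l) ->
  (forall l, 0 <= g l) -> measurable_fun [set: R] f -> int1 g ->
  (\int[leb]_(l in E) (f l)%:E <= (\int[leb]_l g l)%:E)%E.
Proof.
move=> mE fg g0 mf ig; rewrite -int1_fin//.
apply: (@le_trans _ _ (\int[leb]_(l in E) (g l)%:E)%E).
  apply: ge0_le_integral => //.
  - by move=> l /fg /andP[f0 _]; rewrite lee_fin.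
  - by apply/measurable_EFinP; exact: measurable_funTS.
  - by apply/measurable_EFinP; apply: measurable_funTS; exact: int1_measurable.
  - by move=> l /fg /andP[_ h]; rewrite lee_fin.
apply: ge0_subset_integral => //.
- by apply/measurable_EFinP; exact: int1_measurable.
- by move=> l _; rewrite lee_fin.
Qed.

(** A test function supported in t <= d = 1/(2 (L + rho)) sees psi l t >= 1/2 for 0 <= l <= L, by
    the Lipschitz bound and psi l 0 = 1. Its transform is then at least half its mass, and the
    transform times [wp] is integrable. *)
Lemma wp_low (L : R) : 0 < L -> (\int[leb]_(l in `]-oo, L]) (wp l)%:E < +oo)%E.
Proof.
move=> L0; have Lr : 0 < L + rho by rewrite addr_gt0.
pose d := (2 * (L + rho))^-1; have d0 : 0 < d by rewrite invr_gt0 mulr_gt0.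
have tF := test_flat d0; set F := (fun y => _) in tF; have iF := test_int1 tF.
have FD0 t : 0 <= F (T t) * Dp t by rewrite mulr_ge0 ?flatexp_ge0 ?Dp_ge0.
(* A lower bound for the integrand on [d/4, d/2], which makes the mass positive. *)
pose k := F (T (d / 2)) * D (d / 4).
have k0 : 0 < k.
  rewrite mulr_gt0 ?D_gt0 ?divr_gt0// /F flatexp_gt0//.
  have : T (d / 2) < T d by apply: T_lt; lra.
  by lra.
have z0 : 0 < \int[leb]_t (F (T t) * Dp t).
  apply: (@lt_le_trans _ _ (k * (d / 2 - d / 4))); first by rewrite mulr_gt0//; lra.
  apply: Rintegral_lower => //; first by lra.
  move=> t /andP[t1 t2]; have t0 : 0 <= t by lra.
  rewrite /Dp t0; apply: ler_pM; rewrite ?flatexp_ge0// ?D_ge0//; first by lra.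
    apply: flatexp_le; have : T t <= T (d / 2) by exact: T_le.
    by lra.
  by apply: D_le => //; lra.
have hz l : 0 <= l <= L -> \int[leb]_t (F (T t) * Dp t) <= 2 * hat (fun t => F (T t)) l.
  move=> /andP[l0 lL]; rewrite /hat /tr -RintegralZl//; last exact: (int1_kernelr kern_le1 kern_continuous).
  apply: le_Rintegral => //.
    by apply: int1Zl; exact: (int1_kernelr kern_le1 kern_continuous).
  move=> t _; have [t0|t0] := leP 0 (t : R); last by rewrite /Dp (leNgt 0 t) t0 /= mulr0 mul0r mulr0.
  have [td|dt] := leP t d; last first.
    have Td : T d < T t by exact: T_lt (ltW d0) dt.
    by rewrite {1 2}/F flatexp0 ?mul0r ?mulr0//; lra.
  rewrite mulrCA ler_peMr//.
  have := psi_lip l (lexx 0) t0; rewrite psi0 sub0r normrN ler_norml /kern !(ger0_norm t0) (ger0_norm l0) => /andP[_].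
  have : (l + rho) * t <= (L + rho) * d by apply: ler_pM => //; [rewrite addr_ge0// ltW|rewrite lerD2r].
  have : (L + rho) * d = 1 / 2 by rewrite /d; field; rewrite gt_eqF.
  by lra.
have iA := test_hat_int1 tF.
pose g l := 2 / \int[leb]_t (F (T t) * Dp t) * `|hat (fun t => F (T t)) l * wp l|.
apply: (@le_lt_trans _ _ (\int[leb]_l g l)%:E); last exact: ltry.
apply: integral_le_Rint => //.
- move=> l; rewrite /= in_itv /= => lL; rewrite wp_ge0 /=.
  have [l0|l0] := leP 0 l; last by rewrite {1}/wp (leNgt 0 l) l0 /= /g mulr_ge0// divr_ge0// ltW.
  rewrite /g normrM (ger0_norm (wp_ge0 l)) mulrA ler_peMl ?wp_ge0//.
  rewrite mulrAC ler_pdivlMr// mul1r; apply: le_trans (hz l _) _; first by rewrite l0.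
  by rewrite ler_wpM2l// ler_norm.
- by move=> l; rewrite /g mulr_ge0// divr_ge0// ltW.
- exact: wp_measurable.
- by apply: int1Zl; exact: int1_norm.
Qed.

(** By the equation, the energy has derivative -2 p psi1^2. *)
Lemma energy_le (a l t : R) : 0 < a -> a <= t ->
  psi1 l t ^+ 2 + (l ^+ 2 + rho ^+ 2) * psi l t ^+ 2 <= psi1 l a ^+ 2 + (l ^+ 2 + rho ^+ 2) * psi l a ^+ 2.
Proof.
move=> a0 aT; pose E (t : R) := psi1 l t ^+ 2 + (l ^+ 2 + rho ^+ 2) * psi l t ^+ 2.
pose E' (t : R) := 2 * psi1 l t * (psi2 l t + (l ^+ 2 + rho ^+ 2) * psi l t).
have dE (x : R) : is_derive x 1 E (E' x).
  have d1 := is_deriveM (dpsi1 l x) (dpsi1 l x).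
  have d2 := is_deriveZ (l ^+ 2 + rho ^+ 2) (is_deriveM (dpsi l x) (dpsi l x)).
  by apply: (is_derive_eq (is_deriveD d1 d2)); rewrite /E' /GRing.scale /=; ring.
have [u /andP[au ut] h] := @MVT_segment R E E' a t aT (fun x _ => dE x) (continuous_subspaceT (fun x => differentiable_continuous ((derivable1_diffP _ _).1 (let: DeriveDef h _ := dE x in h)))).
rewrite -subr_le0 -!/(E _) h mulr_le0_ge0 ?subr_ge0//.
have u0 : 0 < u by exact: lt_le_trans a0 au.
have -> : E' u = - (2 * p u * psi1 l u ^+ 2).
  by have := ode l u0; rewrite /E' => o; rewrite (_ : psi2 l u + _ = - (p u * psi1 l u)); [ring|lra].
by rewrite oppr_le0 mulr_ge0 ?sqr_ge0// mulr_ge0// p_ge0.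
Qed.

(* The energy M^2 = psi1^2 + (l^2 + rho^2) psi^2 at a - e dominates the energy
   at all later times, which bounds the variation of psi and psi1. If h is a
   small multiple of 1/L, the values of psi at a and a + h therefore determine
   psi and psi1 up to a small multiple of M, and this survives replacing them by
   averages A1, A2 over a window of width e. *)
Lemma dyadic_pointwise (a l L A1 A2 : R) (e := (152 * L)^-1) (h := (16 * L)^-1) :
  0 < L -> rho <= L -> L <= l -> l <= 2 * L -> 0 < a - e ->
  (forall t, a - e <= t <= a + h -> p t <= L) ->
  (forall M, (forall t, a - e <= t -> `|psi1 l t| <= M) -> `|psi l a - A1| <= e * M /\ `|psi l (a + h) - A2| <= e * M) ->
  psi l a ^+ 2 <= 11552 * (A1 ^+ 2 + A2 ^+ 2).
Proof.
move=> L0 rL Ll l2 ae pL hA.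
have Le : L * e = 152^-1 by rewrite /e; field; rewrite gt_eqF.
have Lh : L * h = 16^-1 by rewrite /h; field; rewrite gt_eqF.
have e0 : 0 < e by rewrite invr_gt0 mulr_gt0.
have h0 : 0 < h by rewrite invr_gt0 mulr_gt0.
pose m2 := l ^+ 2 + rho ^+ 2.
pose M := Num.sqrt (psi1 l (a - e) ^+ 2 + m2 * psi l (a - e) ^+ 2).
have m20 : 0 <= m2 by rewrite addr_ge0 ?sqr_ge0.
have M0 : 0 <= M by exact: sqrtr_ge0.
have M2 : M ^+ 2 = psi1 l (a - e) ^+ 2 + m2 * psi l (a - e) ^+ 2.
  by rewrite sqr_sqrtr// addr_ge0 ?sqr_ge0// mulr_ge0 ?sqr_ge0.
have m2l : L ^+ 2 <= m2 by rewrite /m2; nra.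
have m2u : m2 <= 9 * L ^+ 2.
  have : 0 <= (2 * L - l) * (2 * L + l) by rewrite mulr_ge0//; lra.
  have : 0 <= (L - rho) * (L + rho) by rewrite mulr_ge0 ?subr_ge0// addr_ge0 ?ltW.
  by rewrite /m2; have := sqr_ge0 L; lra.
have E t : a - e <= t -> psi1 l t ^+ 2 + m2 * psi l t ^+ 2 <= M ^+ 2 by rewrite M2; exact: energy_le.
have b1 t : a - e <= t -> `|psi1 l t| <= M.
  move=> /E Et; rewrite -(@ler_pXn2r _ 2) ?nnegrE// real_normK ?num_real//.
  by apply: le_trans Et; rewrite lerDl mulr_ge0 ?sqr_ge0.
(* |psi2| <= p |psi1| + m2 |psi|, where p <= L and m2 |psi| <= sqrt(m2) M <= 3 L M. *)
have b2 t : a - e <= t <= a + h -> `|psi2 l t| <= 4 * L * M.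
  move=> /[dup] tI /andP[ta _]; have t0 : 0 < t by exact: lt_le_trans ta.
  have -> : psi2 l t = - (p t * psi1 l t) - m2 * psi l t by have := ode l t0; rewrite /m2; lra.
  apply: le_trans (ler_normB _ _) _; rewrite normrN !normrM (ger0_norm (p_ge0 t0)) (ger0_norm m20).
  have : p t * `|psi1 l t| <= L * M by rewrite ler_pM// ?p_ge0// ?pL// b1.
  have : m2 * `|psi l t| <= 3 * L * M.
    rewrite -(@ler_pXn2r _ 2) ?nnegrE ?mulr_ge0// ?(ltW L0)// exprMn real_normK ?num_real//.
    rewrite [in leRHS]exprMn; apply: (@le_trans _ _ (m2 * M ^+ 2)).
      rewrite expr2 -mulrA ler_wpM2l//; apply: le_trans (E _ ta); rewrite lerDr ?sqr_ge0//.
    by rewrite ler_wpM2r ?sqr_ge0//; lra.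
  by lra.
have [k1 k2] := hA M b1.
have i1 : `|psi l a - psi l (a - e)| <= M * e.
  have := @lip_mvt R (psi l) (psi1 l) (a - e) a M (dpsi l) _ _; rewrite opprB addrCA subrr addr0.
  by apply; [lra|move=> t /andP[? _]; exact: b1].
(* At u the slope is the difference quotient over [a, a + h], that is 16 L times the difference of
   the two values. *)
have [u] := @MVT_segment R (psi l) (psi1 l) a (a + h) ltac:(lra) (fun x _ => dpsi l x) (continuous_subspaceT (fun x => differentiable_continuous ((derivable1_diffP _ _).1 (let: DeriveDef h _ := dpsi l x in h)))).
rewrite in_itv /= => /andP[au uh]; rewrite addrAC subrr add0r => hu.
have i2 : `|psi1 l u - psi1 l (a - e)| <= 4 * L * M * (u - (a - e)).
  by apply: (lip_mvt (dpsi1 l)); [lra|move=> t /andP[? ?]; apply: b2; lra].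
have i3 : `|psi1 l u - psi1 l (a - e)| <= (1 / 4 + 4 / 152) * M.
  apply: (le_trans i2); apply: (@le_trans _ _ (4 * L * M * (h + e))).
    by rewrite ler_wpM2l ?mulr_ge0// ?(ltW L0)//; lra.
  by rewrite (_ : _ * (h + e) = 4 * (L * h + L * e) * M); [rewrite Lh Le; lra|ring].
have i4 : `|psi1 l u| <= 16 * L * (`|psi l a| + `|psi l (a + h)|).
  have -> : psi1 l u = 16 * L * (psi l (a + h) - psi l a).
    by rewrite hu (_ : _ * (_ * h) = 16 * psi1 l u * (L * h)); [rewrite Lh; field|ring].
  rewrite normrM ger0_norm ?mulr_ge0 ?(ltW L0)// ler_wpM2l ?mulr_ge0 ?(ltW L0)//.
  by rewrite (le_trans (ler_normB _ _))// addrC.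
have i5 : M <= `|psi1 l (a - e)| + 3 * L * `|psi l (a - e)|.
  rewrite -(@ler_pXn2r _ 2) ?nnegrE ?addr_ge0 ?mulr_ge0 ?(ltW L0)// M2 sqrrD exprMn !real_normK ?num_real//.
  have : 0 <= `|psi1 l (a - e)| * (3 * L * `|psi l (a - e)|) *+ 2 by rewrite mulrn_wge0// !mulr_ge0 ?(ltW L0).
  have : m2 * psi l (a - e) ^+ 2 <= (3 * L) ^+ 2 * psi l (a - e) ^+ 2 by rewrite ler_wpM2r ?sqr_ge0//; lra.
  by lra.
have LM (x : R) : L * (e * x) = x / 152 by rewrite mulrA Le mulrC.
have j1 : L * `|psi l (a - e)| <= L * `|psi l a| + M / 152.
  have := ler_wpM2l (ltW L0) i1; have := ler_normB (psi l a) (psi l a - psi l (a - e)).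
  rewrite opprB addrCA subrr addr0 => n1 n2; have := ler_wpM2l (ltW L0) n1; have := LM M.
  by rewrite (mulrC M e) in n2; lra.
have j2 : `|psi1 l (a - e)| <= `|psi1 l u| + `|psi1 l u - psi1 l (a - e)|.
  by have := ler_normB (psi1 l u) (psi1 l u - psi1 l (a - e)); rewrite opprB addrCA subrr addr0.
have j3 : L * `|psi l a| <= L * `|A1| + M / 152.
  have := ler_normD (psi l a - A1) A1; rewrite subrK => n1.
  by have := ler_wpM2l (ltW L0) n1; have := ler_wpM2l (ltW L0) k1; have := LM M; lra.
have j4 : L * `|psi l (a + h)| <= L * `|A2| + M / 152.
  have := ler_normD (psi l (a + h) - A2) A2; rewrite subrK => n1.
  by have := ler_wpM2l (ltW L0) n1; have := ler_wpM2l (ltW L0) k2; have := LM M; lra.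
(* The preceding bounds add up to M <= 19 L |A1| + 16 L |A2| + (80/152) M; absorbing the last term
   leaves room for the factor 76 = 4 . 19. *)
have F1 : M <= 76 * (L * (`|A1| + `|A2|)).
  by have := mulr_ge0 (ltW L0) (normr_ge0 A1); have := mulr_ge0 (ltW L0) (normr_ge0 A2); lra.
have F2 : L ^+ 2 * psi l a ^+ 2 <= M ^+ 2.
  apply: (@le_trans _ _ (m2 * psi l a ^+ 2)); first by rewrite ler_wpM2r ?sqr_ge0.
  by apply: le_trans (E a _); [rewrite lerDr sqr_ge0|lra].
have F3 : M ^+ 2 <= L ^+ 2 * (76 ^+ 2 * (`|A1| + `|A2|) ^+ 2).
  rewrite (_ : _ * _ = (76 * (L * (`|A1| + `|A2|))) ^+ 2); last by ring.
  by rewrite !expr2; exact: ler_pM.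
have := le_trans F2 F3; rewrite ler_pM2l ?exprn_gt0// => F4; apply: (le_trans F4).
(* 11552 is twice the square of 76, from (|A1| + |A2|)^2 <= 2 (A1^2 + A2^2). *)
rewrite -(real_normK (num_real A1)) -(real_normK (num_real A2)).
by have := sqr_ge0 (`|A1| - `|A2|); lra.
Qed.

(* The Lipschitz bounds on T turn a bump in T t of width proportional to e into a
   bump in t supported in [x - e, x + e] with integral of order e. *)
Lemma bump (t0 b : R) : 0 < t0 -> exists2 z, 0 < z & forall x e : R, t0 <= x - e -> x + e <= b -> 0 < e ->
  exists F, [/\ test F, forall y, 0 <= F y <= 1, forall t, 0 <= t -> e < `|t - x| -> F (T t) = 0
    & z * e <= \int[leb]_t (F (T t) * Dp t)].
Proof.
move=> t00; have [m [M [m0 M0 mM]]] := T_lip b t00.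
exists (flatexp 2^-1 * flatexp 2^-1 * D t0 * (m / (2 * M))).
  by rewrite !mulr_gt0 ?flatexp_gt0 ?D_gt0 ?invr_gt0 ?mulr_gt0.
move=> x e xe xb e0.
pose N := (m * e)^-1; have N0 : 0 < N by rewrite invr_gt0 mulr_gt0.
have Nme : N * (m * e) = 1 by rewrite mulVf// gt_eqF// mulr_gt0.
pose F y := flatexp (N * y + (1 - N * T x)) * flatexp (- N * y + (1 + N * T x)).
have [+ _] := andP (mM x (x + e) ltac:(lra) ltac:(lra) xb); rewrite addrAC subrr add0r => q1.
have [+ _] := andP (mM (x - e) x xe ltac:(lra) ltac:(lra)); rewrite opprB addrCA subrr addr0 => q2.
have nq1 : 1 <= N * (T (x + e) - T x) by rewrite -Nme ler_wpM2l// ltW.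
have nq2 : 1 <= N * (T x - T (x - e)) by rewrite -Nme ler_wpM2l// ltW.
have tF : test F.
  split; first by apply: smooth1M; apply: smooth1_affine; exact: smooth1_flatexp.
  exists (x + e); first by lra.
  move=> y Ty; rewrite /F [X in _ * X]flatexp0 ?mulr0//.
  by have := ler_wpM2l (ltW N0) Ty; lra.
exists F; split=> //.
- by move=> y; rewrite mulr_ge0 ?flatexp_ge0//= mulr_ile1 ?flatexp_ge0 ?flatexp_le1.
- move=> t tge0; rewrite lter_normr => /orP[h|h].
    rewrite /F [X in _ * X]flatexp0 ?mulr0//.
    have : T (x + e) <= T t by apply: T_le; lra.
    by move=> /(ler_wpM2l (ltW N0)); lra.
  rewrite /F flatexp0 ?mul0r//.
  have : T t <= T (x - e) by apply: T_le; lra.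
  by move=> /(ler_wpM2l (ltW N0)); lra.
(* On [x, x + u] the function T moves by at most 1/(2 N), so both flat factors stay above
   [flatexp 2^-1]. *)
pose u := m * e / (2 * M).
have u0 : 0 < u by rewrite /u divr_gt0 ?mulr_gt0.
have mleM : m <= M.
  have /andP[h1 h2] := mM x (x + e) ltac:(lra) ltac:(lra) xb.
  by have := le_trans h1 h2; rewrite addrAC subrr add0r ler_pM2r.
have ue : u <= e.
  by rewrite /u ler_pdivrMr ?mulr_gt0// mulrC ler_pM2l//; lra.
have NMu : N * (M * u) = 2^-1 by rewrite /N /u; field; rewrite !gt_eqF.
rewrite (_ : _ * e = flatexp 2^-1 * flatexp 2^-1 * D t0 * ((x + u) - x)); last by rewrite /u; ring.
apply: Rintegral_lower; first exact: test_int1.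
- by move=> t; rewrite mulr_ge0 ?Dp_ge0// mulr_ge0 ?flatexp_ge0.
- by lra.
move=> t /andP[xt tu]; have t1 : 0 <= t by lra.
have /andP[p1 p2] := mM x t ltac:(lra) xt ltac:(lra).
have w1 : N * (T t - T x) <= 2^-1.
  rewrite -NMu ler_wpM2l ?(ltW N0)// (le_trans p2)// ler_wpM2l ?(ltW M0)//; lra.
have w2 : 0 <= N * (T t - T x).
  by rewrite mulr_ge0 ?(ltW N0)// (le_trans _ p1)// mulr_ge0 ?(ltW m0)//; lra.
rewrite /Dp t1; apply: ler_pM.
- by rewrite mulr_ge0 ?flatexp_ge0.
- by apply: D_ge0; lra.
- by apply: ler_pM; rewrite ?flatexp_ge0//; apply: flatexp_le; lra.
- by apply: D_le; lra.
Qed.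

(** The quotient is an average of psi l over [x - e, x + e] with weight F D, so it differs from psi
    l x by at most e times a bound on the slope. *)
Lemma smear (F : R -> R) (x e l M : R) : test F -> (forall y, 0 <= F y) -> 0 <= x - e -> 0 < e ->
  (forall t, 0 <= t -> e < `|t - x| -> F (T t) = 0) -> 0 < \int[leb]_t (F (T t) * Dp t) ->
  (forall t, x - e <= t -> `|psi1 l t| <= M) ->
  `|psi l x - hat (fun t => F (T t)) l / \int[leb]_t (F (T t) * Dp t)| <= e * M.
Proof.
move=> tF F0 xe e0 Fx Z0 hM; set Z := \int[leb]_t _ in Z0 *.
have iF := test_int1 tF; have iK := int1_kernelr kern_le1 kern_continuous l iF.
have M0 : 0 <= M by apply: le_trans (hM x _); rewrite ?normr_ge0//; lra.
rewrite -(ler_pM2r Z0) -[X in _ * X <= _](ger0_norm (ltW Z0)) -normrM mulrBl divfK ?gt_eqF//.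
rewrite /hat /tr /Z -!RintegralZl// -RintegralB//; last exact: int1Zl.
have iD : int1 (fun t => psi l x * (F (T t) * Dp t) - F (T t) * Dp t * kern l t) by apply: int1B => //; exact: int1Zl.
apply: le_trans (le_normr_Rintegral _ iD) _ => //; apply: le_Rintegral => //.
- exact: int1_norm.
- exact: int1Zl.
move=> t _; rewrite mulrC -mulrBr normrM (ger0_norm (mulr_ge0 (F0 _) (Dp_ge0 _))) mulrC.
have [t0|t0] := leP 0 (t : R); last by rewrite /Dp (leNgt 0 t) t0 /= !mulr0.
have [te|et] := leP `|t - x| e; last by rewrite Fx// mul0r !mulr0.
rewrite ler_wpM2r ?mulr_ge0 ?Dp_ge0// /kern (ger0_norm t0).
apply: (@le_trans _ _ (M * `|t - x|)); last by rewrite mulrC ler_wpM2r.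
move: te; rewrite ler_norml => /andP[t1 t2].
have [tx|/ltW xt] := leP t x.
  by rewrite (distrC t) (ger0_norm (x := x - t)) ?subr_ge0//; apply: (lip_mvt (dpsi l) tx) => v /andP[? _]; apply: hM; lra.
by rewrite distrC (ger0_norm (x := t - x)) ?subr_ge0//; apply: (lip_mvt (dpsi l) xt) => v /andP[? _]; apply: hM; lra.
Qed.

(** Plancherel for F with itself, together with F^2 <= F, bounds the integral of the squared
    transform by Z / c before the division by Z^2. *)
Lemma smear_norm (F : R -> R) : test F -> (forall y, 0 <= F y <= 1) ->
  let Z := \int[leb]_t (F (T t) * Dp t) in 0 < Z ->
  int1 (fun l => (hat (fun t => F (T t)) l / Z) ^+ 2 * wp l) /\
  \int[leb]_l ((hat (fun t => F (T t)) l / Z) ^+ 2 * wp l) <= (c * Z)^-1.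
Proof.
move=> tF F01 Z Z0; have iF := test_int1 tF; have [i1 E] := plancherel tF iF.
have eqf : (fun l => (hat (fun t => F (T t)) l / Z) ^+ 2 * wp l) =
  (fun l => Z^-1 ^+ 2 * (hat (fun t => F (T t)) l * wp l * hat (fun t => F (T t)) l)).
  by apply/funext => l; ring.
rewrite eqf; split; first exact: int1Zl.
rewrite RintegralZl// -(ler_pM2l c_gt0) mulrCA E.
have : \int[leb]_t (F (T t) * Dp t * F (T t)) <= Z.
  apply: (Rint_ge0_le _ _ _ iF).2.
  - by move=> t; have /andP[? _] := F01 (T t); rewrite !mulr_ge0 ?Dp_ge0.
  - by move=> t; have /andP[? ?] := F01 (T t); rewrite ler_piMr// mulr_ge0 ?Dp_ge0.
  - by apply: measurable_funM (int1_measurable iF) _; apply: continuous_measurable_fun; exact: test_continuous.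
move=> h; apply: (@le_trans _ _ (Z^-1 ^+ 2 * Z)); first by rewrite ler_wpM2l ?sqr_ge0.
by rewrite le_eqVlt; apply/orP; left; apply/eqP; field; rewrite !gt_eqF.
Qed.

(** Hides the numerals 11552 and 152 behind variables, so that later arithmetic sees only k > 0 and
    q >= 2. *)
Lemma dyadic_constants : exists k q : R, [/\ 0 < k, 2 <= q & forall a l L A1 A2 : R,
  0 < L -> rho <= L -> L <= l -> l <= 2 * L -> 0 < a - (q * L)^-1 ->
  (forall t, a - (q * L)^-1 <= t <= a + (16 * L)^-1 -> p t <= L) ->
  (forall M, (forall t, a - (q * L)^-1 <= t -> `|psi1 l t| <= M) ->
     `|psi l a - A1| <= (q * L)^-1 * M /\ `|psi l (a + (16 * L)^-1) - A2| <= (q * L)^-1 * M) ->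
  psi l a ^+ 2 <= k * (A1 ^+ 2 + A2 ^+ 2)].
Proof.
by exists 11552, 152; split; rewrite ?ltr0n ?ler_nat//; exact: dyadic_pointwise.
Qed.

(** The two bumps of half-width e = 1/(q L), at a and at a + 1/(16 L), have mass at least z e each,
    so by [smear_norm] the squares of the two averages integrate to at most 2 q L / (c z). *)
Lemma dyadic_bound (t0 b : R) : 0 < t0 -> exists C L0 : R, [/\ 0 < C, 0 < L0 & forall L a : R, L0 <= L -> t0 <= a <= b ->
  (\int[leb]_(l in `]L, (2 * L)%R]) (psi l a ^+ 2 * wp l)%:E <= (C * L)%:E)%E].
Proof.
move=> t00; have t20 : 0 < t0 / 2 by rewrite divr_gt0.
have [z z0 hz] := bump (b + 2) t20; have [P hP] := p_le (b + 2) t20.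
have [k [q [k0 q2 dyad]]] := dyadic_constants.
have q0 : 0 < q by lra.
(* The threshold for L makes rho and p at most L and keeps both windows inside [t0/2, b + 2]. *)
exists (k * (2 * q) / (c * z)), (1 + rho + `|P| + t0^-1); split.
- by apply: divr_gt0; apply: mulr_gt0 => //; apply: mulr_gt0.
- by rewrite addr_gt0 ?invr_gt0// ltr_wpDr// addr_gt0.
move=> L a LL /andP[ta ab].
have ti : 0 < t0^-1 by rewrite invr_gt0.
have P0 := normr_ge0 P; have PP := ler_norm P.
have L1 : 1 <= L by have := rho0; lra.
have L0 : 0 < L by lra.
have rL : rho <= L by lra.
have PL : P <= L by have := rho0; lra.
have tL : t0^-1 <= L by have := rho0; lra.
pose e := (q * L)^-1; pose h := (16 * L)^-1.
have e0 : 0 < e by rewrite invr_gt0; exact: mulr_gt0.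
have h0 : 0 < h by rewrite invr_gt0 mulr_gt0.
have Li0 : 0 < L^-1 by rewrite invr_gt0.
have Li : L^-1 <= 1 by rewrite invf_le1.
have eL : e <= L^-1 / 2.
  by rewrite /e invfM mulrC ler_pM2l// lef_pV2// posrE.
have et : e <= t0 / 2.
  by apply: (le_trans eL); rewrite ler_pM2r// invf_ple ?posrE.
have h1 : h <= 1 by rewrite /h invfM; lra.
have e1 : e <= 1 by lra.
have n1 : t0 / 2 <= a - e by lra.
have n2 : a + e <= b + 2 by lra.
have n3 : t0 / 2 <= a + h - e by lra.
have n4 : a + h + e <= b + 2 by lra.
have n5 : 0 <= a + h - e by lra.
have n6 (t : R) : a - e <= t -> t <= a + h -> t0 / 2 <= t <= b + 2 by lra.
have n7 (t : R) : a + h - e <= t -> a - e <= t by lra.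
have [F [tF F01 FS FZ]] := hz a e n1 n2 e0.
have [G [tG G01 GS GZ]] := hz (a + h) e n3 n4 e0.
set ZF := \int[leb]_t (F (T t) * Dp t) in FZ.
set ZG := \int[leb]_t (G (T t) * Dp t) in GZ.
have ze : 0 < z * e by rewrite mulr_gt0.
have ZF0 : 0 < ZF by exact: lt_le_trans ze FZ.
have ZG0 : 0 < ZG by exact: lt_le_trans ze GZ.
have [iF nF] := smear_norm tF F01 ZF0.
have [iG nG] := smear_norm tG G01 ZG0.
have iZ Z : z * e <= Z -> (c * Z)^-1 <= q * L / (c * z).
  move=> zZ; have Z0 := lt_le_trans ze zZ.
  rewrite (_ : _ / _ = (c * (z * e))^-1); last by rewrite /e; field; rewrite !gt_eqF.
  by rewrite lef_pV2 ?posrE ?mulr_gt0// ler_pM2l.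
pose gF l := (hat (fun t => F (T t)) l / ZF) ^+ 2 * wp l.
pose gG l := (hat (fun t => G (T t)) l / ZG) ^+ 2 * wp l.
apply: (@le_trans _ _ (\int[leb]_l (k * (gF l + gG l)))%:E).
  apply: integral_le_Rint => //.
  - move=> l; rewrite /= in_itv /= => /andP[Ll l2]; rewrite mulr_ge0 ?sqr_ge0 ?wp_ge0//=.
    rewrite /gF /gG -mulrDl mulrA ler_wpM2r ?wp_ge0//.
    apply: (dyad a l L _ _ L0 rL (ltW Ll) l2); rewrite -/e -/h; first exact: lt_le_trans n1.
      by move=> t /andP[t1 t2]; apply: le_trans PL; apply: hP; exact: n6.
    move=> M hM; split; apply: smear => //.
    + by move=> y; case/andP: (F01 y).
    + by apply: le_trans n1; exact: ltW.
    + by move=> y; case/andP: (G01 y).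
    + by move=> t /n7; exact: hM.
  - by move=> l; apply: (mulr_ge0 (ltW k0)); rewrite addr_ge0// mulr_ge0 ?sqr_ge0 ?wp_ge0.
  - apply: measurable_funM wp_measurable; apply: measurable_funX.
    by apply: continuous_measurable_fun; exact: psi_lc.
  - by apply: int1Zl; exact: int1D.
rewrite lee_fin RintegralZl//; last exact: int1D.
rewrite RintegralD//; have hF := le_trans nF (iZ _ FZ); have hG := le_trans nG (iZ _ GZ).
rewrite (_ : k * (2 * q) / (c * z) * L = k * (2 * (q * L / (c * z)))); last by ring.
by rewrite (ler_pM2l k0) mulr_natl mulr2n; exact: lerD.
Qed.

Definition sob l := (l ^+ 2 + rho ^+ 2) `^ s.

Lemma sob_gt0 (l : R) : 0 < sob l.
Proof. by rewrite powR_gt0// ltr_wpDl ?sqr_ge0// exprn_gt0. Qed.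

Lemma sob_measurable : measurable_fun [set: R] sob.
Proof.
apply: (measurableT_comp (measurable_powR s)); exact: measurable_funD.
Qed.

(** (l^2 + rho^2)^s >= L^(2s), split so that the factor L cancels the dyadic bound while the inverse
    of the other factor decays geometrically, because 2 s > 1. *)
Lemma sob_ge (l L : R) : 0 < L -> L <= l -> L * L `^ (2 * s - 1) <= sob l.
Proof.
move=> L0 Ll; have s0 : 0 <= s by apply: ltW; apply: lt_trans s12; rewrite invr_gt0.
rewrite -[X in X * _](powRr1 (ltW L0)) -powRD; last by apply/implyP => _; rewrite gt_eqF.
rewrite addrC subrK powRrM -[2]/(2%:R) powR_mulrn ?(ltW L0)//.
apply: ge0_ler_powR => //; rewrite ?nnegrE ?addr_ge0 ?sqr_ge0//.
by rewrite ler_wpDr ?sqr_ge0// ler_pXn2r// nnegrE ltW// (lt_le_trans L0).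
Qed.

Lemma weighted_integrand_ge0 (l a : R) : 0 <= (sob l)^-1 * kern l a ^+ 2 * wp l.
Proof. by rewrite mulr_ge0 ?wp_ge0// mulr_ge0 ?sqr_ge0// invr_ge0 ltW ?sob_gt0. Qed.

Lemma weighted_integrand_measurable (a : R) : measurable_fun [set: R] (fun l => (sob l)^-1 * kern l a ^+ 2 * wp l).
Proof.
apply: measurable_funM wp_measurable; apply: measurable_funM; last exact: measurable_funX (kern_measurable a).
rewrite (_ : (fun l => _) = (fun l => (l ^+ 2 + rho ^+ 2) `^ (- s))); last by apply/funext => l; rewrite powRN.
apply: (measurableT_comp (measurable_powR (- s))); exact: measurable_funD.
Qed.

(* Sum the bounds C L (L^2)^(-s) over dyadic L; this is where s > 1/2 enters. *)
Lemma weighted_bound (t0 b : R) : 0 < t0 -> exists M : R, forall a, t0 <= a <= b ->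
  (\int[leb]_l ((sob l)^-1 * kern l a ^+ 2 * wp l)%:E <= M%:E)%E.
Proof.
move=> t00; have [C [L0 [C0 L00 hC]]] := dyadic_bound b t00.
have [W hW] : exists W : R, (\int[leb]_(l in `]-oo, L0]) (wp l)%:E = W%:E)%E.
  have := wp_low L00; have : (0 <= \int[leb]_(l in `]-oo, L0]) (wp l)%:E)%E.
    by apply: integral_ge0 => l _; rewrite lee_fin wp_ge0.
  by case: (integral _ _ _) => [W| |]// _ _; exists W.
have e0 : 0 < 2 * s - 1 by have := s12; lra.
(* The common ratio 2^(1 - 2s) < 1 of the dyadic series. *)
pose q := (2 `^ (2 * s - 1))^-1.
have q1 : q < 1.
  rewrite invf_lt1 ?powR_gt0//; have := gt0_ltr_powR e0 (x := 1) (y := 2).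
  by rewrite powR1; apply; rewrite ?nnegrE ?ltr1n.
have q0 : 0 < q by rewrite invr_gt0 powR_gt0.
pose B := C * (L0 `^ (2 * s - 1))^-1.
have B0 : 0 < B by rewrite mulr_gt0// invr_gt0 powR_gt0.
pose W0 := ((rho ^+ 2) `^ s)^-1 * W.
exists (W0 + B / (1 - q)) => a aI; have a0 : 0 <= a by case/andP: aI => ? _; lra.
pose f l := (sob l)^-1 * kern l a ^+ 2 * wp l.
have f0 l : 0 <= f l by exact: weighted_integrand_ge0.
have mf : measurable_fun [set: R] f by exact: weighted_integrand_measurable.
have mfE E : measurable_fun E (fun l => (f l)%:E).
  by apply/measurable_EFinP; exact: measurable_funTS.
pose Lk k := L0 * 2 ^+ k.
have Lk0 k : 0 < Lk k by rewrite mulr_gt0// exprn_gt0.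
have J0 : (\int[leb]_(l in `]-oo, L0]) (f l)%:E <= W0%:E)%E.
  rewrite /W0 EFinM -hW -ge0_integralZl//.
  - apply: ge0_le_integral => //.
    + by move=> l _; rewrite lee_fin.
    + exact: mfE.
    + by apply/measurable_EFinP; apply: measurable_funTS; apply: measurable_funM => //; exact: wp_measurable.
    + move=> l _; rewrite -EFinM lee_fin ler_wpM2r ?wp_ge0//.
      apply: (@le_trans _ _ ((sob l)^-1)).
        rewrite ler_piMr ?invr_ge0 ?(ltW (sob_gt0 _))// -(real_normK (num_real _)).
        by rewrite expr_le1// kern_le1.
      rewrite lef_pV2 ?posrE ?sob_gt0 ?powR_gt0 ?exprn_gt0//.
      apply: ge0_ler_powR; rewrite ?nnegrE ?addr_ge0 ?sqr_ge0//.
        by apply: ltW; apply: lt_trans s12; rewrite invr_gt0.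
      by rewrite lerDr sqr_ge0.
  - by apply/measurable_EFinP; apply: measurable_funTS; exact: wp_measurable.
  - by move=> l _; rewrite lee_fin wp_ge0.
  - by rewrite lee_fin invr_ge0 powR_ge0.
have Dk k : (\int[leb]_(l in `]Lk k, Lk k.+1]) (f l)%:E <= (B * q ^+ k)%:E)%E.
  have LkS : Lk k.+1 = 2 * Lk k by rewrite /Lk exprS mulrCA.
  have LL : L0 <= Lk k by rewrite /Lk ler_peMr ?(ltW L00)// exprn_ege1// ler1n.
  pose v := (Lk k * Lk k `^ (2 * s - 1))^-1.
  have v0 : 0 < v by rewrite invr_gt0 mulr_gt0 ?powR_gt0.
  have -> : B * q ^+ k = v * (C * Lk k).
    rewrite /v /B /q [in RHS]/Lk (powRM _ (ltW L00)) ?exprn_ge0// -(powR_mulrn k (ler0n _ 2)) -powRrM.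
    rewrite (mulrC k%:R) powRrM (powR_mulrn k (powR_ge0 2 (2 * s - 1))) -/(Lk k) exprVn.
    by field; rewrite !gt_eqF ?powR_gt0 ?exprn_gt0 ?powR_gt0.
  rewrite EFinM; apply: le_trans (lee_wpmul2l _ (hC _ _ LL aI)); last by rewrite lee_fin ltW.
  have mg : measurable_fun [set: R] (fun l => psi l a ^+ 2 * wp l).
    apply: measurable_funM wp_measurable; apply: measurable_funX.
    by apply: continuous_measurable_fun; exact: psi_lc.
  have g0 l : 0 <= psi l a ^+ 2 * wp l by rewrite mulr_ge0 ?sqr_ge0 ?wp_ge0.
  rewrite -LkS -ge0_integralZl//.
  - apply: ge0_le_integral => //.
    + by move=> l _; rewrite lee_fin.
    + exact: mfE.
    + by apply/measurable_EFinP; apply: measurable_funTS; apply: measurable_funM.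
    + move=> l; rewrite /= in_itv /= => /andP[Ll _]; rewrite -EFinM lee_fin /f -mulrA /kern (ger0_norm a0).
      by rewrite ler_wpM2r// lef_pV2 ?posrE ?sob_gt0 ?mulr_gt0 ?powR_gt0// sob_ge// ltW.
  - by apply/measurable_EFinP; exact: measurable_funTS.
  - by move=> l _; rewrite lee_fin.
  - by rewrite lee_fin ltW.
have Jk k : (\int[leb]_(l in `]-oo, Lk k]) (f l)%:E <= (W0 + B * (1 - q ^+ k) / (1 - q))%:E)%E.
  elim: k => [|k IH]; first by rewrite /Lk expr0 mulr1 subrr mulr0 mul0r addr0.
  have -> : [set` `]-oo, Lk k.+1]] = [set` `]-oo, Lk k]] `|` [set` `]Lk k, Lk k.+1]].
    by rewrite -itv_bndbnd_setU// bnd_simp /Lk ler_pM2l// ler_weXn2l// ler1n.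
  rewrite ge0_integral_setU//=.
  - apply: le_trans (leeD IH (Dk k)) _; rewrite -EFinD lee_fin le_eqVlt; apply/orP; left; apply/eqP.
    by rewrite exprS; field; rewrite subr_eq0 eq_sym lt_eqF.
  - exact: mfE.
  - by move=> l _; rewrite lee_fin.
  - rewrite disj_set2E; apply/eqP/seteqP; split=> // l /=; rewrite !in_itv /= => -[l1 /andP[l2 _]].
    by have := lt_le_trans l2 l1; rewrite ltxx.
(* l / L0 < n + 1 <= 2^(n + 1), so the half-lines up to [Lk k] exhaust the line. *)
have bc : \bigcup_k [set` `]-oo, Lk k]] = [set: R].
  apply/seteqP; split=> // l _; pose n := Num.truncn (l / L0).
  exists n.+1 => //=; rewrite in_itv /= /Lk mulrC -ler_pdivrMr//.
  apply: (@le_trans _ _ n.+1%:R); first by rewrite ltW// truncnS_gt.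
  by rewrite -natrX ler_nat ltnW// ltn_expl.
have nd : {homo (fun k => [set` `]-oo, Lk k]]) : n m / (n <= m)%N >-> (n <= m)%O}.
  move=> n m nm; rewrite subsetEset => l /=; rewrite !in_itv /= => /le_trans; apply.
  by rewrite /Lk ler_pM2l// ler_weXn2l// ler1n.
have := @ge0_nondecreasing_set_cvg_integral _ (measurableTypeR R) R (fun k => [set` `]-oo, Lk k]]) (fun l => (f l)%:E) leb nd
  (fun k => measurable_itv _) (fun k => mfE _) (fun k l _ => f0 l).
rewrite bc => /(cvge_le _); apply; apply: nearW => k; apply: (le_trans (Jk k)).
rewrite lee_fin lerD2l ler_pM2r ?invr_gt0 ?subr_gt0// ler_piMr ?(ltW B0)// lerBlDr lerDl.
by rewrite exprn_ge0// ltW.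
Qed.

(** The pointwise inequality x y <= (S x^2 + y^2 / S) / 2, with S the Sobolev weight, acts as
    Cauchy-Schwarz: the first term is the Sobolev integral of h, the second is bounded uniformly in
    a by [weighted_bound]. *)
Lemma hat_kern_bound (t0 b : R) (h : R -> R) : 0 < t0 -> int1 (fun t => h t * Dp t) ->
  int1 (fun l => sob l * hat h l ^+ 2 * wp l) ->
  exists M : R, forall a, t0 <= a <= b -> (\int[leb]_l `|hat h l * wp l * kern l a|%:E <= M%:E)%E.
Proof.
move=> t00 ih iS; have [M hM] := weighted_bound b t00.
exists (\int[leb]_l (2^-1 * (sob l * hat h l ^+ 2 * wp l)) + 2^-1 * M) => a /hM{}hM.
have mh := hat_measurable ih.
pose g l := (sob l)^-1 * kern l a ^+ 2 * wp l.
have g0 l : 0 <= g l by exact: weighted_integrand_ge0.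
have mg : measurable_fun [set: R] g by exact: weighted_integrand_measurable.
have f0 l : 0 <= sob l * hat h l ^+ 2 * wp l by rewrite mulr_ge0 ?wp_ge0// mulr_ge0 ?sqr_ge0// ltW ?sob_gt0.
have mf := int1_measurable iS.
apply: (@le_trans _ _ (\int[leb]_l ((2^-1 * (sob l * hat h l ^+ 2 * wp l))%:E + (2^-1 * g l)%:E))%E).
  apply: ge0_le_integral => //.
  - apply/measurable_EFinP; apply: measurableT_comp => //; apply: measurable_funM (kern_measurable a).
    exact: measurable_funM mh wp_measurable.
  - by apply: emeasurable_funD; apply/measurable_EFinP; apply: measurable_funM.
  move=> l _; rewrite -EFinD lee_fin !normrM (ger0_norm (wp_ge0 l)).
  have s0 := sob_gt0 l; set x := `|hat h l|; set y := `|kern l a|.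
  rewrite /g -(real_normK (num_real (hat h l))) -(real_normK (num_real (kern l a))) -/x -/y.
  rewrite -mulrDr -mulrDl mulrA mulrAC ler_wpM2r ?wp_ge0// -subr_ge0.
  rewrite (_ : _ - _ = 2^-1 * (sob l)^-1 * (sob l * x - y) ^+ 2); last by field; rewrite gt_eqF.
  by rewrite mulr_ge0 ?sqr_ge0// mulr_ge0// invr_ge0 ltW.
rewrite ge0_integralD//.
- rewrite EFinD; apply: leeD; first by rewrite int1_fin//; exact: int1Zl.
  under eq_integral do rewrite EFinM.
  rewrite ge0_integralZl//.
  - by rewrite EFinM lee_wpmul2l// lee_fin.
  - by apply/measurable_EFinP.
  - by move=> l _; rewrite lee_fin.
- by move=> l _; rewrite lee_fin mulr_ge0.
- by apply/measurable_EFinP; apply: measurable_funM.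
- by move=> l _; rewrite lee_fin mulr_ge0.
- by apply/measurable_EFinP; apply: measurable_funM.
Qed.

Definition inv_hat (h : R -> R) t := c * \int[leb]_l (hat h l * wp l * kern l t).

(** Counterpart of [plancherel] for h merely in the Sobolev class: the exchange of integrals rests
    on [hat_kern_bound], whence the support condition on B. *)
Lemma hat_duality (t0 b : R) (h B : R -> R) : 0 < t0 -> int1 (fun t => h t * Dp t) ->
  int1 (fun l => sob l * hat h l ^+ 2 * wp l) -> int1 B -> (forall t, B t != 0 -> t0 <= t <= b) ->
  int1 (fun t => B t * inv_hat h t) /\
  c * \int[leb]_l (hat h l * wp l * tr kern B l) = \int[leb]_t (B t * inv_hat h t).
Proof.
move=> t00 ih iS iB Bs; have [M hM] := hat_kern_bound b t00 ih iS.
have [] := @fubini_kernel R kern kern_le1 kern_continuous (fun l => hat h l * wp l) B M _ iB _.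
- exact: measurable_funM (hat_measurable ih) wp_measurable.
- by move=> t /Bs; exact: hM.
move=> _ i2 E; have -> : (fun t => B t * inv_hat h t) = (fun t => c * (B t * \int[leb]_l (hat h l * wp l * kern l t))).
  by apply/funext => t; rewrite /inv_hat mulrCA.
by split; [exact: int1Zl|rewrite E RintegralZl].
Qed.

Lemma flatexp_cvg (z : R) : flatexp (n.+1%:R * z) @[n --> \oo] --> ((if 0 < z then 1 else 0) : R).
Proof.
have [z0|z0] := ltP 0 z; last first.
  rewrite (_ : (fun n => _) = cst 0); first exact: cvg_cst.
  by apply/funext => n /=; rewrite flatexp0// mulr_ge0_le0.
rewrite (_ : (fun n => _) = (fun n => expR (- (z^-1 * n.+1%:R^-1)))); last first.
  by apply/funext => n; rewrite flatexpE ?mulr_gt0// invfM mulrC.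
rewrite /= -[X in _ --> X]expR0 -[in X in _ --> X](oppr0 R) -(mulr0 z^-1).
apply: (@cvg_comp _ _ _ (fun n : nat => - (z^-1 * n.+1%:R^-1)) expR _ (nbhs (- (z^-1 * 0)))); last exact: continuous_expR.
by apply: cvgN; apply: cvgM; [exact: cvg_cst|exact: cvg_harmonic].
Qed.

(** The tests flatexp (n (T t - T x)) flatexp (n (T y - T t)) are bounded by 1 and converge to the
    indicator of ]x, y[, so dominated convergence applies. *)
Lemma test_orthogonal (t0 b : R) (e : R -> R) : 0 < t0 -> int1 e -> (forall t, e t != 0 -> t0 <= t <= b) ->
  (forall F, test F -> (forall t, 0 <= t -> F (T t) != 0 -> t0 <= t <= b) -> \int[leb]_t (e t * F (T t)) = 0) ->
  forall x y, t0 <= x -> x < y -> y <= b -> \int[leb]_(t in `]x, y[) e t = 0.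
Proof.
move=> t00 ie es eF x y tx xy yb.
have x0 : 0 <= x by exact: le_trans (ltW t00) tx.
have y0 : 0 < y by exact: le_lt_trans x0 xy.
pose F (n : nat) (z : R) : R := flatexp (n.+1%:R * z + - (n.+1%:R * T x)) * flatexp ((- n.+1%:R) * z + n.+1%:R * T y).
have FE n z : F n z = flatexp (n.+1%:R * (z - T x)) * flatexp (n.+1%:R * (T y - z)).
  by rewrite /F; congr (flatexp _ * flatexp _); ring.
have tF n : test (F n).
  split; first by apply: smooth1M; apply: smooth1_affine; exact: smooth1_flatexp.
  exists y => // z Tz; rewrite FE [X in _ * X]flatexp0 ?mulr0// mulr_ge0_le0// subr_le0//.
have lim t : e t * F n (T t) @[n --> \oo] --> (e \_ `]x, y[) t.
  have [et|et] := eqVneq (e t) 0.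
    rewrite (_ : (fun n => _) = cst 0); last by apply/funext => n; rewrite et mul0r.
    by rewrite patchE et if_same; exact: cvg_cst.
  have /andP[t1 t2] := es _ et; have t3 : 0 <= t by exact: le_trans (ltW t00) t1.
  rewrite (_ : (e \_ `]x, y[) t = e t * ((if 0 < T t - T x then 1 else 0) * (if 0 < T y - T t then 1 else 0))).
    apply: cvgM; first exact: cvg_cst.
    by rewrite (_ : (fun n => _) = (fun n => flatexp (n.+1%:R * (T t - T x)) * flatexp (n.+1%:R * (T y - T t))));
      [apply: cvgM; exact: flatexp_cvg|apply/funext => n; rewrite FE].
  have Tlt (u v : R) : 0 <= u -> 0 <= v -> (T u < T v) = (u < v).
    move=> u0 v0; apply/idP/idP; last exact: T_lt.
    by rewrite ltNge => h; rewrite ltNge; apply: contra h; exact: T_le.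
  rewrite patchE mem_setE in_itv /= !subr_gt0 !Tlt ?(ltW y0)//.
  by case: (x < t); case: (t < y); rewrite ?mulr1 ?mulr0 ?mul0r ?mulr0.
have b1 (n : nat) t : `|F n (T t)| <= 1.
  by rewrite ger0_norm ?mulr_ge0 ?flatexp_ge0// mulr_ile1 ?flatexp_ge0 ?flatexp_le1.
have mFn n : measurable_fun [set: R] (fun t => F n (T t)).
  by apply: continuous_measurable_fun; exact: test_continuous.
have := @dominated_cvg _ _ R leb setT measurableT (fun n t => (e t * F n (T t))%:E) (fun t => ((e \_ `]x, y[) t)%:E) (fun t => `|e t|%:E) _ _ _ _ _.
have i0 n : (\int[leb]_t (e t * F n (T t))%:E = 0)%E.
  have ieF : int1 (fun t => e t * F n (T t)) by exact: int1M.
  rewrite (int1_fin ieF) (eF _ (tF n))// => t t3; rewrite FE mulf_eq0 negb_or => /andP[f1 f2].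
  have h1 : T x < T t by rewrite ltNge; apply: contra f1 => h; rewrite flatexp0// mulr_ge0_le0// subr_le0.
  have h2 : T t < T y by rewrite ltNge; apply: contra f2 => h; rewrite flatexp0// mulr_ge0_le0// subr_le0.
  apply/andP; split.
    by rewrite leNgt; apply/negP => tt; have := lt_le_trans h1 (T_le t3 (le_trans (ltW tt) tx)); rewrite ltxx.
  by rewrite leNgt; apply/negP => tt; have := lt_le_trans h2 (T_le (ltW y0) (le_trans yb (ltW tt))); rewrite ltxx.
move=> h; have {h} : (\int[leb]_t (e t * F n (T t))%:E)%E @[n --> \oo] --> (\int[leb]_t ((e \_ `]x, y[) t)%:E)%E.
  apply: h.
  - by move=> n; apply/measurable_EFinP; exact: measurable_funM (int1_measurable ie) (mFn n).
  - by move=> t _; apply/fine_cvgP; split; [exact: nearW|exact: lim].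
  - by move=> t _.
  - exact: int1_norm.
  - by move=> n t _; rewrite lee_fin normrM ler_piMr.
under eq_fun do rewrite i0.
rewrite Rintegral_mkcond /Rintegral => h.
have := cvg_unique _ (cvg_cst 0%E) h => <-//.
Qed.

(** h and its inverted transform, both multiplied by D, have the same integrals against tests, by
    [plancherel] and [hat_duality]. Their difference on [t0, b] thus integrates to 0 over intervals
    and vanishes almost everywhere by Lebesgue differentiation; D > 0 is then divided out. *)
Lemma inversion_ae_itv (t0 b : R) (h : R -> R) : 0 < t0 -> int1 (fun t => h t * Dp t) ->
  int1 (fun l => sob l * hat h l ^+ 2 * wp l) -> {ae leb, forall t, t0 < t < b -> h t = inv_hat h t}.
Proof.
move=> t00 ih iS.
pose ind (t : R) : R := \1_(`[t0, b] : set R) t.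
have ind1 t : `|ind t| <= 1 by rewrite /ind indicE; case: (_ \in _); rewrite ?normr1 ?normr0.
have mind : measurable_fun [set: R] ind by exact: measurable_indic.
have indE (t : R) : t0 <= t <= b -> ind t = 1 by move=> tI; rewrite /ind indicE mem_setE in_itv /= tI.
have ind0 t : ind t != 0 -> t0 <= t <= b by rewrite /ind indicE mem_setE in_itv /=; case: (_ <= _ <= _); rewrite ?eqxx.
have iB : int1 (fun t => Dp t * ind t).
  apply: (@int1_itv _ t0 b); first exact: measurable_funM Dp_measurable mind.
    have [M DM] := @continuous_bounded D t0 b D_continuous.
    exists M => t tI; rewrite normrM; apply: le_trans (DM t tI); rewrite /Dp (le_trans (ltW t00) (andP tI).1).
    by rewrite ler_piMr.
  by move=> t; apply: contraNeq; rewrite mulf_eq0 negb_or => /andP[_ /ind0].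
have Bs t : Dp t * ind t != 0 -> t0 <= t <= b by rewrite mulf_eq0 negb_or => /andP[_ /ind0].
have [iBh _] := hat_duality t00 ih iS iB Bs.
pose e t := h t * Dp t * ind t - Dp t * ind t * inv_hat h t.
have ie : int1 e by apply: int1B => //; exact: int1M.
have es t : e t != 0 -> t0 <= t <= b.
  by apply: contraNT => ti; rewrite /e (_ : ind t = 0) ?mulr0 ?mul0r ?subrr//; apply/eqP/negP => /negP/ind0; exact/negP.
have eF F : test F -> (forall t, 0 <= t -> F (T t) != 0 -> t0 <= t <= b) -> \int[leb]_t (e t * F (T t)) = 0.
  move=> tF Fs; have iF := test_int1 tF.
  have Fs' t : F (T t) * Dp t != 0 -> t0 <= t <= b.
    by rewrite mulf_eq0 negb_or /Dp; case: ifP => [t1 /andP[/(Fs _ t1)]|_]; rewrite ?eqxx ?andbF.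
  have [i1 E1] := hat_duality t00 ih iS iF Fs'.
  have [i2 E2] := plancherel tF ih.
  have i3 : int1 (fun t => h t * Dp t * F (T t)).
    have cF := test_continuous tF; have [M FM] := @continuous_bounded (fun t => F (T t)) t0 b cF.
    apply: (int1_le _ (int1Zl M ih)) => [|t].
      by apply: measurable_funM (int1_measurable ih) _; exact: continuous_measurable_fun.
    have [D0|D0] := eqVneq (F (T t) * Dp t) 0; first by rewrite -mulrA (mulrC (Dp t)) D0 mulr0 normr0.
    by rewrite mulrC normrM [leRHS]normrM ler_wpM2r// (le_trans (FM t (Fs' t D0)))// ler_norm.
  have eqf : (fun t => e t * F (T t)) = (fun t => h t * Dp t * F (T t) - F (T t) * Dp t * inv_hat h t).
    apply/funext => t; have [D0|D0] := eqVneq (F (T t) * Dp t) 0.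
      rewrite D0 mul0r -mulrA (mulrC (Dp t)) D0 mulr0 subr0 /e mulrBl.
      rewrite (_ : _ * F (T t) = h t * ind t * (F (T t) * Dp t)); last by ring.
      by rewrite (_ : Dp t * _ * _ * _ = ind t * inv_hat h t * (F (T t) * Dp t)); [rewrite D0 !mulr0 subrr|ring].
    by rewrite /e indE ?Fs'//; ring.
  rewrite eqf (RintegralB measurableT i3 i1) -E1 -E2; apply/eqP; rewrite subr_eq0; apply/eqP; congr (_ * _); apply: eq_Rintegral => l _.
  by rewrite -/(hat (fun t => F (T t)) l) mulrC mulrA mulrAC.
have e0 := test_orthogonal t00 ie es eF.
have loc : locally_integrable [set: R] e.
  by have := integrable_locally measurableT ie; rewrite patch_setT.
have ieI (I : interval R) : leb.-integrable [set` I] (EFin \o e) by exact: (integrableS measurableT).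
have ftc := @FTC1 R e (BLeft t0) (fun y => ieI _) loc.
apply: (negligibleS _ ftc) => t /= ht ft; apply: ht => /andP[t1 t2].
have [] := ft; first by rewrite lte_fin.
move=> _ Ft.
(* Outside the exceptional set, [e t] is the derivative at t of the indefinite integral, which is
   identically 0 near t. *)
have e00 : e t = 0.
  rewrite -Ft derive1E (@near_eq_derive _ _ _ _ (cst 0)) ?derive_cst ?oner_neq0//.
  have : nbhs (t : R) [set` `]t0, b[].
    by apply: open_nbhs_nbhs; split; [exact: interval_open|rewrite /= in_itv /= t1].
  apply: filterS => y; rewrite /= in_itv /= => /andP[ty yb].
  rewrite /= -(Rintegral_itv_bndo_bndc (ieI _)) -(Rintegral_itv_obnd_cbnd (ieI _)); by rewrite e0// ltW.
have t3 : 0 < t by exact: lt_trans t1.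
have : Dp t * (h t - inv_hat h t) = 0.
  by move: e00; rewrite /e indE ?(ltW t1) ?(ltW t2)// => <-; ring.
have D0 : 0 < Dp t by rewrite /Dp (ltW t3) D_gt0.
by move/eqP; rewrite mulf_eq0 gt_eqF//= subr_eq0 => /eqP.
Qed.

Theorem inversion_ae (h : R -> R) : int1 (fun t => h t * Dp t) ->
  int1 (fun l => sob l * hat h l ^+ 2 * wp l) -> {ae leb, forall t, 0 < t -> h t = inv_hat h t}.
Proof.
move=> ih iS.
have n0 (n : nat) : 0 < (n.+1%:R)^-1 :> R by rewrite invr_gt0.
have : leb.-negligible (\bigcup_n ~` [set t : R | n.+1%:R^-1 < t < n.+1%:R -> h t = inv_hat h t]).
  by apply: negligible_bigcup => n; exact: (inversion_ae_itv n.+1%:R (n0 n) ih iS).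
apply: negligibleS => t /= /not_implyP[t0 ht].
pose n := Num.truncn (t + t^-1).
have tn : t + t^-1 < n.+1%:R by exact: truncnS_gt.
have ti : 0 < t^-1 by rewrite invr_gt0.
exists n => //= H; apply: ht; apply: H; apply/andP; split; last by apply: lt_trans tn; rewrite ltrDl.
by rewrite invf_plt ?posrE//; apply: lt_trans tn; rewrite ltrDr.
Qed.

End HalfLine.

Lemma oscillatory_cvg (R : realType) (A m g : R -> R) : int1 A -> measurable_fun [set: R] m -> continuous g ->
  (forall x, `|g x| <= 1) ->
  (fun y : R => \int[@lebesgue_measure R]_l (A l * g (y * m l))) @ (0 : R) --> \int[@lebesgue_measure R]_l (A l * g 0).
Proof.
move=> iA mm cg g1.
have mg y : measurable_fun [set: R] (fun l => g (y * m l)).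
  by apply: (measurableT_comp (continuous_measurable_fun cg)); exact: measurable_funM.
rewrite (_ : (fun l => A l * g 0) = (fun l => A l * g (0 * m l))); last by apply/funext => l; rewrite mul0r.
have := @continuity_under_integral R _ (measurableTypeR R) lebesgue_measure (fun y l => A l * g (y * m l)) setT measurableT (- 1) 1 _ _ (fun l => `|A l|) _ _.
apply; last by rewrite inE /= in_itv /=; apply/andP; split; lra.
- by move=> y _; exact: int1M.
- apply: aeW => l _ y _; apply: cvgM; first exact: cvg_cst.
  apply: (@cvg_comp _ _ _ (fun y : R => y * m l) g _ (nbhs (y * m l))); last exact: cg.
  by apply: cvgM; [exact: cvg_id|exact: cvg_cst].
- exact: int1_norm.
- by move=> y _; apply: aeW => l _; rewrite normrM ler_piMr.
Qed.

Lemma continuous_near_pole (K : numFieldType) (f h : K -> K) (u z : K) n : u != z -> {for u, continuous h} ->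
  (\forall w \near u, w != z -> f w = h w / (w - z) ^+ n) -> {for u, continuous f}.
Proof.
move=> uz ch fE; have nz : (u - z) ^+ n != 0 by rewrite expf_neq0// subr_eq0.
have c1 : (fun w : K => w - z) @ u --> u - z by exact: (cvgB (@cvg_id _ (nbhs u)) (cvg_cst z)).
have c2 : (fun w : K => (w - z) ^+ n) @ u --> (u - z) ^+ n.
  elim: (n) => [|k IH]; last first.
    by rewrite exprS (_ : (fun w => _) = (fun w : K => (w - z) * (w - z) ^+ k)); [exact: cvgM c1 IH|apply/funext => w; rewrite exprS].
  move=> A /nbhs_singleton A1; exists 1 => //= w _; rewrite expr0; exact: A1.
have uz0 : 0 < `|u - z| by rewrite normr_gt0 subr_eq0.
have neq : \forall w \near u, w != z.
  have : \forall w \near u, `|u - w| < `|u - z| by exact: (nbhsx_ballx u _ uz0).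
  by apply: filterS => w; apply: contraTneq => ->; rewrite ltxx.
have Eu : f u = h u / (u - z) ^+ n by exact: nbhs_singleton fE uz.
suff : f @ u --> f u by [].
rewrite Eu; apply: cvg_trans (cvgM ch (cvgV nz c2)); apply: near_eq_cvg; first exact: (nbhs_filter u).
by apply: (@filterS2 _ (nbhs u) (nbhs_filter u) _ _ _ _ fE neq) => w fw wz; rewrite fw.
Qed.

(** * Complex numbers and meromorphic functions *)

Section ComplexNumbers.
Variable R : realType.
Local Notation C := (Cplx R).

Lemma norm_cabs (z : C) : `|z| = ofR (cabs z).
Proof. by []. Qed.

Lemma ofR_lt (x y : R) : (ofR x < ofR y :> C) = (x < y).
Proof. exact: ltcR. Qed.

Lemma cabs_ofR (x : R) : cabs (ofR x) = `|x|.
Proof. by rewrite /cabs /ofR /= expr0n /= addr0 sqrtr_sqr. Qed.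

Lemma ofRB (x y : R) : ofR x - ofR y = ofR (x - y).
Proof. by rewrite /ofR; simpc. Qed.

Lemma cabs_le (u v : R) : cabs (Complex u v : C) <= `|u| + `|v|.
Proof.
rewrite /cabs /= -[leRHS]ger0_norm ?addr_ge0// -sqrtr_sqr ler_wsqrtr//.
by rewrite sqrrD !real_normK ?num_real// addrAC lerDl mulrn_wge0// mulr_ge0.
Qed.

Lemma cabsE2 (z : C) : cabs z ^+ 2 = re z ^+ 2 + im z ^+ 2.
Proof. by case: z => u v; rewrite /cabs /= sqr_sqrtr// addr_ge0 ?sqr_ge0. Qed.

Lemma cabs_dist (z w : C) : `|cabs z - cabs w| <= cabs (z - w).
Proof.
have tri (x y : C) : cabs x <= cabs (x - y) + cabs y.
  have : ofR (cabs x) <= ofR (cabs (x - y)) + ofR (cabs y) :> C.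
    by rewrite -!norm_cabs -{1}(subrK y x); exact: ler_normD.
  by rewrite /ofR; simpc.
have wz : cabs (w - z) = cabs (z - w).
  by have := distrC w z; rewrite !norm_cabs => -[].
have h1 := tri z w; have h2 := tri w z; rewrite wz in h2.
by rewrite ler_norml; apply/andP; split; lra.
Qed.

Lemma pos_ofR (e : C) : 0 < e -> exists2 d : R, 0 < d & e = ofR d.
Proof.
case: e => u v; rewrite ltcE /= => /andP[/eqP v0 u0]; exists u => //.
by rewrite /ofR v0.
Qed.

Lemma cvg_Cplx (T : Type) (F : set_system T) {FF : Filter F} (u : T -> C) (z : C) :
  (forall d : R, 0 < d -> \forall x \near F, cabs (z - u x) < d) -> u @ F --> z.
Proof.
move=> h; apply/cvgrPdist_lt => e /pos_ofR[d d0 ->].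
by apply: filterS (h d d0) => x; rewrite norm_cabs ofR_lt.
Qed.

Lemma ofR_continuous : continuous (@ofR R : R -> C).
Proof.
move=> x; apply: cvg_Cplx => d d0.
have : \forall y \near x, `|x - y| < d by exact: (nbhsx_ballx x d d0).
by apply: filterS => y; rewrite ofRB cabs_ofR.
Qed.

Lemma cabs_continuous : continuous (@cabs R : C -> R).
Proof.
move=> z; apply/(@cvgrPdist_lt _ _ _ (nbhs z) (nbhs_filter z)) => d d0.
have d0' : 0 < ofR d :> C by rewrite ofR_lt.
have : \forall w \near z, `|z - w| < ofR d by exact: (nbhsx_ballx z (ofR d) d0').
by apply: filterS => w; rewrite norm_cabs ofR_lt; apply: le_lt_trans; exact: cabs_dist.
Qed.

Lemma cvg_Complex (T : Type) (F : set_system T) {FF : Filter F} (u v : T -> R) (x y : R) :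
  u @ F --> x -> v @ F --> y -> (fun t => Complex (u t) (v t) : C) @ F --> (Complex x y : C).
Proof.
move=> /cvgrPdist_lt hu /cvgrPdist_lt hv; apply: cvg_Cplx => d d0.
have d20 : 0 < d / 2 by rewrite divr_gt0.
apply: filterS2 (hu _ d20) (hv _ d20) => t ut vt.
apply: le_lt_trans (_ : cabs (Complex (x - u t) (y - v t)) < d) => //.
by apply: le_lt_trans (cabs_le _ _) _; lra.
Qed.

(** Serves the measurability of |c(l)|^-2. A pole, or a point with an arbitrary value, can only be l
    itself, and such points are isolated. *)
Lemma meromorphic_continuous (h : C -> C) (l : R) : meromorphic h ->
  \forall y \near l, y != l -> {for y, continuous (fun x : R => cabs (h (ofR x)))}.
Proof.
move=> /(_ (ofR l)) [n [h1 [dh1 hE]]].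
have hE' : \forall w \near (ofR l : C), \forall w' \near w, w' != ofR l -> h w' = h1 w' / (w' - ofR l) ^+ n.
  exact: (near_join hE).
have := @ofR_continuous l; move=> ol.
have d1 : \forall y \near l, derivable h1 (ofR y) 1 by exact: (ol _ dh1).
have d2 : \forall y \near l, \forall w' \near (ofR y : C), w' != ofR l -> h w' = h1 w' / (w' - ofR l) ^+ n.
  by exact: (ol _ hE').
apply: filterS2 d1 d2 => y dy Ey yl.
have yl' : ofR y != ofR l :> C by apply: contra yl => /eqP[->].
have ch : {for (ofR y : C), continuous h}.
  apply: (@continuous_near_pole C h h1 (ofR y) (ofR l) n yl' _ Ey).
  exact: (differentiable_continuous ((derivable1_diffP _ _).1 dy)).
apply: (@cvg_comp _ _ _ (fun x : R => h (ofR x)) (@cabs R) _ (nbhs (h (ofR y)))); last exact: cabs_continuous.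
by apply: (@cvg_comp _ _ _ (@ofR R) h _ (nbhs (ofR y : C))); [exact: ofR_continuous|exact: ch].
Qed.

(** The preimage of an open set is its interior together with some points of discontinuity; these
    are countable, each being isolated by an interval with rational centre and radius. *)
Lemma measurable_isolated_discontinuities (g : R -> R) :
  (forall l : R, \forall y \near l, y != l -> {for y, continuous g}) -> measurable_fun [set: R] g.
Proof.
move=> gl; apply: (measurability (@RGenOpens.G R)); first exact: RGenOpens.measurableE.
move=> _ [_ [a [b ->] <-]]; rewrite setTI; set U := g @^-1` _.
pose S := [set l | ~ {for l, continuous g}].
pose P (q : rat * rat) l := [/\ S l, U l, `|ratr q.1 - l| < ratr q.2 & forall y, `|ratr q.1 - y| < ratr q.2 -> S y -> y = l].
have -> : U = U^° `|` \bigcup_q [set l | P q l].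
  apply/seteqP; split=> [l Ul|l [/interior_subset//|[q _ []]//]].
  have [cl|Sl] := pselect {for l, continuous g}.
    by left; apply: cl; apply: open_nbhs_nbhs; split => //; exact: interval_open.
  right; have /nbhs_ballP[e /= e0 el] := gl l.
  have [r] := @rat_in_itvoo R 0 (e / 2) (divr_gt0 e0 (ltr0n _ 2)).
  rewrite in_itv /= => /andP[r0 re].
  have [q] := @rat_in_itvoo R (l - ratr r) (l + ratr r) ltac:(lra).
  rewrite in_itv /= => /andP[q1 q2].
  exists (q, r) => //; split=> //=; first by rewrite ltr_norml; apply/andP; split; lra.
  move=> y; rewrite /= ltr_norml => /andP[y1 y2] Sy.
  apply: contrapT => /eqP yl; apply: Sy; apply: el => //.
  by rewrite /ball /= ltr_norml; apply/andP; split; lra.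
apply: measurableU; first by apply: open_measurable; exact: open_interior.
apply: countable_bigcupT_measurable; first exact: countableP.
move=> q; have [[l Pl]|nP] := pselect (exists l, P q l); last first.
  by rewrite (_ : [set l | P q l] = set0) ?measurable0//; apply/seteqP; split=> // l Pl; apply: nP; exists l.
rewrite (_ : [set l | P q l] = [set l]); first exact: measurable_set1.
by apply/seteqP; split=> [z [Sz _ zq _]|z ->//]; case: Pl => _ _ _; exact.
Qed.

End ComplexNumbers.

HB.instance Definition _ (R : realType) (V W : normedVectType R) :=
  Vector.on (V * W)%type.

Lemma crdS (R : realType) (V : normedVectType R) i (I : Type) (r : seq I) (F : I -> V) :
  crd i (\sum_(j <- r) F j) = \sum_(j <- r) crd i (F j).
Proof. exact: linear_sum. Qed.

Lemma pairZ (R : realType) (V W : normedModType R) (k : R) (v : V) (w : W) :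
  k *: ((v, w) : V * W) = (k *: v, k *: w).
Proof. by []. Qed.

Lemma cvg_crd (R : realType) (V : normedVectType R) (T : Type) (F : set_system T)
    (u : T -> V) (l : V) : Filter F ->
  (forall i, (fun t => crd i (u t)) @ F --> crd i l) -> u @ F --> l.
Proof.
move=> FF ul; rewrite (crdE l) (_ : u = fun t => \sum_i crd i (u t) *: bas i); last first.
  by apply/funext => t; rewrite -crdE.
by apply: cvg_big => [|i _]; [exact: add_continuous|exact: cvgZr_tmp].
Qed.

Lemma is_derive_crd (R : realType) (V : normedModType R) (W : normedVectType R)
    (f : V -> W) x v w :
  (forall i, is_derive x v (fun y => crd i (f y)) (crd i w)) -> is_derive x v f w.
Proof.
move=> df; apply/is_derive_cvgP; apply: cvg_crd => i.
have /is_derive_cvgP H := df i.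
apply: cvg_trans H; apply: near_eq_cvg; apply: nearW => h.
by rewrite crdZ crdD crdN.
Qed.

(** * Lie groups in the exponential chart *)

Section TopGroup.
Variable G : topGroupType.
Implicit Types x y : G.

Lemma mulg_cvg (T : Type) (F : set_system T) (FF : Filter F) (u v : T -> G) x y :
  u @ F --> x -> v @ F --> y -> (fun t => u t * v t)%g @ F --> (x * y)%g.
Proof.
move=> ux vy.
have uv : (fun t => (u t, v t)) @ F --> (x, y) by exact: cvg_pair.
exact: (@cvg_comp _ _ _ _ (fun p : G * G => (p.1 * p.2)%g) _ _ _ uv (mulg_continuous (x, y))).
Qed.

Lemma mulgl_continuous x : continuous (fun y => (x * y)%g).
Proof. by move=> y; apply: mulg_cvg => //; exact: cvg_cst. Qed.

Lemma nbhs_mulgl x y (A : set G) : nbhs y A -> nbhs (x * y)%g [set (x * z)%g | z in A].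
Proof.
move=> yA.
have H : nbhs (x * y)%g [set z | A (x^-1 * z)%g].
  by have := @mulgl_continuous x^-1%g (x * y)%g; rewrite /continuous_at mulKg; apply.
by apply: filterS H => z /= Az; exists (x^-1 * z)%g => //; rewrite mulgA mulgV mul1g.
Qed.

Lemma nbhs_mulgl1 x (A : set G) : nbhs 1%g A -> nbhs x [set (x * z)%g | z in A].
Proof. by move=> /(nbhs_mulgl x); rewrite mulg1. Qed.

(** Translating the neighbourhood of 1 shows that H is open and that its complement is open. This is
    how local facts are extended to the whole group. *)
Lemma connected_generated (H : set G) : connected [set: G] -> H 1%g ->
  (forall x y, H x -> H y -> H (x * y)%g) -> (forall x, H x -> H x^-1%g) ->
  nbhs 1%g H -> forall x, H x.
Proof.
move=> cG H1 HM HV nH x.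
have oH : open H.
  rewrite openE => y Hy; apply: filterS (nbhs_mulgl1 y nH) => _ [z Hz <-].
  exact: HM.
have cH : closed H.
  rewrite -[H]setCK; apply: open_closedC; rewrite openE => y nHy.
  apply: filterS (nbhs_mulgl1 y nH) => _ [z Hz <-] Hyz; apply: nHy.
  by rewrite -(mulgK z y); apply: HM => //; exact: HV.
rewrite (cG H)//.
- by exists 1%g.
- by exists H => //; rewrite setTI.
- by exists H => //; rewrite setTI.
Qed.

End TopGroup.

(** * One-parameter groups and the adjoint representation *)

Section LieGroup.
Variables (R : realType) (G : topGroupType) (g : normedVectType R).
Variables (br : g -> g -> g) (ex : g -> G).
Hypothesis lieE : is_lie_exp br ex.
Implicit Types (X Y Z W : g) (x y : G) (s t : R).

Lemma lexD s t X : ex ((s + t) *: X) = (ex (s *: X) * ex (t *: X))%g.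
Proof. exact: (lie_exp_line lieE). Qed.

Lemma lie_exp0 : ex 0 = 1%g.
Proof.
have := lexD 0 0 0; rewrite !scaler0 => /(congr1 (fun z => (ex 0)^-1 * z)%g).
by rewrite mulVg mulgA mulVg mul1g.
Qed.

Lemma lexNl s X : (ex (- s *: X) * ex (s *: X))%g = 1%g.
Proof. by rewrite -lexD addNr scale0r lie_exp0. Qed.

Lemma lexN X : ex (- X) = (ex X)^-1%g.
Proof.
have := lexNl 1 X; rewrite scaleN1r scale1r => h.
by rewrite -[LHS](mulgK (ex X)) h mul1g.
Qed.

Lemma lexMn n X : ex (n%:R *: X) = (ex X ^+ n)%g.
Proof.
elim: n => [|n IH]; first by rewrite scale0r lie_exp0.
by rewrite -addn1 natrD lexD IH scale1r addn1 expgSr.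
Qed.

(** The chart gives continuity near 0 only; elsewhere exp X is the (n + 1)-st power of exp (X / (n +
    1)), with X / (n + 1) inside the chart. *)
Lemma lex_continuous : continuous ex.
Proof.
have [U [oU _ cU _]] := lie_exp_chart lieE.
move=> X.
have c0 : (fun s : R => s *: X) @ 0^' --> (0 : g).
  by rewrite -(scale0r X); apply: cvgZr_tmp; exact: nbhs_dnbhs.
have : \forall s \near 0^', U (s *: X) by apply: c0; exact: open_nbhs_nbhs.
move/nbhs_ballP => [e /= e0 eU].
have [n ne] := ltr_add_invr e0; move: ne; rewrite add0r => ne.
have UX : U ((n.+1)%:R^-1 *: X).
  apply: eU; last by rewrite invr_eq0 pnatr_eq0.
  by rewrite -ball_normE /= sub0r normrN ger0_norm.
have -> : ex = (fun x : G => x ^+ n.+1)%g \o ex \o (fun Y => (n.+1)%:R^-1 *: Y).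
  by apply/funext => Y /=; rewrite -lexMn scalerA mulfV ?scale1r// pnatr_eq0.
have powc k : continuous (fun x : G => x ^+ k)%g.
  elim: k => [|k IH]; first by move=> x; exact: cvg_cst.
  rewrite (_ : (fun x : G => x ^+ k.+1)%g = (fun x => x * x ^+ k)%g).
    by move=> x; apply: mulg_cvg; [exact: cvg_id|exact: IH].
  by apply/funext => x; rewrite expgS.
have cs : continuous (fun Y : g => (n.+1)%:R^-1 *: Y).
  by move=> Y; apply: cvgZl_tmp; exact: cvg_id.
apply: continuous_comp; first exact: cs.
by apply: continuous_comp; [apply: cU; rewrite inE|exact: powc].
Qed.

Definition lmul : g * g -> g := projT1 (cid (lie_exp_mul lieE)).

Lemma lmulP : [/\ lmul (0, 0) = 0, smooth_near (0, 0) lmul,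
    \forall p \near nbhs ((0, 0) : g * g), ex (lmul p) = (ex p.1 * ex p.2)%g
  & forall X Y : g, br X Y = 'D_((X, 0) : g * g) ('D_((0, Y) : g * g) lmul) (0, 0)
                           - 'D_((Y, 0) : g * g) ('D_((0, X) : g * g) lmul) (0, 0)].
Proof. by rewrite /lmul; case: cid. Qed.

(** The local facts are gathered on one ball, so that estimates can be chained without shrinking
    neighbourhoods. *)
Record lie_radius (r L : R) : Prop := LieRadius {
  lr_gt0 : 0 < r;
  lr_ge1 : 1 <= L;
  lr_inj : forall X Y, `|X| < r -> `|Y| < r -> ex X = ex Y -> X = Y;
  lr_mul : forall X Y, `|X| < r -> `|Y| < r -> ex (lmul (X, Y)) = (ex X * ex Y)%g;
  lr_m0 : forall X, `|X| < r -> lmul (X, 0) = X;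
  lr_0m : forall X, `|X| < r -> lmul (0, X) = X;
  lr_mN : forall X, `|X| < r -> lmul (X, - X) = 0;
  lr_lip : forall X Y X' Y', `|X| < r -> `|Y| < r -> `|X'| < r -> `|Y'| < r ->
    `|lmul (X, Y) - lmul (X', Y')| <= L * Num.max `|X - X'| `|Y - Y'|;
  lr_smooth : forall k, Ck_on k [set p : g * g | `|p| < r] lmul
}.

Lemma lie_radius_exists : exists r L : R, lie_radius r L.
Proof.
have [m0 [U [[oU U0] cU]] mE _] := lmulP.
have [r1 [L [r1_gt0 L0 lip]]] := C1_lip oU (cU 1%N) U0.
have [V [[oV V0] Vinj _ _]] := lie_exp_chart lieE.
have /nbhs_ballP[r2 /= r2_gt0 r2V] := open_nbhs_nbhs (conj oV V0).
have /nbhs_ballP[r3 /= r3_gt0 r3m] := mE.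
have /nbhs_ballP[r4 /= r4_gt0 r4U] := open_nbhs_nbhs (conj oU U0).
pose L' := L + 1; have L'1 : 1 <= L' by rewrite lerDr ltW.
have L'0 : 0 < L' by exact: lt_le_trans L'1.
(* The bound r <= r2 / L' makes products of two elements of the ball land where exp is injective. *)
pose r := Num.min (Num.min r1 r3) (Num.min r4 (r2 / L')).
have r0 : 0 < r by rewrite !lt_min r1_gt0 r3_gt0 r4_gt0 divr_gt0.
have r_r4 : r <= r4 by rewrite /r !ge_min lexx !orbT.
have r_r1 : r <= r1 by rewrite /r !ge_min lexx.
have r_r3 : r <= r3 by rewrite /r !ge_min lexx orbT.
have r_r2L : r * L' <= r2 by rewrite -ler_pdivlMr// /r !ge_min lexx !orbT.
have r_r2 : r <= r2 by apply: le_trans r_r2L; rewrite ler_peMr// ltW.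
have b X Y c : `|X| < c -> `|Y| < c -> ball ((0, 0) : g * g) c (X, Y).
  by move=> Xc Yc; split; rewrite -ball_normE /= sub0r normrN.
have inj X Y : `|X| < r2 -> `|Y| < r2 -> ex X = ex Y -> X = Y.
  move=> Xr Yr; apply: Vinj; rewrite inE; apply: r2V;
  by rewrite -ball_normE /= sub0r normrN.
have z : `|0 : g| < r by rewrite normr0.
have lip' X Y X' Y' : `|X| < r -> `|Y| < r -> `|X'| < r -> `|Y'| < r ->
    `|lmul (X, Y) - lmul (X', Y')| <= L' * Num.max `|X - X'| `|Y - Y'|.
  move=> Xr Yr Xr' Yr'; apply: le_trans (lip (X, Y) (X', Y') _ _) _.
  - by apply: b; exact: lt_le_trans r_r1.
  - by apply: b; exact: lt_le_trans r_r1.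
  rewrite prod_normE /= ler_wpM2r ?lerDl// le_max normr_ge0//.
have small X Y : `|X| < r -> `|Y| < r -> `|lmul (X, Y)| < r2.
  move=> Xr Yr; have := lip' X Y 0 0 Xr Yr z z; rewrite m0 !subr0.
  move=> /le_lt_trans; apply; apply: lt_le_trans r_r2L.
  by rewrite mulrC ltr_pM2r// gt_max Xr.
have mul X Y : `|X| < r -> `|Y| < r -> ex (lmul (X, Y)) = (ex X * ex Y)%g.
  by move=> Xr Yr; apply: r3m; apply: b; exact: lt_le_trans r_r3.
have rU p : `|p| < r -> U p.
  move=> pr; apply: r4U; rewrite ball_prod_normE /= (_ : (0, 0) - p = - p); last exact: sub0r.
  by rewrite normrN (lt_le_trans pr).
exists r, L'; split => //.
- by move=> X Y Xr Yr; apply: inj; exact: lt_le_trans r_r2.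
- by move=> X Xr; apply: inj; [exact: small|exact: lt_le_trans r_r2|rewrite mul// lie_exp0 mulg1].
- by move=> X Xr; apply: inj; [exact: small|exact: lt_le_trans r_r2|rewrite mul// lie_exp0 mul1g].
- move=> X Xr; apply: inj; [by apply: small; rewrite ?normrN|by rewrite normr0|].
  by rewrite mul ?normrN// lexN mulgV lie_exp0.
- by move=> k; apply: Ck_on_le (cU k) => p /= /rU.
Qed.

Lemma nbhs_lex (e : R) : 0 < e -> nbhs (1%g : G) (ex @` [set X | `|X| < e]).
Proof.
move=> e0; have [V [[oV V0] _ _ Vo]] := lie_exp_chart lieE.
rewrite nbhsE; exists (ex @` (V `&` [set X | `|X| < e])).
  split.
    apply: Vo; first exact: subIsetl.
    apply: openI => //; have -> : [set X : g | `|X| < e] = ball 0 e.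
      by apply/seteqP; split => X; rewrite -ball_normE /= sub0r normrN.
    exact: ball_open.
  by exists 0; [split => //=; rewrite normr0|exact: lie_exp0].
by move=> _ [X [_ Xe] <-]; exists X.
Qed.

Section Radius.
Variables (r L : R).
Hypothesis rL : lie_radius r L.

Let r0 : 0 < r := lr_gt0 rL.
Let L1 : 1 <= L := lr_ge1 rL.
Let L0 : 0 < L. Proof. exact: lt_le_trans L1. Qed.
Let z : `|0 : g| < r. Proof. by rewrite normr0. Qed.

Lemma near_lex_unique x : (forall e : R, 0 < e -> exists2 Z, `|Z| < e & x = ex Z) ->
  x = 1%g.
Proof.
move=> H; have [Z Zr XZ] := H r r0.
have Z0 : Z = 0.
  apply/eqP; rewrite -normr_le0 leNgt; apply/negP => Z0.
  have e'0 : 0 < Num.min `|Z| r by rewrite lt_min Z0.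
  have [Z' Z'e XZ'] := H _ e'0.
  have [Z'Z Z'r] : `|Z'| < `|Z| /\ `|Z'| < r by apply/andP; rewrite -lt_min.
  by move: Z'Z; rewrite (lr_inj rL Zr Z'r) ?ltxx// -XZ.
by rewrite XZ Z0 lie_exp0.
Qed.

Lemma lex_line_inj Z W : (forall s, ex (s *: Z) = ex (s *: W)) -> Z = W.
Proof.
move=> ZW; pose s := r / (`|Z| + `|W| + 1).
have d0 : 0 < `|Z| + `|W| + 1 by rewrite ltr_wpDl// addr_ge0.
have s0 : 0 < s by rewrite divr_gt0.
have b V : `|V| < `|Z| + `|W| + 1 -> `|s *: V| < r.
  by move=> Vb; rewrite normrZ gtr0_norm// /s mulrAC ltr_pdivrMr// ltr_pM2l.
apply: (scalerI (lt0r_neq0 s0)); apply: (lr_inj rL); last exact: ZW.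
- by apply: b; have := normr_ge0 W; lra.
- by apply: b; have := normr_ge0 Z; lra.
Qed.

(** Comparing [lmul (E N, Z)] with [lmul (0, Z) = Z] adds only L |E N| at each step, so the
    Lipschitz constant does not compound over N steps. *)
Lemma lie_step_product (x : nat -> G) (E : nat -> g) (N : nat) :
  (forall i, (i < N)%N -> x i.+1 = (ex (E i) * x i)%g) ->
  L * (\sum_(i < N) `|E i|) < r ->
  exists2 Z, `|Z| <= L * (\sum_(i < N) `|E i|) & x N = (ex Z * x 0)%g.
Proof.
elim: N => [|N IH] xE Er.
  by exists 0; [rewrite normr0 big_ord0 mulr0|rewrite lie_exp0 mul1g].
move: Er; rewrite big_ord_recr/= mulrDr => Er.
have EN : 0 <= L * `|E N| by rewrite mulr_ge0// ltW.
have Er' : L * (\sum_(i < N) `|E i|) < r by apply: le_lt_trans Er; rewrite lerDl.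
have [Z Zb xN] := IH (fun i iN => xE i (ltnW iN)) Er'.
have Zr : `|Z| < r by exact: le_lt_trans Er'.
have ENr : `|E N| < r.
  apply: (@le_lt_trans _ _ (L * `|E N|)); first by rewrite ler_peMl.
  by apply: le_lt_trans Er; rewrite lerDr mulr_ge0// ?sumr_ge0// ltW.
exists (lmul (E N, Z)); last by rewrite xE// xN mulgA (lr_mul rL).
have := lr_lip rL ENr Zr z Zr; rewrite (lr_0m rL)//.
rewrite subr0 subrr normr0 max_l// => h.
rewrite -[X in `|X|](subrK Z) (le_trans (ler_normD _ _))// addrC.
exact: lerD.
Qed.

(** Two uses of the Lipschitz bound, against [lmul (c, 0) = c] and [lmul (c, - c) = 0]. *)
Lemma lex_conj_small c e : `|c| < r / 2 -> L * `|e| < r / 2 ->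
  exists2 E, `|E| <= L ^+ 2 * `|e| & (ex c * ex e * ex (- c))%g = ex E.
Proof.
move=> cr er.
have cr' : `|c| < r by have := r0; lra.
have er' : `|e| < r.
  by apply: (@le_lt_trans _ _ (L * `|e|)); [rewrite ler_peMl|have := r0; lra].
have Ncr : `|- c| < r by rewrite normrN.
have := lr_lip rL cr' er' cr' z; rewrite (lr_m0 rL)// subrr normr0 subr0 max_r// => h.
have mr : `|lmul (c, e)| < r.
  rewrite -[X in `|X|](subrK c) (le_lt_trans (ler_normD _ _))//; lra.
exists (lmul (lmul (c, e), - c)); last by rewrite !(lr_mul rL).
have := lr_lip rL mr Ncr cr' Ncr; rewrite (lr_mN rL)// subrr normr0 subr0 max_l// => h'.
by rewrite (le_trans h')// expr2 -mulrA ler_pM2l.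
Qed.

(** For small s the element gam(s) exp(-sW) telescopes into N conjugates of gam(h) exp(-hW), with h
    = s/N. Each is the exponential of a vector of size o(h), so the product is the exponential of an
    arbitrarily small vector, hence 1. Other values of s are reached by taking powers. *)
Lemma lex_one_parameter (gam : R -> G) (c : R -> g) W :
  (forall s t, gam (s + t) = gam s * gam t)%g ->
  (\forall s \near 0, gam s = ex (c s)) -> c 0 = 0 ->
  is_derive (0 : R) 1 c W -> forall s, gam s = ex (s *: W).
Proof.
move=> gamD gamE c0 dc.
have gam0 : gam 0 = 1%g.
  have := gamD 0 0; rewrite addr0 => /(congr1 (fun z => (gam 0)^-1 * z)%g).
  by rewrite mulVg mulgA mulVg mul1g.
have gamMn n s : gam (n%:R * s) = (gam s ^+ n)%g.
  elim: n => [|n IH]; first by rewrite mul0r gam0 expg0.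
  by rewrite -addn1 natrD mulrDl mul1r gamD IH addn1 expgSr.
have dcE e : 0 < e -> exists2 d : R, 0 < d & forall s, `|s| < d -> `|c s - s *: W| <= e * `|s|.
  move=> e0; move/is_derive_cvgP : dc => /cvgrPdist_le/(_ _ e0)/nbhs_ballP[d /= d0 dP].
  exists d => // s sd; have [->|s0] := eqVneq s 0.
    by rewrite c0 scale0r subrr !normr0 mulr0.
  have := dP s; rewrite -ball_normE /= sub0r normrN => /(_ sd s0).
  rewrite [s%:A]mulr1 addr0 c0 subr0 => h.
  rewrite -[c s](scalerKV s0) -scalerBr normrZ mulrC ler_pM2r ?normr_gt0//.
  by rewrite distrC.
have /nbhs_ballP[d1 /= d1_gt0 gamd1] := gamE.
have [d2 d2_gt0 cd2] := dcE _ ltr01.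
pose M := `|W| + 1; have M0 : 0 < M by rewrite ltr_wpDl.
pose d := Num.min (Num.min d1 d2) (r / 2 / M).
have d0 : 0 < d by rewrite !lt_min d1_gt0 d2_gt0 !divr_gt0.
have gamd s : `|s| < d -> gam s = ex (c s) /\ `|c s| < r / 2.
  rewrite /d !lt_min => /andP[/andP[sd1 sd2] sM]; split.
    by apply: gamd1; rewrite -ball_normE /= sub0r normrN.
  rewrite -[c s](subrK (s *: W)) (le_lt_trans (ler_normD _ _))//.
  have := cd2 s sd2; rewrite mul1r normrZ => h; move: sM; rewrite ltr_pdivlMr// /M => sM.
  nra.
clearbody d.
have small s : `|s| < d -> gam s = ex (s *: W).
  move=> sd; suff : (gam s * ex (- s *: W) = 1)%g.
    move=> /(congr1 (fun z => z * ex (s *: W))%g).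
    by rewrite -mulgA lexNl mulg1 mul1g.
  apply: near_lex_unique => e e0.
  pose e1 := Num.min e r / 3.
  have e1_gt0 : 0 < e1 by rewrite divr_gt0// lt_min e0.
  have e1_e : e1 < e by rewrite /e1; have : Num.min e r <= e; [rewrite ge_min lexx|have : 0 < Num.min e r; [rewrite lt_min e0|lra]].
  have e1_r : e1 < r / 2 by rewrite /e1; have : Num.min e r <= r; [rewrite ge_min lexx orbT|have := r0; lra].
  (* The power L^4 collects one L from the size of [eh], L^2 from conjugation, and one L from
     multiplying the steps. *)
  pose eta := e1 / (L ^+ 4 * (`|s| + 1)).
  have dn0 : 0 < L ^+ 4 * (`|s| + 1) by rewrite mulr_gt0 ?exprn_gt0// ltr_wpDl.
  have eta0 : 0 < eta by rewrite divr_gt0.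
  have [d3 d3_gt0 cd3] := dcE _ eta0.
  have q0 : 0 < Num.min (Num.min d d3) (r / M) / (`|s| + 1).
    by rewrite divr_gt0 ?ltr_wpDl// !lt_min d0 d3_gt0 divr_gt0.
  have [n ] := ltr_add_invr q0; rewrite add0r ltr_pdivlMr ?ltr_wpDl// => nq.
  pose N := n.+1; pose h := s / N%:R.
  have N0 : (0 : R) < N%:R by rewrite ltr0n.
  have hs : `|h| < Num.min (Num.min d d3) (r / M).
    rewrite normrM (gtr0_norm (x := N%:R^-1)) ?invr_gt0//; apply: le_lt_trans nq.
    by rewrite mulrC ler_pM2l ?invr_gt0// lerDl.
  move: hs; rewrite !lt_min => /andP[/andP[hd hd3] hM].
  have [gamh ch] := gamd h hd.
  have chr : `|c h| < r by have := r0; lra.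
  have hWr : `|- h *: W| < r.
    rewrite scaleNr normrN normrZ; move: hM; rewrite ltr_pdivlMr// => hM.
    by apply: le_lt_trans hM; rewrite ler_wpM2l// lerDl.
  have hWr' : `|h *: W| < r by move: hWr; rewrite scaleNr normrN.
  pose eh := lmul (c h, - h *: W).
  have ehb : `|eh| <= L * (eta * `|h|).
    have := lr_lip rL chr hWr hWr' hWr.
    rewrite {2}scaleNr (lr_mN rL)// !subr0 subrr normr0 max_l// => H.
    by rewrite (le_trans H)// ler_pM2l// cd3.
  have hN : `|h| * N%:R = `|s|.
    by rewrite /h normrM (gtr0_norm (x := N%:R^-1)) ?invr_gt0// divfK// gt_eqF.
  have ehN : L ^+ 3 * `|eh| * N%:R <= e1.
    apply: (@le_trans _ _ (L ^+ 3 * (L * (eta * `|h|)) * N%:R)).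
      rewrite ler_wpM2r ?(ltW N0)//; apply: ler_wpM2l; last exact: ehb.
      by rewrite exprn_ge0// ltW.
    rewrite (_ : _ * _ = L ^+ 4 * eta * (`|h| * N%:R)); last by ring.
    rewrite hN /eta [leLHS](_ : _ = e1 * (`|s| / (`|s| + 1))); last first.
      by field; rewrite !gt_eqF// ltr_wpDl.
    by rewrite ler_piMr ?(ltW e1_gt0)// ler_pdivrMr ?ltr_wpDl// mul1r lerDl.
  have Lge k : 1 <= L ^+ k by rewrite exprn_ege1.
  have ehr : L * `|eh| < r / 2.
    apply: le_lt_trans e1_r; apply: le_trans ehN.
    rewrite (_ : L ^+ 3 * _ * _ = L * `|eh| * (L ^+ 2 * N%:R)); last by ring.
    rewrite ler_peMr ?mulr_ge0 ?(ltW L0)//.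
    by rewrite -[leLHS]mulr1; apply: ler_pM => //; rewrite ler1n.
  have /choice[E HE] : forall i : nat, exists E, (i < N)%N ->
      `|E| <= L ^+ 2 * `|eh| /\ (ex (c (i%:R * h)%R) * ex eh * ex (- c (i%:R * h)%R))%g = ex E.
    move=> i; case: (ltnP i N) => iN; last by exists 0.
    have ih : `|i%:R * h| < d.
      apply: le_lt_trans sd; rewrite -hN mulrC normrM ler_wpM2l// ger0_norm// ler_nat ltnW//.
    have [_ cr] := gamd _ ih.
    by have [E E1 E2] := lex_conj_small cr ehr; exists E.
  (* x 0 = 1 and x N = gam(s) exp(-sW); consecutive terms differ by a conjugate of exp(eh). *)
  pose x i := (gam (i%:R * h)%R * ex (- (i%:R * h)%R *: W))%g.
  have xE i : (i < N)%N -> x i.+1 = (ex (E i) * x i)%g.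
    move=> iN; have [_ <-] := HE i iN.
    have ih : `|i%:R * h| < d.
      apply: le_lt_trans sd; rewrite -hN mulrC normrM ler_wpM2l// ger0_norm// ler_nat ltnW//.
    have [gi _] := gamd _ ih.
    rewrite /x lexN -gi /eh (lr_mul rL)//.
    rewrite -[in i.+1%:R]addn1 natrD mulrDl mul1r gamD gamh opprD [- (_ * h) - h]addrC lexD.
    by rewrite !mulgA mulgVK.
  have sumE : L * \sum_(i < N) `|E i| <= e1.
    apply: le_trans ehN; rewrite exprS -mulrA -mulrA ler_pM2l// mulr_natr.
    rewrite mulrnAr -[X in _ *+ X](card_ord N) -sumr_const ler_sum// => i _.
    by have [] := HE i (ltn_ord i).
  have [|Z Zb xN] := lie_step_product xE; first by have := r0; lra.
  exists Z; first by apply: le_lt_trans e1_e; exact: le_trans sumE.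
  move: xN; rewrite /x mul0r gam0 oppr0 scale0r lie_exp0 !mulg1.
  by rewrite mulrC /h divfK ?gt_eqF.
move=> s.
have q0 : 0 < d / (`|s| + 1) by rewrite divr_gt0// ltr_wpDl.
have [n ] := ltr_add_invr q0; rewrite add0r ltr_pdivlMr ?ltr_wpDl// => nq.
have N0 : (0 : R) < n.+1%:R by rewrite ltr0n.
have -> : s = n.+1%:R * (s / n.+1%:R) by rewrite mulrC divfK// gt_eqF.
rewrite gamMn small ?lexMn; first by rewrite -lexMn scalerA.
rewrite normrM (gtr0_norm (x := n.+1%:R^-1)) ?invr_gt0//; apply: le_lt_trans nq.
by rewrite mulrC ler_pM2l ?invr_gt0// lerDl.
Qed.

Lemma derive_lmul_l X Z : `|X| < r -> 'D_((Z, 0) : g * g) lmul (X, 0) = Z.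
Proof.
move=> Xr.
suff H : is_derive ((X, 0) : g * g) ((Z, 0) : g * g) lmul Z by exact: (@derive_val _ _ _ _ _ _ _ H).
have Z1 : 0 < `|Z| + 1 by rewrite ltr_wpDl.
apply/is_derive_cvgP/cvgrPdist_le => e e0; near=> h.
have h0 : h != 0 by near: h; exact: nbhs_dnbhs_neq.
have -> : h *: ((Z, 0) : g * g) + (X, 0) = (h *: Z + X, 0).
  by congr pair; rewrite /= scaler0 addr0.
rewrite !(lr_m0 rL)//; first by rewrite addrK scalerK// subrr normr0 ltW.
rewrite (le_lt_trans (ler_normD _ _))// normrZ -ltrBrDr.
have : `|h| < (r - `|X|) / (`|Z| + 1).
  by near: h; apply: dnbhs0_lt; rewrite divr_gt0 ?subr_gt0// ltr_wpDl.
by rewrite ltr_pdivlMr// mulrDr mulr1 => ?; have := normr_ge0 h; lra.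
Unshelve. all: by end_near. Qed.

Lemma derive_lmul_r Y Z : `|Y| < r -> 'D_((0, Z) : g * g) lmul (0, Y) = Z.
Proof.
move=> Xr.
suff H : is_derive ((0, Y) : g * g) ((0, Z) : g * g) lmul Z by exact: (@derive_val _ _ _ _ _ _ _ H).
have Z1 : 0 < `|Z| + 1 by rewrite ltr_wpDl.
apply/is_derive_cvgP/cvgrPdist_le => e e0; near=> h.
have h0 : h != 0 by near: h; exact: nbhs_dnbhs_neq.
have -> : h *: ((0, Z) : g * g) + (0, Y) = (0, h *: Z + Y).
  by congr pair; rewrite /= scaler0 addr0.
rewrite !(lr_0m rL)//; first by rewrite addrK scalerK// subrr normr0 ltW.
rewrite (le_lt_trans (ler_normD _ _))// normrZ -ltrBrDr.
have : `|h| < (r - `|Y|) / (`|Z| + 1).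
  by near: h; apply: dnbhs0_lt; rewrite divr_gt0 ?subr_gt0// ltr_wpDl.
by rewrite ltr_pdivlMr// mulrDr mulr1 => ?; have := normr_ge0 h; lra.
Unshelve. all: by end_near. Qed.

Let oU : open [set p : g * g | `|p| < r].
Proof.
rewrite (_ : [set p : g * g | _] = ball 0 r); first exact: ball_open.
by apply/seteqP; split => p; rewrite -ball_normE /= sub0r normrN.
Qed.

Let U1 X : `|X| < r -> [set p : g * g | `|p| < r] (X, 0).
Proof. by move=> Xr /=; rewrite prod_normE /= normr0 gt_max Xr. Qed.

Let UN X : `|X| < r -> [set p : g * g | `|p| < r] (X, - X).
Proof. by move=> Xr /=; rewrite prod_normE /= normrN gt_max Xr. Qed.

Let cm k : Ck_on k [set p : g * g | `|p| < r] lmul := lr_smooth rL k.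

(* The derivative at s = 0 of log (exp X exp (sZ) exp (-X)). *)
Definition Ad_chart X Z : g :=
  'D_(('D_((0, Z) : g * g) lmul (X, 0), 0) : g * g) lmul (X, - X).

Lemma Ad_chart_linear X : `|X| < r -> linear (Ad_chart X).
Proof.
move=> Xr k Z Z'; rewrite /Ad_chart.
have -> : ((0, k *: Z + Z') : g * g) = k *: (0, Z) + (0, Z').
  by congr pair; rewrite /= scaler0 add0r.
rewrite (@C1_deriveD R _ _ oU _ lmul _ _ _ (cm 1) (U1 Xr)) (@C1_deriveZ R _ _ _ lmul _ _ _ (cm 1) (U1 Xr)).
set a := 'D_(0, Z) _ _; set b := 'D_(0, Z') _ _.
have -> : ((k *: a + b, 0) : g * g) = k *: (a, 0) + (b, 0).
  by congr pair; rewrite /= scaler0 add0r.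
by rewrite (@C1_deriveD R _ _ oU _ lmul _ _ _ (cm 1) (UN Xr)) (@C1_deriveZ R _ _ _ lmul _ _ _ (cm 1) (UN Xr)).
Qed.

(** The left-hand side is a one-parameter group in s, so only its derivative at 0 in the chart has
    to be computed. *)
Lemma Ad_chartP X Z s : `|X| < r / 2 ->
  (ex X * ex (s *: Z) * ex (- X))%g = ex (s *: Ad_chart X Z).
Proof.
move=> Xr2; have Xr : `|X| < r by have := r0; lra.
have NXr : `|- X| < r by rewrite normrN.
pose c t := lmul (lmul (X, t *: Z), - X).
pose l := 'D_((0, Z) : g * g) lmul (X, 0).
move: s; apply: (lex_one_parameter (c := c)).
- move=> s t; rewrite scalerDl lexN -!mulgA; congr (_ * _)%g.
  by rewrite -scalerDl lexD -!mulgA; congr (_ * _)%g; rewrite mulKg.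
- near=> s; rewrite /c.
  have sZ : L * `|s *: Z| < r / 2.
    rewrite normrZ; have : `|s| < (r / 2) / (L * (`|Z| + 1)).
      near: s; apply/nbhs_ballP; exists (r / 2 / (L * (`|Z| + 1))).
        by rewrite /= !divr_gt0// mulr_gt0// ltr_wpDl.
      by move=> t; rewrite -ball_normE /= sub0r normrN.
    rewrite ltr_pdivlMr ?mulr_gt0 ?ltr_wpDl//; apply: le_lt_trans.
    by rewrite mulrCA ler_wpM2l// ler_wpM2l ?(ltW L0)// lerDl.
  have sZr : `|s *: Z| < r.
    by apply: (@le_lt_trans _ _ (L * `|s *: Z|)); [rewrite ler_peMl|have := r0; lra].
  rewrite !(lr_mul rL)//.
  have := lr_lip rL Xr sZr Xr z; rewrite (lr_m0 rL)// subrr normr0 subr0 max_r// => h.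
  rewrite -[X in `|X|](subrK X) (le_lt_trans (ler_normD _ _))//; lra.
- by rewrite /c scale0r (lr_m0 rL)// (lr_mN rL).
apply/is_derive_cvgP.
have dl : is_derive ((X, 0) : g * g) ((0, Z) : g * g) lmul l by exact: Ck_on_is_derive (cm 1) (U1 Xr).
have /is_derive_cvgP dA : is_derive ((X, - X) : g * g) ((l, 0) : g * g) lmul (Ad_chart X Z).
  exact: Ck_on_is_derive (cm 1) (UN Xr).
rewrite -[Ad_chart X Z]addr0.
(* [c1] replaces the inner product of X and hZ by its first-order expansion X + h l; the Lipschitz
   bound makes the error o(h). *)
pose c1 h := lmul (h *: ((l, 0) : g * g) + (X, - X)).
rewrite (_ : (fun h : R => _) = (fun h : R => h^-1 *: (c1 h - lmul (X, - X))) +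
   (fun h : R => h^-1 *: (c h - c1 h))); last first.
  apply/funext => h; rewrite fctE -scalerDr; congr (_ *: _).
  rewrite [h%:A]mulr1 addr0 /(c 0) scale0r (lr_m0 rL)// (lr_mN rL)// !subr0.
  by rewrite addrC subrK.
apply: cvgD; first exact: dA.
move/is_derive_cvgP : dl => dl.
apply/cvgr0Pnorm_le => e e0.
move/cvgrPdist_le : dl => /(_ (e / L)) dl.
near=> h.
have h0 : h != 0 by near: h; exact: nbhs_dnbhs_neq.
have c1E : c1 h = lmul (h *: l + X, - X).
  by rewrite /c1; congr lmul; congr pair; rewrite /= scaler0 add0r.
rewrite normrZ normfV ler_pdivrMl ?normr_gt0// /c c1E.
have hl : `|h *: l + X| < r.
  rewrite (le_lt_trans (ler_normD _ _))// normrZ.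
  have : `|h| < (r / 2) / (`|l| + 1).
    by near: h; apply: dnbhs0_lt; rewrite !divr_gt0// ltr_wpDl.
  rewrite ltr_pdivlMr ?ltr_wpDl// mulrDr mulr1 => ?; have := normr_ge0 h; lra.
have hZ : L * `|h *: Z| < r / 2.
  rewrite normrZ; have : `|h| < (r / 2) / (L * (`|Z| + 1)).
    by near: h; apply: dnbhs0_lt; rewrite !divr_gt0// mulr_gt0// ltr_wpDl.
  rewrite ltr_pdivlMr ?mulr_gt0 ?ltr_wpDl//; apply: le_lt_trans.
  by rewrite mulrCA ler_wpM2l// ler_wpM2l ?(ltW L0)// lerDl.
have hZr : `|h *: Z| < r.
  by apply: (@le_lt_trans _ _ (L * `|h *: Z|)); [rewrite ler_peMl|have := r0; lra].
have mr : `|lmul (X, h *: Z)| < r.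
  have := lr_lip rL Xr hZr Xr z; rewrite (lr_m0 rL)// subrr normr0 subr0 max_r// => H.
  rewrite -[X in `|X|](subrK X) (le_lt_trans (ler_normD _ _))//; lra.
have := lr_lip rL mr NXr hl NXr; rewrite subrr normr0 max_l//.
move=> /le_trans; apply.
have : `|l - h^-1 *: (lmul (h *: ((0, Z) : g * g) + (X, 0)) - lmul (X, 0))| <= e / L.
  by near: h; apply: dl; rewrite divr_gt0.
have -> : h *: ((0, Z) : g * g) + (X, 0) = (X, h *: Z).
  by congr pair; rewrite /= ?scaler0 ?add0r ?addr0.
rewrite (lr_m0 rL)// ler_pdivlMr// => H.
rewrite [`|h| * e]mulrC -ler_pdivrMr ?normr_gt0//; apply: le_trans H.
rewrite (_ : lmul (X, h *: Z) - (h *: l + X) =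
  - (h *: (l - h^-1 *: (lmul (X, h *: Z) - X)))); last first.
  by rewrite scalerBr scalerA mulfV// scale1r; vec.
by rewrite normrN normrZ [`|h| * _]mulrC mulrA mulfK ?normr_eq0// mulrC.
Unshelve. all: by end_near. Qed.

(** The direction of the outer derivative depends on X; expanding it in a basis leaves derivatives
    in fixed directions, which are smooth in X. *)
Lemma Ad_chartE X Z : `|X| < r -> Ad_chart X Z =
  \sum_j crd j ('D_((0, Z) : g * g) lmul (X, 0)) *: 'D_((bas j, 0) : g * g) lmul (X, - X).
Proof.
move=> Xr; rewrite /Ad_chart; set l := 'D_(0, Z) lmul (X, 0).
rewrite [in LHS](crdE l).
elim: (index_enum _) => [|j s IH].
  by rewrite !big_nil derive0.
rewrite !big_cons -IH.
have -> : ((crd j l *: bas j + \sum_(i <- s) crd i l *: bas i, 0) : g * g) =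
    crd j l *: (bas j, 0) + (\sum_(i <- s) crd i l *: bas i, 0).
  by congr pair; rewrite /= scaler0 add0r.
by rewrite (@C1_deriveD R _ _ oU _ lmul _ _ _ (cm 1) (UN Xr)) (@C1_deriveZ R _ _ _ lmul _ _ _ (cm 1) (UN Xr)).
Qed.

Lemma Ad_chart_smooth Z k i : Ck_on k [set X | `|X| < r] (fun X => crd i (Ad_chart X Z)).
Proof.
have oV : open [set X : g | `|X| < r].
  rewrite (_ : [set X : g | _] = ball 0 r); first exact: ball_open.
  by apply/seteqP; split => p; rewrite -ball_normE /= sub0r normrN.
have cc j : continuous (crd j : g -> R) := @linear_continuous_fd _ g R (crd j).
pose l1 (X : g) : g * g := (X, 0).
have l1L : linear l1 by move=> a X Y; congr pair; rewrite /= scaler0 add0r.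
pose l1l := GRing.isLinear.Build _ _ _ _ _ l1L.
pose L1' : {linear g -> (g * g)%type} := HB.pack l1 l1l.
pose l2 (X : g) : g * g := (X, - X).
have l2L : linear l2 by move=> a X Y; congr pair; rewrite /= opprD scalerN.
pose l2l := GRing.isLinear.Build _ _ _ _ _ l2L.
pose L2' : {linear g -> (g * g)%type} := HB.pack l2 l2l.
have D1 v k' : Ck_on k' [set X | `|X| < r] (fun X => 'D_v lmul (X, 0)).
  have := @Ck_on_affine _ _ _ _ k' _ ('D_v lmul) L1' 0 (@linear_continuous_fd _ _ _ L1') oU (Ck_on_derive v (cm k'.+1)).
  under [X in Ck_on _ _ X]eq_fun do rewrite addr0.
  by apply: Ck_on_le => X /= Xr; rewrite addr0; exact: U1.
have D2 v k' : Ck_on k' [set X | `|X| < r] (fun X => 'D_v lmul (X, - X)).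
  have := @Ck_on_affine _ _ _ _ k' _ ('D_v lmul) L2' 0 (@linear_continuous_fd _ _ _ L2') oU (Ck_on_derive v (cm k'.+1)).
  under [X in Ck_on _ _ X]eq_fun do rewrite addr0.
  by apply: Ck_on_le => X /= Xr; rewrite addr0; exact: UN.
have H : Ck_on k [set X | `|X| < r] (fun X => \sum_j
    crd j ('D_((0, Z) : g * g) lmul (X, 0)) * crd i ('D_((bas j, 0) : g * g) lmul (X, - X))).
  apply: Ck_on_sum => // j; apply: Ck_onM => //.
    exact: (@Ck_on_lin _ _ _ _ _ _ (fun X => 'D_((0, Z) : g * g) lmul (X, 0)) (crd j) oV (cc j) (D1 _ _)).
  exact: (@Ck_on_lin _ _ _ _ _ _ (fun X => 'D_((bas j, 0) : g * g) lmul (X, - X)) (crd i) oV (cc i) (D2 _ _)).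
apply: Ck_on_eq H => // X /= Xr; rewrite Ad_chartE// crdS.
by apply: eq_bigr => j _; rewrite crdZ.
Qed.

(** Product rule in [Ad_chartE]. Along (X, - X) the derivative of ['D_(v, 0) lmul] at 0 is minus its
    derivative along (0, X), because lmul (Y, 0) = Y has no second-order part; Schwarz then gives
    the form in which [lie_exp_mul] expresses the bracket. *)
Lemma is_derive_Ad_chart X Z : is_derive (0 : R) 1 (fun t => Ad_chart (t *: X) Z) (br X Z).
Proof.
have [m0 _ _ brE] := lmulP.
have V0 : [set p : g * g | `|p| < r] 0 by rewrite /= normr0.
have d1 (u v : g * g) : is_derive (0 : R) 1 (fun t : R => 'D_v lmul (t *: u)) ('D_u ('D_v lmul) 0).
  have H : is_derive ((0 : R) *: u + 0) u ('D_v lmul) ('D_u ('D_v lmul) 0).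
    by rewrite scale0r addr0; apply: (Ck_on_is_derive u (Ck_on_derive v (cm 2))).
  have := is_derive_line H.
  by under eq_fun do rewrite addr0.
have da : is_derive (0 : R) 1 (fun t : R => 'D_((0, Z) : g * g) lmul (t *: X, 0)) ('D_((X, 0) : g * g) ('D_((0, Z) : g * g) lmul) 0).
  have := d1 (X, 0) (0, Z); rewrite (_ : (fun t : R => _) = (fun t : R => 'D_((0, Z) : g * g) lmul (t *: X, 0)))//.
  by apply/funext => t; rewrite pairZ scaler0.
have db v : is_derive (0 : R) 1 (fun t : R => 'D_((v, 0) : g * g) lmul (t *: X, - (t *: X))) ('D_((X, - X) : g * g) ('D_((v, 0) : g * g) lmul) 0).
  have := d1 (X, - X) (v, 0); rewrite (_ : (fun t : R => _) = (fun t : R => 'D_((v, 0) : g * g) lmul (t *: X, - (t *: X))))//.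
  by apply/funext => t; rewrite pairZ scalerN.
have dbE v : 'D_((X, - X) : g * g) ('D_((v, 0) : g * g) lmul) 0 =
    - 'D_((v, 0) : g * g) ('D_((0, X) : g * g) lmul) 0.
  have -> : ((X, - X) : g * g) = (X, 0) + (- 1) *: (0, X).
    by congr pair; rewrite /= ?scaler0 ?addr0// scaleN1r add0r.
  rewrite (@C1_deriveD R _ _ oU _ _ _ _ _ (Ck_on_derive _ (cm 2)) V0).
  rewrite (@C1_deriveZ R _ _ _ _ _ _ _ (Ck_on_derive _ (cm 2)) V0) scaleN1r.
  rewrite (schwarz (0, X) (v, 0) oU (cm 2) V0) [X in X - _](_ : _ = 0) ?sub0r//.
  suff [_ ->] : is_derive (0 : g * g) ((X, 0) : g * g) ('D_((v, 0) : g * g) lmul) 0 by [].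
  apply/is_derive_cvgP/cvgrPdist_le => e e0; near=> h.
  have -> : h *: ((X, 0) : g * g) + 0 = (h *: X, 0).
    by congr pair; rewrite /= ?scaler0 addr0.
  rewrite !derive_lmul_l ?normr0// ?subrr ?scaler0 ?subrr ?normr0 ?ltW//.
  rewrite normrZ; have : `|h| < r / (`|X| + 1).
    by near: h; apply: dnbhs0_lt; rewrite divr_gt0// ltr_wpDl.
  by rewrite ltr_pdivlMr ?ltr_wpDl// mulrDr mulr1 => ?; have := normr_ge0 h; lra.
have E i : is_derive (0 : R) 1 (fun t : R => \sum_j crd j ('D_((0, Z) : g * g) lmul (t *: X, 0)) *
    crd i ('D_((bas j, 0) : g * g) lmul (t *: X, - (t *: X)))) (crd i (br X Z)).
  have cc j : continuous (crd j : g -> R) := @linear_continuous_fd _ g R (crd j).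
  have H j := is_deriveM (is_derive_lin (L := crd j) (cc j) da) (is_derive_lin (L := crd i) (cc i) (db (bas j))).
  have H2 := is_derive_sum H.
  apply: is_derive_eq.
    rewrite (_ : (fun t : R => _) = \sum_j ((fun t => crd j ('D_((0, Z) : g * g) lmul (t *: X, 0))) *
    (fun t => crd i ('D_((bas j, 0) : g * g) lmul (t *: X, - (t *: X)))))).
      exact: H2.
    by apply/funext => t; rewrite fct_sumE.
  rewrite scale0r oppr0 /= brE crdD.
  rewrite big_split/= addrC; congr (_ + _).
    transitivity (crd i (\sum_j crd j ('D_((X, 0) : g * g) ('D_((0, Z) : g * g) lmul) 0) *: bas j)).
      rewrite crdS; apply: eq_bigr => j _; rewrite crdZ derive_lmul_l ?normr0//.
      exact: mulrC.
    by rewrite -crdE.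
  transitivity (crd i (\sum_j crd j Z *: - 'D_((bas j, 0) : g * g) ('D_((0, X) : g * g) lmul) 0)).
    rewrite crdS; apply: eq_bigr => j _; rewrite crdZ dbE derive_lmul_r ?normr0//.
  congr (crd i _); rewrite [in RHS](crdE Z).
  have CX := Ck_on_derive ((0, X) : g * g) (cm 2).
  elim: (index_enum _) => [|j s IH]; first by rewrite !big_nil derive0 oppr0.
  rewrite !big_cons IH.
  have -> : ((crd j Z *: bas j + \sum_(i0 <- s) crd i0 Z *: bas i0, 0) : g * g) =
      crd j Z *: (bas j, 0) + (\sum_(i0 <- s) crd i0 Z *: bas i0, 0).
    by congr pair; rewrite /= scaler0 add0r.
  rewrite (@C1_deriveD R _ _ oU _ _ _ _ _ CX V0) (@C1_deriveZ R _ _ _ _ _ _ _ CX V0).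
  by rewrite opprD scalerN.
apply: is_derive_crd => i; have Ei := E i.
have oV : open [set t : R | `|t *: X| < r].
  have ct : continuous (fun t : R => `|t *: X|).
    by move=> t; apply: cvg_norm; apply: cvgZr_tmp; exact: cvg_id.
  by apply: (open_comp (f := fun t : R => `|t *: X|) (D := [set y : R | y < r])); [move=> t _; exact: ct|exact: open_lt].
apply: (is_derive_near oV) Ei; first by rewrite /= scale0r normr0.
move=> t /= tr; rewrite Ad_chartE// crdS.
by apply: eq_bigr => j _; rewrite crdZ.
Unshelve. all: by end_near. Qed.

Lemma is_derive_lmul0 (a b : R -> g) A B : a 0 = 0 -> b 0 = 0 ->
  is_derive (0 : R) 1 a A -> is_derive (0 : R) 1 b B ->
  is_derive (0 : R) 1 (fun s => lmul (a s, b s)) (A + B).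
Proof.
move=> a0 b0 da' db'; have /is_derive_cvgP da := da'; have /is_derive_cvgP db := db'.
apply/is_derive_cvgP.
have V0 : [set p : g * g | `|p| < r] 0 by rewrite /= normr0.
have m0 : lmul 0 = 0 by apply: (lr_m0 rL z).
have D0 P Q : 'D_((P, Q) : g * g) lmul 0 = P + Q.
  have -> : ((P, Q) : g * g) = (P, 0) + (0, Q) by congr pair; rewrite /= ?addr0 ?add0r.
  by rewrite (@C1_deriveD R _ _ oU _ _ _ _ _ (cm 1) V0) derive_lmul_l// derive_lmul_r.
have c0 (u : R -> g) U : is_derive (0 : R) 1 u U -> u 0 = 0 -> u @ 0^' --> (0 : g).
  move=> [du _] u0.
  have H : u @ (0 : R) --> u 0 := differentiable_continuous (proj1 (derivable1_diffP _ _) du).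
  by rewrite u0 in H; move=> S /H; exact: nbhs_dnbhs.
have a0' := c0 _ _ da' a0; have b0' := c0 _ _ db' b0.
rewrite -[A + B]addr0.
rewrite (_ : (fun h : R => _) = (fun h : R => h^-1 *: (a (h *: 1 + 0) - a 0)) +
    (fun h : R => h^-1 *: (b (h *: 1 + 0) - b 0)) +
    (fun h : R => h^-1 *: (lmul (a h, b h) - (a h + b h)))); last first.
  apply/funext => h; rewrite !fctE -!scalerDr; congr (_ *: _).
  by rewrite [h%:A]mulr1 addr0 a0 b0 m0 !subr0 addrC subrK.
apply: cvgD; first exact: cvgD.
apply/cvgr0Pnorm_le => e e0.
pose M := `|A| + `|B| + 2; have M0 : 0 < M by rewrite ltr_wpDl// addr_ge0.
have eM : 0 < e / M by rewrite divr_gt0.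
have T := C1_taylor oU (cm 1) V0 eM.
have abT : \forall h \near 0^', `|lmul (a h, b h) - (a h + b h)| <= e / M * `|(a h, b h) : g * g|.
  have ab : (fun h => (a h, b h)) @ 0^' --> ((0, 0) : g * g) by exact: cvg_pair.
  have T' : \forall h \near 0^', (fun v : g * g => `|lmul (v + 0) - lmul 0 - 'D_v lmul 0| <= e / M * `|v|) (a h, b h) := ab _ T.
  apply: filterS T' => h /=.
  by rewrite addr0 m0 subr0 D0.
move/cvgrPdist_le : da => /(_ 1 ltr01) da; move/cvgrPdist_le : db => /(_ 1 ltr01) db.
near=> h.
have h0 : h != 0 by near: h; exact: nbhs_dnbhs_neq.
rewrite normrZ normfV ler_pdivrMl ?normr_gt0//.
apply: (@le_trans _ _ (e / M * `|(a h, b h) : g * g|)); first by near: h.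
have bd (u : R -> g) U : u 0 = 0 -> `|U - h^-1 *: (u (h *: 1 + 0) - u 0)| <= 1 -> `|u h| <= (`|U| + 1) * `|h|.
  move=> u0; rewrite [h%:A]mulr1 addr0 u0 subr0 => H.
  rewrite -[u h](scalerKV h0) normrZ mulrC ler_pM2r ?normr_gt0//.
  rewrite -[h^-1 *: u h](subrK U) (le_trans (ler_normD _ _))// addrC lerD2l.
  by rewrite distrC.
have ah : `|a h| <= (`|A| + 1) * `|h| by apply: bd => //; near: h.
have bh : `|b h| <= (`|B| + 1) * `|h| by apply: bd => //; near: h.
rewrite [leRHS](_ : _ = e / M * (M * `|h|)); last by field; rewrite gt_eqF.
rewrite ler_pM2l// prod_normE /= ge_max.
have := normr_ge0 h; have := normr_ge0 A; have := normr_ge0 B; rewrite /M => *.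
by apply/andP; split; nra.
Unshelve. all: by end_near. Qed.

End Radius.

Lemma is_derive0_cst (f : R -> g) : (forall t : R, is_derive t 1 f 0) -> forall s t, f s = f t.
Proof.
move=> df s t; apply: crd_inj => i.
apply: (is_derive_0_is_cst (f := fun t => crd i (f t))) => u.
have := is_derive_lin (L := crd i) (@linear_continuous_fd _ g R (crd i)) (df u).
by rewrite linear0.
Qed.

Definition Ad x Z : g := xget 0 [set W | forall s, (x * ex (s *: Z) * x^-1)%g = ex (s *: W)].

Hypothesis cG : connected [set: G].

(** The elements for which conjugation, by them and by their inverses, has a linear generator form a
    subgroup, which contains a neighbourhood of 1 by [Ad_chartP]. *)
Lemma Ad_exists x : exists2 A : g -> g, linear A &
  forall Z s, (x * ex (s *: Z) * x^-1)%g = ex (s *: A Z).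
Proof.
have [r [L rL]] := lie_radius_exists.
pose P x := exists2 A : g -> g, linear A &
  forall Z s, (x * ex (s *: Z) * x^-1)%g = ex (s *: A Z).
suff : P x /\ P x^-1%g by case.
pose H : set G := [set x | P x /\ P x^-1%g].
have P1 : P 1%g by exists id => // Z s; rewrite mul1g invg1 mulg1.
have PM y y' : P y -> P y' -> P (y * y')%g.
  move=> [A lA AE] [A' lA' A'E]; exists (A \o A').
    by move=> k u v; rewrite /= lA' lA.
  by move=> Z s; rewrite /= -AE -A'E invgM !mulgA.
apply: (@connected_generated G H cG); rewrite /H /=.
- by rewrite invg1.
- by move=> y y' [Py PVy] [Py' PVy']; split; [exact: PM|rewrite invgM; exact: PM].
- by move=> y [Py PVy]; rewrite invgK.
- have r0 := lr_gt0 rL; have r2 : 0 < r / 2 by rewrite divr_gt0.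
  apply: filterS (nbhs_lex r2) => _ [X /= Xr <-].
  have Q Y : `|Y| < r / 2 -> P (ex Y).
    move=> Yr; exists (Ad_chart Y); first by apply: (Ad_chart_linear rL); lra.
    by move=> Z s; rewrite -lexN (Ad_chartP rL).
  by split; [exact: Q|rewrite -lexN; apply: Q; rewrite normrN].
Qed.

Lemma Ad_unique x Z W : (forall s, (x * ex (s *: Z) * x^-1)%g = ex (s *: W)) ->
  Ad x Z = W.
Proof.
have [r [L rL]] := lie_radius_exists.
move=> H; rewrite /Ad; case: xgetP => [W' _ W'E|/(_ W)/(_ H)//].
by apply: (lex_line_inj rL) => s; rewrite -H -W'E.
Qed.

Lemma AdP x Z s : (x * ex (s *: Z) * x^-1)%g = ex (s *: Ad x Z).
Proof. by have [A _ AE] := Ad_exists x; rewrite (Ad_unique (W := A Z)). Qed.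

Lemma Ad_lex x Z : (x * ex Z * x^-1)%g = ex (Ad x Z).
Proof. by have := AdP x Z 1; rewrite !scale1r. Qed.

Lemma Ad_is_linear x : linear (Ad x).
Proof.
have [A lA AE] := Ad_exists x => k u v.
by rewrite !(Ad_unique (AE _)) lA.
Qed.

HB.instance Definition _ x := GRing.isLinear.Build R g g *:%R (Ad x) (Ad_is_linear x).

Lemma AdM x y Z : Ad (x * y)%g Z = Ad x (Ad y Z).
Proof. by apply: Ad_unique => s; rewrite -AdP -AdP invgM !mulgA. Qed.

Lemma Ad1 Z : Ad 1%g Z = Z.
Proof. by apply: Ad_unique => s; rewrite mul1g invg1 mulg1. Qed.

Lemma AdVK x Z : Ad x^-1%g (Ad x Z) = Z.
Proof. by rewrite -AdM mulVg Ad1. Qed.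

Lemma AdKV x Z : Ad x (Ad x^-1%g Z) = Z.
Proof. by rewrite -AdM mulgV Ad1. Qed.

Lemma AdD x Y Z : Ad x (Y + Z) = Ad x Y + Ad x Z. Proof. exact: linearD. Qed.
Lemma AdN x Z : Ad x (- Z) = - Ad x Z. Proof. exact: linearN. Qed.
Lemma AdZ x k Z : Ad x (k *: Z) = k *: Ad x Z. Proof. exact: linearZ. Qed.
Lemma Ad0 x : Ad x 0 = 0. Proof. exact: linear0. Qed.

Lemma Ad_near : exists2 d : R, 0 < d & forall X Z, `|X| < d -> Ad (ex X) Z = Ad_chart X Z.
Proof.
have [r [L rL]] := lie_radius_exists.
exists (r / 2); first by have := lr_gt0 rL; lra.
by move=> X Z Xr; apply: Ad_unique => s; rewrite -lexN (Ad_chartP rL).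
Qed.

Lemma Ad_smooth : exists2 d : R, 0 < d & forall Z k i,
  Ck_on k [set X | `|X| < d] (fun X => crd i (Ad (ex X) Z)).
Proof.
have [r [L rL]] := lie_radius_exists; have [d d0 dE] := Ad_near.
exists (Num.min r d); first by rewrite lt_min d0 (lr_gt0 rL).
move=> Z k i.
have oV : open [set X : g | `|X| < Num.min r d].
  rewrite (_ : [set X : g | _] = ball 0 (Num.min r d)); first exact: ball_open.
  by apply/seteqP; split => p; rewrite -ball_normE /= sub0r normrN.
have H : Ck_on k [set X | `|X| < Num.min r d] (fun X => crd i (Ad_chart X Z)).
  by apply: Ck_on_le (Ad_chart_smooth rL Z k i) => X /=; rewrite lt_min => /andP[].
by apply: Ck_on_eq H => // X /=; rewrite lt_min => /andP[_ /dE ->].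
Qed.

Lemma Ad_continuous Z : continuous (fun x => Ad x Z).
Proof.
have [d d0 dS] := Ad_smooth.
have c0 : {for 0, continuous (fun X => Ad (ex X) Z)}.
  by apply: cvg_crd => i; apply: (Ck_on_continuous (dS Z 0%N i)); rewrite /= normr0.
have c1 : (fun x => Ad x Z) @ (1%g : G) --> Z.
  move=> A; rewrite -{1}(Ad1 Z) -{1}lie_exp0 => /c0/nbhs_ballP[e /= e0 eA].
  apply: filterS (nbhs_lex e0) => _ [X /= Xe <-]; apply: eA.
  by rewrite -ball_normE /= sub0r normrN.
move=> x; rewrite /continuous_at.
have cx : (fun y => Ad x (Ad (x^-1 * y)%g Z)) @ x --> Ad x Z.
  apply: (@cvg_comp _ _ _ (fun y => Ad (x^-1 * y)%g Z) (Ad x) _ (nbhs Z)).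
    apply: (@cvg_comp _ _ _ (fun y => x^-1 * y)%g (fun x => Ad x Z) _ (nbhs (1%g : G))) => //.
    by rewrite -(mulVg x); exact: mulgl_continuous.
  exact: linear_continuous_fd.
by rewrite (_ : (fun x => Ad x Z) = (fun y => Ad x (Ad (x^-1 * y)%g Z)))//; apply/funext => y; rewrite -AdM mulgA mulgV mul1g.
Qed.

(** exp((t + h)X) splits with exp(hX) on the right or on the left, which gives two formulas for one
    derivative; their agreement is [Ad_bracket]. *)
Lemma is_derive_AdE X Z t :
  is_derive t 1 (fun t => Ad (ex (t *: X)) Z) (Ad (ex (t *: X)) (br X Z)) /\
  is_derive t 1 (fun t => Ad (ex (t *: X)) Z) (br X (Ad (ex (t *: X)) Z)).
Proof.
have [r [L rL]] := lie_radius_exists; have [d d0 dE] := Ad_near.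
have D0 Y : is_derive (0 : R) 1 (fun t => Ad (ex (t *: X)) Y) (br X Y).
  have oV : open [set t : R | `|t *: X| < d].
    have ct : continuous (fun t : R => `|t *: X|).
      by move=> u; apply: cvg_norm; apply: cvgZr_tmp; exact: cvg_id.
    by apply: (open_comp (f := fun t : R => `|t *: X|) (D := [set y : R | y < d])); [move=> u _; exact: ct|exact: open_lt].
  apply: (is_derive_near oV) (is_derive_Ad_chart rL X Y); first by rewrite /= scale0r normr0.
  by move=> u /= ud; rewrite dE.
split; apply/is_derive_cvgP.
- have /is_derive_cvgP H := D0 Z.
  have := @cvg_comp _ _ _ _ (Ad (ex (t *: X))) _ _ _ H (@linear_continuous_fd _ _ _ _ _).
  apply: cvg_trans; apply: near_eq_cvg; apply: nearW => h /=.
  by rewrite AdZ AdD AdN -AdM -lexD [h%:A]mulr1 addr0 scale0r lie_exp0 Ad1 [t + h]addrC.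
- have /is_derive_cvgP H := D0 (Ad (ex (t *: X)) Z).
  apply: cvg_trans H; apply: near_eq_cvg; apply: nearW => h /=.
  by rewrite [h%:A]mulr1 addr0 scale0r lie_exp0 Ad1 lexD AdM.
Qed.

Lemma Ad_bracket X Z t : br X (Ad (ex (t *: X)) Z) = Ad (ex (t *: X)) (br X Z).
Proof. by have [H1 H2] := is_derive_AdE X Z t; exact: is_derive_uniq H2 H1. Qed.

Lemma Ad_fixed X Z t : br X Z = 0 -> Ad (ex (t *: X)) Z = Z.
Proof.
move=> XZ; rewrite -[RHS]Ad1 -lie_exp0 -(scale0r X).
apply: (is_derive0_cst (f := fun t => Ad (ex (t *: X)) Z)) => u.
by have [+ _] := is_derive_AdE X Z u; rewrite XZ Ad0.
Qed.

(** e^(-ku) Ad(exp(uX)) Z has derivative 0 in u. *)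
Lemma Ad_eigen X Z t k : br X Z = k *: Z -> Ad (ex (t *: X)) Z = expR (k * t) *: Z.
Proof.
move=> XZ; apply: crd_inj => i; rewrite crdZ.
have de u : is_derive (u : R) 1 (fun u => expR (- (k * u))) (expR (- (k * u)) * (- k)).
  apply: (@is_derive1_comp _ expR (fun u => - (k * u))).
  apply: is_deriveN; apply: (is_derive_eq (is_deriveM (is_derive_cst k u 1) (is_derive_id u (1 : R)))).
  by rewrite scaler0 addr0 [_ *: _]mulr1.
have H u : is_derive (u : R) 1 (fun u => expR (- (k * u)) * crd i (Ad (ex (u *: X)) Z)) 0.
  have [d _] := is_derive_AdE X Z u.
  have dl := is_derive_lin (L := crd i) (@linear_continuous_fd _ g R (crd i)) d.
  apply: (is_derive_eq (is_deriveM (de u) dl)).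
  by rewrite /= XZ AdZ crdZ -[_ *: _]/(_ * _) -[X in _ + X]/(_ * _); ring.
have := is_derive_0_is_cst t 0 H.
rewrite mulr0 oppr0 expR0 mul1r scale0r lie_exp0 Ad1 => <-.
by rewrite mulrA -expRD subrr expR0 mul1r.
Qed.

Lemma lex_commute X Y s t : br X Y = 0 ->
  (ex (s *: X) * ex (t *: Y) = ex (t *: Y) * ex (s *: X))%g.
Proof.
move=> XY; have := AdP (ex (s *: X)) Y t; rewrite Ad_fixed// => /(congr1 (fun z => z * ex (s *: X))%g).
by rewrite mulgVK.
Qed.

Lemma near_small (X : g) (r : R) : 0 < r -> \forall s \near (0 : R), `|s *: X| < r.
Proof.
move=> r0; have ct : continuous (fun t : R => `|t *: X|).
  by move=> u; apply: cvg_norm; apply: cvgZr_tmp; exact: cvg_id.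
have := ct 0; rewrite /continuous_at scale0r normr0 => /cvgrPdist_lt/(_ _ r0).
by apply: filterS => s; rewrite sub0r normrN normr_id.
Qed.

Lemma is_derive_line_id (X : g) (u : R) : is_derive u 1 (fun s => s *: X) X.
Proof.
apply/is_derive_cvgP/cvgrPdist_le => e e0; near=> h.
rewrite [h%:A]mulr1 scalerDl addrK scalerK ?subrr ?normr0 ?ltW//.
by near: h; exact: nbhs_dnbhs_neq.
Unshelve. all: by end_near. Qed.

Lemma lexDc X Y : br X Y = 0 -> ex (X + Y) = (ex X * ex Y)%g.
Proof.
have [r [L rL]] := lie_radius_exists; have r0 := lr_gt0 rL.
move=> XY; pose gam s := (ex (s *: X) * ex (s *: Y))%g.
suff : forall s, gam s = ex (s *: (X + Y)) by move/(_ 1); rewrite /gam !scale1r.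
apply: (lex_one_parameter rL (c := fun s => lmul (s *: X, s *: Y))).
- move=> s t; rewrite /gam !lexD -!mulgA; congr (_ * _)%g; rewrite !mulgA; congr (_ * _)%g.
  exact: lex_commute.
- near=> s; rewrite (lr_mul rL)//.
    by near: s; exact: near_small.
  by near: s; exact: near_small.
- by rewrite !scale0r (lr_m0 rL) ?normr0.
- by apply: (is_derive_lmul0 rL); rewrite ?scale0r//; exact: is_derive_line_id.
Unshelve. all: by end_near. Qed.

Hypothesis lieB : is_lie_bracket br.

Lemma brC X Y : br X Y = - br Y X.
Proof.
have := lie_alternating lieB (X + Y).
have lD U V W' : br U (V + W') = br U V + br U W'.
  by have := lie_linearr lieB U 1 V W'; rewrite !scale1r.
have lDl U V W' : br (V + W') U = br V U + br W' U.
  by have := lie_linearl lieB U 1 V W'; rewrite /= !scale1r.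
rewrite lDl !lD !(lie_alternating lieB) add0r addr0 => /eqP.
by rewrite addr_eq0 => /eqP.
Qed.

Lemma brZr X k Y : br X (k *: Y) = k *: br X Y.
Proof.
have b0 : br X 0 = 0.
  by have := lie_linearr lieB X 1 0 0; rewrite !scale1r addr0 => /eqP; rewrite -subr_eq0 opprD addrA subrr sub0r oppr_eq0 => /eqP.
by have := lie_linearr lieB X k Y 0; rewrite b0 !addr0.
Qed.

Lemma brDr X Y Z : br X (Y + Z) = br X Y + br X Z.
Proof. by have := lie_linearr lieB X 1 Y Z; rewrite !scale1r. Qed.

Lemma brNr X Y : br X (- Y) = - br X Y.
Proof. by rewrite -scaleN1r brZr scaleN1r. Qed.

Lemma br0r X : br X 0 = 0.
Proof. by rewrite -[X in br _ X](scale0r (0 : g)) brZr scale0r. Qed.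

Lemma brDl X Y Z : br (X + Y) Z = br X Z + br Y Z.
Proof. by rewrite !(brC _ Z) brDr opprD. Qed.

Lemma brZl k X Y : br (k *: X) Y = k *: br X Y.
Proof. by rewrite !(brC _ Y) brZr scalerN. Qed.

Lemma brNl X Y : br (- X) Y = - br X Y.
Proof. by rewrite !(brC _ Y) brNr. Qed.

Lemma br0l X : br 0 X = 0.
Proof. by rewrite brC br0r oppr0. Qed.

Lemma brxx X : br X X = 0. Proof. exact: (lie_alternating lieB). Qed.

Lemma Ad_unipotent X Y t : br X (br X Y) = 0 -> Ad (ex (t *: X)) Y = Y + t *: br X Y.
Proof.
move=> XXY.
suff : Ad (ex (t *: X)) Y - t *: br X Y = Ad (ex (0 *: X)) Y - 0 *: br X Y.
  by rewrite !scale0r lie_exp0 Ad1 subr0 => /eqP; rewrite subr_eq => /eqP.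
apply: (is_derive0_cst (f := fun t => Ad (ex (t *: X)) Y - t *: br X Y)) => u.
have [d _] := is_derive_AdE X Y u.
apply: (is_derive_eq (is_deriveB d (is_derive_line_id (br X Y) u))).
by rewrite Ad_fixed// subrr.
Qed.

(** Baker-Campbell-Hausdorff in the two-step nilpotent case, which is that of n, whose only roots
    are 1 and 2. The curve exp(sX) exp(sY) exp(-(s^2/2) C) is a one-parameter group with derivative
    X + Y at 0. *)
Lemma lexD_two_step X Y : br X (br X Y) = 0 -> br Y (br X Y) = 0 ->
  (ex X * ex Y)%g = ex (X + Y + 2^-1 *: br X Y).
Proof.
have [r [L rL]] := lie_radius_exists; have r0 := lr_gt0 rL.
move=> XC YC; set C := br X Y in XC YC *.
pose gam s := (ex (s *: X) * ex (s *: Y) * ex (- (s ^+ 2 / 2)%R *: C))%g.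
have XYC : br (X + Y) (2^-1 *: C) = 0 by rewrite brZr brDl XC YC addr0 scaler0.
suff : forall s, gam s = ex (s *: (X + Y)).
  move=> H; rewrite [RHS]lexDc// -[X + Y]scale1r -(H 1) /gam !scale1r expr1n mul1r.
  by rewrite -mulgA -lexD addNr scale0r lie_exp0 mulg1.
(* exp(sY) and exp(tX) commute up to exp(-st C), and C commutes with X and Y. *)
have sw s t : (ex (s *: Y) * ex (t *: X) = ex (t *: X) * (ex (s *: Y) * ex (- (s * t)%R *: C)))%g.
  have := AdP (ex (- t *: X)) Y s; rewrite Ad_unipotent// -lexN !scaleNr opprK => H.
  rewrite -[ex (- ((s * t) *: C))]/(ex _) (_ : (ex (s *: Y) * ex (- ((s * t) *: C)))%g = ex (s *: (Y - t *: C))).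
    by rewrite -H lexN !mulgA mulgV mul1g.
  by rewrite scalerBr scalerA lexDc// brNr brZr brZl YC !scaler0 oppr0.
have dC : is_derive (0 : R) 1 (fun s => - (s ^+ 2 / 2) *: C) 0.
  apply/is_derive_cvgP/cvgr0Pnorm_le => e e0; near=> h.
  have h0 : h != 0 by near: h; exact: nbhs_dnbhs_neq.
  rewrite [h%:A]mulr1 addr0 expr0n mul0r oppr0 scale0r subr0 scalerA.
  rewrite (_ : h^-1 * _ = - (h / 2)); last by field.
  rewrite normrZ normrN normrM [`|2^-1|]ger0_norm ?invr_ge0//.
  have : `|h| < e / (`|C| + 1).
    by near: h; apply: dnbhs0_lt; rewrite divr_gt0// ltr_wpDl.
  rewrite ltr_pdivlMr ?ltr_wpDl// => ?; have := normr_ge0 C; have := normr_ge0 h; nra.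
have cont0 (c : R -> g) D : is_derive (0 : R) 1 c D -> c 0 = 0 -> \forall s \near (0 : R), `|c s| < r.
  move=> [D1 _] c0.
  have H : c @ (0 : R) --> c 0 := differentiable_continuous (proj1 (derivable1_diffP _ _) D1).
  move: H; rewrite c0 => /cvgrPdist_lt/(_ _ r0).
  by apply: filterS => s; rewrite sub0r normrN.
have dXY : is_derive (0 : R) 1 (fun s => lmul (s *: X, s *: Y)) (X + Y).
  by apply: (is_derive_lmul0 rL); rewrite ?scale0r//; exact: is_derive_line_id.
have XY0 : lmul (0 *: X, 0 *: Y) = 0 by rewrite !scale0r (lr_m0 rL) ?normr0.
have C0 : - ((0 : R) ^+ 2 / 2) *: C = 0 by rewrite expr0n mul0r oppr0 scale0r.
have cX s t : (ex (s *: X) * ex (t *: C) = ex (t *: C) * ex (s *: X))%g by exact: lex_commute.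
have cY s t : (ex (s *: Y) * ex (t *: C) = ex (t *: C) * ex (s *: Y))%g by exact: lex_commute.
apply: (lex_one_parameter rL (c := fun s => lmul (lmul (s *: X, s *: Y), - (s ^+ 2 / 2) *: C))).
- move=> s t; rewrite /gam.
  have -> : - ((s + t) ^+ 2 / 2) = - (s * t) + (- (s ^+ 2 / 2) + - (t ^+ 2 / 2)).
    by field.
  rewrite !lexD -!mulgA; congr (_ * _)%g.
  rewrite [in RHS](mulgA (ex (- (s ^+ 2 / 2) *: C))) -cX -!mulgA.
  rewrite [in RHS](mulgA (ex (s *: Y))) sw -!mulgA; congr (_ * _)%g; congr (_ * _)%g.
  rewrite [in RHS](mulgA (ex (- (s ^+ 2 / 2) *: C)) (ex (t *: Y))) -cY -!mulgA.
  by rewrite [in RHS](mulgA (ex (- (s * t) *: C)) (ex (t *: Y))) -cY -!mulgA.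
- near=> s.
  have sX : `|s *: X| < r by near: s; exact: near_small.
  have sY : `|s *: Y| < r by near: s; exact: near_small.
  rewrite !(lr_mul rL)//.
  + by near: s; exact: cont0 dXY XY0.
  + by near: s; exact: cont0 dC C0.
- by rewrite XY0 C0 (lr_m0 rL) ?normr0.
- by rewrite -[X + Y]addr0; apply: (is_derive_lmul0 rL).
Unshelve. all: by end_near. Qed.

End LieGroup.

Ltac vecf := apply: crd_inj => ?; rewrite !(crdD, crdN, crdZ, crd0); by field.

(** * Restricted roots *)

Section SymmetricOperators.
Variables (R : realType) (g : normedVectType R) (ip : g -> g -> R).
Hypothesis ipC : forall X Y, ip X Y = ip Y X.
Hypothesis ipDl : forall X Y Z, ip (X + Y) Z = ip X Z + ip Y Z.
Hypothesis ipZl : forall k X Y, ip (k *: X) Y = k * ip X Y.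
Hypothesis ip_gt0 : forall X, X != 0 -> 0 < ip X X.
Implicit Types (X Y Z u v : g) (W : {vspace g}).

Lemma ipDr X Y Z : ip X (Y + Z) = ip X Y + ip X Z.
Proof. by rewrite ipC ipDl !(ipC _ X). Qed.
Lemma ipZr k X Y : ip X (k *: Y) = k * ip X Y.
Proof. by rewrite ipC ipZl ipC. Qed.
Lemma ip0l X : ip 0 X = 0. Proof. by rewrite -(scale0r (0 : g)) ipZl mul0r. Qed.
Lemma ip0r X : ip X 0 = 0. Proof. by rewrite ipC ip0l. Qed.
Lemma ipNl X Y : ip (- X) Y = - ip X Y. Proof. by rewrite -scaleN1r ipZl mulN1r. Qed.
Lemma ipNr X Y : ip X (- Y) = - ip X Y. Proof. by rewrite ipC ipNl ipC. Qed.
Lemma ip_suml (I : Type) (r : seq I) (F : I -> g) X :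
  ip (\sum_(i <- r) F i) X = \sum_(i <- r) ip (F i) X.
Proof.
by elim: r => [|i r IH]; rewrite ?big_nil ?ip0l// !big_cons ipDl IH.
Qed.
Lemma ip_sumr (I : Type) (r : seq I) (F : I -> g) X :
  ip X (\sum_(i <- r) F i) = \sum_(i <- r) ip X (F i).
Proof. by rewrite ipC ip_suml; apply: eq_bigr => i _; exact: ipC. Qed.
Lemma ip_ge0 X : 0 <= ip X X.
Proof. by have [->|/ip_gt0/ltW//] := eqVneq X 0; rewrite ip0l. Qed.
Lemma ip_eq0 X : ip X X = 0 -> X = 0.
Proof. by move=> X0; apply/eqP; apply: contraTT isT => /ip_gt0; rewrite X0 ltxx. Qed.

Lemma ip_continuous (T : Type) (F : set_system T) (u v : T -> g) x y : Filter F ->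
  u @ F --> x -> v @ F --> y -> (fun t => ip (u t) (v t)) @ F --> ip x y.
Proof.
move=> FF ux vy.
have E a b : ip a b = \sum_i \sum_j crd i a * crd j b * ip (bas i) (bas j).
  rewrite {1}(crdE a) ip_suml; apply: eq_bigr => i _; rewrite {1}(crdE b) ip_sumr.
  by apply: eq_bigr => j _; rewrite ipZl ipZr mulrA.
under eq_cvg do rewrite E; rewrite E.
have cc j : continuous (crd j : g -> R) := @linear_continuous_fd _ g R (crd j).
apply: cvg_big => [|i _]; first exact: add_continuous.
apply: cvg_big => [|j _]; first exact: add_continuous.
apply: cvgM; last exact: cvg_cst.
apply: cvgM.
- exact: (@cvg_comp _ _ _ u (crd i) _ _ _ ux (cc i x)).
- exact: (@cvg_comp _ _ _ v (crd j) _ _ _ vy (cc j y)).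
Qed.

Lemma ip_norm_bounds : exists2 c : R, 0 < c &
  forall X, c * `|X| ^+ 2 <= ip X X <= c^-1 * `|X| ^+ 2.
Proof.
pose S := [set X : g | `|X| = 1].
have [S0|S0] := pselect (S !=set0); last first.
  exists 1 => // X; have -> : X = 0.
    apply/eqP; apply: contrapT => /negP X0; apply: S0; exists (`|X|^-1 *: X) => /=.
    by rewrite /S /= normrZ ger0_norm ?invr_ge0// mulVf ?normr_eq0.
  by rewrite normr0 expr0n !mulr0 ip0l lexx.
have cS : compact S.
  apply: (@closed_bounded_compact _ _ _ 1); last by move=> v /= ->.
  have /= := @closed_comp _ _ (fun x : g => `|x| : R) [set r | r = 1].
  by apply => [x _|]; [exact: norm_continuous|exact: closed_eq].
have cf : {within S, continuous (fun X => ip X X)}.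
  by apply: continuous_subspaceT => X; apply: ip_continuous; exact: cvg_id.
have [a /[!inE] Sa mina] := compact_EVT_min S0 cS cf.
have [b /[!inE] Sb maxb] := compact_EVT_max S0 cS cf.
have nz Y : S Y -> Y != 0.
  by rewrite /S /= => Y1; rewrite -normr_gt0 Y1.
pose c := Num.min (ip a a) (ip b b)^-1.
have c0 : 0 < c by rewrite lt_min invr_gt0 !ip_gt0//; exact: nz.
exists c => // X; have [->|X0] := eqVneq X 0.
  by rewrite normr0 expr0n !mulr0 ip0l lexx.
have X0' : 0 < `|X| by rewrite normr_gt0.
pose Y := `|X|^-1 *: X.
have YS : Y \in S by rewrite inE /S /= normrZ ger0_norm ?invr_ge0// mulVf ?normr_eq0.
have XE : ip X X = ip Y Y * `|X| ^+ 2.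
  by rewrite /Y ipZl ipZr; field; rewrite gt_eqF.
rewrite XE !ler_pM2r ?exprn_gt0//; apply/andP; split.
  by apply: le_trans (mina _ YS); rewrite /c ge_min lexx.
apply: le_trans (maxb _ YS) _; rewrite -[leLHS]invrK lef_pV2 ?posrE ?invr_gt0 ?ip_gt0 ?(nz _ Sb)//.
by rewrite /c ge_min lexx orbT.
Qed.

Lemma vspace_closed W : closed [set v | v \in W].
Proof.
rewrite (_ : [set v | v \in W] = [set v | v - projv W v = 0]).
  pose f v := v - projv W v.
  have lf : linear f by move=> k u v; rewrite /f linearP scalerBr opprD addrACA.
  pose fl := GRing.isLinear.Build _ _ _ _ _ lf.
  pose F : {linear g -> g} := HB.pack f fl.
  apply: (@closed_comp _ _ F [set v | v = 0]); last exact: (accessible_closed_set1 (hausdorff_accessible (@norm_hausdorff _ g))).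
  by move=> x _; exact: linear_continuous_fd.
apply/seteqP; split => v /=; first by move/projv_id ->; rewrite subrr.
by move/eqP; rewrite subr_eq0 => /eqP ->; exact: memv_proj.
Qed.

Lemma ip_sphere_compact W : compact [set v | v \in W /\ ip v v = 1].
Proof.
have [c c0 cP] := ip_norm_bounds.
apply: (@closed_bounded_compact _ _ _ (c^-1 + 1)).
  rewrite (_ : [set v | _] = [set v | v \in W] `&` [set v | ip v v = 1])//.
  apply: closedI; first exact: vspace_closed.
  have /= := @closed_comp _ _ (fun x : g => ip x x) [set r | r = 1].
  by apply => [x _|]; [apply: ip_continuous; exact: cvg_id|exact: closed_eq].
move=> v [_ v1]; have /andP[] := cP v; rewrite v1 mulrC -ler_pdivlMr// div1r => h _.
have : 0 <= c^-1 by rewrite invr_ge0 ltW.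
by have := normr_ge0 v; nra.
Qed.

Definition ipf X : 'Hom(g, R^o) := linfun (ip X : g -> R^o).

Lemma ipfE X Y : ipf X Y = ip X Y.
Proof.
have l : linear (ip X : g -> R^o) by move=> k u v; rewrite ipDr ipZr.
pose fl := GRing.isLinear.Build _ _ _ _ _ l.
pose F : {linear g -> R^o} := HB.pack (ip X : g -> R^o) fl.
exact: (lfunE F).
Qed.

Variable T : 'End(g).
Hypothesis Tsym : forall X Y, ip (T X) Y = ip X (T Y).

(** Take v maximising the Rayleigh quotient on the compact unit sphere of W, with maximum l: the
    residue w = Tv - lv is orthogonal to v, and the first variation in its direction is 2 |w|^2. *)
Lemma symmetric_eigenvector W : (T @: W <= W)%VS -> W != 0%VS ->
  exists2 v, v \in W & ip v v = 1 /\ exists l : R, T v = l *: v.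
Proof.
move=> TW W0; pose S := [set v | v \in W /\ ip v v = 1].
have S0 : S !=set0.
  exists ((Num.sqrt (ip (vpick W) (vpick W)))^-1 *: vpick W); split.
    by apply: memvZ; exact: memv_pick.
  have p0 : 0 < ip (vpick W) (vpick W) by rewrite ip_gt0// vpick0.
  rewrite ipZl ipZr mulrA -expr2 exprVn sqr_sqrtr ?ltW//.
  by rewrite mulVf ?gt_eqF.
have cf : {within S, continuous (fun X => ip (T X) X)}.
  apply: continuous_subspaceT => X; apply: ip_continuous; last exact: cvg_id.
  exact: linear_continuous_fd.
have [v /[!inE] -[Wv v1] maxv] := compact_EVT_max S0 (@ip_sphere_compact W) cf.
pose l := ip (T v) v.
have maxq u : u \in W -> ip (T u) u <= l * ip u u.
  move=> Wu; have [->|u0] := eqVneq u 0; first by rewrite linear0 !ip0l mulr0.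
  have p0 := ip_gt0 u0; have s0 : 0 < Num.sqrt (ip u u) by rewrite sqrtr_gt0.
  pose k := (Num.sqrt (ip u u))^-1.
  have k2 : k ^+ 2 = (ip u u)^-1 by rewrite exprVn sqr_sqrtr// ltW.
  have : k *: u \in S.
    by rewrite inE; split; [exact: memvZ|rewrite ipZl ipZr mulrA -expr2 k2 mulVf ?gt_eqF].
  move/maxv; rewrite -/l linearZ ipZl ipZr mulrA -expr2 k2.
  by rewrite mulrC ler_pdivrMr.
exists v => //; split => //; exists l.
apply/eqP; rewrite -subr_eq0; apply/eqP; apply: ip_eq0.
pose w := T v - l *: v.
have Ww : w \in W.
  by rewrite memvB ?memvZ//; apply: (subvP TW); rewrite memv_img.
have wv : ip w v = 0 by rewrite ipDl ipNl ipZl v1 mulr1 subrr.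
have Tvw : ip (T v) w = ip w w.
  by rewrite [in RHS]/w ipDl ipNl ipZl (ipC v) wv mulr0 subr0.
rewrite -/w; move: w Ww wv Tvw => w Ww wv Tvw.
(* First variation of the Rayleigh quotient along v + t w. *)
have H t : 2 * t * ip w w <= t ^+ 2 * (l * ip w w - ip (T w) w).
  have := maxq (v + t *: w) (memvD Wv (memvZ t Ww)).
  have -> : T (v + t *: w) = T v + t *: T w by rewrite linearD linearZ.
  rewrite !(ipDl, ipDr, ipZl, ipZr) (Tsym w v) -/l Tvw (ipC w) Tvw.
  by rewrite v1 wv (ipC v) wv; nra.
have c0 := ip_ge0 w.
pose B := l * ip w w - ip (T w) w.
apply/eqP; rewrite eq_le c0 andbT leNgt; apply/negP => p0.
have B1 : 0 < `|B| + 1 by rewrite ltr_wpDl.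
have := H (ip w w / (`|B| + 1)); rewrite -/B.
have t0 : 0 < ip w w / (`|B| + 1) by rewrite divr_gt0.
set t := ip w w / _ in t0 *.
have tB : t * `|B| <= ip w w.
  by rewrite /t mulrAC ler_pdivrMr// ler_wpM2l// lerDl.
have := ler_norm B; nra.
Qed.

Lemma symmetric_eigenbasis W : (T @: W <= W)%VS -> exists es : seq (g * R),
  [/\ size es = \dim W, (forall p, p \in es -> [/\ p.1 \in W, ip p.1 p.1 = 1 & T p.1 = p.2 *: p.1]) &
     forall v, v \in W -> v = \sum_(p <- es) ip v p.1 *: p.1].
Proof.
have [n] := ubnP (\dim W); elim: n W => // n IH W Wn TW.
have [->|W0] := eqVneq W 0%VS.
  by exists [::]; split => //; [rewrite dimv0|move=> v; rewrite memv0 big_nil => /eqP].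
have [e We [e1 [l Te]]] := symmetric_eigenvector TW W0.
pose W' := (W :&: lker (ipf e))%VS.
have W'P v : v \in W' -> v \in W /\ ip e v = 0.
  by rewrite memv_cap memv_ker ipfE => /andP[-> /eqP].
have dW : \dim W = (\dim W').+1.
  rewrite -(limg_ker_dim (ipf e) W) -/W' -addn1; congr addn.
  apply/eqP; rewrite eqn_leq; apply/andP; split.
    apply: leq_trans (dimvS (subvf _)) _; by rewrite dimvf.
  rewrite lt0n dimv_eq0; apply/negP => /eqP E.
  have : ipf e e \in (ipf e @: W)%VS by rewrite memv_img.
  by rewrite E memv0 ipfE e1 oner_eq0.
have TW' : (T @: W' <= W')%VS.
  apply/subvP => _ /memv_imgP[v /W'P[Wv ev] ->].
  rewrite memv_cap memv_ker ipfE -Tsym Te ipZl ev mulr0 eqxx andbT.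
  by apply: (subvP TW); rewrite memv_img.
have [|es [ses esP esE]] := IH W' _ TW'; first by move: Wn; rewrite dW.
exists ((e, l) :: es); split.
- by rewrite /= ses dW.
- by move=> p; rewrite inE => /orP[/eqP ->//|/esP[/W'P[]]].
move=> v Wv; rewrite big_cons /=.
have vW' : v - ip v e *: e \in W'.
  rewrite memv_cap memvB ?memvZ//= memv_ker ipfE ipDr ipNr ipZr e1 mulr1.
  by rewrite ipC subrr.
rewrite -[LHS](subrK (ip v e *: e)) addrC; congr (_ + _).
rewrite [LHS](esE _ vW'); apply: eq_big_seq => p /esP[/W'P[_ ep] _ _].
by rewrite ipDl ipNl ipZl ep mulr0 subr0.
Qed.

(* Tight frames: the weights make normalisations by square roots unnecessary. *)
Definition frame W (es : seq (g * R)) :=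
  (forall p, p \in es -> p.1 \in W) /\
  forall v, v \in W -> v = \sum_(p <- es) (p.2 * ip v p.1) *: p.1.

(** Both sides are the trace of b relative to the inner product; expand the members of one frame in
    the other. *)
Lemma frame_trace W es fs (b : g -> g -> R) : frame W es -> frame W fs ->
  (forall X Y Z, b (X + Y) Z = b X Z + b Y Z) -> (forall k X Y, b (k *: X) Y = k * b X Y) ->
  (forall X Y Z, b Z (X + Y) = b Z X + b Z Y) -> (forall k X Y, b Y (k *: X) = k * b Y X) ->
  \sum_(p <- es) p.2 * b p.1 p.1 = \sum_(p <- fs) p.2 * b p.1 p.1.
Proof.
move=> [eW eE] [fW fE] bDl bZl bDr bZr.
have b0l Z : b 0 Z = 0 by rewrite -(scale0r (0 : g)) bZl mul0r.
have b0r Z : b Z 0 = 0 by rewrite -(scale0r (0 : g)) bZr mul0r.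
have bsl (r : seq (g * R)) F Z : b (\sum_(i <- r) F i) Z = \sum_(i <- r) b (F i) Z.
  by elim: r => [|i r IH]; rewrite ?big_nil ?b0l// !big_cons bDl IH.
have bsr (r : seq (g * R)) F Z : b Z (\sum_(i <- r) F i) = \sum_(i <- r) b Z (F i).
  by elim: r => [|i r IH]; rewrite ?big_nil ?b0r// !big_cons bDr IH.
transitivity (\sum_(p <- es) \sum_(q <- fs) p.2 * (q.2 * ip p.1 q.1 * b p.1 q.1)).
  apply: eq_big_seq => p /eW pW; rewrite {2}(fE _ pW) bsr mulr_sumr.
  by apply: eq_bigr => q _; rewrite bZr.
rewrite exchange_big; apply: eq_big_seq => q /fW qW /=.
have -> : b q.1 q.1 = b (\sum_(p <- es) (p.2 * ip q.1 p.1) *: p.1) q.1 by rewrite -(eE _ qW).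
rewrite bsl mulr_sumr.
by apply: eq_bigr => p _; rewrite bZl (ipC p.1); ring.
Qed.

Lemma frame_image W es (A : {linear g -> g}) (A' : g -> g) : frame W es ->
  (forall v, v \in W -> A v \in W) -> (forall v, v \in W -> A' v \in W) ->
  (forall v, A (A' v) = v) -> (forall u v, ip (A u) (A v) = ip u v) ->
  frame W [seq (A p.1, p.2) | p <- es].
Proof.
move=> [eW eE] AW A'W AK Aip; split.
  by move=> p /mapP[q /eW qW ->]; exact: AW.
move=> v vW; rewrite big_map /= -{1}(AK v) {1}(eE _ (A'W _ vW)) linear_sum.
apply: eq_bigr => p _; rewrite linearZ; congr (_ * _ *: _).
by rewrite -Aip AK.
Qed.

End SymmetricOperators.

(** * Root spaces, and frames adapted to them *)

Section RootSpaces.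
Variables (R : realType) (X : rankOneSpace R).
Local Notation g := (lie_alg X).
Local Notation br := (@bracket R X).
Local Notation th := (@cartan_inv R X).
Local Notation H := (H0 X).
Implicit Types (U V W Z E : g).

Let lieB : is_lie_bracket br := bracket_lie X.

HB.instance Definition _ U := GRing.isLinear.Build R g g *:%R (br U) (lie_linearr lieB U).

Lemma adE U V : ad br U V = br U V.
Proof. exact: (lfunE (br U)). Qed.

Definition ltr (f : 'End(g)) : R := \tr (passmx.mxof (vbasis {:g}) (vbasis {:g}) f).

Let bP : basis_of {:g} (vbasis {:g}) := vbasisP _.

Lemma ltrC f f' : ltr (f \o f')%VF = ltr (f' \o f)%VF.
Proof. by rewrite /ltr !(passmx.mxof_comp _ _ bP) mxtrace_mulC. Qed.

Lemma ltrP k f f' : ltr (k *: f + f') = k * ltr f + ltr f'.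
Proof. by rewrite /ltr passmx.mxof_linear mxtraceD mxtraceZ. Qed.

Lemma ltrD f f' : ltr (f + f') = ltr f + ltr f'.
Proof. by have := ltrP 1 f f'; rewrite scale1r mul1r. Qed.

Lemma ltrZ k f : ltr (k *: f) = k * ltr f.
Proof.
have l0 : ltr 0 = 0 by have := ltrP 1 0 0; rewrite scaler0 addr0 mul1r => h; lra.
by have := ltrP k f 0; rewrite l0 !addr0.
Qed.

Lemma ltrN f : ltr (- f) = - ltr f.
Proof. by rewrite -scaleN1r ltrZ mulN1r. Qed.

Lemma killingE U V : killing br U V = ltr (ad br U \o ad br V)%VF.
Proof. by []. Qed.

Lemma killingC U V : killing br U V = killing br V U.
Proof. by rewrite !killingE ltrC. Qed.

Lemma adD U V : ad br (U + V) = ad br U + ad br V.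
Proof. by apply/lfunP => Z; rewrite add_lfunE !adE (brDl lieB). Qed.

Lemma adZ k U : ad br (k *: U) = k *: ad br U.
Proof. by apply/lfunP => Z; rewrite scale_lfunE !adE (brZl lieB). Qed.

Lemma jacobi U V Z : br U (br V Z) = br (br U V) Z + br V (br U Z).
Proof.
have := lie_jacobi lieB U V Z; rewrite (brC lieB Z (br U V)) (brC lieB Z U) (brNr lieB).
move/eqP; rewrite -addrA -opprD subr_eq0 => /eqP ->.
by rewrite addrC.
Qed.

Lemma ad_br U V : ad br (br U V) = (ad br U \o ad br V)%VF - (ad br V \o ad br U)%VF.
Proof.
apply/lfunP => Z; rewrite add_lfunE opp_lfunE !comp_lfunE !adE jacobi.
by rewrite addrK.
Qed.

Lemma killing_br U V Z : killing br (br U V) Z = killing br U (br V Z).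
Proof.
rewrite !killingE !ad_br comp_lfunDl comp_lfunDr comp_lfunNl comp_lfunNr !ltrD !ltrN.
rewrite -!comp_lfunA; congr (_ - _).
by rewrite ltrC -comp_lfunA.
Qed.

Let thP : is_cartan_involution br th := cartan_invP X.

Lemma thK U : th (th U) = U. Proof. by case: thP. Qed.
Lemma th_br U V : th (br U V) = br (th U) (th V). Proof. by case: thP. Qed.

Lemma killing_th U V : killing br (th U) (th V) = killing br U V.
Proof.
have E W : ad br (th W) = (th \o (ad br W \o th))%VF.
  by apply/lfunP => Z; rewrite !comp_lfunE !adE th_br thK.
rewrite !killingE !E.
have -> : ((th \o (ad br U \o th)) \o (th \o (ad br V \o th)) =
    th \o ((ad br U \o ad br V) \o th))%VF.
  by apply/lfunP => Z; rewrite !comp_lfunE thK.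
rewrite ltrC -comp_lfunA; congr ltr.
by apply/lfunP => Z; rewrite !comp_lfunE thK.
Qed.

Lemma leigP (f : 'End(g)) (a : R) U : (U \in passmx.leigenspace f a) = (f U == a *: U).
Proof. by rewrite memv_ker add_lfunE opp_lfunE scale_lfunE id_lfunE subr_eq0. Qed.

Lemma H_neq0 : H != 0.
Proof.
apply/eqP => H0; have := alpha_root X; rewrite /passmx.leigenvalue.
move/eqP; apply; apply/eqP; rewrite -subv0; apply/subvP => v.
rewrite leigP adE H0 (br0l lieB) scale1r => /eqP <-; exact: mem0v.
Qed.

Lemma flat_line : flat X = <[H]>%VS.
Proof.
apply/eqP; rewrite eq_sym eqEdim rank_one dim_vline H_neq0 andbT.
by rewrite -memvE H0_flat.
Qed.

Lemma thH : th H = - H.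
Proof.
have [[/subvP sub _] _] := flat_maximal X.
by have := sub _ (H0_flat X); rewrite leigP scaleN1r => /eqP.
Qed.

(** The Killing form twisted by theta is positive definite up to sign; the scaling gives [H0] norm
    1, as the metric demands. *)
Definition ip U V : R := - killing br U (th V) / killing br H H.

Lemma killingHN : killing br H (- H) = - killing br H H.
Proof. by rewrite !killingE -scaleN1r adZ -comp_lfunZr ltrZ mulN1r. Qed.

Lemma killingHH_gt0 : 0 < killing br H H.
Proof.
have [_ _ /(_ H H_neq0)] := thP; rewrite thH.
by rewrite killingHN oppr_lt0.
Qed.

Lemma ipC U V : ip U V = ip V U.
Proof. by rewrite /ip -{1}(thK U) killing_th killingC. Qed.

Lemma ipDl U V Z : ip (U + V) Z = ip U Z + ip V Z.
Proof. by rewrite /ip !killingE adD comp_lfunDl ltrD opprD mulrDl. Qed.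

Lemma ipZl k U V : ip (k *: U) V = k * ip U V.
Proof. by rewrite /ip !killingE adZ -comp_lfunZl ltrZ -mulrN mulrA. Qed.

Lemma ip_gt0 U : U != 0 -> 0 < ip U U.
Proof.
by move=> U0; rewrite /ip divr_gt0 ?killingHH_gt0// oppr_gt0; case: thP => _ _; apply.
Qed.

(** Invariance of the Killing form. It makes [ad H] symmetric, and [ad] of any vector fixed by theta
    skew. *)
Lemma ip_br Z U V : ip (br Z U) V = - ip U (br (th Z) V).
Proof.
rewrite /ip (brC lieB Z) th_br thK.
have -> : killing br (- br U Z) (th V) = - killing br (br U Z) (th V).
  by rewrite !killingE -scaleN1r adZ -comp_lfunZl ltrZ mulN1r.
by rewrite killing_br opprK mulNr opprK.
Qed.

Lemma ip_th U V : ip (th U) (th V) = ip U V.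
Proof. by rewrite /ip killing_th. Qed.

Lemma ipHH : ip H H = 1.
Proof.
by rewrite /ip thH killingHN opprK divff// gt_eqF// killingHH_gt0.
Qed.

Let ipDr := ipDr ipC ipDl.
Let ipZr := ipZr ipC ipZl.
Let ipNl := ipNl ipZl.
Let ipNr := ipNr ipC ipZl.

Lemma adH_sym U V : ip (ad br H U) V = ip U (ad br H V).
Proof. by rewrite !adE ip_br thH (brNl lieB) ipNr opprK. Qed.

Lemma th_eig (b : R) E : br H E = b *: E -> br H (th E) = - b *: th E.
Proof.
move=> HE; have := congr1 th HE; rewrite th_br thH (brNl lieB) linearZ /= => /eqP.
by rewrite eqr_oppLR -scaleNr => /eqP.
Qed.

Lemma root_space_gt2 (b : R) V : 2 < b -> br H V = b *: V -> V = 0.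
Proof.
move=> b2 HV; apply/eqP; apply: contraT => V0.
have b0 : b != 0 by rewrite gt_eqF//; lra.
have : passmx.leigenvalue (ad br H) b.
  rewrite /passmx.leigenvalue; apply/negP => /eqP E.
  have : V \in passmx.leigenspace (ad br H) b by rewrite leigP adE HV.
  by rewrite E memv0 (negbTE V0).
move/(restricted_roots b0); rewrite !inE => /or4P[] /eqP bE; exfalso; lra.
Qed.

Lemma eigen_br (a b : R) U V : br H U = a *: U -> br H V = b *: V ->
  br H (br U V) = (a + b) *: br U V.
Proof.
by move=> HU HV; rewrite jacobi HU HV (brZl lieB) (brZr lieB) scalerDl.
Qed.

(* The centraliser of H in the (-1)-eigenspace of the Cartan involution is the line through H, by maximality of the flat. *)
Lemma centraliser_H U : br H U = 0 -> th U = - U -> U = ip U H *: H.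
Proof.
move=> HU tU.
have [[fl ab] mx] := flat_maximal X.
have : U \in flat X.
  have <- : (flat X + <[U]>)%VS = flat X.
    apply: mx; last exact: addvSl.
    split.
      apply/subvP => _ /memv_addP[u uf [_ /vlineP[k ->] ->]].
      apply: memvD; first exact: (subvP fl).
      by apply: memvZ; rewrite leigP tU scaleN1r.
    move=> u v /memv_addP[u1 u1f [_ /vlineP[k ->] ->]] /memv_addP[v1 v1f [_ /vlineP[k' ->] ->]].
    move: u1f v1f; rewrite flat_line => /vlineP[a ->] /vlineP[b ->].
    rewrite !(brDl lieB, brDr lieB, brZl lieB, brZr lieB) !(brxx lieB) HU (brC lieB U) HU.
    by rewrite oppr0 !scaler0 !addr0.
  by apply: (subvP (addvSr _ _)); rewrite memv_line.
by rewrite flat_line => /vlineP[k ->]; rewrite ipZl ipHH mulr1.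
Qed.

(** [E, theta E] commutes with H and is sent to its opposite by theta, so it is a multiple of H,
    determined by pairing with H. *)
Lemma br_th (b : R) E : br H E = b *: E -> br E (th E) = - (b * ip E E) *: H.
Proof.
move=> HE; have HtE := th_eig HE.
have c : br H (br E (th E)) = 0 by rewrite (eigen_br HE HtE) subrr scale0r.
have t : th (br E (th E)) = - br E (th E) by rewrite th_br thK (brC lieB).
rewrite (centraliser_H c t); congr (_ *: _).
rewrite ip_br (brC lieB (th E)) HtE ipNr ipZr opprK ip_th.
by rewrite mulNr.
Qed.

Definition nn : {vspace g} := (root_space X 1 + root_space X 2)%VS.

Lemma eigen_orth (a b : R) U V : a != b -> br H U = a *: U -> br H V = b *: V -> ip U V = 0.
Proof.
move=> ab HU HV; have := adH_sym U V; rewrite !adE HU HV ipZl ipZr => /eqP.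
by rewrite -subr_eq0 -mulrBl mulf_eq0 subr_eq0 (negbTE ab) => /eqP.
Qed.

Lemma root_spaceP (a : R) U : reflect (br H U = a *: U) (U \in root_space X a).
Proof. by rewrite leigP adE; exact: eqP. Qed.

Lemma eigenbasis : exists es : seq (g * R),
  (forall p, p \in es -> [/\ ip p.1 p.1 = 1, br H p.1 = p.2 *: p.1 & p.2 \in [:: 0; 1; - 1; 2; - 2]]) /\
  forall v, v = \sum_(p <- es) ip v p.1 *: p.1.
Proof.
have [es [_ esP esE]] := symmetric_eigenbasis ipC ipDl ipZl ip_gt0 adH_sym (subvf (ad br H @: fullv)%VS).
exists es; split => [p pes|v]; last by apply: esE; exact: memvf.
have [_ p1] := esP p pes; rewrite adE => pE; split => //.
have [->|p20] := eqVneq p.2 0; first by rewrite inE eqxx.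
rewrite inE; apply/orP; right; apply: (@restricted_roots R X _ p20).
rewrite /passmx.leigenvalue; apply/negP => /eqP E.
have : p.1 \in passmx.leigenspace (ad br H) p.2 by rewrite leigP adE pE.
by rewrite E memv0 => /eqP p10; move: p1; rewrite p10 (@ip0l _ _ ip ipZl) => /esym/eqP; rewrite oner_eq0.
Qed.

(** Each vector is stored with its root, so that the last clause is 2 rho counted with
    multiplicities. *)
Lemma nbasis : exists es : seq (g * R), [/\
  (forall p, p \in es -> [/\ ip p.1 p.1 = 1, br H p.1 = p.2 *: p.1, p.1 \in nn & p.2 = 1 \/ p.2 = 2]),
  (forall v, v \in nn -> v = \sum_(p <- es) ip v p.1 *: p.1) &
  \sum_(p <- es) p.2 = 2 * rho X].
Proof.
have TW (a : R) : (ad br H @: root_space X a <= root_space X a)%VS.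
  apply/subvP => _ /memv_imgP[v /root_spaceP HV ->].
  by rewrite adE HV memvZ//; exact/root_spaceP.
have basis (a : R) : exists es : seq (g * R), [/\ size es = \dim (root_space X a),
  (forall p, p \in es -> [/\ ip p.1 p.1 = 1, br H p.1 = a *: p.1 & p.2 = a]) &
  forall v, v \in root_space X a -> v = \sum_(p <- es) ip v p.1 *: p.1].
  have [es [sz esP esE]] := symmetric_eigenbasis ipC ipDl ipZl ip_gt0 adH_sym (TW a).
  exists es; split => // p /esP[/root_spaceP pa p1]; rewrite adE => pE; split => //.
  apply/eqP; rewrite -subr_eq0; have := congr2 (fun u v => ip (u - v) p.1) pE pa.
  by rewrite subrr (ip0l ipZl) -scalerBl ipZl p1 mulr1 => /esym/eqP.
have [e1 [s1 e1P e1E]] := basis 1; have [e2 [s2 e2P e2E]] := basis 2.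
have n12 : (1 : R) != 2 by rewrite lt_eqF//; lra.
exists (e1 ++ e2); split.
- move=> p; rewrite mem_cat => /orP[/e1P|/e2P] [p1 pE p2].
    split; [by []|by rewrite p2| |by left].
    by apply: (subvP (addvSl _ _)); apply/root_spaceP.
  split; [by []|by rewrite p2| |by right].
  by apply: (subvP (addvSr _ _)); apply/root_spaceP.
- move=> v /memv_addP[v1 v1E [v2 v2E ->]]; rewrite big_cat /=; congr (_ + _).
    rewrite {1}(e1E _ v1E); apply: eq_big_seq => p /e1P[_ pE _].
    by rewrite ipDl (eigen_orth _ (root_spaceP _ _ v2E) pE) ?addr0// eq_sym.
  rewrite {1}(e2E _ v2E); apply: eq_big_seq => p /e2P[_ pE _].
  by rewrite ipDl (eigen_orth _ (root_spaceP _ _ v1E) pE) ?add0r.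
- rewrite big_cat /= /rho mulrC divfK ?pnatr_eq0//; congr (_ + _).
    rewrite (eq_big_seq (fun=> 1)); last by move=> p /e1P[].
    by rewrite big_const_seq count_predT s1 -[iter _ _ _]/(iter _ (+%R 1) 0) iter_addr_0.
  rewrite (eq_big_seq (fun=> 2)); last by move=> p /e2P[].
  by rewrite big_const_seq count_predT s2 iter_addr_0 mulr_natr.
Qed.

Lemma root_decomposition v : exists v0 n n', [/\ v = v0 + n + th n', br H v0 = 0, n \in nn & n' \in nn].
Proof.
have [es [esP esE]] := eigenbasis.
pose s (P : pred R) := \sum_(p <- es | P p.2) ip v p.1 *: p.1.
pose pos (x : R) := (x == 1) || (x == 2); pose neg (x : R) := (x == - 1) || (x == - 2).
have n12 : [/\ (1 : R) != 0, (2 : R) != 0, (- 1 : R) != 0 & (- 2 : R) != 0].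
  by split; rewrite ?oppr_eq0 ?pnatr_eq0 ?oner_eq0.
exists (s (fun x => x == 0)), (s pos), (th (s neg)); split.
- rewrite thK {1}(esE v) (bigID (fun p => p.2 == 0)) /= -addrA; congr (_ + _).
  rewrite (bigID (fun p => pos p.2)) /=; congr (_ + _).
    apply: eq_bigl => p; rewrite /pos; case: n12 => a b _ _.
    by have [->|] := eqVneq p.2 1; [rewrite a|have [->|] := eqVneq p.2 2; rewrite ?b ?andbF].
  rewrite [LHS]big_mkcond [RHS]big_mkcond; apply: eq_big_seq => p /esP[_ _]. 
  have h : [/\ (1 : R) == - 1 = false, (1 : R) == -2 = false, (2 : R) == -1 = false & (2 : R) == -2 = false].
    by split; apply/negP => /eqP; lra.
  case: n12 => a b c d; case: h => h1 h2 h3 h4; rewrite !inE /pos /neg => /or4P[/eqP ->|/eqP ->|/eqP ->|/orP[] /eqP ->].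
  + by rewrite eqxx ![0 == _]eq_sym (negbTE c) (negbTE d).
  + by rewrite eqxx andbF h1 h2.
  + by rewrite (negbTE c) eqxx ![- 1 == _]eq_sym h1 h3.
  + by rewrite eqxx orbT andbF h3 h4.
  + by rewrite (negbTE d) ![- 2 == _]eq_sym h2 h4 eqxx orbT.
- rewrite /s linear_sum /= big_seq_cond big1// => p /andP[/esP[_ pE _] /eqP p0].
  by rewrite (brZr lieB) pE p0 scale0r scaler0.
- rewrite /s big_seq_cond; apply: memv_suml => p /andP[/esP[_ pE _] /orP[] /eqP p2]; apply: memvZ.
    by apply: (subvP (addvSl _ _)); apply/root_spaceP; rewrite pE p2.
  by apply: (subvP (addvSr _ _)); apply/root_spaceP; rewrite pE p2.
- rewrite /s linear_sum big_seq_cond; apply: memv_suml => p /andP[/esP[_ pE _] /orP[] /eqP p2].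
    rewrite linearZ; apply: memvZ; apply: (subvP (addvSl _ _)); apply/root_spaceP.
    by have := th_eig pE; rewrite p2 opprK.
  rewrite linearZ; apply: memvZ; apply: (subvP (addvSr _ _)); apply/root_spaceP.
  by have := th_eig pE; rewrite p2 opprK.
Qed.

Lemma nn_orth_neg n n' : n \in nn -> n' \in nn -> ip n (th n') = 0.
Proof.
move=> /memv_addP[a /root_spaceP Ha [b /root_spaceP Hb ->]].
move=> /memv_addP[a' /root_spaceP Ha' [b' /root_spaceP Hb' ->]].
rewrite linearD /= ipDl !ipDr.
rewrite (eigen_orth _ Ha (th_eig Ha')) ?(eigen_orth _ Ha (th_eig Hb'));
  rewrite ?(eigen_orth _ Hb (th_eig Ha')) ?(eigen_orth _ Hb (th_eig Hb')) ?addr0//.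
all: by rewrite gt_eqF//; lra.
Qed.

Lemma nn_orth0 n v0 : n \in nn -> br H v0 = 0 -> ip n v0 = 0.
Proof.
move=> /memv_addP[a /root_spaceP Ha [b /root_spaceP Hb ->]] H0.
have {}H0 : br H v0 = 0 *: v0 by rewrite scale0r.
by rewrite ipDl (eigen_orth _ Ha H0) ?(eigen_orth _ Hb H0) ?addr0 ?pnatr_eq0 ?oner_eq0.
Qed.

(** theta n' = (n' + theta n') - n' lies in k + n, and the part commuting with H is a vector fixed
    by theta plus a multiple of H. *)
Lemma iwasawa_decomposition v : exists Y h n, [/\ v = Y + h *: H + n, th Y = Y & n \in nn].
Proof.
have [v0 [n [n' [-> H0 nN n'N]]]] := root_decomposition v.
pose Q := 2^-1 *: (v0 - th v0).
have Hq : br H (th v0) = 0.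
  have := @th_eig 0 v0; rewrite scale0r oppr0 scale0r; exact.
have QE : Q = ip Q H *: H.
  apply: centraliser_H; first by rewrite /Q (brZr lieB) (brDr lieB) (brNr lieB) H0 Hq subr0 scaler0.
  by rewrite /Q linearZ linearB /= thK -scalerN opprB.
exists (2^-1 *: (v0 + th v0) + (n' + th n')), (ip Q H), (n - n'); split.
- rewrite -QE /Q; vecf.
- by rewrite linearD linearZ !linearD /= !thK; vec.
- exact: memvB.
Qed.

Definition nbs : seq (g * R) := sval (cid nbasis).

Lemma nbsP p : p \in nbs ->
  [/\ ip p.1 p.1 = 1, br H p.1 = p.2 *: p.1, p.1 \in nn & p.2 = 1 \/ p.2 = 2].
Proof. by move=> ?; have [h _ _] := svalP (cid nbasis); exact: h. Qed.

Lemma nbsE v : v \in nn -> v = \sum_(p <- nbs) ip v p.1 *: p.1.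
Proof. by move=> ?; have [_ h _] := svalP (cid nbasis); exact: h. Qed.

Lemma nbs_sum : \sum_(p <- nbs) p.2 = 2 * rho X.
Proof. by have [_ _ h] := svalP (cid nbasis). Qed.

(** A frame of the (-1)-eigenspace of theta. For a unit root vector e, the vector e - theta e has
    squared norm 2, whence the weight 1/2. *)
Definition pframe : seq (g * R) := (H, 1 : R) :: [seq (p.1 - th p.1, 2^-1 : R) | p <- nbs].

Lemma pframeP : frame ip (passmx.leigenspace th (- 1)) pframe.
Proof.
split=> [p|v].
  rewrite inE => /orP[/eqP ->|/mapP[q _ ->]]; rewrite leigP scaleN1r /= ?thH//.
  by rewrite linearB /= thK opprB.
rewrite leigP scaleN1r => /eqP tv.
have [v0 [n [n' [vE Hv0 nN n'N]]]] := root_decomposition v.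
have Hq : br H (th v0) = 0.
  have := @th_eig 0 v0; rewrite scale0r oppr0 scale0r; exact.
pose Q := 2^-1 *: (v0 - th v0); pose M := n - n'.
have MN : M \in nn by exact: memvB.
have HQ : br H Q = 0 by rewrite /Q (brZr lieB) (brDr lieB) (brNr lieB) Hv0 Hq subr0 scaler0.
have QE : Q = ip Q H *: H.
  apply: centraliser_H => //.
  by rewrite /Q linearZ linearB /= thK -scalerN opprB.
have vE2 : v = Q + 2^-1 *: (M - th M).
  have : v = 2^-1 *: (v - th v) by rewrite tv; vecf.
  move=> ->; rewrite {1 2}vE !linearD linearN /= thK /Q /M; vec.
have tQ : th Q = - Q by rewrite /Q linearZ linearB /= thK -scalerN opprB.
have HH : br H H = 0 by rewrite (brxx lieB).
clearbody Q M.
have tHH : ip (th M) H = 0 by rewrite -(thK H) ip_th thH ipNr (nn_orth0 MN HH) oppr0.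
have vH : ip v H = ip Q H.
  by rewrite vE2 ipDl ipZl ipDl ipNl tHH (nn_orth0 MN HH) oppr0 addr0 mulr0 addr0.
rewrite /pframe big_cons big_map /= mul1r vH -QE {1}vE2; congr (_ + _).
have tME : th M = \sum_(p <- nbs) ip M p.1 *: th p.1.
  rewrite {1}(nbsE MN) linear_sum; apply: eq_bigr => p _; exact: linearZ.
rewrite {1}(nbsE MN) tME -sumrB scaler_sumr; apply: eq_big_seq => p /nbsP[p1 pH pN _].
rewrite -scalerBr scalerA; congr (_ * _ *: _).
rewrite vE2 ipDl ipZl !ipDr !ipNr !ipDl !ipNl.
rewrite ip_th (nn_orth_neg MN pN) (ipC (th M)) (nn_orth_neg pN MN).
rewrite (ipC Q) (nn_orth0 pN HQ) (ipC Q) -(thK Q) ip_th.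
by rewrite tQ ipNr (nn_orth0 pN HQ); field.
Qed.

(** Take the root 2 if it occurs and 1 otherwise: adding a positive root then leaves the set of
    roots, so brackets with n vanish. *)
Lemma top_root : exists X0 (q : R), [/\ q = 1 \/ q = 2, ip X0 X0 = 1, br H X0 = q *: X0, X0 \in nn &
  forall n, n \in nn -> br n X0 = 0].
Proof.
have vec_of (W : {vspace g}) : W != 0%VS -> exists2 v, v \in W & ip v v = 1.
  move=> W0; have p0 : 0 < ip (vpick W) (vpick W) by rewrite ip_gt0// vpick0.
  exists ((Num.sqrt (ip (vpick W) (vpick W)))^-1 *: vpick W).
    by apply: memvZ; exact: memv_pick.
  by rewrite ipZl ipZr mulrA -expr2 exprVn sqr_sqrtr ?ltW// mulVf ?gt_eqF.
have [z2|nz2] := eqVneq (root_space X 2) 0%VS; last first.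
  have [v v2 v1] := vec_of _ nz2; exists v, 2.
  have /root_spaceP Hv := v2; split => //; [by right|exact: (subvP (addvSr _ _))|].
  move=> _ /memv_addP[a /root_spaceP Ha [b /root_spaceP Hb ->]].
  rewrite (brDl lieB) (root_space_gt2 _ (eigen_br Ha Hv)) ?(root_space_gt2 _ (eigen_br Hb Hv)) ?addr0//; lra.
have nz1 : root_space X 1 != 0%VS by exact: alpha_root X.
have [v v2 v1] := vec_of _ nz1; exists v, 1.
have /root_spaceP Hv := v2; split => //; [by left|exact: (subvP (addvSl _ _))|].
move=> _ /memv_addP[a /root_spaceP Ha [b /root_spaceP Hb ->]].
rewrite (brDl lieB) (root_space_gt2 _ (eigen_br Hb Hv)) ?addr0//; last lra.
have : br a v \in root_space X 2 by apply/root_spaceP; exact: eigen_br.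
by rewrite z2 memv0 => /eqP.
Qed.

Definition X0 : g := sval (cid top_root).
Definition q0 : R := sval (cid (svalP (cid top_root))).

Lemma X0P : [/\ q0 = 1 \/ q0 = 2, ip X0 X0 = 1, br H X0 = q0 *: X0, X0 \in nn &
  forall n, n \in nn -> br n X0 = 0].
Proof. exact: svalP (cid (svalP (cid top_root))). Qed.

Lemma q0_gt0 : 0 < q0. Proof. by have [[]->]:= X0P. Qed.

Lemma ip_br_X0 P : ip (br P X0) X0 = q0 * ip P H.
Proof.
have [_ X1 HX _ _] := X0P.
rewrite (brC lieB P) ipNl ip_br opprK (brC lieB) (br_th HX) X1 mulr1 ipC.
by rewrite scaleNr opprK ipZl ipC.
Qed.

(* Only the negative root vector theta e of e - theta e moves the highest root vector, by an amount read off [e, theta e] = - beta H. *)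
Lemma casimir_X0 : \sum_(p <- pframe) p.2 * ip (br p.1 X0) (br p.1 X0) = q0 ^+ 2 + q0 * rho X.
Proof.
have [_ X1 HX XN nX] := X0P.
rewrite /pframe big_cons /= HX !(ipZl, ipZr) X1 mul1r mulr1 -expr2; congr (_ + _).
rewrite big_map /=.
have -> : q0 * rho X = \sum_(p <- nbs) q0 / 2 * p.2.
  by rewrite -mulr_sumr nbs_sum; field.
apply: eq_big_seq => p /nbsP[p1 pH pN _].
rewrite (brDl lieB) (brNl lieB) (nX _ pN) add0r ipNl ipNr opprK ip_br thK.
rewrite jacobi (nX _ pN) (br0r lieB) addr0 (br_th pH) p1 mulr1 (brZl lieB) HX.
by rewrite !ipZr X1; field.
Qed.

Lemma br_ZY p : p \in nbs -> br (p.1 - th p.1) (p.1 + th p.1) = - (2 * p.2) *: H.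
Proof.
move=> /nbsP[p1 pH _ _].
rewrite (brDl lieB) !(brDr lieB) !(brNl lieB) !(brxx lieB) (brC lieB (th _)) (br_th pH) p1; vec.
Qed.

Lemma nn_br n n' : n \in nn -> n' \in nn -> br n n' \in root_space X 2.
Proof.
move=> /memv_addP[a /root_spaceP Ha [b /root_spaceP Hb ->]].
move=> /memv_addP[a' /root_spaceP Ha' [b' /root_spaceP Hb' ->]].
rewrite (brDl lieB) !(brDr lieB).
have -> : br b a' = 0 by apply: root_space_gt2 (eigen_br Hb Ha'); lra.
have -> : br b b' = 0 by apply: root_space_gt2 (eigen_br Hb Hb'); lra.
have -> : br a b' = 0 by apply: root_space_gt2 (eigen_br Ha Hb'); lra.
rewrite !addr0.
by apply/root_spaceP; exact: eigen_br.
Qed.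

Lemma nn_br2 n z : n \in nn -> z \in root_space X 2 -> br n z = 0.
Proof.
move=> /memv_addP[a /root_spaceP Ha [b /root_spaceP Hb ->]] /root_spaceP Hz.
rewrite (brDl lieB); have -> : br a z = 0 by apply: root_space_gt2 (eigen_br Ha Hz); lra.
by rewrite add0r; apply: root_space_gt2 (eigen_br Hb Hz); lra.
Qed.

(** For n = a + b with roots 1 and 2, [H, n] = n + b, where b commutes with n and is orthogonal to
    a. This serves to bound n by means of Ad(exp n) H. *)
Lemma nn_adH n : n \in nn -> [/\ br H n \in nn, br n (br H n) = 0 & ip n n <= ip (br H n) (br H n)].
Proof.
move=> nN; have /memv_addP[a aE [b bE nE]] := nN.
have /root_spaceP Ha := aE; have /root_spaceP Hb := bE.
have HnE : br H n = n + b by rewrite nE (brDr lieB) Ha Hb; vec.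
have bN : b \in nn by apply: (subvP (addvSr _ _)).
have ab : ip a b = 0 by rewrite (eigen_orth _ Ha Hb)// lt_eqF//; lra.
split; first by rewrite HnE memvD.
  by rewrite HnE (brDr lieB) (brxx lieB) (nn_br2 nN bE) addr0.
rewrite HnE nE !(ipDl, ipDr) ab (ipC b a) ab.
have := ip_ge0 ipZl ip_gt0 b; lra.
Qed.

End RootSpaces.

Lemma local_min_derive (R : realType) (f : R -> R) l : is_derive (0 : R) 1 f l ->
  (\forall s \near (0 : R), f 0 <= f s) -> l = 0.
Proof.
move=> /is_derive_cvgP df /nbhs_ballP[d /= d0 dP].
apply/eqP; rewrite -normr_le0 leNgt; apply/negP => l0.
move/cvgrPdist_lt : df => /(_ _ l0) /nbhs_ballP[e /= e0 eP].
pose h := Num.min d e / 2; have de : 0 < Num.min d e by rewrite lt_min d0.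
have h0 : 0 < h by rewrite divr_gt0.
have hd : h < d by have : Num.min d e <= d by [rewrite ge_min lexx]; rewrite /h; lra.
have he : h < e by have : Num.min d e <= e by [rewrite ge_min lexx orbT]; rewrite /h; lra.
have bh (x : R) k : 0 < k -> `|x| < k -> ball (0 : R) k x by move=> ? ?; rewrite -ball_normE /= sub0r normrN.
have := eP h; rewrite /= => /(_ (bh _ _ e0 _)); rewrite gtr0_norm// gt_eqF// => /(_ he isT).
have := eP (- h); rewrite /= => /(_ (bh _ _ e0 _)); rewrite normrN gtr0_norm// oppr_eq0 gt_eqF// => /(_ he isT).
have := dP h (bh _ _ d0 _); rewrite gtr0_norm// => /(_ hd).
have := dP (- h) (bh _ _ d0 _); rewrite normrN gtr0_norm// => /(_ hd) /=.
rewrite /GRing.scale /= !mulr1 !addr0 invrN => fm fp.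
have hi : 0 < h^-1 by rewrite invr_gt0.
have q1 : 0 <= h^-1 * (f h - f 0) by rewrite mulr_ge0 ?subr_ge0// ltW.
have q2 : - h^-1 * (f (- h) - f 0) <= 0 by rewrite mulNr oppr_le0 mulr_ge0 ?subr_ge0// ltW.
case: (lerP 0 l) => l1.
  by rewrite [X in _ < X -> _ -> _]ger0_norm// ltr_norml => /andP[_ +] _; lra.
by rewrite [X in _ < X -> _]ltr0_norm// => _; rewrite [X in _ < X -> _]ltr0_norm// ltr_norml => /andP[+ _]; lra.
Qed.

(** * The maximal compact subgroup *)

Section Adjoint.
Variables (R : realType) (X : rankOneSpace R).
Local Notation g := (lie_alg X).
Local Notation br := (@bracket R X).
Local Notation th := (@cartan_inv R X).
Local Notation ex := (@lie_exp R X).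
Local Notation H := (H0 X).
Implicit Types (U V W Y Z E : g) (x y : X).

Let lieB : is_lie_bracket br := bracket_lie X.
Let lieE : is_lie_exp br ex := lie_expP X.
Let cG : connected [set: X] := @Defs.group_connected R X.

Lemma ip_addr U V Z : ip U (V + Z) = ip U V + ip U Z.
Proof. exact: (ipDr (@ipC R X) (@ipDl R X)). Qed.
Lemma ip_scaler k U V : ip U (k *: V) = k * ip U V.
Proof. exact: (ipZr (@ipC R X) (@ipZl R X)). Qed.
Lemma ip_oppl U V : ip (- U) V = - ip U V. Proof. exact: (ipNl (@ipZl R X)). Qed.
Lemma ip_oppr U V : ip U (- V) = - ip U V.
Proof. exact: (ipNr (@ipC R X) (@ipZl R X)). Qed.
Lemma ip_zerol U : ip 0 U = 0. Proof. exact: (ip0l (@ipZl R X)). Qed.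
Lemma ip_zeror U : ip U 0 = 0. Proof. exact: (ip0r (@ipC R X) (@ipZl R X)). Qed.
Lemma ip_self_ge0 U : 0 <= ip U U. Proof. exact: (ip_ge0 (@ipZl R X) (@ip_gt0 R X)). Qed.
Lemma ip_self_eq0 U : ip U U = 0 -> U = 0. Proof. exact: (ip_eq0 (@ip_gt0 R X)). Qed.
Lemma ip_cvg (T : Type) (F : set_system T) {FF : Filter F} (u v : T -> g) U V :
  u @ F --> U -> v @ F --> V -> (fun t => ip (u t) (v t)) @ F --> ip U V.
Proof. exact: (ip_continuous (@ipC R X) (@ipDl R X) (@ipZl R X)). Qed.

Definition Adj x : g -> g := Ad ex x.

HB.instance Definition _ x := GRing.isLinear.Build R g g *:%R (Adj x) (Ad_is_linear lieE cG x).

Lemma AdjM x y Z : Adj (x * y)%g Z = Adj x (Adj y Z). Proof. exact: (AdM lieE cG). Qed.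
Lemma Adj1 Z : Adj 1%g Z = Z. Proof. exact: (Ad1 lieE). Qed.
Lemma AdjVK x Z : Adj x^-1%g (Adj x Z) = Z. Proof. exact: (AdVK lieE cG). Qed.
Lemma AdjKV x Z : Adj x (Adj x^-1%g Z) = Z. Proof. exact: (AdKV lieE cG). Qed.
Lemma Adj_lex x Z : (x * ex Z * x^-1)%g = ex (Adj x Z). Proof. exact: (Ad_lex lieE cG). Qed.
Lemma Adj_continuous Z : continuous (Adj ^~ Z). Proof. exact: (Ad_continuous lieE cG). Qed.
Lemma is_derive_Adj Z V (t : R) :
  is_derive t 1 (fun t => Adj (ex (t *: Z)) V) (br Z (Adj (ex (t *: Z)) V)).
Proof. by have [] := is_derive_AdE lieE cG Z V t. Qed.

Lemma is_derive_ip (u v : R -> g) (t : R) u' v' : is_derive t 1 u u' -> is_derive t 1 v v' ->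
  is_derive t 1 (fun s => ip (u s) (v s)) (ip u' (v t) + ip (u t) v').
Proof.
move=> du dv.
have cu : (fun h : R => u (h + t)) @ 0^' --> u t.
  have /derivable1_diffP/differentiable_continuous cu := @ex_derive _ _ _ _ _ _ _ du.
  apply: (@cvg_comp _ _ _ (fun h : R => h + t) u _ (nbhs t)); last exact: cu.
  apply: cvg_within_filter; by have : (fun h : R => h + t) @ (0 : R) --> 0 + t; [apply: cvgD; [exact: cvg_id|exact: cvg_cst]|rewrite add0r].
move: du dv => /is_derive_cvgP du /is_derive_cvgP dv.
apply/is_derive_cvgP.
have E h : h^-1 *: (ip (u (h *: 1 + t)) (v (h *: 1 + t)) - ip (u t) (v t)) =
  ip (h^-1 *: (u (h *: 1 + t) - u t)) (v t) + ip (u (h + t)) (h^-1 *: (v (h *: 1 + t) - v t)).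
  rewrite [h *: 1]mulr1 ipZl ip_scaler ipDl ip_addr ip_oppl ip_oppr.
  by rewrite /GRing.scale /=; ring.
under eq_cvg do rewrite E.
by apply: cvgD; apply: ip_cvg => //; exact: cvg_cst.
Qed.

(** Uniqueness for v' = [Z, v]: the curve Ad(exp(-sZ)) v(s) has derivative 0, computed in
    coordinates as a sum of products. *)
Lemma Adj_ode Z (v : R -> g) : (forall t : R, is_derive t 1 v (br Z (v t))) ->
  forall t, v t = Adj (ex (t *: Z)) (v 0).
Proof.
move=> dv t.
pose w (s : R) := Adj (ex (- s *: Z)) (v s).
suff wE : w t = w 0.
  by rewrite -[LHS](AdjKV (ex (t *: Z))) -(lexN lieE) -scaleNr -/(w t) wE /w oppr0 scale0r (lie_exp0 lieE) Adj1.
apply: is_derive0_cst => s; apply: is_derive_crd => i.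
pose a j (r : R) := crd j (v r); pose b j (r : R) := crd i (Adj (ex (- r *: Z)) (bas j)).
have -> : (fun y : R => crd i (w y)) = \sum_j (a j * b j).
  apply/funext => r; rewrite /w {1}(crdE (v r)) linear_sum crdS fct_sumE.
  by apply: eq_bigr => j _; rewrite linearZ crdZ.
have da j : is_derive s 1 (a j) (crd j (br Z (v s))).
  exact: (is_derive_lin (L := crd j) (@linear_continuous_fd _ g R (crd j)) (dv s)).
have db j : is_derive s 1 (b j) (- crd i (br Z (Adj (ex (- s *: Z)) (bas j)))).
  have dN : is_derive s 1 (fun r : R => - r) (- 1 : R) by apply: is_deriveN.
  have dA := is_derive_lin (L := crd i) (@linear_continuous_fd _ g R (crd i)) (is_derive_Adj Z (bas j) (- s)).
  have := @is_derive1_comp _ (fun r : R => crd i (Adj (ex (r *: Z)) (bas j))) (fun r : R => - r) s _ _ dA dN.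
  by move=> h; apply: (is_derive_eq h); rewrite mulrN1.
apply: (is_derive_eq (is_derive_sum (fun j => is_deriveM (da j) (db j)))).
have -> : (crd i 0 : R) = crd i (Adj (ex (- s *: Z)) (br Z (v s)) - br Z (Adj (ex (- s *: Z)) (v s))).
  have := Ad_bracket lieE cG Z (v s) (- s); rewrite -/(Adj _ _) -/(Adj _ _) => ->.
  by rewrite subrr.
have -> : Adj (ex (- s *: Z)) (br Z (v s)) =
    \sum_j crd j (br Z (v s)) *: Adj (ex (- s *: Z)) (bas j).
  by rewrite {1}(crdE (br Z (v s))) linear_sum; apply: eq_bigr => j _; rewrite linearZ.
have -> : br Z (Adj (ex (- s *: Z)) (v s)) =
    \sum_j crd j (v s) *: br Z (Adj (ex (- s *: Z)) (bas j)).
  rewrite {1}(crdE (v s)) !linear_sum; apply: eq_bigr => j _.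
  by rewrite linearZ /= (brZr lieB).
rewrite crdD crdN !crdS -sumrB.
by apply: eq_bigr => j _; rewrite !crdZ /a /b /GRing.scale /=; ring.
Qed.

(** x commutes with all exponentials, and these generate the connected group. *)
Lemma lie_commute_ext x : (forall V, Adj x V = V) -> forall y, (x * y = y * x)%g.
Proof.
move=> AxV; apply: (connected_generated cG (H := [set y | (x * y = y * x)%g])) => /=.
- by rewrite mulg1 mul1g.
- by move=> y z yE zE; rewrite mulgA yE -mulgA zE mulgA.
- by move=> y yE; rewrite -[LHS](mulKg y) (mulgA y) -yE mulgK.
- apply: filterS (nbhs_lex lieE ltr01) => _ [Z _ <-] /=.
  by have := congr1 (fun z => z * x)%g (Adj_lex x Z); rewrite AxV mulgVK.
Qed.

Lemma th_continuous : continuous th.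
Proof. exact: linear_continuous_fd. Qed.

(** Both sides solve v' = [theta Z, v]. This stands in for an involution of the group, which is not
    constructed. *)
Lemma Adj_th Z V : Adj (ex (th Z)) (th V) = th (Adj (ex Z) V).
Proof.
pose v (s : R) := th (Adj (ex (s *: Z)) V).
have dv (t : R) : is_derive t 1 v (br (th Z) (v t)).
  rewrite /v -th_br; apply: (is_derive_lin (L := th) th_continuous).
  exact: is_derive_Adj.
by have := Adj_ode dv 1; rewrite /v !scale1r scale0r (lie_exp0 lieE) Adj1 => ->.
Qed.

(** exp(Z) exp(-theta Z) acts trivially under Ad, hence is central. The centre is finite, so for
    small Z this element is 1, and exp is injective near 0. *)
Lemma small_fixed_by_theta : exists2 d : R, 0 < d & forall Z, `|Z| < d ->
  (forall V, Adj (ex Z) (th V) = th (Adj (ex Z) V)) -> th Z = Z.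
Proof.
have [r [L rL]] := lie_radius_exists lieE; have r0 := lr_gt0 rL.
pose C := [set z : X | (forall x, (z * x = x * z)%g) /\ z != 1%g].
have cC : closed C.
  apply: (accessible_finite_set_closed.1 (hausdorff_accessible (@group_hausdorff R X))).
  by apply: sub_finite_set (finite_center X) => z [].
pose f Z := (ex Z * ex (- th Z))%g.
have cf : f @ (0 : g) --> 1%g.
  rewrite -[1%g]mulg1; apply: mulg_cvg.
    by have := @lex_continuous _ _ _ _ _ lieE 0; rewrite /continuous_at (lie_exp0 lieE).
  have -> : (1 : X)%g = ex (- th 0) by rewrite linear0 oppr0 (lie_exp0 lieE).
  apply: (@cvg_comp _ _ _ (fun Z => - th Z) ex _ (nbhs (- th 0))); last exact: (lex_continuous lieE).
  by apply: cvgN; exact: th_continuous.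
have nC : nbhs 1%g (~` C).
  apply: open_nbhs_nbhs; split; first exact: closed_openC.
  by move=> [_ /eqP].
have /nbhs_ballP[e /= e0 eP] := cf _ nC.
have [Ct Ct0 CtP] := linear_bounded th.
have K0 : 0 < 1 + Ct by rewrite addr_gt0.
exists (Num.min e (r / (1 + Ct))); first by rewrite lt_min e0 divr_gt0.
move=> Z; rewrite lt_min => /andP[Ze]; rewrite ltr_pdivlMr// => Zr AZ.
have Zr1 : `|Z| < r by have := normr_ge0 Z; nra.
have tZr : `|th Z| < r by have := CtP Z; have := normr_ge0 Z; nra.
have : ~ C (f Z) by apply: (eP Z); rewrite -ball_normE /= sub0r normrN.
have fC : forall x, (f Z * x = x * f Z)%g.
  apply: lie_commute_ext => V; rewrite /f AdjM (lexN lieE).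
  have E W : Adj (ex Z) W = Adj (ex (th Z)) W.
    by have := Adj_th Z (th W); rewrite thK AZ thK.
  by rewrite E AdjKV.
have [f1 _|f1] := eqVneq (f Z) 1%g; last by move=> h; exfalso; apply: h.
apply/esym/(lr_inj rL) => //.
by move/(congr1 (fun z => z * ex (th Z))%g): f1; rewrite /f (lexN lieE) mulgVK mul1g.
Qed.

Lemma maxK_theta k V : maxK k -> Adj k (th V) = th (Adj k V).
Proof. by move=> [Y /=]; rewrite leigP scale1r => /eqP tY <-; rewrite -Adj_th tY. Qed.

Lemma maxK_ip k U V : maxK k -> ip (Adj k U) (Adj k V) = ip U V.
Proof.
move=> [Y /=]; rewrite leigP scale1r => /eqP tY <-.
pose f (s : R) := ip (Adj (ex (s *: Y)) U) (Adj (ex (s *: Y)) V).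
have -> : ip (Adj (ex Y) U) (Adj (ex Y) V) = f 1 by rewrite /f scale1r.
have -> : ip U V = f 0 by rewrite /f scale0r (lie_exp0 lieE) !Adj1.
apply: is_derive_0_is_cst => s.
apply: (is_derive_eq (is_derive_ip (is_derive_Adj Y U s) (is_derive_Adj Y V s))).
by rewrite ip_br tY addrC subrr.
Qed.

Lemma maxK1 : maxK (1%g : X).
Proof. by exists 0 => /=; [exact: mem0v|exact: (lie_exp0 lieE)]. Qed.

Lemma maxKV (k : X) : maxK k -> maxK k^-1%g.
Proof. by move=> [Y /= Yk <-]; exists (- Y) => /=; [rewrite memvN|exact: (lexN lieE)]. Qed.

Lemma Adj_ip_adjoint k U V : maxK k -> ip (Adj k U) V = ip U (Adj k^-1%g V).
Proof. by move=> kK; rewrite -(maxK_ip _ _ (maxKV kK)) AdjVK. Qed.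

Lemma riesz (z : g -> R) : (forall U V, z (U + V) = z U + z V) ->
  (forall k U, z (k *: U) = k * z U) -> exists Z, forall V, z V = ip Z V.
Proof.
move=> zD zZ; have [es [_ esE]] := eigenbasis X.
have z0 : z 0 = 0 by rewrite -(scale0r (0 : g)) zZ mul0r.
exists (\sum_(p <- es) z p.1 *: p.1) => V; rewrite {1}(esE V).
elim: es {esE} => [|p es IH]; first by rewrite !big_nil z0 ip_zerol.
by rewrite !big_cons zD zZ ipDl ipZl IH mulrC (ipC V).
Qed.

Local Notation lmul := (lmul lieE).

Section Gauss.
Variables (r L : R).
Hypothesis rL : lie_radius lieE r L.
Let r0 : 0 < r := lr_gt0 rL.

Lemma openB : open [set p : g * g | `|p| < r].
Proof.
rewrite (_ : [set p : g * g | _] = ball 0 r); first exact: ball_open.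
by apply/seteqP; split => p; rewrite -ball_normE /= sub0r normrN.
Qed.

Lemma pair0_small Y : `|Y| < r -> [set p : g * g | `|p| < r] (Y, 0).
Proof. by move=> Yr /=; rewrite prod_normE /= normr0 gt_max Yr. Qed.

Lemma is_derive_lmul_line Y W : `|Y| < r ->
  is_derive (0 : R) 1 (fun s : R => lmul (Y, s *: W)) ('D_(0, W) lmul (Y, 0)).
Proof.
move=> Yr.
have d := Ck_on_is_derive (0, W) (lr_smooth rL 1%N) (pair0_small Yr).
have E : 0 *: ((0, W) : g * g) + (Y, 0) = (Y, 0) by rewrite scale0r add0r.
rewrite -[in X in is_derive X _ _ _]E in d.
apply: (is_derive_eq _ erefl).
have -> : (fun s : R => lmul (Y, s *: W)) = fun s => lmul (s *: ((0, W) : g * g) + (Y, 0)).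
  by apply/funext => s; rewrite pairZ scaler0; congr (lmul (_, _)); rewrite ?add0r ?addr0.
exact: (is_derive_line d).
Qed.

Lemma lmul_near Y W : `|Y| < r -> (fun s : R => lmul (Y, s *: W)) @ (0 : R) --> Y.
Proof.
move=> Yr; have := @is_derive_lmul_line Y W Yr => d.
have /derivable1_diffP/differentiable_continuous := @ex_derive _ _ _ _ _ _ _ d.
by rewrite /prop_for /continuous_at /= scale0r (lr_m0 rL).
Qed.

Lemma near_lt (Y : g) (u : R -> g) : u @ (0 : R) --> Y -> `|Y| < r -> \forall s \near (0 : R), `|u s| < r.
Proof.
move=> uY Yr; have : (fun s => `|u s|) @ (0 : R) --> `|Y| by apply: cvg_norm.
by move/cvgr_lt; apply.
Qed.

Lemma near_scale_lt W : \forall s \near (0 : R), `|s *: W| < r.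
Proof. exact: near_small. Qed.

(* Because exp Y exp (sV) = exp (Y + sV). *)
Lemma derive_lmul_commuting Y V : `|Y| < r -> br Y V = 0 -> 'D_(0, V) lmul (Y, 0) = V.
Proof.
move=> Yr YV.
have c : (fun s : R => Y + s *: V) @ (0 : R) --> Y.
  rewrite -[X in _ --> X]addr0 -[X in _ --> _ + X](scale0r V).
  by apply: cvgD; [exact: cvg_cst|apply: cvgZr_tmp; exact: cvg_id].
apply: (is_derive_uniq (is_derive_lmul_line V Yr)).
have dY : is_derive (0 : R) 1 (fun s : R => Y + s *: V) V.
  have /is_derive_cvgP d := is_derive_line_id V 0; apply/is_derive_cvgP.
  by under eq_cvg do rewrite opprD addrACA subrr add0r.
apply/is_derive_cvgP; move/is_derive_cvgP : dY => dY.
apply: cvg_trans dY; apply: near_eq_cvg.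
have := near_lt (lmul_near V Yr) Yr; have := near_lt c Yr; have := near_scale_lt V.
move=> /nbhs_dnbhs A1 /nbhs_dnbhs A2 /nbhs_dnbhs A3.
near=> h; rewrite /= !addr0 scale0r addr0 (lr_m0 rL)//; congr (_ *: (_ - _)).
rewrite [h%:A]mulr1; apply: (lr_inj rL); [by near: h|by near: h|].
rewrite (lr_mul rL)//; last by near: h.
by rewrite (lexDc lieE cG)// (brZr lieB) YV scaler0.
Unshelve. all: by end_near. Qed.

(** Conjugation by x fixes exp Y and carries exp(Y) exp(sW) to exp(Y) exp(s Ad x W). *)
Lemma derive_lmul_equivariant x Y W : `|Y| < r -> Adj x Y = Y ->
  'D_(0, Adj x W) lmul (Y, 0) = Adj x ('D_(0, W) lmul (Y, 0)).
Proof.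
move=> Yr xY.
apply: (is_derive_uniq (is_derive_lmul_line (Adj x W) Yr)).
have dx := is_derive_lin (L := Adj x) (@linear_continuous_fd _ g g (Adj x)) (is_derive_lmul_line W Yr).
apply/is_derive_cvgP; move/is_derive_cvgP : dx => dx.
apply: cvg_trans dx; apply: near_eq_cvg.
have cA : (fun s : R => Adj x (lmul (Y, s *: W))) @ (0 : R) --> Y.
  rewrite -[X in _ --> X]xY.
  apply: (@cvg_comp _ _ _ (fun s : R => lmul (Y, s *: W)) (Adj x)); first exact: lmul_near.
  exact: (@linear_continuous_fd _ g g (Adj x)).
have := near_lt (lmul_near (Adj x W) Yr) Yr; have := near_lt cA Yr.
have := near_scale_lt W; have := near_scale_lt (Adj x W).
move=> /nbhs_dnbhs A1 /nbhs_dnbhs A2 /nbhs_dnbhs A3 /nbhs_dnbhs A4.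
near=> h; rewrite /= !addr0 !scale0r (lr_m0 rL)// xY; congr (_ *: (_ - _)).
rewrite [h%:A]mulr1; apply: (lr_inj rL); [by near: h|by near: h|].
rewrite -Adj_lex !(lr_mul rL)//; [|by near: h|by near: h].
rewrite -[in RHS]linearZ /= -{2}xY -!Adj_lex.
by rewrite !mulgA mulgVK.
Unshelve. all: by end_near. Qed.

(* Gauss lemma. The gradient Z0 of W |-> <Y, L_Y W> is fixed by exp(RY), hence L_Y Z0 = Z0, which forces |Z0 - Y| = 0. *)
Lemma gauss Y W : th Y = Y -> `|Y| < r -> ip Y ('D_(0, W) lmul (Y, 0)) = ip Y W.
Proof.
move=> tY Yr; pose D V := 'D_((0, V) : g * g) lmul (Y, 0).
have C1 := lr_smooth rL 1%N; have Y0 := pair0_small Yr.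
have [] := @riesz (fun V => ip Y (D V)).
- move=> U V; rewrite -ip_addr /D -(C1_deriveD openB _ _ C1 Y0).
  by congr (ip _ ('D_ _ _ _)); congr pair; rewrite /= addr0.
- by move=> k U; rewrite -ip_scaler /D -(C1_deriveZ _ _ C1 Y0) pairZ scaler0.
move=> Z0 Z0E.
have YZ : br Y Z0 = 0.
  have fix_ s : Adj (ex (s *: Y)) Z0 = Z0.
    have kK : maxK (ex (s *: Y)).
      by exists (s *: Y) => //=; rewrite leigP linearZ /= tY scale1r.
    have cY : Adj (ex (s *: Y)) Y = Y by apply: (Ad_fixed lieE cG); exact: (brxx lieB).
    apply/eqP; rewrite -subr_eq0; apply/eqP/ip_self_eq0.
    set V := _ - _; rewrite {1}/V ipDl ip_oppl (Adj_ip_adjoint _ _ kK) -!Z0E /D.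
    have cY' : Adj (ex (s *: Y))^-1%g Y = Y by have := AdjVK (ex (s *: Y)) Y; rewrite cY.
    rewrite derive_lmul_equivariant// -(Adj_ip_adjoint _ _ kK) cY.
    by rewrite subrr.
  have d := is_derive_Adj Y Z0 0; rewrite fix_ in d.
  apply: (is_derive_uniq d); rewrite (_ : (fun t => _) = cst Z0); first exact: is_derive_cst.
  by apply/funext => t; exact: fix_.
have e1 := Z0E Z0; rewrite /D (derive_lmul_commuting Yr YZ) in e1.
have e2 := Z0E Y; rewrite /D (derive_lmul_commuting Yr (brxx lieB Y)) in e2.
rewrite Z0E; congr ip; apply/eqP; rewrite -subr_eq0; apply/eqP/ip_self_eq0.
rewrite ipDl !ip_addr !ip_oppl !ip_oppr; move: e1 e2; rewrite (ipC Z0 Y); lra.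
Qed.

End Gauss.

Fixpoint lprod (Y : nat -> g) n : X :=
  if n is m.+1 then (lprod Y m * ex (Y m))%g else 1%g.

Lemma lprodD (Y : nat -> g) m n : lprod Y (m + n) = (lprod Y m * lprod (fun i => Y (m + i)%N) n)%g.
Proof.
elim: n => [|n IH]; first by rewrite addn0 mulg1.
by rewrite addnS /= IH mulgA.
Qed.

Lemma lprod_cst (Y : nat -> g) Z n : (forall i, (i < n)%N -> Y i = Z) -> lprod Y n = ex (n%:R *: Z).
Proof.
elim: n => [|n IH] YZ /=; first by rewrite scale0r (lie_exp0 lieE).
rewrite YZ// IH => [|i iN]; last by rewrite YZ// ltnW.
by rewrite -(addn1 n) natrD (lexD lieE) scale1r.
Qed.

Lemma lprod_eq (Y Y' : nat -> g) n : (forall i, (i < n)%N -> Y i = Y' i) -> lprod Y n = lprod Y' n.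
Proof.
elim: n => [//|n IH] YY /=; rewrite YY// IH// => i iN; by rewrite YY// ltnW.
Qed.

Lemma lprod_continuous n : continuous (fun Y : prod_topology (fun _ : nat => g) => lprod Y n).
Proof.
elim: n => [|n IH] Y; first exact: (@cst_continuous _ X 1%g Y).
rewrite /continuous_at [lprod _ _]/=.
have cY : (fun Z : prod_topology (fun _ : nat => g) => ex (Z n)) @ Y --> ex (Y n).
  apply: (@cvg_comp _ _ _ (fun Z : prod_topology (fun _ : nat => g) => Z n) ex _ (nbhs (Y n)));
    last exact: (lex_continuous lieE).
  exact: (@proj_continuous _ (fun=> g) n Y).
have := @mulg_cvg X _ _ (nbhs_filter Y) (fun Z : prod_topology (fun _ : nat => g) => lprod Z n) _ _ _ (IH Y) cY.
exact.
Qed.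

Lemma theta_ball_compact (c : R) : compact [set Y | th Y = Y /\ ip Y Y <= c].
Proof.
have [k k0 kP] := ip_norm_bounds (@ipC R X) (@ipDl R X) (@ipZl R X) (@ip_gt0 R X).
apply: (@closed_bounded_compact _ _ _ (k^-1 * `|c| + 1)).
  rewrite (_ : [set Y | _] = [set v | v \in passmx.leigenspace th 1] `&` [set Y | ip Y Y <= c]).
    apply: closedI; first exact: vspace_closed.
    have /= := @closed_comp _ _ (fun x : g => ip x x) [set r | r <= c].
    by apply => [x _|]; [apply: ip_cvg; exact: cvg_id|exact: closed_le].
  by apply/seteqP; split => Y /=; rewrite leigP scale1r => -[/eqP ? ?].
move=> Y [_ Yc]; have /andP[h _] := kP Y.
have : `|Y| ^+ 2 <= k^-1 * `|c|.
  by rewrite mulrC ler_pdivlMr// mulrC (le_trans h)// (le_trans Yc)// ler_norm.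
by have := normr_ge0 Y; nra.
Qed.

Lemma small_ip (d : R) : 0 < d -> exists2 c : R, 0 < c & forall Y, ip Y Y < c -> `|Y| < d.
Proof.
move=> d0; have [k k0 kP] := ip_norm_bounds (@ipC R X) (@ipDl R X) (@ipZl R X) (@ip_gt0 R X).
exists (k * d ^+ 2); first by rewrite mulr_gt0// exprn_gt0.
move=> Y Yd; have /andP[h _] := kP Y.
have := le_lt_trans h Yd; rewrite ltr_pM2l// ltr_pXn2r// ?nnegrE//; exact: ltW.
Qed.

(* Among the factorisations of an element of K K into N short exponentials, one of minimal energy has equal consecutive factors by the Gauss lemma, and so is itself an exponential. *)
Lemma maxKM (k1 k2 : X) : maxK k1 -> maxK k2 -> maxK (k1 * k2)%g.
Proof.
move=> [A /=]; rewrite leigP scale1r => /eqP tA kA [B /=]; rewrite leigP scale1r => /eqP tB kB.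
set u := (k1 * k2)%g.
have [r [L rL]] := lie_radius_exists lieE; have r0 := lr_gt0 rL.
have [d d0 dP] := small_fixed_by_theta.
have m0 : 0 < Num.min r d by rewrite lt_min r0.
have [c c0 cP] := small_ip m0.
(* Cutting A and B into M equal pieces each brings the energy below c, and then every factor of a
   minimiser is short. *)
pose M := (Num.truncn ((ip A A + ip B B) / c)).+1.
have M0 : (0 : R) < M%:R by rewrite ltr0n.
have Mc : (ip A A + ip B B) / M%:R < c.
  rewrite ltr_pdivrMr// mulrC -ltr_pdivrMr//; exact: truncnS_gt.
clearbody M.
pose N := (M + M)%N.
(* Infinite sequences instead of N-tuples, so that compactness is Tychonoff's theorem. *)
pose T := prod_topology (fun _ : nat => g).
pose S : set T := [set Y | (forall i, th (Y i) = Y i /\ ip (Y i) (Y i) <= c)] `&` [set Y | lprod Y N = u].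
have cS : compact S.
  apply: compact_closedI.
    apply: (@tychonoff nat (fun=> g) (fun=> [set Z | th Z = Z /\ ip Z Z <= c])) => _.
    exact: theta_ball_compact.
  have := @closed_comp T X (fun Y : T => lprod Y N) [set u].
  apply => [Y _|]; first exact: lprod_continuous.
  exact: (accessible_closed_set1 (hausdorff_accessible (@group_hausdorff R X))).
pose energy (Y : nat -> g) := \sum_(i < N) ip (Y i) (Y i).
pose Y0 (i : nat) := M%:R^-1 *: (if (i < M)%N then A else B).
have E0 : energy Y0 = (ip A A + ip B B) / M%:R.
  rewrite /energy /N big_split_ord /Y0.
  have half (C : g) : \sum_(i < M) ip (M%:R^-1 *: C) (M%:R^-1 *: C) = ip C C / M%:R.
    by rewrite sumr_const card_ord ipZl ip_scaler -mulr_natr; field; rewrite gt_eqF.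
  rewrite mulrDl -!half; congr (_ + _); apply: eq_bigr => i _ /=.
    by rewrite ltn_ord.
  by rewrite ltnNge leq_addr.
have le_energy (Y : nat -> g) i : (i < N)%N -> ip (Y i) (Y i) <= energy Y.
  move=> iN; rewrite /energy (bigD1 (Ordinal iN)) //= lerDl sumr_ge0// => j _; exact: ip_self_ge0.
have SY0 : S Y0.
  split => /= [i|].
    split; first by rewrite /Y0 linearZ; case: ifP => _; rewrite /= ?tA ?tB.
    apply: le_trans (ltW Mc); rewrite /Y0 ipZl ip_scaler.
    have := ip_self_ge0 A; have := ip_self_ge0 B => hB hA.
    have M1 : M%:R^-1 <= 1 :> R by rewrite invf_le1// ler1n -(ltr0n R).
    have Mi : 0 < M%:R^-1 :> R by rewrite invr_gt0.
    rewrite [X in _ <= X]mulrC ler_pM2l//.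
    case: ifP => _; nra.
  rewrite /N lprodD (@lprod_cst _ (M%:R^-1 *: A)); last by move=> i iM; rewrite /Y0 iM.
  rewrite (@lprod_cst _ (M%:R^-1 *: B)); last by move=> i _; rewrite /Y0 ltnNge leq_addr.
  by rewrite !scalerA mulfV ?gt_eqF// !scale1r kA kB.
have S0 : S !=set0 by exists Y0.
have cE : {within S, continuous (fun Y : T => energy Y)}.
  have c1 (i : nat) (Y : T) : (fun Z : T => ip (Z i) (Z i)) @ Y --> ip (Y i) (Y i).
    have cY : (fun Z : T => Z i) @ Y --> Y i := @proj_continuous _ (fun=> g) i Y.
    exact: (ip_cvg cY cY).
  have c2 n : continuous (fun Z : T => \sum_(i < n) ip (Z i) (Z i)).
    elim: n => [|n IH] Y.
      by rewrite (_ : (fun Z : T => _) = cst 0); [exact: cst_continuous|apply/funext => Z; rewrite big_ord0].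
    rewrite (_ : (fun Z : T => _) = fun Z : T => \sum_(i < n) ip (Z i) (Z i) + ip (Z n) (Z n)); last first.
      by apply/funext => Z; rewrite big_ord_recr.
    have i0 := IH Y; rewrite /continuous_at in i0 *; exact: (cvgD i0 (c1 n Y)).
  exact: continuous_subspaceT (c2 N).
have [Y /[!inE] -[YS Yu] Ymin] := compact_EVT_min S0 cS cE.
have EY : energy Y < c.
  by apply: le_lt_trans Mc; rewrite -E0; apply: Ymin; rewrite inE.
have Ysmall i : (i < N)%N -> `|Y i| < r /\ `|Y i| < d.
  by move=> iN; apply/andP; rewrite -lt_min cP// (le_lt_trans (le_energy _ _ iN)).
have step i : (i.+1 < N)%N -> Y i = Y i.+1.
  move=> iN; have iN' := ltnW iN.
  set P := Y i; set Q := Y i.+1; pose W := P - Q.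
  have [Pr Pd] := Ysmall _ iN'; have [Qr Qd] := Ysmall _ iN.
  have [tP Pc] := YS i; have [tQ Qc] := YS i.+1.
  have NQr : `|- Q| < r by rewrite normrN.
  have tW : th W = W by rewrite /W linearB /= tP tQ.
  (* exp(P) exp(sW) and exp(-sW) exp(Q) have the same product as exp(P) and exp(Q). By the Gauss
     lemma the energy of the pair has derivative 2 |P - Q|^2 at s = 0, and minimality makes it 0. *)
  pose Ps (s : R) := lmul (P, s *: W); pose Qs (s : R) := - lmul (- Q, s *: W).
  pose phi s := ip (Ps s) (Ps s) + ip (Qs s) (Qs s).
  have dP0 := is_derive_lmul_line rL W Pr; have dQ0 := is_derive_lmul_line rL W NQr.
  have dphi : is_derive (0 : R) 1 phi (2 * ip W W).
    have h := is_deriveD (is_derive_ip dP0 dP0) (is_derive_ip dQ0 dQ0).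
    have -> : phi = (fun s => ip (Ps s) (Ps s)) + (fun s => ip (lmul (- Q, s *: W)) (lmul (- Q, s *: W))).
      by apply/funext => s; rewrite /phi /Qs ip_oppl ip_oppr opprK.
    apply: (is_derive_eq h); rewrite scale0r !(lr_m0 rL)//.
    rewrite ![ip ('D_ _ _ _) _]ipC !(gauss rL)// ?linearN /= ?tQ//.
    have -> : ip W W = ip P W - ip Q W by rewrite {1}/W ipDl ip_oppl.
    by rewrite ip_oppl /P; ring.
  have := local_min_derive dphi; move=> /(_ _) h.
  suff : 2 * ip W W = 0.
    move/eqP; rewrite mulf_eq0 pnatr_eq0 /= => /eqP/ip_self_eq0/eqP.
    by rewrite subr_eq0 => /eqP.
  have phi0 : phi 0 = ip P P + ip Q Q.
    by rewrite /phi /Ps /Qs scale0r !(lr_m0 rL)// opprK.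
  apply: h; rewrite phi0.
  have cP' := lmul_near rL W Pr; have cQ' := lmul_near rL W NQr.
  have nP := near_lt cP' Pr; have nQ := near_lt cQ' NQr.
  have nPd := near_lt cP' Pd; have nQd : \forall s \near (0 : R), `|lmul (- Q, s *: W)| < d.
    by apply: (near_lt cQ'); rewrite normrN.
  have Pc' : ip P P < c by apply: le_lt_trans EY; exact: le_energy.
  have Qc' : ip Q Q < c by apply: le_lt_trans EY; exact: le_energy.
  have nPc : \forall s \near (0 : R), ip (Ps s) (Ps s) < c.
    exact: (cvgr_lt _ (ip_cvg cP' cP') _ Pc').
  have nQc : \forall s \near (0 : R), ip (Qs s) (Qs s) < c.
    have Qc2 : ip (- Q) (- Q) < c by rewrite ip_oppl ip_oppr opprK.
    have n0 := cvgr_lt _ (ip_cvg cQ' cQ') _ Qc2.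
    by apply: filterS (n0 _ _) => s; rewrite /Qs ip_oppl ip_oppr opprK.
  have nW := near_scale_lt rL W.
  near=> s.
  have sW : `|s *: W| < r by near: s.
  have PsE : ex (Ps s) = (ex P * ex (s *: W))%g by rewrite (lr_mul rL).
  have QsE : ex (lmul (- Q, s *: W)) = (ex (- Q) * ex (s *: W))%g by rewrite (lr_mul rL).
  (* A short vector whose exponential commutes with theta under Ad is fixed by theta, so the varied
     factors remain admissible. *)
  have tPs : th (Ps s) = Ps s.
    apply: dP => [|V]; first by near: s.
    rewrite PsE !AdjM !(@maxK_theta (ex _))//.
      by exists P => //=; rewrite leigP scale1r tP.
    by exists (s *: W) => //=; rewrite leigP scale1r linearZ /= tW.
  have tQs : th (Qs s) = Qs s.
    rewrite linearN /=; congr (- _); apply: dP => [|V]; first by near: s.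
    rewrite QsE !AdjM !(@maxK_theta (ex _))//.
      by exists (- Q) => //=; rewrite leigP scale1r linearN /= tQ.
    by exists (s *: W) => //=; rewrite leigP scale1r linearZ /= tW.
  pose Y' (j : nat) := if j == i then Ps s else if j == i.+1 then Qs s else Y j.
  have Y'i : Y' i = Ps s by rewrite /Y' eqxx.
  have Y'i1 : Y' i.+1 = Qs s by rewrite /Y' eqxx gtn_eqF.
  have Y'j j : j != i -> j != i.+1 -> Y' j = Y j by rewrite /Y' => /negbTE -> /negbTE ->.
  have Y'S : S Y'.
    split => /= [j|].
      rewrite /Y'; case: eqP => _; first by split => //; apply: ltW; near: s.
      case: eqP => _; first by split => //; apply: ltW; near: s.
      exact: YS.
    rewrite -Yu -(subnKC iN) !lprodD /=.
    have -> : lprod Y' i = lprod Y i.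
      by apply: lprod_eq => j ji; rewrite Y'j// ltn_eqF// ltnW.
    have -> : lprod (fun j => Y' (i.+2 + j)%N) (N - i.+2) = lprod (fun j => Y (i.+2 + j)%N) (N - i.+2).
      by apply: lprod_eq => j _; rewrite Y'j// gtn_eqF// addSn ltnS ?leq_addr// addSn ltnW// ltnS leq_addr.
    congr (_ * _)%g; rewrite Y'i Y'i1 -!mulgA; congr (_ * _)%g.
    rewrite PsE /Qs (lexN lieE) QsE invgM (lexN lieE) invgK -!mulgA; congr (_ * _)%g.
    by rewrite mulgA mulgV mul1g.
  have := Ymin Y'; rewrite inE => /(_ Y'S).
  have iI : Ordinal iN' != Ordinal iN by rewrite -val_eqE /= ltn_eqF.
  rewrite /energy (bigD1 (Ordinal iN'))//= (bigD1 (Ordinal iN)) /=; last by rewrite eq_sym.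
  rewrite [X in _ <= X](bigD1 (Ordinal iN'))//= [X in _ <= _ + X](bigD1 (Ordinal iN)) /=; last by rewrite eq_sym.
  rewrite Y'i Y'i1 !addrA.
  rewrite [X in _ <= _ + X](eq_bigr (fun j : 'I_N => ip (Y j) (Y j))) ?lerD2r//.
  by move=> j /andP[ji ji1]; rewrite Y'j// -val_eqE.
have Yall i : (i < N)%N -> Y i = Y 0%N.
  by elim: i => [//|i IH] iN; rewrite -step// IH// ltnW.
exists (N%:R *: Y 0%N); last by rewrite -Yu (lprod_cst Yall).
by rewrite /= leigP scale1r linearZ /= (YS 0%N).1.
Unshelve. all: by end_near. Qed.

(** Near a limit point x there is k = x exp(Z) in K with Z short. Commutation of Ad with theta
    passes to the limit x, so it holds for exp(Z), and Z is fixed by theta. *)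
Lemma maxK_closed : closed (@maxK R X).
Proof.
have [d d0 dP] := small_fixed_by_theta.
move=> x xK.
have xth V : Adj x (th V) = th (Adj x V).
  have : closed [set y : X | Adj y (th V) - th (Adj y V) = 0].
    apply: (@closed_comp _ _ (fun y : X => Adj y (th V) - th (Adj y V)) [set v | v = 0]); last first.
      exact: (accessible_closed_set1 (hausdorff_accessible (@norm_hausdorff _ g))).
    move=> y _; apply: cvgB; first exact: Adj_continuous.
    by apply: (@cvg_comp _ _ _ (fun y : X => Adj y V) th _ (nbhs (Adj y V))); [exact: Adj_continuous|exact: th_continuous].
  move=> /(_ x) h; apply/eqP; rewrite -subr_eq0; apply/eqP; apply: h => A /xK[y [yK Ay]].
  by exists y; split => //=; rewrite maxK_theta// subrr.
have [k0 [kK [z [Z /= Zd <-] kE]]] := xK _ (nbhs_mulgl1 x (nbhs_lex lieE d0)).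
set k := (x * ex Z)%g in kE; rewrite -kE in kK.
have ZE : ex Z = (x^-1 * k)%g by rewrite /k mulKg.
have xE : x = (k * (ex Z)^-1)%g by rewrite /k mulgK.
clearbody k.
have tZ : th Z = Z.
  apply: dP => // V; rewrite ZE !AdjM (maxK_theta _ kK).
  by rewrite -[RHS](AdjVK x) xth AdjKV.
rewrite xE; apply: maxKM => //; apply: maxKV; exists Z => //=; by rewrite leigP scale1r tZ.
Qed.

End Adjoint.

(** * Polar and Iwasawa decompositions *)

Section Polar.
Variables (R : realType) (X : rankOneSpace R).
Local Notation g := (lie_alg X).
Local Notation br := (@bracket R X).
Local Notation th := (@cartan_inv R X).
Local Notation ex := (@lie_exp R X).
Local Notation H := (H0 X).
Implicit Types (U V W Z E : g) (x y k : X).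

Let lieB : is_lie_bracket br := bracket_lie X.
Let lieE : is_lie_exp br ex := lie_expP X.
Let cG : connected [set: X] := @Defs.group_connected R X.

Lemma a_D (s t : R) : a_ X (s + t) = (a_ X s * a_ X t)%g.
Proof. exact: (lexD lieE). Qed.
Lemma a_0 : a_ X 0 = 1%g. Proof. by rewrite /a_ scale0r (lie_exp0 lieE). Qed.
Lemma a_N (t : R) : a_ X (- t) = (a_ X t)^-1%g.
Proof. by rewrite /a_ scaleNr (lexN lieE). Qed.
Lemma a_continuous : continuous (a_ X : R -> X).
Proof.
move=> t; apply: (@cvg_comp _ _ _ (fun t : R => t *: H) ex _ (nbhs (t *: H))); last exact: (lex_continuous lieE).
by apply: cvgZr_tmp; exact: cvg_id.
Qed.

Lemma Adj_a (b : R) V (t : R) : br H V = b *: V -> Adj (a_ X t) V = expR (b * t) *: V.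
Proof. by move=> HV; rewrite /Adj /a_ (Ad_eigen lieE cG _ HV). Qed.

Definition eb : seq (g * R) := sval (cid (eigenbasis X)).
Lemma ebP p : p \in eb ->
  [/\ ip p.1 p.1 = 1, br H p.1 = p.2 *: p.1 & p.2 \in [:: 0; 1; - 1; 2; - 2]].
Proof. by move=> ?; have [h _] := svalP (cid (eigenbasis X)); exact: h. Qed.
Lemma ebE V : V = \sum_(p <- eb) ip V p.1 *: p.1.
Proof. by have [_ h] := svalP (cid (eigenbasis X)). Qed.

Definition ebf : seq (g * R) := [seq (p.1, 1 : R) | p <- eb].
Lemma ebfP : frame (@ip R X) fullv ebf.
Proof.
split=> [p _|V _]; first exact: memvf.
by rewrite /ebf big_map [LHS]ebE; apply: eq_bigr => p _; rewrite mul1r.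
Qed.

(* The squared Hilbert-Schmidt norm of Ad x: smooth, bi-invariant under K, and
   strictly increasing along the chamber, it serves as radial coordinate. *)
Definition tau x : R := \sum_(p <- eb) ip (Adj x p.1) (Adj x p.1).

Lemma tau_frame x fs : frame (@ip R X) fullv fs ->
  tau x = \sum_(p <- fs) p.2 * ip (Adj x p.1) (Adj x p.1).
Proof.
move=> fP; transitivity (\sum_(p <- ebf) p.2 * ip (Adj x p.1) (Adj x p.1)).
  by rewrite /ebf big_map; apply: eq_bigr => p _; rewrite mul1r.
apply: (frame_trace (@ipC R X) (b := fun U V => ip (Adj x U) (Adj x V)) ebfP fP) => *.
- by rewrite linearD ipDl.
- by rewrite linearZ ipZl.
- by rewrite linearD ip_addr.
- by rewrite linearZ ip_scaler.
Qed.

Lemma tau_Kl k x : maxK k -> tau (k * x)%g = tau x.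
Proof. by move=> kK; apply: eq_bigr => p _; rewrite !AdjM (maxK_ip _ _ kK). Qed.

(** Ad k carries a frame to a frame, and the trace does not depend on the frame. *)
Lemma tau_Kr k x : maxK k -> tau (x * k)%g = tau x.
Proof.
move=> kK.
have fP : frame (@ip R X) fullv [seq (Adj k p.1, p.2) | p <- ebf].
  apply: (frame_image (A' := Adj k^-1%g)) => //; first exact: ebfP.
  - by move=> *; exact: memvf.
  - by move=> *; exact: memvf.
  - exact: AdjKV.
  - by move=> U V; exact: maxK_ip.
rewrite (tau_frame x fP) !big_map; apply: eq_bigr => p _.
by rewrite mul1r !AdjM.
Qed.

(** The values of tau on the eigenbasis and on its image under theta are averaged, so that evenness
    in t is visible. *)
Definition Tt (t : R) : R := \sum_(p <- eb) 2^-1 * (expR (2 * p.2 * t) + expR (- (2 * p.2 * t))).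

Lemma tau_a t : tau (a_ X t) = Tt t.
Proof.
have E1 : tau (a_ X t) = \sum_(p <- eb) expR (2 * p.2 * t).
  apply: eq_big_seq => p /ebP[p1 pH _].
  by rewrite (Adj_a _ pH) ipZl ip_scaler p1 mulr1 -expRD; congr expR; ring.
have E2 : tau (a_ X t) = \sum_(p <- eb) expR (- (2 * p.2 * t)).
  have fP : frame (@ip R X) fullv [seq (th p.1, p.2) | p <- ebf].
    apply: (frame_image (A' := th)) => //; first exact: ebfP.
    - by move=> *; exact: memvf.
    - by move=> *; exact: memvf.
    - exact: thK.
    - exact: ip_th.
  rewrite (tau_frame _ fP) !big_map; apply: eq_big_seq => p /ebP[p1 pH _].
  rewrite mul1r (Adj_a _ (th_eig pH)) ipZl ip_scaler ip_th p1 mulr1 -expRD.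
  by congr expR; ring.
by rewrite /Tt -mulr_sumr big_split /= -E1 -E2; field.
Qed.

Lemma TtN t : Tt (- t) = Tt t.
Proof. by apply: eq_bigr => p _; rewrite mulrN opprK addrC. Qed.

Definition dTt (t : R) : R := \sum_(p <- eb) p.2 * (expR (2 * p.2 * t) - expR (- (2 * p.2 * t))).

Lemma is_derive_exp_lin (b : R) (t : R) : is_derive t 1 (fun t : R => expR (b * t)) (b * expR (b * t)).
Proof.
have h : is_derive t 1 (fun t : R => b * t) b.
  by apply: (is_derive_eq (is_deriveM (is_derive_cst b t 1) (is_derive_id t (1 : R)))); rewrite scaler0 addr0 /GRing.scale /= mulr1.
by apply: (is_derive_eq (@is_derive1_comp _ expR (fun t : R => b * t) t _ _ (is_derive_expR _) h)); rewrite mulrC.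
Qed.

Lemma is_derive_seqsum (I : Type) (r : seq I) (F : I -> R -> R) (dF : I -> R) (t : R) :
  (forall i, is_derive t 1 (F i) (dF i)) ->
  is_derive t 1 (fun s : R => \sum_(i <- r) F i s) (\sum_(i <- r) dF i).
Proof.
move=> dh; elim: r => [|i r IH].
  rewrite big_nil (_ : (fun s : R => _) = cst 0); first exact: is_derive_cst.
  by apply/funext => s; rewrite big_nil.
rewrite big_cons (_ : (fun s : R => _) = F i + (fun s : R => \sum_(i <- r) F i s)).
  exact: is_deriveD.
by apply/funext => s; rewrite big_cons.
Qed.

Lemma is_derive_Tt (t : R) : is_derive t 1 Tt (dTt t).
Proof.
apply: is_derive_seqsum => p.
have h1 := is_derive_exp_lin (2 * p.2) t; have h2 := is_derive_exp_lin (- (2 * p.2)) t.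
have h := is_deriveM (is_derive_cst (2^-1 : R) t 1) (is_deriveD h1 h2).
rewrite (_ : (fun s : R => _) = cst (2^-1) * ((fun t : R => expR (2 * p.2 * t)) + (fun t : R => expR (- (2 * p.2) * t)))).
  by apply: (is_derive_eq h); rewrite scaler0 addr0 /GRing.scale /= !mulNr; field.
by apply/funext => s; rewrite /= -mulNr.
Qed.

Lemma root_exists : exists2 p, p \in eb & p.2 != 0.
Proof.
apply: contrapT => no.
have H0 V : br H V = 0.
  rewrite (ebE V) linear_sum big_seq big1// => p pe; rewrite linearZ.
  have [_ pH _] := ebP pe; rewrite /= pH.
  have [->|p0] := eqVneq p.2 0; first by rewrite scale0r scaler0.
  by exfalso; apply: no; exists p.
have := alpha_root X; rewrite /passmx.leigenvalue => /eqP; apply; apply/eqP.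
rewrite -subv0; apply/subvP => v; rewrite leigP adE H0 scale1r eq_sym => /eqP ->; exact: mem0v.
Qed.

Lemma dTt_term_ge0 (b t : R) : 0 < t -> 0 <= b * (expR (2 * b * t) - expR (- (2 * b * t))).
Proof.
move=> t0; have [b0|b0] := lerP 0 b.
  by rewrite mulr_ge0// subr_ge0 ler_expR; nra.
by rewrite mulr_le0 ?(ltW b0)// subr_le0 ler_expR; nra.
Qed.

Lemma dTt_gt0 t : 0 < t -> 0 < dTt t.
Proof.
move=> t0; have [p pe p0] := root_exists.
rewrite /dTt (perm_big _ (perm_to_rem pe)) big_cons ltr_pwDl//.
  case: (ltgtP p.2 0) p0 => // b0 _.
    by rewrite nmulr_rgt0// subr_lt0 ltr_expR; nra.
  by rewrite pmulr_rgt0// subr_gt0 ltr_expR; nra.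
by apply: sumr_ge0 => q _; exact: dTt_term_ge0.
Qed.

Lemma Tt_continuous : continuous Tt.
Proof.
move=> t; exact/differentiable_continuous/derivable1_diffP/(@ex_derive _ _ _ _ _ _ _ (is_derive_Tt t)).
Qed.

Lemma Tt_lt s t : 0 <= s -> s < t -> Tt s < Tt t.
Proof.
move=> s0 st.
have ct : {within `[s, t], continuous Tt} := continuous_subspaceT Tt_continuous.
have [c] := @MVT _ Tt dTt s t st (fun (x : R) _ => is_derive_Tt x) ct.
rewrite in_itv /= => /andP[sc _] E; rewrite -subr_gt0 E mulr_gt0 ?subr_gt0//.
by apply: dTt_gt0; exact: le_lt_trans sc.
Qed.

Lemma Tt_unbounded (M : R) : exists2 t, 0 < t & M < Tt t.
Proof.
have [p pe p0] := root_exists.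
have [_ _ pj] := ebP pe.
have t0 : 0 < `|M| + 1 by rewrite ltr_wpDl.
exists (`|M| + 1) => //.
rewrite /Tt (perm_big _ (perm_to_rem pe)) big_cons.
apply: ltr_wpDr.
  by apply: sumr_ge0 => q _; rewrite mulr_ge0 ?addr_ge0 ?expR_ge0.
have e1 := expR_ge1Dx (2 * p.2 * (`|M| + 1)); have e2 := expR_ge1Dx (- (2 * p.2 * (`|M| + 1))).
have e3 := expR_gt0 (2 * p.2 * (`|M| + 1)); have e4 := expR_gt0 (- (2 * p.2 * (`|M| + 1))).
have := ler_norm M; have := normr_ge0 M.
by move: pj; rewrite !inE (negbTE p0) /= => /or4P[] /eqP pE; rewrite pE in e1 e2 e3 e4 *; nra.
Qed.

Lemma tau_continuous : continuous tau.
Proof.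
move=> x; apply: cvg_big => [|p _]; first exact: add_continuous.
by apply: ip_cvg; exact: Adj_continuous.
Qed.

(** Cauchy-Schwarz with vector coefficients. It bounds the operator norm of Ad x by its
    Hilbert-Schmidt norm, and so makes tau submultiplicative. *)
Lemma ip_sum_sq_le (r : seq (g * R)) (c : g * R -> R) (w : g * R -> g) :
  ip (\sum_(p <- r) c p *: w p) (\sum_(p <- r) c p *: w p) <=
  (\sum_(p <- r) c p ^+ 2) * \sum_(p <- r) ip (w p) (w p).
Proof.
elim: r => [|p r IH]; first by rewrite !big_nil ip_zerol mul0r.
rewrite !big_cons; set S := (\sum_(j <- r) _ : g) in IH *.
set A := \sum_(j <- r) c j ^+ 2 in IH *; set B := \sum_(j <- r) ip _ _ in IH *.
have A0 : 0 <= A by apply: sumr_ge0 => j _; exact: sqr_ge0.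
have B0 : 0 <= B by apply: sumr_ge0 => j _; exact: ip_self_ge0.
have W0 := ip_self_ge0 (w p).
rewrite ipDl !ip_addr !ipZl !ip_scaler (ipC S).
have [A1|A1] := eqVneq A 0.
  have S0 : S = 0 by apply: ip_self_eq0; apply/eqP; rewrite eq_le ip_self_ge0 andbT -(mul0r B) -A1.
  rewrite S0 ip_zeror ip_zerol A1; have := sqr_ge0 (c p); nra.
have {}A1 : 0 < A by rewrite lt_neqAle eq_sym A1.
(* Positivity of this square controls the cross term between the new vector and the partial sum. *)
have := ip_self_ge0 (A *: w p - c p *: S).
rewrite ipDl !ip_addr !ip_oppl !ip_oppr !ipZl !ip_scaler (ipC S) => h.
have h2 : A * (2 * c p * ip (w p) S) <= A * (A * ip (w p) (w p) + c p ^+ 2 * B).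
  have := sqr_ge0 (c p); nra.
by rewrite ler_pM2l// in h2; nra.
Qed.

Lemma tau_bound x V : ip (Adj x V) (Adj x V) <= tau x * ip V V.
Proof.
have -> : ip V V = \sum_(p <- eb) ip V p.1 ^+ 2.
  rewrite {1}(ebE V) (ip_suml (@ipDl R X) (@ipZl R X)); apply: eq_bigr => p _.
  by rewrite ipZl ipC expr2.
have -> : Adj x V = \sum_(p <- eb) ip V p.1 *: Adj x p.1.
  by rewrite {1}(ebE V) linear_sum; apply: eq_bigr => p _; rewrite linearZ.
rewrite mulrC; exact: ip_sum_sq_le.
Qed.

Lemma tauM x y : tau (x * y)%g <= tau x * tau y.
Proof.
rewrite {3}/tau mulr_sumr; apply: ler_sum => p _; rewrite AdjM; exact: tau_bound.
Qed.

Section InvariantMeasure.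
Variables (kap mu : {measure set (Borel X) -> \bar R}).
Hypothesis kapP : is_haar_K kap.
Hypothesis muP : is_invariant_measure kap mu.
Hypothesis cK : compact (@maxK R X).

Lemma Borel_open (A : set X) : open A -> measurable (A : set (Borel X)).
Proof. by move=> oA; exact: sub_sigma_algebra. Qed.

Lemma Borel_closed (A : set X) : closed A -> measurable (A : set (Borel X)).
Proof.
by move=> cA; rewrite -(setCK (A : set (Borel X))); apply: measurableC; apply: Borel_open; exact: closed_openC.
Qed.

Lemma Borel_continuous (f : X -> R) : continuous f ->
  measurable_fun [set: Borel X] (f : Borel X -> R).
Proof.
move=> cf; apply: (measurability (@RGenOpens.G R)); first exact: RGenOpens.measurableE.
move=> _ [_ [a [b ->] <-]]; rewrite setTI; apply: Borel_open.
by apply: open_comp => //; exact: interval_open.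
Qed.

Lemma maxK_measurable : measurable (@maxK R X : set (Borel X)).
Proof. exact: Borel_closed (@maxK_closed R X). Qed.

Definition c0 : R := sval (cid2 muP.2).
Lemma c0_gt0 : 0 < c0. Proof. by rewrite /c0; case: cid2. Qed.
Lemma polarE (f : Borel X -> \bar R) : measurable_fun setT f -> (forall x, 0 <= f x)%E ->
  (\int[mu]_x f x = c0%:E * \int[kap]_(k1 in @maxK R X) \int[lebesgue_measure]_(t in `[0%R, +oo[)
         \int[kap]_(k2 in @maxK R X) (f ((k1 : X) * a_ X t * (k2 : X))%g * (D X t)%:E))%E.
Proof. by move=> mf f0; rewrite /c0; case: cid2 => /= c _; apply. Qed.

Lemma sinh_gt0 (t : R) : 0 < t -> 0 < Defs.sinh t.
Proof. by move=> t0; rewrite /Defs.sinh divr_gt0// subr_gt0 ltr_expR; lra. Qed.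
Lemma sinh0 : Defs.sinh (0 : R) = 0.
Proof. by rewrite /Defs.sinh oppr0 subrr mul0r. Qed.
Lemma sinh_ge0 (t : R) : 0 <= t -> 0 <= Defs.sinh t.
Proof. by rewrite le_eqVlt => /orP[/eqP <-|/sinh_gt0/ltW//]; rewrite sinh0. Qed.
Lemma sinh_le (s t : R) : s <= t -> Defs.sinh s <= Defs.sinh t.
Proof.
move=> st; rewrite /Defs.sinh ler_pM2r ?invr_gt0//.
have : expR s <= expR t by rewrite ler_expR.
have : expR (- t) <= expR (- s) by rewrite ler_expR lerN2.
lra.
Qed.
Lemma D_gt0 t : 0 < t -> 0 < D X t.
Proof. by move=> t0; rewrite /D mulr_gt0// exprn_gt0// sinh_gt0// mulr_gt0. Qed.
Lemma D_ge0 t : 0 <= t -> 0 <= D X t.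
Proof. by move=> t0; rewrite /D mulr_ge0// exprn_ge0// sinh_ge0// mulr_ge0. Qed.
Lemma D_le s t : 0 <= s -> s <= t -> D X s <= D X t.
Proof.
move=> s0 st; have t0 := le_trans s0 st.
apply: ler_pM; rewrite ?exprn_ge0 ?sinh_ge0 ?mulr_ge0//.
  by rewrite lerXn2r// ?nnegrE ?sinh_ge0//; exact: sinh_le.
by rewrite lerXn2r// ?nnegrE ?sinh_ge0 ?mulr_ge0//; apply: sinh_le; rewrite ler_pM2l.
Qed.

Lemma sinh_continuous : continuous (fun t : R => Defs.sinh t).
Proof.
move=> t; rewrite /continuous_at /Defs.sinh; apply: cvgM; last exact: cvg_cst.
apply: cvgB; first exact: continuous_expR.
apply: (@cvg_comp _ _ _ (fun t : R => - t) expR _ (nbhs (- t))); last exact: continuous_expR.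
by apply: cvgN; exact: cvg_id.
Qed.

Lemma D_continuous : continuous (D X : R -> R).
Proof.
have cX n (f : R -> R) : continuous f -> continuous (fun t => f t ^+ n).
  move=> cf t; exact: (@cvg_comp _ _ _ f (fun x : R => x ^+ n) _ (nbhs (f t)) _ (cf t) (@exprn_continuous _ n (f t))).
move=> t; apply: cvgM; first exact: (cX _ _ sinh_continuous).
apply: (cX _ (fun t : R => Defs.sinh (2 * t))) => {}t.
apply: (@cvg_comp _ _ _ (fun t : R => 2 * t) (fun t : R => Defs.sinh t) _ (nbhs (2 * t))); last exact: sinh_continuous.
by apply: cvgM; [exact: cvg_cst|exact: cvg_id].
Qed.

Lemma kap_cst (c : \bar R) : (\int[kap]_(k in @maxK R X) c = c)%E.
Proof.
have [kK _ _] := kapP.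
by rewrite integral_cst ?kK ?mule1//; exact: maxK_measurable.
Qed.

Lemma mu_setT_neq0 : mu setT <> 0%E.
Proof.
have -> : mu setT = (\int[mu]_x 1)%E by rewrite integral_cst ?mul1e.
rewrite polarE//.
under eq_integral do under eq_integral do rewrite kap_cst mul1e.
rewrite kap_cst => /eqP; rewrite mule_eq0 gt_eqF ?lte_fin ?c0_gt0//= => /eqP E.
have : (\int[lebesgue_measure]_(t in `[1%R, 2%R]) (D X 1)%:E <= 0)%E.
  rewrite -E; apply: (@le_trans _ _ (\int[lebesgue_measure]_(t in `[1%R, 2%R]) (D X t)%:E)%E).
    apply: ge0_le_integral => //=.
    - by move=> t _; rewrite lee_fin D_ge0.
    - apply/measurable_EFinP; apply: measurable_funTS; apply: continuous_measurable_fun; exact: D_continuous.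
    - by move=> t; rewrite in_itv /= => /andP[t1 _]; rewrite lee_fin D_le.
  apply: ge0_subset_integral => //=.
  - apply/measurable_EFinP; apply: measurable_funTS; apply: continuous_measurable_fun; exact: D_continuous.
  - by move=> t; rewrite in_itv /= andbT => t0; rewrite lee_fin D_ge0.
  - by apply: subset_itv; rewrite ?bnd_simp//; lra.
rewrite integral_cst//= lebesgue_measure_itv /= lte_fin ltrDl ltr01 -EFinB addrK mule1.
by rewrite leNgt lte_fin D_gt0.
Qed.

Lemma mu_polar_null (U : set X) : open U ->
  (forall k1 t k2, maxK k1 -> 0 <= t -> maxK k2 -> ~ U (k1 * a_ X t * k2)%g) -> mu U = 0%E.
Proof.
move=> oU nU; have mU := Borel_open oU.
have -> : mu U = (\int[mu]_x (\1_(U : set (Borel X)) x)%:E)%E by rewrite integral_indic// setIT.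
rewrite polarE; [|by apply/measurable_EFinP; exact: measurable_indic|by move=> x; rewrite lee_fin].
rewrite (eq_integral (fun=> 0%E)) ?integral0 ?mule0// => k1 /[!inE] kK1.
rewrite (eq_integral (fun=> 0%E)) ?integral0// => t /[!inE]; rewrite /= in_itv /= andbT => t0.
rewrite (eq_integral (fun=> 0%E)) ?integral0// => k2 /[!inE] kK2.
by rewrite indicE memNset ?mul0e//; exact: nU.
Qed.

(** Short exponentials generate the connected group; with [lprod_compact] this makes G
    sigma-compact. *)
Lemma lprod_exhausts (r : R) : 0 < r -> forall x : X, exists n (Y : nat -> g),
  (forall i, `|Y i| <= r) /\ x = lprod Y n.
Proof.
move=> r0; apply: (connected_generated cG (H := [set x | exists n (Y : nat -> g),
  (forall i, `|Y i| <= r) /\ x = lprod Y n])) => /=.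
- by exists 0, (fun=> 0); split => // i; rewrite normr0 ltW.
- move=> _ _ [m [Y [Yr ->]]] [n [Z [Zr ->]]].
  exists (m + n)%N, (fun i => if (i < m)%N then Y i else Z (i - m)%N); split => [i|].
    by case: ifP.
  rewrite lprodD; congr (_ * _)%g; apply: lprod_eq => i im; first by rewrite im.
  by rewrite ltnNge leq_addr addKn.
- move=> _ [n [Y [Yr ->]]]; elim: n Y Yr => [|n IH] Y Yr /=.
    by exists 0, (fun=> 0); split => [i|]; rewrite ?normr0 ?ltW// invg1.
  rewrite invgM; have [m [Z [Zr ->]]] := IH _ Yr.
  exists m.+1, (fun i => if i is j.+1 then Z j else - Y n); split => [[|i]|]; rewrite ?normrN//.
  rewrite -add1n lprodD /= mul1g (lexN lieE); congr (_ * _)%g.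
- apply: filterS (nbhs_lex lieE r0) => _ [Y /= Yr <-]; exists 1, (fun=> Y).
  by split => [_|]; [exact: ltW|rewrite /= mul1g].
Qed.

Lemma lprod_compact (r : R) n : compact [set lprod Y n | Y in [set Y : nat -> g | forall i, `|Y i| <= r]].
Proof.
have cB : compact [set Z : g | `|Z| <= r].
  apply: (@closed_bounded_compact _ _ _ r) => //.
  have /= := @closed_comp _ _ (fun x : g => `|x| : R) [set s | s <= r].
  by apply => [x _|]; [exact: norm_continuous|exact: closed_le].
have ct := @tychonoff nat (fun=> g) (fun=> [set Z | `|Z| <= r]) (fun=> cB).
by apply: (continuous_compact _ ct); apply: continuous_subspaceT; exact: (@lprod_continuous R X n).
Qed.

(** Finitely many translates of a null open set would cover any compact set, and G is a countable
    union of compact sets, against mu G != 0. *)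
Lemma mu_open_neq0 (U : set X) x : open U -> U x -> mu U <> 0%E.
Proof.
move=> oU Ux U0; apply: mu_setT_neq0; apply/eqP.
have [mul _] := muP.
have oyU y : open [set (y * z)%g | z in U].
  rewrite (_ : [set (y * z)%g | z in U] = (fun z => (y^-1 * z)%g) @^-1` U).
    by apply: open_comp => // z _; exact: mulgl_continuous.
  by apply/seteqP; split => [_ [z Uz <-]|z Uz] /=; rewrite ?mulKg//; exists (y^-1 * z)%g => //; rewrite mulVKg.
have nullC (C : set X) : compact C -> mu.-negligible (C : set (Borel X)).
  rewrite compact_cover => /(_ X setT (fun y => [set (y * z)%g | z in U])) [||D _ DC].
  - by move=> y _; exact: oyU.
  - by move=> y _; exists (y * x^-1)%g => //; exists x => //; rewrite mulgVK.
  apply: (@negligibleS _ (Borel X) R mu _ C DC); rewrite /cover bigcup_fset.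
  elim/big_ind: _ => [|A B|y _]; [exact: negligible_set0|exact: negligibleU|].
  exists [set (y * z)%g | z in U]; split => //; first exact: Borel_open.
  by rewrite -[RHS]U0; exact: mul y U (Borel_open oU).
have : mu.-negligible [set: Borel X].
  pose E n : set X := [set lprod Y n | Y in [set Y : nat -> g | forall i, `|Y i| <= 1]].
  apply: (@negligibleS _ (Borel X) R mu (\bigcup_n (E n : set (Borel X)))); last first.
    by apply: negligible_bigcup => n; apply: nullC; exact: lprod_compact.
  by move=> y _; have [n [Y [Yr ->]]] := lprod_exhausts ltr01 y; exists n => //; exists Y.
by move=> [A [mA A0]]; rewrite subTset => <-; rewrite A0.
Qed.

Lemma bounded_KAK_compact (T : R) : compact
  [set z : X | exists k1 t k2, [/\ maxK k1, 0 <= t <= T, maxK k2 & z = (k1 * a_ X t * k2)%g]].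
Proof.
pose S := (@maxK R X `*` [set` `[0, T]]) `*` @maxK R X.
have cS : compact S by apply: compact_setX => //; apply: compact_setX => //; exact: segment_compact.
pose f (p : X * R * X) := (p.1.1 * a_ X p.1.2 * p.2)%g.
have cf : continuous f.
  move=> p; apply: mulg_cvg; last exact: cvg_snd.
  have c1 : (fun p : X * R * X => p.1) @ p --> p.1 by exact: cvg_fst.
  have c11 : (fun p : X * R * X => p.1.1) @ p --> p.1.1 by apply: cvg_comp c1 _; exact: cvg_fst.
  have c12 : (fun p : X * R * X => p.1.2) @ p --> p.1.2 by apply: cvg_comp c1 _; exact: cvg_snd.
  apply: mulg_cvg => //.
  by apply: (@cvg_comp _ _ _ (fun p : X * R * X => p.1.2) (a_ X) _ (nbhs p.1.2)); [exact: c12|exact: a_continuous].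
rewrite (_ : [set z | _] = f @` S).
  by apply: continuous_compact => //; exact: continuous_subspaceT.
apply/seteqP; split => [_ [k1 [t [k2 [k1K tT k2K ->]]]]|_ [[[k1 t] k2] /= [[k1K tT] k2K] <-]].
  by exists ((k1, t), k2) => //; split => //=; split => //=; rewrite in_itv.
by exists k1, t, k2; split => //; move: tT; rewrite /= in_itv.
Qed.

(** By the polar integration formula an open set missing K A K is null. With T chosen so that Tt T >
    tau x + 1, the part of K A K where tau < tau x + 1 lies in the compact set t <= T; if x were
    outside that set, it would have a null open neighbourhood. *)
Theorem KAK_decomposition x : exists k1 t k2, [/\ maxK k1, 0 <= t, maxK k2 & x = (k1 * a_ X t * k2)%g].
Proof.
have [T T0 TM] := Tt_unbounded (tau x + 1).
set C := [set z : X | exists k1 t k2, [/\ maxK k1, 0 <= t <= T, maxK k2 & z = (k1 * a_ X t * k2)%g]].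
have [[k1 [t [k2 [k1K /andP[t0 _] k2K xE]]]]|xC] := pselect (C x); first by exists k1, t, k2.
exfalso; pose U := [set z | tau z < tau x + 1] `&` ~` C.
have oU : open U.
  apply: openI.
    have := @open_comp _ _ tau [set r | r < tau x + 1]; apply => [z _|]; first exact: tau_continuous.
    exact: open_lt.
  by apply: closed_openC; apply: compact_closed; [exact: group_hausdorff|exact: bounded_KAK_compact].
apply: (@mu_open_neq0 U x oU); first by split => //=; rewrite ltrDl.
apply: mu_polar_null => // k1 t k2 k1K t0 k2K [/= tU]; apply.
exists k1, t, k2; split => //; rewrite t0 /=.
move: tU; rewrite tau_Kr// tau_Kl// tau_a => tU; rewrite leNgt; apply/negP => Tt'.
by have := Tt_lt (ltW T0) Tt'; lra.
Qed.

(** Inversion of k1 a_t k2 replaces t by -t, and [Tt] is even. *)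
Lemma tauV x : tau x^-1%g = tau x.
Proof.
have [k1 [t [k2 [k1K _ k2K ->]]]] := KAK_decomposition x.
rewrite tau_Kr// tau_Kl// invgM tau_Kl; last exact: maxKV.
rewrite invgM tau_Kr; last exact: maxKV.
by rewrite -a_N !tau_a TtN.
Qed.

Lemma nn_Adj_a (t : R) Z : Z \in nn X -> Adj (a_ X t) Z \in nn X.
Proof.
move=> /memv_addP[a aE [b bE ->]]; have /root_spaceP Ha := aE; have /root_spaceP Hb := bE.
rewrite linearD /= (Adj_a _ Ha) (Adj_a _ Hb); apply: memvD; apply: memvZ.
  exact: (subvP (addvSl _ _)).
exact: (subvP (addvSr _ _)).
Qed.

Lemma nn_mul Z W : Z \in nn X -> W \in nn X ->
  exists2 V, V \in nn X & (ex Z * ex W)%g = ex V.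
Proof.
move=> ZN WN; have ZW := nn_br ZN WN.
exists (Z + W + 2^-1 *: br Z W).
  by apply: memvD; [exact: memvD|apply: memvZ; exact: (subvP (addvSr _ _))].
by apply: (lexD_two_step lieE cG lieB); apply: nn_br2.
Qed.

Lemma Adj_unip_X0 Z : Z \in nn X -> Adj (ex Z) (X0 X) = X0 X.
Proof.
have [_ _ _ _ nX] := X0P X => ZN.
by have := Ad_fixed lieE cG 1 (nX _ ZN); rewrite scale1r.
Qed.

Lemma Adj_a_X0 (t : R) : Adj (a_ X t) (X0 X) = expR (q0 X * t) *: X0 X.
Proof. by have [_ _ HX _ _] := X0P X; exact: Adj_a. Qed.

Lemma tau_ge0 x : 0 <= tau x.
Proof. by apply: sumr_ge0 => p _; exact: ip_self_ge0. Qed.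

(* The part of AN on which tau is bounded is compact: Ad(b) acts on the top root vector by a power of the A-part, and Ad(exp Z) H = H - [H, Z]. *)
Lemma AN_bounded (M : R) : exists T, forall (t : R) Z, Z \in nn X -> tau (a_ X t * ex Z)%g <= M ->
  `|t| <= T /\ ip Z Z <= T.
Proof.
have [_ X1 _ XN _] := X0P X; have qp := q0_gt0 X.
pose T := `|M| / (2 * q0 X); exists (`|T| + `|Tt T * M|) => t Z ZN tM.
have M0 : 0 <= M by apply: le_trans tM; exact: tau_ge0.
have b1 : expR (2 * (q0 X * t)) <= M.
  have := tau_bound (a_ X t * ex Z)%g (X0 X).
  rewrite AdjM Adj_unip_X0// Adj_a_X0 ipZl ip_scaler X1 !mulr1 -expRD => h.
  by apply: le_trans tM; apply: le_trans h; rewrite ler_expR; lra.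
(* The same estimate for the inverse, through [tauV], bounds t from the other side. *)
have b2 : expR (- (2 * (q0 X * t))) <= M.
  have := tau_bound (a_ X t * ex Z)^-1%g (X0 X).
  rewrite tauV invgM -a_N -(lexN lieE) AdjM Adj_a_X0 linearZ /= Adj_unip_X0 ?memvN//.
  rewrite ipZl ip_scaler X1 !mulr1 -expRD => h.
  by apply: le_trans tM; apply: le_trans h; rewrite ler_expR; lra.
have e1 := expR_ge1Dx (2 * (q0 X * t)); have e2 := expR_ge1Dx (- (2 * (q0 X * t))).
have tT : `|t| <= T.
  rewrite /T (ger0_norm M0) ler_pdivlMr ?mulr_gt0//.
  by case: (lerP 0 t) => ht; [rewrite ger0_norm|rewrite ltr0_norm]; nra.
have T0 : 0 <= T by apply: le_trans tT.
split; first by rewrite (le_trans tT)// (ger0_norm T0) lerDl.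
have TtT : Tt t <= Tt T.
  have -> : Tt t = Tt `|t| by case: (lerP 0 t) => ht; [rewrite ger0_norm|rewrite ltr0_norm// TtN].
  by move: tT; rewrite le_eqVlt => /orP[/eqP ->//|/(Tt_lt (normr_ge0 _))/ltW].
have [HZN ZHZ ZZ] := nn_adH ZN.
have AH : Adj (ex Z) H = H - br H Z.
  have h : br Z (br Z H) = 0 by rewrite (brC lieB Z H) (brNr lieB) ZHZ oppr0.
  by have := Ad_unipotent lieE cG 1 h; rewrite !scale1r (brC lieB Z H).
have HH : br H H = 0 by exact: (brxx lieB).
have tZ : tau (ex Z) <= Tt T * M.
  have -> : ex Z = (a_ X (- t) * (a_ X t * ex Z))%g by rewrite mulgA -a_D addNr a_0 mul1g.
  apply: le_trans (tauM _ _) _; rewrite tau_a TtN; apply: ler_pM => //.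
  by rewrite -tau_a tau_ge0.
  exact: tau_ge0.
have := tau_bound (ex Z) H; rewrite AH ipHH mulr1 ipDl !ip_addr ip_oppl !ip_oppr ip_oppl.
rewrite (ipC H) (nn_orth0 HZN HH) ipHH => h.
have := ler_norm (Tt T * M); have := normr_ge0 T; lra.
Qed.

Lemma is_derive_tau y W : is_derive (0 : R) 1 (fun s : R => tau (y * ex (s *: W))%g)
  (\sum_(p <- eb) 2 * ip (Adj y (br W p.1)) (Adj y p.1)).
Proof.
apply: is_derive_seqsum => p.
have d := is_derive_lin (L := Adj y) (@linear_continuous_fd _ g g (Adj y)) (is_derive_Adj W p.1 0).
rewrite scale0r (lie_exp0 lieE) Adj1 in d.
rewrite (_ : (fun s : R => _) = fun s : R => ip (Adj y (Adj (ex (s *: W)) p.1)) (Adj y (Adj (ex (s *: W)) p.1))).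
  apply: (is_derive_eq (is_derive_ip d d)); rewrite scale0r (lie_exp0 lieE) Adj1 (ipC (Adj y p.1)); ring.
by apply/funext => s; rewrite AdjM.
Qed.

(** Let y minimise tau on x A N. Its derivative vanishes in the directions of n and H, as A N is
    stable under right multiplication by them, and in those of k by invariance, hence in all
    directions. For y = k1 a_t k2 the direction Ad(k2^-1) H gives dTt t = 0, so t = 0 and y lies in
    K. *)
Theorem iwasawa x : exists k t Z, [/\ maxK k, Z \in nn X & x = (k * a_ X t * ex Z)%g].
Proof.
pose F (p : R * g) := tau (x * a_ X p.1 * ex p.2)%g.
have cF : continuous F.
  move=> p; apply: (@cvg_comp _ _ _ (fun p : R * g => (x * a_ X p.1 * ex p.2)%g) tau _ (nbhs (x * a_ X p.1 * ex p.2)%g));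
    last exact: tau_continuous.
  have c1 : (fun p : R * g => p.1) @ p --> p.1 by exact: cvg_fst.
  have c2 : (fun p : R * g => p.2) @ p --> p.2 by exact: cvg_snd.
  apply: mulg_cvg; last first.
    by apply: (@cvg_comp _ _ _ (fun p : R * g => p.2) ex _ (nbhs p.2)); [exact: c2|exact: (lex_continuous lieE)].
  apply: mulg_cvg; first exact: cvg_cst.
  by apply: (@cvg_comp _ _ _ (fun p : R * g => p.1) (a_ X) _ (nbhs p.1)); [exact: c1|exact: a_continuous].
pose S := [set p : R * g | p.2 \in nn X /\ F p <= tau x].
have S0 : S !=set0 by exists (0, 0); split => /=; rewrite ?mem0v// /F /= a_0 (lie_exp0 lieE) !mulg1.
(* tau(an) <= tau(x^-1) tau(xan), so the sublevel set of [F] is bounded. *)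
have [T TP] := AN_bounded (tau x^-1%g * tau x).
have cS : compact S.
  have cB : compact ([set` `[- T, T]] `*` [set Z : g | Z \in nn X /\ ip Z Z <= T]).
    apply: compact_setX; first exact: segment_compact.
    have [c c0 cP] := ip_norm_bounds (@ipC R X) (@ipDl R X) (@ipZl R X) (@ip_gt0 R X).
    apply: (@closed_bounded_compact _ _ _ (c^-1 * `|T| + 1)).
      apply: closedI; first exact: vspace_closed.
      have /= := @closed_comp _ _ (fun x : g => ip x x) [set r | r <= T].
      by apply => [z _|]; [apply: ip_cvg; exact: cvg_id|exact: closed_le].
    move=> Y [_ Yc]; have /andP[h _] := cP Y.
    have : `|Y| ^+ 2 <= c^-1 * `|T|.
      by rewrite mulrC ler_pdivlMr// mulrC (le_trans h)// (le_trans Yc)// ler_norm.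
    by have := normr_ge0 Y; nra.
  apply: subclosed_compact cB _.
    apply: closedI.
      apply: (@closed_comp _ _ (fun p : R * g => p.2) [set Z | Z \in nn X]); last exact: vspace_closed.
      by move=> p _; exact: cvg_snd.
    have /= := @closed_comp _ _ F [set r | r <= tau x].
    by apply => [z _|]; [exact: cF|exact: closed_le].
  move=> [t Z] [/= ZN Ft]; have [|t1 t2] := TP t Z ZN.
    have -> : (a_ X t * ex Z)%g = (x^-1 * (x * a_ X t * ex Z))%g by rewrite !mulgA mulVg mul1g.
    by apply: le_trans (tauM _ _) _; rewrite ler_wpM2l// tau_ge0.
  by split => //=; rewrite in_itv /= -ler_norml.
have [[t0 Z0] /[!inE] -[/= ZN Fx] Fmin] := compact_EVT_min S0 cS (continuous_subspaceT cF).
set y := (x * a_ X t0 * ex Z0)%g.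
have ymin t Z : Z \in nn X -> tau y <= tau (x * a_ X t * ex Z)%g.
  move=> ZN'; have [h|h] := lerP (tau (x * a_ X t * ex Z)%g) (tau x).
    by have := Fmin (t, Z); rewrite inE; apply.
  by apply: le_trans (ltW h).
pose dtau W := \sum_(p <- eb) 2 * ip (Adj y (br W p.1)) (Adj y p.1).
have dmin W : (forall s : R, tau y <= tau (y * ex (s *: W))%g) -> dtau W = 0.
  move=> h; apply: (local_min_derive (is_derive_tau y W)).
  by near=> s; rewrite scale0r (lie_exp0 lieE) mulg1.
have dN W : W \in nn X -> dtau W = 0.
  move=> WN; apply: dmin => s; have [V VN VE] := nn_mul ZN (memvZ s WN).
    have -> : (y * ex (s *: W))%g = (x * a_ X t0 * ex V)%g by rewrite /y -mulgA VE.
  exact: ymin.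
have dH : dtau H = 0.
  apply: dmin => s.
  have -> : (y * ex (s *: H))%g = (x * a_ X (t0 + s) * ex (Adj (a_ X (- s)) Z0))%g.
    rewrite /y -Adj_lex a_D -/(a_ X s) a_N invgK -!mulgA; do 2 congr (_ * _)%g.
    by rewrite !mulgA mulgV mul1g.
  by apply: ymin; exact: nn_Adj_a.
have dK W : th W = W -> dtau W = 0.
  move=> tW; apply: dmin => s; rewrite tau_Kr//.
  by exists (s *: W) => //=; rewrite leigP scale1r linearZ /= tW.
have dD U V : dtau (U + V) = dtau U + dtau V.
  rewrite /dtau -big_split; apply: eq_bigr => p _ /=.
  by rewrite (brDl lieB) linearD ipDl mulrDr.
have dZ (k : R) V : dtau (k *: V) = k * dtau V.
  rewrite /dtau mulr_sumr; apply: eq_bigr => p _ /=.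
  by rewrite (brZl lieB) linearZ ipZl mulrCA.
have d0 W : dtau W = 0.
  have [Y [h [n [-> tY nN]]]] := iwasawa_decomposition W.
  by rewrite !dD dZ dK// dH dN// mulr0 !addr0.
have [k1 [t [k2 [k1K t0' k2K yE]]]] := KAK_decomposition y.
have t00 : t = 0.
  apply/eqP; rewrite eq_le t0' andbT leNgt; apply/negP => /dTt_gt0.
  pose W := Adj k2^-1%g H.
  have := is_derive_tau y W; rewrite -/(dtau W) d0 => d.
  have dT : is_derive (0 : R) 1 (fun s : R => Tt (t + s)) (dTt t).
    apply: (is_derive_translate (f := Tt)); rewrite addr0; exact: is_derive_Tt.
  have -> : dTt t = 0; last by rewrite ltxx.
  apply: (is_derive_uniq dT).
  rewrite (_ : (fun s : R => _) = fun s : R => tau (y * ex (s *: W))%g)//.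
  apply/funext => s; rewrite /W -linearZ /= -Adj_lex invgK yE.
  rewrite -/(a_ X s) -!mulgA mulVKg !mulgA tau_Kr// -mulgA -a_D.
  by rewrite tau_Kl// tau_a.
exists (k1 * k2)%g, (- t0), (Adj (a_ X t0) (- Z0)); split; [exact: maxKM| |].
  by apply: nn_Adj_a; rewrite memvN.
have -> : (k1 * k2)%g = y by rewrite yE t00 a_0 mulg1.
rewrite -Adj_lex /y (lexN lieE) a_N -!mulgA.
by rewrite mulKg mulVKg mulgV mulg1.
Unshelve. all: by end_near. Qed.

(* Since Ad (k a_t n) X0 = e^(q0 t) Ad k X0 for the top root vector X0, this is
   the A-coordinate of x in KAN. *)
Definition height x : R := ln (ip (Adj x (X0 X)) (Adj x (X0 X))) / (2 * q0 X).

Lemma Adj_neq0 x V : V != 0 -> Adj x V != 0.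
Proof. by apply: contra => /eqP E; rewrite -(AdjVK x V) E linear0. Qed.

Lemma X0_neq0 : X0 X != 0.
Proof.
have [_ X1 _ _ _] := X0P X; apply/eqP => E; move: X1; rewrite E ip_zerol => /esym/eqP.
by rewrite oner_eq0.
Qed.

Lemma height_kan k (t : R) Z : maxK k -> Z \in nn X -> height (k * a_ X t * ex Z)%g = t.
Proof.
move=> kK ZN; have [_ X1 _ _ _] := X0P X; have q := q0_gt0 X.
rewrite /height !AdjM Adj_unip_X0// Adj_a_X0 linearZ /= ipZl ip_scaler maxK_ip// X1 mulr1 -expRD expRK.
by field; rewrite gt_eqF.
Qed.

(** [xget] selects some admissible t: [iwasawa] provides one, and [height_kan] shows that there is
    no other. *)
Lemma iwasawaHE x : iwasawaH x = height x.
Proof.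
rewrite /iwasawaH; case: xgetP => [t _ [k [n [kK [Z /= ZN <-] ->]]]|h].
  by rewrite height_kan.
have [k [t [Z [kK ZN xE]]]] := iwasawa x.
by exfalso; apply: (h t); exists k, (ex Z); split => //; exists Z.
Qed.

Lemma height_continuous : continuous height.
Proof.
move=> x; apply: cvgM; last exact: cvg_cst.
apply: (@cvg_comp _ _ _ (fun x => ip (Adj x (X0 X)) (Adj x (X0 X))) (@ln R) _ (nbhs (ip (Adj x (X0 X)) (Adj x (X0 X))))).
  by apply: ip_cvg; exact: Adj_continuous.
by apply: continuous_ln; apply: ip_gt0; apply: Adj_neq0; exact: X0_neq0.
Qed.

End InvariantMeasure.

End Polar.

(** * The radial part of the Laplacian *)

Section KIntegral.
Variables (R : realType) (X : rankOneSpace R).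
Local Notation g := (lie_alg X).
Local Notation br := (@bracket R X).
Local Notation th := (@cartan_inv R X).
Local Notation ex := (@lie_exp R X).
Local Notation H := (H0 X).
Local Notation K := (@maxK R X).
Implicit Types (U V W Y Z E : g) (x y k : X) (B : X -> R).

Let lieB : is_lie_bracket br := bracket_lie X.
Let lieE : is_lie_exp br ex := lie_expP X.
Let cG : connected [set: X] := @Defs.group_connected R X.

Variable kap : {measure set (Borel X) -> \bar R}.
Hypothesis kapP : is_haar_K kap.
Hypothesis cK : compact K.

Lemma K_integrable B : continuous B -> kap.-integrable (K : set (Borel X)) (EFin \o (B : Borel X -> R)).
Proof.
move=> cB; have [kK _ _] := kapP.
apply: measurable_bounded_integrable.
- exact: maxK_measurable.
- by rewrite kK ltry.
- by apply: measurable_funTS; exact: Borel_continuous.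
have cBK : compact (B @` K) by apply: continuous_compact => //; exact: continuous_subspaceT.
have [M [_ MP]] := compact_bounded cBK; exists M; split; first exact: num_real.
by move=> m Mm k kK'; apply: (MP _ Mm); exists k.
Qed.

Definition Kint B : R := (\int[kap]_(k in (K : set (Borel X))) B k)%R.

Lemma KintD B B' : continuous B -> continuous B' -> Kint (fun k => B k + B' k) = Kint B + Kint B'.
Proof. by move=> cB cB'; apply: RintegralD; [exact: maxK_measurable|exact: K_integrable|exact: K_integrable]. Qed.

Lemma KintZ (c : R) B : continuous B -> Kint (fun k => c * B k) = c * Kint B.
Proof. by move=> cB; apply: RintegralZl; [exact: maxK_measurable|exact: K_integrable]. Qed.

Lemma Kint_cst (c : R) : Kint (fun=> c) = c.
Proof. by rewrite /Kint /Rintegral kap_cst. Qed.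

Lemma Kint_translate B k : K k -> continuous B -> Kint (fun y => B (k * y)%g) = Kint B.
Proof.
move=> kK cB; have [_ _ inv] := kapP.
pose m (y : Borel X) : Borel X := (k * (y : X))%g.
have mm : measurable_fun setT m.
  apply: (@measurability _ _ (Borel X) (Borel X) setT m (@open X)) => //.
  move=> _ [A oA <-]; rewrite setTI; apply: Borel_open.
  by apply: open_comp => // y _; exact: mulgl_continuous.
have mK : m @^-1` K = K.
  apply/seteqP; split => y /= yK.
    by rewrite -(mulKg k y); apply: maxKM => //; exact: maxKV.
  exact: maxKM.
have pm A : measurable A -> pushforward kap m A = kap A.
  move=> mA; rewrite /pushforward -(inv _ _ (maxKV kK) mA); congr (kap _).
  apply/seteqP; split => [y /= yA|_ [y yA <-]] /=; first by exists (k * y)%g => //; rewrite mulKg.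
  by rewrite /m mulVKg.
rewrite /Kint /Rintegral; congr fine.
have iB := K_integrable cB.
have mKm := @maxK_measurable R X.
transitivity (\int[pushforward kap m]_(y in K) (B y)%:E)%E.
  rewrite [RHS]integral_pushforward//= ?mK//.
    by apply/measurable_EFinP; exact: Borel_continuous.
  by apply: K_integrable => y; apply: (@cvg_comp _ _ _ (fun y => (k * y)%g) B _ (nbhs (k * y)%g)); [exact: mulgl_continuous|exact: cB].
by apply: eq_measure_integral => A mA _; exact: pm.
Qed.

(** Differentiation along the right-invariant field of W, asked at every point so that it can be
    iterated. *)
Definition left_der W (B B' : X -> R) := forall y : X,
  is_derive (0 : R) 1 (fun r : R => B (ex (r *: W) * y)%g) (B' y).

Lemma left_derE W B B' y (r : R) : left_der W B B' ->
  is_derive r 1 (fun r : R => B (ex (r *: W) * y)%g) (B' (ex (r *: W) * y)%g).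
Proof.
move=> d; have dr := d (ex (r *: W) * y)%g.
have E : (fun r0 : R => B (ex (r0 *: W) * y)%g) = (fun s : R => B (ex ((- r + s) *: W) * (ex (r *: W) * y))%g).
  apply/funext => s; rewrite mulgA -(lexD lieE); congr (B (ex (_ *: _) * y)%g); ring.
rewrite E; apply: (is_derive_translate (f := fun s : R => B (ex (s *: W) * (ex (r *: W) * y))%g)).
by rewrite addNr; exact: dr.
Qed.

Lemma orbit_continuous W x : continuous (fun p : R * X => (ex (p.1 *: W) * x * p.2)%g).
Proof.
move=> p; have c1 : (fun p : R * X => p.1) @ p --> p.1 by exact: cvg_fst.
have c2 : (fun p : R * X => p.2) @ p --> p.2 by exact: cvg_snd.
apply: mulg_cvg => //; apply: mulg_cvg; last exact: cvg_cst.
apply: (@cvg_comp _ _ _ (fun p : R * X => p.1 *: W) ex _ (nbhs (p.1 *: W))); last exact: (lex_continuous lieE).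
by apply: cvgZr_tmp.
Qed.

Lemma Kint_derive W B B' x (r : R) : continuous B -> continuous B' -> left_der W B B' ->
  is_derive r 1 (fun r : R => Kint (fun k => B (ex (r *: W) * x * k)%g)) (Kint (fun k => B' (ex (r *: W) * x * k)%g)).
Proof.
move=> cB cB' dB.
pose f (s : R) (k : Borel X) : R := B (ex (s *: W) * x * (k : X))%g.
have co (C : X -> R) : continuous C -> continuous (fun p : R * X => C (ex (p.1 *: W) * x * p.2)%g).
  move=> cC p; apply: (@cvg_comp _ _ _ (fun p : R * X => (ex (p.1 *: W) * x * p.2)%g) C _ (nbhs (ex (p.1 *: W) * x * p.2)%g)); last exact: cC.
  exact: orbit_continuous.
have cs (C : X -> R) s : continuous C -> continuous (fun k : X => C (ex (s *: W) * x * k)%g).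
  move=> cC k; apply: (@cvg_comp _ _ _ (fun k : X => (ex (s *: W) * x * k)%g) C _ (nbhs (ex (s *: W) * x * k)%g)); last exact: cC.
  exact: mulgl_continuous.
have df (s : R) k : is_derive s 1 (f ^~ k) (B' (ex (s *: W) * x * (k : X))%g).
  rewrite /f; have := left_derE (x * (k : X))%g s dB.
  rewrite mulgA; under eq_fun do rewrite mulgA; exact.
have cS : compact ([set` `[r - 1, r + 1]] `*` K) by apply: compact_setX => //; exact: segment_compact.
have cBK := continuous_compact (continuous_subspaceT (co B' cB')) cS.
have [M [_ MP]] := compact_bounded cBK.
have mK := @maxK_measurable R X.
have := @cvg_differentiation_under_integral R _ (Borel X) kap f K mK r (r - 1) (r + 1) _ _ _ (fun=> `|M| + 1) _ _ _.
have r1 : `]r - 1, r + 1[%classic r by rewrite /= in_itv /=; apply/andP; split; lra.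
move=> /(_ r1); have i1 : forall s, `]r - 1, r + 1[%classic s -> kap.-integrable K (EFin \o f s).
  by move=> s _; apply: K_integrable; exact: (cs B s cB).
move=> /(_ i1); have i2 : forall s k, `]r - 1, r + 1[%classic s -> K k -> derivable (f ^~ k) s 1.
  by move=> s k _ _; exact: ex_derive.
move=> /(_ i2); have i3 : forall y : Borel X, 0 <= `|M| + 1 by move=> _; rewrite addr_ge0.
move=> /(_ i3); have i4 : kap.-integrable K (EFin \o (fun=> `|M| + 1 : R)).
  by apply: (K_integrable (B := fun=> `|M| + 1)); exact: cst_continuous.
move=> /(_ i4); have dE s k : partial1of2 f s k = B' (ex (s *: W) * x * (k : X))%g.
  by rewrite partial1of2E; exact: (@derive_val _ _ _ _ _ _ _ (df s k)).
have i5 : forall s k, `]r - 1, r + 1[%classic s -> K k -> `|partial1of2 f s k| <= `|M| + 1.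
  move=> s k; rewrite /= in_itv /= => /andP[s1 s2] kK; rewrite dE.
  apply: (MP (`|M| + 1)); first by rewrite (le_lt_trans (ler_norm M))// ltrDl.
  by exists (s, k) => //; split => //=; rewrite in_itv /= !ltW.
move=> /(_ i5) h; apply/is_derive_cvgP.
under eq_cvg do rewrite [_ *: 1]mulr1.
rewrite (_ : Kint _ = (\int[kap]_(y in (K : set (Borel X))) partial1of2 f r y)%R)//.
by apply: eq_Rintegral => k _; rewrite dE.
Qed.

Lemma Adj_br x U V : Adj x (br U V) = br (Adj x U) (Adj x V).
Proof.
have d1 := is_derive_lin (L := Adj x) (@linear_continuous_fd _ g g (Adj x)) (is_derive_Adj U V 0).
have d2 := is_derive_Adj (Adj x U) (Adj x V) 0.
rewrite scale0r (lie_exp0 lieE) Adj1 in d1; rewrite scale0r (lie_exp0 lieE) Adj1 in d2.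
apply: (is_derive_uniq d1).
rewrite (_ : (fun s : R => Adj x _) = fun s : R => Adj (ex (s *: Adj x U)) (Adj x V))//.
by apply/funext => s; rewrite -linearZ /= -Adj_lex !AdjM AdjVK.
Qed.

Local Notation q := (q0 X).
(** [hN] is e^(2 q height); [h1 W] and [h2 W] are the first and second derivatives of [height] along
    W. *)
Definition hN x := ip (Adj x (X0 X)) (Adj x (X0 X)).
Definition h1 W x := ip (br W (Adj x (X0 X))) (Adj x (X0 X)) / (q * hN x).
Definition h2 W x :=
  (ip (br W (br W (Adj x (X0 X)))) (Adj x (X0 X)) + ip (br W (Adj x (X0 X))) (br W (Adj x (X0 X)))) / (q * hN x)
  - 2 * ip (br W (Adj x (X0 X))) (Adj x (X0 X)) ^+ 2 / (q * hN x ^+ 2).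

Lemma hN_gt0 x : 0 < hN x.
Proof. by apply: ip_gt0; apply: Adj_neq0; exact: X0_neq0. Qed.

Lemma is_derive_orbit W x : is_derive (0 : R) 1 (fun r : R => Adj (ex (r *: W) * x)%g (X0 X)) (br W (Adj x (X0 X))).
Proof.
have := is_derive_Adj W (Adj x (X0 X)) 0; rewrite scale0r (lie_exp0 lieE) Adj1.
rewrite (_ : (fun t : R => _) = fun r : R => Adj (ex (r *: W) * x)%g (X0 X))//.
by apply/funext => s; rewrite AdjM.
Qed.

Lemma is_derive_br W (u : R -> g) (t : R) u' : is_derive t 1 u u' ->
  is_derive t 1 (fun s => br W (u s)) (br W u').
Proof. exact: (is_derive_lin (L := br W) (@linear_continuous_fd _ g g (br W))). Qed.

Lemma left_der_hN W : left_der W hN (fun x => 2 * ip (br W (Adj x (X0 X))) (Adj x (X0 X))).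
Proof.
move=> x; have d := is_derive_orbit W x.
apply: (is_derive_eq (is_derive_ip d d)).
by rewrite scale0r (lie_exp0 lieE) mul1g (ipC (Adj x _)); ring.
Qed.

Lemma left_der_height W : left_der W (@height R X) (h1 W).
Proof.
move=> x; have d := left_der_hN W x; have q0 := q0_gt0 X; have n0 := hN_gt0 x.
have dl := is_derive1_ln n0.
have dl' : is_derive (hN (ex (0 *: W) * x)%g) 1 (@ln R) (hN x)^-1.
  by rewrite scale0r (lie_exp0 lieE) mul1g.
have d2 := is_derive_comp1 (V := R^o) (f := fun r : R => hN (ex (r *: W) * x)%g) (F := @ln R) d dl'.
have d3 := is_deriveM d2 (is_derive_cst ((2 * q)^-1 : R) (0 : R) 1).
apply: (is_derive_eq d3); rewrite scaler0 add0r /GRing.scale /= /h1.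
by field; rewrite !gt_eqF.
Qed.

Lemma left_der_h1 W : left_der W (h1 W) (h2 W).
Proof.
move=> x; have d := is_derive_orbit W x; have q0 := q0_gt0 X; have n0 := hN_gt0 x.
have d1 := is_derive_ip (is_derive_br W d) d.
have d2 := left_der_hN W x.
have x0 : (ex (0 *: W) * x = x)%g by rewrite scale0r (lie_exp0 lieE) mul1g.
have n0' : q * hN (ex (0 *: W) * x)%g != 0 by rewrite x0 mulf_neq0// gt_eqF.
have d4 := is_deriveM (is_derive_cst (q : R) (0 : R) 1) d2.
have d5 := @is_deriveV R (fun r : R => q * hN (ex (r *: W) * x)%g) 0 _ 1 n0' d4.
apply: (is_derive_eq (is_deriveM d1 d5)).
rewrite /= x0 scaler0 addr0 /GRing.scale /= /h2.
by rewrite expr2; field; rewrite !gt_eqF.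
Qed.

Lemma Adj_X0_cvg x : (fun y => Adj y (X0 X)) @ x --> Adj x (X0 X).
Proof. exact: Adj_continuous. Qed.

Lemma br_cvg W (T : Type) (F : set_system T) {FF : Filter F} (u : T -> g) U :
  u @ F --> U -> (fun t => br W (u t)) @ F --> br W U.
Proof.
move=> uU; apply: (@cvg_comp _ _ _ u (br W) _ (nbhs U)) => //.
exact: (@linear_continuous_fd _ g g (br W)).
Qed.

Lemma hN_continuous : continuous hN.
Proof. by move=> x; apply: ip_cvg; exact: Adj_X0_cvg. Qed.

Lemma h1_continuous W : continuous (h1 W).
Proof.
move=> x; have q0 := q0_gt0 X; have n0 := hN_gt0 x; have c := @Adj_X0_cvg x.
apply: cvgM; first by apply: ip_cvg => //; exact: br_cvg.
apply: cvgV; first by rewrite mulf_neq0// gt_eqF.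
by apply: cvgM; [exact: cvg_cst|exact: hN_continuous].
Qed.

Lemma h2_continuous W : continuous (h2 W).
Proof.
move=> x; have q0 := q0_gt0 X; have n0 := hN_gt0 x; have c := @Adj_X0_cvg x.
have c1 : (fun y => br W (Adj y (X0 X))) @ x --> br W (Adj x (X0 X)) by exact: br_cvg.
have c2 : (fun y => br W (br W (Adj y (X0 X)))) @ x --> br W (br W (Adj x (X0 X))) by exact: br_cvg.
 have cN := @hN_continuous x.
apply: cvgB; apply: cvgM.
- by apply: cvgD; apply: ip_cvg.
- apply: cvgV; first by rewrite mulf_neq0// gt_eqF.
  by apply: cvgM; [exact: cvg_cst|exact: cN].
- apply: cvgM; first exact: cvg_cst.
  by rewrite expr2; under eq_cvg do rewrite expr2; apply: cvgM; apply: ip_cvg.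
- apply: cvgV; first by rewrite mulf_neq0 ?expf_neq0// gt_eqF.
  apply: cvgM; first exact: cvg_cst.
  by rewrite expr2; under eq_cvg do rewrite expr2; apply: cvgM; exact: cN.
Qed.

Section RadialEquation.
Variables (F F1 F2 : R -> R).
Hypotheses (dF : forall t : R, is_derive t 1 F (F1 t)) (dF1 : forall t : R, is_derive t 1 F1 (F2 t)).
Hypothesis cF2 : continuous F2.

Definition B0 x := F (height x).
Definition B1 W x := F1 (height x) * h1 W x.
Definition B2 W x := F2 (height x) * h1 W x ^+ 2 + F1 (height x) * h2 W x.

Lemma left_der_B0 W : left_der W B0 (B1 W).
Proof.
move=> x; have x0 : (ex (0 *: W) * x = x)%g by rewrite scale0r (lie_exp0 lieE) mul1g.
have dF' : is_derive (height (ex (0 *: W) * x)%g) 1 F (F1 (height x)) by rewrite x0.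
exact: (is_derive_comp1 (V := R^o) (left_der_height W x) dF').
Qed.

Lemma left_der_B1 W : left_der W (B1 W) (B2 W).
Proof.
move=> x; have x0 : (ex (0 *: W) * x = x)%g by rewrite scale0r (lie_exp0 lieE) mul1g.
have dF' : is_derive (height (ex (0 *: W) * x)%g) 1 F1 (F2 (height x)) by rewrite x0.
have d1 := is_derive_comp1 (V := R^o) (left_der_height W x) dF'.
apply: (is_derive_eq (is_deriveM d1 (left_der_h1 W x))).
by rewrite x0 /B2 /GRing.scale /=; ring.
Qed.

Lemma F_continuous : continuous F.
Proof. by move=> t; exact/differentiable_continuous/derivable1_diffP/(@ex_derive _ _ _ _ _ _ _ (dF t)). Qed.
Lemma F1_continuous : continuous F1.
Proof. by move=> t; exact/differentiable_continuous/derivable1_diffP/(@ex_derive _ _ _ _ _ _ _ (dF1 t)). Qed.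

Lemma comp_height_continuous (f : R -> R) : continuous f -> continuous (fun x : X => f (height x)).
Proof.
move=> cf x; apply: (@cvg_comp _ _ _ (@height R X) f _ (nbhs (height x))); last exact: cf.
exact: height_continuous.
Qed.

Lemma B0_continuous : continuous B0.
Proof. exact: comp_height_continuous F_continuous. Qed.
Lemma B1_continuous W : continuous (B1 W).
Proof.
by move=> x; apply: cvgM; [exact: comp_height_continuous F1_continuous x|exact: h1_continuous].
Qed.
Lemma B2_continuous W : continuous (B2 W).
Proof.
move=> x; apply: cvgD; apply: cvgM.
- exact: comp_height_continuous cF2 x.
- by rewrite expr2; under eq_cvg do rewrite expr2; apply: cvgM; exact: h1_continuous.
- exact: comp_height_continuous F1_continuous x.
- exact: h2_continuous.
Qed.

(** For B = F o height this is the mean over K of F(H(a_t^-1 k)), the shape of the integral that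
    defines the spherical function. *)
Definition psi (B : X -> R) (t : R) := Kint (fun k => B (a_ X (- t) * k)%g).

Lemma a_psi B (t : R) : psi B t = Kint (fun k => B (ex (t *: - H) * 1 * k)%g).
Proof. by congr Kint; apply/funext => k; rewrite mulg1 /a_ scalerN scaleNr. Qed.

Lemma psi_derive B B' (t : R) : continuous B -> continuous B' -> left_der (- H) B B' ->
  is_derive t 1 (psi B) (psi B' t).
Proof.
move=> cB cB' d; rewrite a_psi (_ : psi B = fun t : R => Kint (fun k => B (ex (t *: - H) * 1 * k)%g)).
  exact: Kint_derive.
by apply/funext => s; exact: a_psi.
Qed.

Definition coshr (t : R) : R := (expR t + expR (- t)) / 2.

Lemma Adj_a_Y p (t : R) : p \in nbs X -> Adj (a_ X (- t)) (p.1 + th p.1) =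
  coshr (p.2 * t) *: (p.1 + th p.1) - Defs.sinh (p.2 * t) *: (p.1 - th p.1).
Proof.
move=> /nbsP[p1 pH pN _].
rewrite linearD /= (Adj_a _ pH) (Adj_a _ (th_eig pH)) /coshr /Defs.sinh mulrN mulrNN; vecf.
Qed.

(** The mean over K is unchanged under k -> exp(sY) k, as Y is fixed by theta. Moved past a_(-t),
    this becomes translation by exp(sW), so derivatives along W have mean 0. *)
Lemma Kint_rotation p (t : R) : p \in nbs X ->
  Kint (fun k => B2 (Adj (a_ X (- t)) (p.1 + th p.1)) (a_ X (- t) * k)%g) = 0.
Proof.
move=> pe; set Y := p.1 + th p.1; set W := Adj _ _.
have YK (s : R) : K (ex (s *: Y)).
  by exists (s *: Y) => //=; rewrite leigP scale1r linearZ /= /Y linearD /= thK addrC.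
have cst_ B : continuous B -> forall s : R, Kint (fun k => B (ex (s *: W) * a_ X (- t) * k)%g) = Kint (fun k => B (a_ X (- t) * k)%g).
  move=> cB s; rewrite -[RHS](Kint_translate (YK s)).
    by congr Kint; apply/funext => k; rewrite /W -linearZ /= -Adj_lex mulgVK !mulgA.
  move=> k; apply: (@cvg_comp _ _ _ (fun k => (a_ X (- t) * k)%g) B _ (nbhs (a_ X (- t) * k)%g)); last exact: cB.
  exact: mulgl_continuous.
have d0 B B' : continuous B -> continuous B' -> left_der W B B' -> Kint (fun k => B' (a_ X (- t) * k)%g) = 0.
  move=> cB cB' d; have := Kint_derive (a_ X (- t)) 0 cB cB' d.
  rewrite (_ : (fun r : R => _) = cst (Kint (fun k => B (a_ X (- t) * k)%g))).
    rewrite (cst_ _ cB') => h; exact: (is_derive_uniq h (is_derive_cst _ _ _)).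
  by apply/funext => s; exact: cst_.
exact: (d0 _ _ (@B1_continuous W) (@B2_continuous W) (@left_der_B1 W)).
Qed.

Variable mu : {measure set (Borel X) -> \bar R}.
Hypothesis muP : is_invariant_measure kap mu.

(** By Iwasawa U is e^(qt) Ad k X0, and the frame may be rotated by Ad k, which reduces both sums to
    the vector X0: the first is then [casimir_X0], the second follows from [ip_br_X0]. *)
Lemma casimir_orbit x : let U := Adj x (X0 X) in
  \sum_(p <- pframe X) p.2 * ip (br p.1 U) (br p.1 U) = hN x * (q ^+ 2 + q * rho X) /\
  \sum_(p <- pframe X) p.2 * ip (br p.1 U) U ^+ 2 = hN x ^+ 2 * q ^+ 2.
Proof.
move=> U; have [_ X1 HX XN nX] := X0P X.
have [k [t [Z [kK ZN xE]]]] := iwasawa kapP muP cK x.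
have UE : U = expR (q * t) *: Adj k (X0 X).
  by rewrite /U xE !AdjM Adj_unip_X0// Adj_a_X0 linearZ.
have NE : hN x = expR (q * t) ^+ 2.
  by rewrite /hN -/U UE ipZl ip_scaler maxK_ip// X1 mulr1 expr2.
pose W0 := passmx.leigenspace th (- 1).
have W0P V : (V \in W0) = (th V == - V) by rewrite leigP scaleN1r.
have fP : frame (@ip R X) W0 [seq (Adj k p.1, p.2) | p <- pframe X].
  apply: (frame_image (A' := Adj k^-1%g)); first exact: pframeP.
  - by move=> V; rewrite !W0P => /eqP tV; rewrite /= -maxK_theta// tV linearN.
  - by move=> V; rewrite !W0P => /eqP tV; rewrite -(maxK_theta _ (maxKV kK)) tV linearN.
  - exact: AdjKV.
  - by move=> *; exact: maxK_ip.
have tr (b : g -> g -> R) := frame_trace (@ipC R X) (b := b) (pframeP X) fP.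
split.
  rewrite (tr (fun P P' => ip (br P U) (br P' U))).
  - rewrite big_map NE -casimir_X0 mulr_sumr; apply: eq_bigr => p _ /=.
    by rewrite UE !(brZr lieB) -!Adj_br ipZl ip_scaler maxK_ip//; ring.
  - by move=> *; rewrite (brDl lieB) ipDl.
  - by move=> *; rewrite (brZl lieB) ipZl.
  - by move=> *; rewrite (brDl lieB) ip_addr.
  - by move=> *; rewrite (brZl lieB) ip_scaler.
rewrite (eq_bigr (fun p : g * R => p.2 * (ip (br p.1 U) U * ip (br p.1 U) U))); last by move=> p _; rewrite expr2.
rewrite (tr (fun P P' => ip (br P U) U * ip (br P' U) U)).
- rewrite big_map NE /=.
  have E : \sum_(p <- pframe X) p.2 * ip H p.1 ^+ 2 = 1.
    have [_ pE] := pframeP X; have HW : H \in W0 by rewrite W0P thH.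
    have := congr1 (ip H) (pE _ HW); rewrite ipHH (ip_sumr (@ipC R X) (@ipDl R X) (@ipZl R X)) => ->.
    by apply: eq_bigr => p _; rewrite ip_scaler expr2 mulrA.
  rewrite -[RHS]mulr1 -E mulr_sumr; apply: eq_bigr => p _.
  rewrite UE !(brZr lieB) -!Adj_br !ipZl !ip_scaler maxK_ip// ip_br_X0 (ipC H); ring.
- by move=> *; rewrite (brDl lieB) ipDl mulrDl.
- by move=> *; rewrite (brZl lieB) ipZl; ring.
- by move=> *; rewrite (brDl lieB) ipDl mulrDr.
- by move=> *; rewrite (brZl lieB) ipZl; ring.
Qed.

(** W = cY - sZ with ad Y skew and ad Z symmetric. By the Jacobi identity and [Z, Y] = -2 p.2 H, the
    mixed term <[Y, U], [Z, U]> is -p.2 <[H, U], U>; this is the source of the coefficient cosh/sinh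
    of the first-order term. *)
Lemma rotation_term p (t : R) x : p \in nbs X -> t != 0 ->
  let U := Adj x (X0 X) in let W := Adj (a_ X (- t)) (p.1 + th p.1) in
  let s := Defs.sinh (p.2 * t) in let c := coshr (p.2 * t) in
  let Z := p.1 - th p.1 in
  2^-1 * s ^- 2 * B2 W x + p.2 * c / s * B1 (- H) x =
  F2 (height x) * (2^-1 * ip (br Z U) U ^+ 2 / (q * hN x) ^+ 2) +
  F1 (height x) * (ip (br Z U) (br Z U) / (q * hN x) - ip (br Z U) U ^+ 2 / (q * hN x ^+ 2)).
Proof.
move=> pe t0 U W s c Z; set Y := p.1 + th p.1.
have [p1 pH pN p12] := nbsP pe.
have q0 := q0_gt0 X; have n0 := hN_gt0 x.
have s0 : s != 0.
  have p2 : 0 < p.2 by case: p12 => ->.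
  case: (ltgtP t 0) t0 => // ht _.
    have -> : s = - Defs.sinh (- (p.2 * t)) by rewrite /s /Defs.sinh opprK; field.
    by rewrite oppr_eq0 gt_eqF// sinh_gt0//; nra.
  by rewrite gt_eqF// sinh_gt0// mulr_gt0.
have WE : W = c *: Y - s *: Z by exact: Adj_a_Y.
have tY : th Y = Y by rewrite /Y linearD /= thK addrC.
have tZ : th Z = - Z by rewrite /Z linearB /= thK opprB.
have YU V V' : ip (br Y V) V' = - ip V (br Y V') by rewrite ip_br tY.
have ZU V V' : ip (br Z V) V' = ip V (br Z V') by rewrite ip_br tZ (brNl lieB) ip_oppr opprK.
have YUU : ip (br Y U) U = 0 by have := YU U U; rewrite (ipC U); lra.
have YZ : ip (br Y U) (br Z U) = - p.2 * ip (br H U) U.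
  have e1 : ip (br Y U) (br Z U) = ip (br Z (br Y U)) U by rewrite ZU.
  have e2 : ip (br Y U) (br Z U) = - ip (br Y (br Z U)) U by rewrite (YU (br Z U) U) opprK ipC.
  have := jacobi Z Y U; rewrite (br_ZY pe) (brZl lieB) => /(congr1 (fun v => ip v U)).
  rewrite ipDl ipZl; move: e1 e2; lra.
have UE : U = Adj x (X0 X) by [].
clearbody Y Z U W s c.
have W1 : ip (br W U) U = - s * ip (br Z U) U.
  by rewrite WE (brDl lieB) (brNl lieB) !(brZl lieB) ipDl ip_oppl !ipZl YUU; ring.
have WW : ip (br W (br W U)) U + ip (br W U) (br W U) = 2 * s ^+ 2 * ip (br Z U) (br Z U) + 2 * s * c * p.2 * ip (br H U) U.
  have -> : ip (br W (br W U)) U = ip (br W U) (- c *: br Y U - s *: br Z U).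
    rewrite {1}WE (brDl lieB) (brNl lieB) !(brZl lieB) ipDl ip_oppl !ipZl YU ZU.
    by rewrite ip_addr ip_oppr !ip_scaler; ring.
  rewrite -ip_addr.
  have -> : - c *: br Y U - s *: br Z U + br W U = - (2 * s) *: br Z U.
    rewrite WE (brDl lieB) (brNl lieB) !(brZl lieB); vec.
  rewrite ip_scaler WE (brDl lieB) (brNl lieB) !(brZl lieB) ipDl ip_oppl !ipZl YZ; ring.
rewrite /B2 /B1 /h1 /h2 -UE W1 WW (brNl lieB) ip_oppl.
move: (hN x) n0 => N n0; move: (ip (br Z U) U) (ip (br Z U) (br Z U)) (ip (br H U) U) => A B C.
move: (F1 _) (F2 _) => f1 f2; field.
by rewrite s0 !gt_eqF.
Qed.

(** The logarithmic derivative m1 coth t + 2 m2 coth 2t of the density [D]. *)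
Definition pcoef (t : R) : R := \sum_(p <- nbs X) p.2 * coshr (p.2 * t) / Defs.sinh (p.2 * t).

(** Up to second derivatives along the rotations, which have mean 0 over K, the radial operator
    applied to F(height) is F'' + 2 rho F'; the two traces of [casimir_orbit] supply the
    coefficients 1 and 2 rho. *)
Lemma pointwise_equation (t : R) x : t != 0 ->
  B2 (- H) x + (\sum_(p <- nbs X) 2^-1 * Defs.sinh (p.2 * t) ^- 2 * B2 (Adj (a_ X (- t)) (p.1 + th p.1)) x)
   + pcoef t * B1 (- H) x = F2 (height x) + 2 * rho X * F1 (height x).
Proof.
move=> t0; have [E1 E2] := casimir_orbit x; have q0 := q0_gt0 X; have n0 := hN_gt0 x.
rewrite -addrA /pcoef mulr_suml -big_split /=.
set U := Adj x (X0 X) in E1 E2.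
rewrite (eq_big_seq (fun p : g * R =>
  F2 (height x) * (2^-1 * ip (br (p.1 - th p.1) U) U ^+ 2 / (q * hN x) ^+ 2) +
  F1 (height x) * (ip (br (p.1 - th p.1) U) (br (p.1 - th p.1) U) / (q * hN x) - ip (br (p.1 - th p.1) U) U ^+ 2 / (q * hN x ^+ 2)))); last first.
  by move=> p pe; rewrite (rotation_term x pe t0).
move: E1 E2; rewrite /pframe !big_cons !big_map /= !mul1r.
set S1 := \sum_(j <- nbs X) 2^-1 * ip (br _ U) (br _ U).
set S2 := \sum_(j <- nbs X) 2^-1 * ip (br _ U) U ^+ 2 => E1 E2.
rewrite big_split /= -!mulr_sumr.
have -> : \sum_(i <- nbs X) 2^-1 * ip (br (i.1 - th i.1) U) U ^+ 2 / (q * hN x) ^+ 2 = S2 / (q * hN x) ^+ 2.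
  by rewrite mulr_suml.
have -> : \sum_(i <- nbs X) (ip (br (i.1 - th i.1) U) (br (i.1 - th i.1) U) / (q * hN x) - ip (br (i.1 - th i.1) U) U ^+ 2 / (q * hN x ^+ 2))
   = 2 * S1 / (q * hN x) - 2 * S2 / (q * hN x ^+ 2).
  rewrite !mulr_sumr !mulr_suml -sumrB; apply: eq_bigr => p _.
  by field; rewrite !gt_eqF.
rewrite /B2 /h1 /h2 -/U !(brNl lieB) (brNr lieB) opprK !ip_oppl !ip_oppr opprK.
have HH : ip (br H (br H U)) U = ip (br H U) (br H U).
  by rewrite ip_br thH (brNl lieB) ip_oppr opprK.
rewrite HH; move: E1 E2 n0.
move: (hN x) (ip (br H U) (br H U)) (ip (br H U) U) S1 S2 (F1 _) (F2 _) => N a b S1 S2 f1 f2.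
rewrite sqrrN => E1 E2 n0.
have -> : S1 = N * (q ^+ 2 + q * rho X) - a by rewrite -E1; ring.
have -> : S2 = N ^+ 2 * q ^+ 2 - b ^+ 2 by rewrite -E2; ring.
by field; rewrite !gt_eqF.
Qed.

Lemma Kint_sum (I : Type) (r : seq I) (B : I -> X -> R) : (forall i, continuous (B i)) ->
  continuous (fun k => \sum_(i <- r) B i k) /\ Kint (fun k => \sum_(i <- r) B i k) = \sum_(i <- r) Kint (B i).
Proof.
move=> cB; elim: r => [|i r [IH1 IH2]].
  rewrite big_nil (_ : (fun k : X => _) = cst 0); first by split; [exact: cst_continuous|exact: Kint_cst].
  by apply/funext => k; rewrite big_nil.
rewrite big_cons (_ : (fun k : X => \sum_(i <- i :: r) B i k) = fun k => B i k + \sum_(i <- r) B i k); last first.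
  by apply/funext => k; rewrite big_cons.
by split; [move=> k; apply: cvgD; [exact: cB|exact: IH1]|rewrite KintD// IH2].
Qed.

Variable kk : R.
Hypothesis FE : forall t, F2 t + 2 * rho X * F1 t = - kk * F t.

Theorem radial_equation (t : R) : t != 0 ->
  psi (B2 (- H)) t + pcoef t * psi (B1 (- H)) t = - kk * psi B0 t.
Proof.
move=> t0.
have ca (B : X -> R) : continuous B -> continuous (fun k : X => B (a_ X (- t) * k)%g).
  move=> cB k; apply: (@cvg_comp _ _ _ (fun k : X => (a_ X (- t) * k)%g) B _ (nbhs (a_ X (- t) * k)%g)); last exact: cB.
  exact: mulgl_continuous.
pose G p (k : X) := 2^-1 * Defs.sinh (p.2 * t) ^- 2 * B2 (Adj (a_ X (- t)) (p.1 + th p.1)) (a_ X (- t) * k)%g.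
have cZ (c : R) (B : X -> R) : continuous B -> continuous (fun k => c * B k).
  by move=> cB k; apply: cvgM; [exact: cvg_cst|exact: cB].
have cG' p : continuous (G p) by apply: cZ; apply: ca; exact: B2_continuous.
have [c1 E1] := @Kint_sum _ (nbs X) G cG'.
have c2 := ca _ (@B2_continuous (- H)); have c3 := ca _ (@B1_continuous (- H)); have c4 := ca _ B0_continuous.
rewrite /psi -(KintZ _ c3) -(KintZ _ c4).
transitivity (Kint (fun k => B2 (- H) (a_ X (- t) * k)%g + \sum_(p <- nbs X) G p k + pcoef t * B1 (- H) (a_ X (- t) * k)%g)).
  rewrite [RHS]KintD; [|by move=> k; apply: cvgD; [exact: c2|exact: c1]|exact: cZ].
  rewrite [X in _ = X + _]KintD// E1 big_seq big1 ?addr0// => p pe.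
  by rewrite KintZ ?Kint_rotation ?mulr0//; apply: ca; exact: B2_continuous.
by congr Kint; apply/funext => k; rewrite /G pointwise_equation// FE.
Qed.

End RadialEquation.

End KIntegral.

Lemma derive_continuous (R : realType) (f f' : R -> R) : (forall t : R, is_derive t 1 f (f' t)) -> continuous f.
Proof. by move=> df t; exact/differentiable_continuous/derivable1_diffP/(@ex_derive _ _ _ _ _ _ _ (df t)). Qed.

Lemma is_derive_neg (R : realType) (u : R -> R) (t d : R) : is_derive t 1 u d -> is_derive t 1 (fun t => - u t) (- d).
Proof.
move/is_derive_cvgP => h; apply/is_derive_cvgP.
by under eq_cvg do rewrite -opprD scalerN; exact: cvgN h.
Qed.

(** * Spherical functions *)

Section SingularOde.
Variables (R : realType) (p : R -> R) (k b : R).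
Hypotheses (b0 : 0 < b) (pb : forall t, 0 < t -> t <= 1 -> b / t <= p t).
Hypotheses (p0 : forall t, 0 < t -> 0 <= p t) (k0 : 0 <= k).

(** If a = u1 0 were positive, p u1 >= a b / (2t) would force u1 to drop by about ab/2 over [0, t],
    however small t is, against the continuity of u1 at 0. *)
Lemma singular_ode_slope (u u1 u2 : R -> R) : (forall t : R, is_derive t 1 u (u1 t)) ->
  (forall t : R, is_derive t 1 u1 (u2 t)) ->
  (forall t, 0 < t -> u2 t + p t * u1 t = - k * u t) -> u1 0 <= 0.
Proof.
move=> du du1 ode; rewrite leNgt; apply/negP => a0; set a := u1 0 in a0 *.
have cu := derive_continuous du; have cu1 := derive_continuous du1.
pose e := Num.min (a / 2) (a * b / 4).
have e0 : 0 < e by rewrite lt_min !divr_gt0// mulr_gt0.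
have /cvgrPdist_lt/(_ _ e0)/nbhs_ballP[d1 /= d10 d1P] := cu1 0.
have /cvgrPdist_lt/(_ _ ltr01)/nbhs_ballP[d2 /= d20 d2P] := cu 0.
pose M := `|u 0| + 1; have M0 : 0 < M by rewrite ltr_wpDl.
have kM : 0 < k * M + 1 by rewrite ltr_wpDl// mulr_ge0// ltW.
pose t := Num.min (Num.min (d1 / 2) (d2 / 2)) (Num.min 1 (a * b / 8 / (k * M + 1))).
have t0 : 0 < t by rewrite !lt_min !divr_gt0// ?mulr_gt0// ltr01.
have td1 : t <= d1 / 2 by rewrite /t !ge_min lexx.
have td2 : t <= d2 / 2 by rewrite /t !ge_min lexx orbT.
have t1 : t <= 1 by rewrite /t !ge_min lexx !orbT.
have tk : t * (k * M + 1) <= a * b / 8.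
  by rewrite -ler_pdivlMr// /t !ge_min lexx !orbT.
clearbody t.
have near1 s : 0 <= s -> s <= t -> `|a - u1 s| < e.
  by move=> s0 st; apply: d1P; rewrite -ball_normE /= sub0r normrN ger0_norm//; lra.
have near2 s : 0 <= s -> s <= t -> `|u 0 - u s| < 1.
  by move=> s0 st; apply: d2P; rewrite -ball_normE /= sub0r normrN ger0_norm//; lra.
have ct : {within `[0, t], continuous u1} := continuous_subspaceT cu1.
have [x] := @MVT _ u1 u2 0 t t0 (fun (x : R) _ => du1 x) ct.
rewrite in_itv /= => /andP[x0 xt] E.
have ux : - M <= u x.
  have := near2 x (ltW x0) (ltW xt); rewrite ltr_norml => /andP[_].
  by have := ler_norm (- u 0); rewrite normrN /M; lra.
have u1x : a / 2 <= u1 x.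
  have := near1 x (ltW x0) (ltW xt); rewrite ltr_norml => /andP[_].
  have : e <= a / 2 by rewrite /e ge_min lexx.
  lra.
have u1t : a - a * b / 4 <= u1 t.
  have := near1 t (ltW t0) (lexx t); rewrite ltr_norml => /andP[_].
  have : e <= a * b / 4 by rewrite /e ge_min lexx orbT.
  lra.
have px : b / t <= p x.
  apply: le_trans (pb x0 (le_trans (ltW xt) t1)).
  by rewrite ler_pM2l// lef_pV2 ?posrE// ltW.
have bt : 0 < b / t by rewrite divr_gt0.
have h1 : b / t * (a / 2) <= p x * u1 x.
  by apply: ler_pM => //; [exact: ltW|rewrite ltW// divr_gt0].
have h2 : u2 x <= - (b / t * (a / 2)) + k * M.
  have := ode x x0; have : - (k * M) <= k * u x by have := ler_wpM2l k0 ux; rewrite mulrN.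
  lra.
have h3 : u2 x * t <= - (b * a / 2) + k * M * t.
  have -> : - (b * a / 2) + k * M * t = (- (b / t * (a / 2)) + k * M) * t by field; rewrite gt_eqF.
  by rewrite ler_pM2r.
move: E; rewrite subr0 -/a => E.
have ab : 0 < a * b by rewrite mulr_gt0.
nra.
Qed.

(** The slope at 0 vanishes, by the previous lemma for u and for -u, and the energy decreases. When
    u 0 = 0 this is a uniqueness statement. *)
Lemma singular_ode_energy (u u1 u2 : R -> R) : (forall t : R, is_derive t 1 u (u1 t)) ->
  (forall t : R, is_derive t 1 u1 (u2 t)) ->
  (forall t, 0 < t -> u2 t + p t * u1 t = - k * u t) ->
  forall t, 0 <= t -> u1 t ^+ 2 + k * u t ^+ 2 <= k * u 0 ^+ 2.
Proof.
move=> du du1 ode t; have s1 := singular_ode_slope du du1 ode.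
have s2 : - u1 0 <= 0.
  have odeN t' : 0 < t' -> - u2 t' + p t' * - u1 t' = - k * - u t' by move=> t0; have := ode t' t0; lra.
  exact: (@singular_ode_slope (fun t => - u t) (fun t => - u1 t) (fun t => - u2 t)
    (fun r => is_derive_neg (du r)) (fun r => is_derive_neg (du1 r)) odeN).
have u10 : u1 0 = 0 by lra.
pose E (s : R) := u1 s ^+ 2 + k * u s ^+ 2.
have E0 : E 0 = k * u 0 ^+ 2 by rewrite /E u10 expr0n add0r.
rewrite -/(E t) -E0 le_eqVlt => /orP[/eqP <-//|t0].
have dE (s : R) : is_derive s 1 E (2 * u1 s * (u2 s + k * u s)).
  have h := is_deriveD (is_deriveM (du1 s) (du1 s)) (is_deriveM (is_derive_cst k s 1) (is_deriveM (du s) (du s))).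
  rewrite (_ : E = u1 * u1 + cst k * (u * u)).
    apply: (is_derive_eq h); rewrite /GRing.scale /=; ring.
  by apply/funext => r; rewrite /E !expr2.
have ct : {within `[0, t], continuous E} := continuous_subspaceT (derive_continuous dE).
have [x] := @MVT _ E _ 0 t t0 (fun (x : R) _ => dE x) ct.
rewrite in_itv /= => /andP[x0 xt] Ex.
rewrite -subr_le0 Ex subr0; apply: mulr_le0_ge0; last exact: ltW.
have -> : u2 x + k * u x = - (p x * u1 x) by have := ode x x0; lra.
by have := p0 x0; have := sqr_ge0 (u1 x); rewrite expr2; nra.
Qed.

End SingularOde.

(** * Spherical functions in polar coordinates *)

Section SphericalFunction.
Variables (R : realType) (X : rankOneSpace R).
Local Notation H := (H0 X).
Local Notation K := (@maxK R X).
Local Notation rho := (rho X).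
Implicit Types (x y k : X) (l t : R).

Lemma rho_gt0 : 0 < rho.
Proof.
have m : (0 < m1 X)%N.
  by rewrite /m1 lt0n dimv_eq0; exact: (alpha_root X).
by rewrite /Defs.rho divr_gt0// ltr_wpDr ?ltr0n// mulr_ge0.
Qed.

Lemma nbs_gt0 p : p \in nbs X -> 0 < p.2 <= 2.
Proof. by move=> /nbsP[_ _ _ [->|->]]; apply/andP; split; lra. Qed.

Lemma coshr_gt0 t : 0 < coshr t.
Proof. by rewrite divr_gt0// addr_gt0// expR_gt0. Qed.

Lemma coshr_ge1 t : 1 <= coshr t.
Proof.
rewrite /coshr; have := expR_ge1Dx t; have := expR_ge1Dx (- t); have := expR_gt0 t; have := expR_gt0 (- t).
by have := expRxMexpNx_1 t; nra.
Qed.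

Lemma sinh_le_exp t : 0 <= t -> Defs.sinh t <= t * expR t.
Proof.
move=> t0; rewrite /Defs.sinh; have := expR_ge1Dx t; have := expR_ge1Dx (- t); have := expR_gt0 t.
by have := expRxMexpNx_1 t; nra.
Qed.

Lemma pterm_ge0 (b t : R) : 0 < b -> 0 < t -> 0 <= b * coshr (b * t) / Defs.sinh (b * t).
Proof.
move=> b0 t0; apply: divr_ge0; last by rewrite sinh_ge0// ltW// mulr_gt0.
by rewrite ltW// mulr_gt0// coshr_gt0.
Qed.

Lemma pcoef_ge0 t : 0 < t -> 0 <= pcoef X t.
Proof.
move=> t0; rewrite /pcoef big_seq sumr_ge0// => p /nbs_gt0/andP[p0 _].
exact: pterm_ge0.
Qed.

(** One root suffices: sinh x <= x e^x with x = p.2 t <= 2 produces the constant e^(-2). *)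
Lemma pcoef_singular t : 0 < t -> t <= 1 -> expR (- 2) / t <= pcoef X t.
Proof.
move=> t0 t1.
have [p pe] : exists p, p \in nbs X.
  have := nbs_sum X; case: (nbs X) => [|p s _]; last by exists p; rewrite mem_head.
  by rewrite big_nil => r0; have r1 := rho_gt0; exfalso; lra.
have p02 := nbs_gt0 pe; have /andP[p0 p2] := p02.
rewrite /pcoef (perm_big _ (perm_to_rem pe)) big_cons; apply: ler_wpDr.
  rewrite big_seq sumr_ge0// => p' /mem_rem/nbs_gt0/andP[p0' _].
  exact: pterm_ge0.
have s0 : 0 < Defs.sinh (p.2 * t) by rewrite sinh_gt0// mulr_gt0.
rewrite ler_pdivlMr// mulrAC ler_pdivrMr//.
have h1 := sinh_le_exp (ltW (mulr_gt0 p0 t0)).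
have h2 : expR (p.2 * t) <= expR 2 by rewrite ler_expR; nra.
have h3 := expRxMexpNx_1 (2 : R); have h4 := expR_gt0 (- 2 : R); have h5 := coshr_ge1 (p.2 * t).
have pt : 0 < p.2 * t by rewrite mulr_gt0.
apply: (@le_trans _ _ (expR (- 2) * (p.2 * t * expR 2))).
  by rewrite ler_pM2l// (le_trans h1)// ler_pM2l.
rewrite mulrCA [expR (- 2) * _]mulrC h3 mulr1 mulrAC; nra.
Qed.

(** [Fc] and [Fs] are the real and imaginary parts of e^(-(il + rho) h); the suffixes 1 and 2 denote
    derivatives in h. *)
Definition Fc l (h : R) : R := expR (- rho * h) * cos (l * h).
Definition Fc1 l (h : R) : R := expR (- rho * h) * (- rho * cos (l * h) - l * sin (l * h)).
Definition Fc2 l (h : R) : R := expR (- rho * h) * ((rho ^+ 2 - l ^+ 2) * cos (l * h) + 2 * rho * l * sin (l * h)).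
Definition Fs l (h : R) : R := - (expR (- rho * h) * sin (l * h)).
Definition Fs1 l (h : R) : R := expR (- rho * h) * (rho * sin (l * h) - l * cos (l * h)).
Definition Fs2 l (h : R) : R := expR (- rho * h) * ((l ^+ 2 - rho ^+ 2) * sin (l * h) + 2 * rho * l * cos (l * h)).

Lemma is_derive_lin1 (b t : R) : is_derive t 1 (fun t : R => b * t) b.
Proof.
by apply: (is_derive_eq (is_deriveM (is_derive_cst b t 1) (is_derive_id t (1 : R)))); rewrite scaler0 addr0 /GRing.scale /= mulr1.
Qed.

Lemma is_derive_trig (A B l h : R) : is_derive h 1 (fun h : R => expR (- rho * h) * (A * cos (l * h) + B * sin (l * h)))
  (expR (- rho * h) * ((- rho * A + l * B) * cos (l * h) + (- rho * B - l * A) * sin (l * h))).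
Proof.
have dc := @is_derive1_comp _ (@cos R) (fun h : R => l * h) h _ _ (is_derive_cos _) (is_derive_lin1 l h).
have ds := @is_derive1_comp _ (@sin R) (fun h : R => l * h) h _ _ (is_derive_sin _) (is_derive_lin1 l h).
have d := is_deriveM (is_derive_exp_lin (- rho) h) (is_deriveD (is_deriveM (is_derive_cst A h 1) dc) (is_deriveM (is_derive_cst B h 1) ds)).
by apply: (is_derive_eq d); rewrite !fctE /GRing.scale /=; ring.
Qed.

Lemma dFc (l h : R) : is_derive h 1 (Fc l) (Fc1 l h).
Proof.
rewrite (_ : Fc l = fun h : R => expR (- rho * h) * (1 * cos (l * h) + 0 * sin (l * h))).
  by apply: (is_derive_eq (is_derive_trig 1 0 l h)); rewrite /Fc1; ring.
by apply/funext => r; rewrite /Fc; ring.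
Qed.
Lemma dFc1 (l h : R) : is_derive h 1 (Fc1 l) (Fc2 l h).
Proof.
rewrite (_ : Fc1 l = fun h : R => expR (- rho * h) * (- rho * cos (l * h) + (- l) * sin (l * h))).
  by apply: (is_derive_eq (is_derive_trig (- rho) (- l) l h)); rewrite /Fc2; ring.
by apply/funext => r; rewrite /Fc1; ring.
Qed.
Lemma dFs (l h : R) : is_derive h 1 (Fs l) (Fs1 l h).
Proof.
rewrite (_ : Fs l = fun h : R => expR (- rho * h) * (0 * cos (l * h) + (- 1) * sin (l * h))).
  by apply: (is_derive_eq (is_derive_trig 0 (- 1) l h)); rewrite /Fs1; ring.
by apply/funext => r; rewrite /Fs; ring.
Qed.
Lemma dFs1 (l h : R) : is_derive h 1 (Fs1 l) (Fs2 l h).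
Proof.
rewrite (_ : Fs1 l = fun h : R => expR (- rho * h) * (- l * cos (l * h) + rho * sin (l * h))).
  by apply: (is_derive_eq (is_derive_trig (- l) rho l h)); rewrite /Fs2; ring.
by apply/funext => r; rewrite /Fs1; ring.
Qed.
Lemma cFc2 l : continuous (Fc2 l).
Proof.
apply: (@derive_continuous _ _ (fun h => expR (- rho * h) * ((- rho * (rho ^+ 2 - l ^+ 2) + l * (2 * rho * l)) * cos (l * h) + (- rho * (2 * rho * l) - l * (rho ^+ 2 - l ^+ 2)) * sin (l * h)))).
move=> h; exact: is_derive_trig.
Qed.
Lemma cFs2 l : continuous (Fs2 l).
Proof.
apply: (@derive_continuous _ _ (fun h => expR (- rho * h) * ((- rho * (2 * rho * l) + l * (l ^+ 2 - rho ^+ 2)) * cos (l * h) + (- rho * (l ^+ 2 - rho ^+ 2) - l * (2 * rho * l)) * sin (l * h)))).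
move=> h; rewrite (_ : Fs2 l = fun h : R => expR (- rho * h) * (2 * rho * l * cos (l * h) + (l ^+ 2 - rho ^+ 2) * sin (l * h))); first exact: is_derive_trig.
by apply/funext => r; rewrite /Fs2; ring.
Qed.
Lemma Fc_eq (l h : R) : Fc2 l h + 2 * rho * Fc1 l h = - (l ^+ 2 + rho ^+ 2) * Fc l h.
Proof. by rewrite /Fc2 /Fc1 /Fc; ring. Qed.
Lemma Fs_eq (l h : R) : Fs2 l h + 2 * rho * Fs1 l h = - (l ^+ 2 + rho ^+ 2) * Fs l h.
Proof. by rewrite /Fs2 /Fs1 /Fs; ring. Qed.

Variables (kap mu : {measure set (Borel X) -> \bar R}).
Hypotheses (kapP : is_haar_K kap) (muP : is_invariant_measure kap mu) (cK : compact K).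

Definition sphi l t : R := psi kap (B0 (Fc l)) t.
Definition sphi1 l t : R := psi kap (B1 (Fc1 l) (- H)) t.
Definition sphi2 l t : R := psi kap (B2 (Fc1 l) (Fc2 l) (- H)) t.
Let chi l t : R := psi kap (B0 (Fs l)) t.
Let chi1 l t : R := psi kap (B1 (Fs1 l) (- H)) t.
Let chi2 l t : R := psi kap (B2 (Fs1 l) (Fs2 l) (- H)) t.

Lemma dsphi l t : is_derive t 1 (sphi l) (sphi1 l t).
Proof.
apply: (psi_derive kapP cK); last exact: (left_der_B0 (dFc l)).
  exact: (B0_continuous (dFc l)).
exact: (B1_continuous (dFc1 l)).
Qed.
Lemma dsphi1 l t : is_derive t 1 (sphi1 l) (sphi2 l t).
Proof.
apply: (psi_derive kapP cK); last exact: (left_der_B1 (dFc1 l)).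
  exact: (B1_continuous (dFc1 l)).
exact: (B2_continuous (dFc1 l) (@cFc2 l)).
Qed.
Lemma sphi_ode l t : 0 < t -> sphi2 l t + pcoef X t * sphi1 l t = - (l ^+ 2 + rho ^+ 2) * sphi l t.
Proof.
move=> t0; apply: (radial_equation kapP cK (dFc l) (dFc1 l) (@cFc2 l) muP); first by move=> s; exact: Fc_eq.
by rewrite gt_eqF.
Qed.

Lemma kk_gt0 l : 0 < l ^+ 2 + rho ^+ 2.
Proof. by rewrite ltr_wpDl ?sqr_ge0// exprn_gt0// rho_gt0. Qed.

Lemma height_K k : K k -> height k = 0.
Proof.
move=> kK; have := @height_kan R X k 0 0 kK (mem0v _).
by rewrite a_0 (lie_exp0 (lie_expP X)) !mulg1.
Qed.

Lemma psi_at0 (F : R -> R) : psi kap (B0 F : X -> R) 0 = F 0.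
Proof.
rewrite /psi -[RHS](Kint_cst kapP); apply: eq_Rintegral => k /[!inE] kK.
by rewrite oppr0 a_0 mul1g /B0 height_K.
Qed.

Lemma sphi0 l : sphi l 0 = 1.
Proof. by rewrite /sphi psi_at0 /Fc !mulr0 cos0 expR0 mulr1. Qed.

Lemma sphi_energy l t : 0 <= t -> sphi1 l t ^+ 2 + (l ^+ 2 + rho ^+ 2) * sphi l t ^+ 2 <= l ^+ 2 + rho ^+ 2.
Proof.
move=> t0; have := singular_ode_energy (expR_gt0 (- 2)) pcoef_singular pcoef_ge0 (ltW (kk_gt0 l)) (dsphi l) (dsphi1 l) (@sphi_ode l) t0.
by rewrite sphi0 expr1n mulr1.
Qed.

Lemma sphi_le1 l t : 0 <= t -> `|sphi l t| <= 1.
Proof.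
move=> t0; have := sphi_energy l t0; have k0 := kk_gt0 l; have := sqr_ge0 (sphi1 l t) => a b.
by rewrite -(expr_le1 (n := 2))// real_normK ?num_real//; nra.
Qed.

Lemma sphi1_le l t : 0 <= t -> sphi1 l t ^+ 2 <= l ^+ 2 + rho ^+ 2.
Proof.
move=> t0; have := sphi_energy l t0; have k0 := kk_gt0 l; have := sqr_ge0 (sphi l t); nra.
Qed.

(** The imaginary part of the spherical function solves the same equation with value 0 at t = 0, so
    its energy vanishes. *)
Lemma chi_eq0 l t : 0 <= t -> chi l t = 0.
Proof.
move=> t0.
have d0 (s : R) : is_derive s 1 (chi l) (chi1 l s).
  apply: (psi_derive kapP cK); last exact: (left_der_B0 (dFs l)).
    exact: (B0_continuous (dFs l)).
  exact: (B1_continuous (dFs1 l)).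
have d1 (s : R) : is_derive s 1 (chi1 l) (chi2 l s).
  apply: (psi_derive kapP cK); last exact: (left_der_B1 (dFs1 l)).
    exact: (B1_continuous (dFs1 l)).
  exact: (B2_continuous (dFs1 l) (@cFs2 l)).
have ode (s : R) : 0 < s -> chi2 l s + pcoef X s * chi1 l s = - (l ^+ 2 + rho ^+ 2) * chi l s.
  move=> s0; apply: (radial_equation kapP cK (dFs l) (dFs1 l) (@cFs2 l) muP); first by move=> r; exact: Fs_eq.
  by rewrite gt_eqF.
have := singular_ode_energy (expR_gt0 (- 2)) pcoef_singular pcoef_ge0 (ltW (kk_gt0 l)) d0 d1 ode t0.
have -> : chi l 0 = 0 by rewrite /chi psi_at0 /Fs !mulr0 sin0 mulr0 oppr0.
rewrite expr0n mulr0; have k0 := kk_gt0 l; have := sqr_ge0 (chi1 l t) => a b.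
have : chi l t ^+ 2 <= 0 by nra.
by move=> c; apply/eqP; rewrite -sqrf_eq0 eq_le c sqr_ge0.
Qed.

Lemma sph_KintE l x : sph kap (ofR l) x =
  Complex (Kint kap (fun k => Fc l (height (x^-1 * k)%g))) (Kint kap (fun k => Fs l (height (x^-1 * k)%g))).
Proof.
rewrite /sph /cintegral; congr Complex; apply: eq_Rintegral => k _;
  rewrite (iwasawaHE kapP muP cK) /cexp /re /im /=.
  by rewrite /Fc -[in RHS]cosN; congr (expR _ * cos _); ring.
by rewrite /Fs -[RHS]mulrN -[in RHS]sinN; congr (expR _ * sin _); ring.
Qed.

Lemma height_Kl k x : K k -> height (k * x)%g = height x.
Proof. by move=> kK; rewrite /height AdjM maxK_ip. Qed.

Lemma sph_radial l k1 k2 x : K k1 -> K k2 -> sph kap (ofR l) (k1 * x * k2)%g = sph kap (ofR l) x.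
Proof.
move=> kK1 kK2; rewrite !sph_KintE.
have E (F : R -> R) : continuous F -> Kint kap (fun k => F (height ((k1 * x * k2)^-1 * k)%g)) = Kint kap (fun k => F (height (x^-1 * k)%g)).
  move=> cF; rewrite -(Kint_translate kapP cK (maxKV kK1) (B := fun k => F (height (x^-1 * k)%g))).
    congr Kint; apply/funext => k; rewrite !invgM -!mulgA height_Kl//; exact: maxKV.
  move=> k; apply: (@cvg_comp _ _ _ (fun k => (x^-1 * k)%g) (fun y => F (height y)) _ (nbhs (x^-1 * k)%g)).
    exact: mulgl_continuous.
  exact: comp_height_continuous.
by rewrite (E _ (F_continuous (dFc l))) (E _ (F_continuous (dFs l))).
Qed.

Lemma sph_a l t : 0 <= t -> sph kap (ofR l) (a_ X t) = Complex (sphi l t) 0.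
Proof. by move=> t0; rewrite sph_KintE -a_N -(chi_eq0 l t0). Qed.

Lemma sphi_lcontinuous t : continuous (sphi ^~ t).
Proof.
move=> l.
have mK := @maxK_measurable R X.
pose f (l : R) (k : Borel X) : R := Fc l (height (a_ X (- t) * (k : X))%g).
pose ga (k : X) := expR (- rho * height (a_ X (- t) * k)%g).
have ca (B : X -> R) : continuous B -> continuous (fun k : X => B (a_ X (- t) * k)%g).
  move=> cB k; apply: (@cvg_comp _ _ _ (fun k : X => (a_ X (- t) * k)%g) B _ (nbhs (a_ X (- t) * k)%g)); last exact: cB.
  exact: mulgl_continuous.
have cga : continuous ga.
  apply: (ca (fun x => expR (- rho * height x))); apply: (comp_height_continuous (f := fun h => expR (- rho * h))).
  exact: derive_continuous (is_derive_exp_lin (- rho)).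
have h := @continuity_under_integral R _ (Borel X) kap f K mK (l - 1) (l + 1) _ _ (fun k : Borel X => ga k) _ _.
apply: h; last by rewrite inE /= in_itv /=; apply/andP; split; lra.
- move=> x _; apply: (K_integrable kapP cK (B := f x)); apply: (ca (fun y => Fc x (height y))).
  exact: comp_height_continuous (F_continuous (dFc x)).
- apply: aeW => k _ x _; rewrite /f /Fc; apply: cvgM; first exact: cvg_cst.
  apply: (@cvg_comp _ _ _ (fun x : R => x * height (a_ X (- t) * k)%g) (@cos R) _ (nbhs (x * height (a_ X (- t) * k)%g))); last exact: continuous_cos.
  by apply: cvgM; [exact: cvg_id|exact: cvg_cst].
- exact: (K_integrable kapP cK (B := ga)).
- move=> x _; apply: aeW => k _; rewrite /f /Fc normrM ger0_norm ?expR_ge0// ler_piMr ?expR_ge0//.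
  exact: cos_max.
Qed.

(** The t of the polar decomposition, recovered from tau: strict monotonicity of [Tt] gives
    uniqueness, and sublevel sets of tau give measurability. *)
Definition sradius x : R := xget 0 [set t | 0 <= t /\ tau x = Tt X t].

Lemma Tt_inj s t : 0 <= s -> 0 <= t -> Tt X s = Tt X t -> s = t.
Proof.
move=> s0 t0 E; case: (ltgtP s t) => // h; [have := Tt_lt X s0 h|have := Tt_lt X t0 h]; by rewrite E ltxx.
Qed.

Lemma sradiusE k1 t k2 : K k1 -> 0 <= t -> K k2 -> sradius (k1 * a_ X t * k2)%g = t.
Proof.
move=> kK1 t0 kK2; rewrite /sradius tau_Kr// tau_Kl// tau_a.
by case: xgetP => [s _ [s0 /esym]|/(_ t)[]//]; exact: Tt_inj.
Qed.

Lemma sradius_decomposition x : exists k1 k2, [/\ K k1, K k2 & x = (k1 * a_ X (sradius x) * k2)%g].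
Proof.
have [k1 [t [k2 [kK1 t0 kK2 xE]]]] := KAK_decomposition kapP muP cK x.
by exists k1, k2; split => //; rewrite {2}xE sradiusE.
Qed.

Lemma sradius_ge0 x : 0 <= sradius x.
Proof. by rewrite /sradius; case: xgetP => [s _ []|]. Qed.

Lemma tau_sradius x : tau x = Tt X (sradius x).
Proof.
have [k1 [k2 [kK1 kK2 xE]]] := sradius_decomposition x.
by rewrite {1}xE tau_Kr// tau_Kl// tau_a.
Qed.

Lemma Tt_le s t : 0 <= s -> 0 <= t -> (Tt X s <= Tt X t) = (s <= t).
Proof.
move=> s0 t0; case: (leP s t) => [|ts]; last by apply/negbTE; rewrite -ltNge Tt_lt.
by rewrite le_eqVlt => /orP[/eqP ->|/(Tt_lt X s0)/ltW]; rewrite ?lexx.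
Qed.

Lemma sradius_measurable : measurable_fun [set: Borel X] (sradius : Borel X -> R).
Proof.
apply: (measurability (@RGenCInfty.G R)); first exact: RGenCInfty.measurableE.
move=> _ [_ [r ->] <-]; rewrite setTI.
have [r0|r0] := leP r 0.
  rewrite (_ : _ @^-1` _ = setT)//; apply/seteqP; split => // x _ /=.
  by rewrite in_itv /= andbT (le_trans r0)// sradius_ge0.
rewrite (_ : _ @^-1` _ = @tau R X @^-1` [set y | Tt X r <= y]).
  by apply: Borel_closed; apply: closed_comp; [move=> y _; exact: tau_continuous|exact: closed_ge].
by apply/seteqP; split => x /=; rewrite in_itv /= andbT tau_sradius Tt_le ?sradius_ge0// ltW.
Qed.

Lemma radialE (T : Type) (G : X -> T) x : (forall k1 k2 y, K k1 -> K k2 -> G (k1 * y * k2)%g = G y) ->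
  G x = G (a_ X (sradius x)).
Proof.
by move=> rG; have [k1 [k2 [kK1 kK2 xE]]] := sradius_decomposition x; rewrite {1}xE rG.
Qed.

Local Notation leb := (@lebesgue_measure R).

Lemma polar_radial (G : X -> \bar R) : (forall k1 k2 y, K k1 -> K k2 -> G (k1 * y * k2)%g = G y) ->
  measurable_fun [set: Borel X] (G : Borel X -> \bar R) -> (forall x, 0 <= G x)%E ->
  (\int[mu]_x G x = (c0 muP)%:E * \int[leb]_(t in `[0%R, +oo[) (G (a_ X t) * (D X t)%:E))%E.
Proof.
move=> rG mG G0; rewrite (polarE muP)//; congr (_ * _)%E.
rewrite -[RHS](kap_cst kapP); apply: eq_integral => k1 /[!inE] kK1.
apply: eq_integral => t _; rewrite -[RHS](kap_cst kapP); apply: eq_integral => k2 /[!inE] kK2.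
by rewrite rG.
Qed.

(** No integrability is assumed: positive and negative parts are compared separately, and if one of
    them is infinite, both real integrals are 0 by convention. *)
Lemma polar_radial_Rintegral (G : X -> R) : (forall k1 k2 y, K k1 -> K k2 -> G (k1 * y * k2)%g = G y) ->
  measurable_fun [set: Borel X] (G : Borel X -> R) ->
  (\int[mu]_x G x = c0 muP * \int[leb]_(t in `[0%R, +oo[) (G (a_ X t) * D X t))%R.
Proof.
move=> rG mG; have c0p := c0_gt0 muP.
rewrite /Rintegral.
have mp : measurable_fun [set: Borel X] (fun x : Borel X => (G x)%:E) by exact/measurable_EFinP.
rewrite integralE [X in _ = _ * fine X]integralE.
have hm (a d : R) : 0 <= d -> (maxe a%:E 0 * d%:E = maxe (a * d)%:E 0)%E.
  by move=> d0; rewrite -!EFin_max -EFinM maxr_pMl// mul0r.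
have e1 : (\int[mu]_x ((fun x : Borel X => (G x)%:E)^\+ x) = (c0 muP)%:E * \int[leb]_(t in `[0%R, +oo[) ((fun t => (G (a_ X t) * D X t)%:E)^\+ t))%E.
  rewrite (polar_radial (G := funepos (fun x : X => (G x)%:E))).
  - congr (_ * _)%E; apply: eq_integral => t; rewrite inE /= in_itv /= andbT => t0.
    by rewrite !funeposE hm ?D_ge0.
  - by move=> k1 k2 y kK1 kK2; rewrite !funeposE rG.
  - exact: measurable_funepos.
  - by move=> x; exact: funepos_ge0.
have e2 : (\int[mu]_x ((fun x : Borel X => (G x)%:E)^\- x) = (c0 muP)%:E * \int[leb]_(t in `[0%R, +oo[) ((fun t => (G (a_ X t) * D X t)%:E)^\- t))%E.
  rewrite (polar_radial (G := funeneg (fun x : X => (G x)%:E))).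
  - congr (_ * _)%E; apply: eq_integral => t; rewrite inE /= in_itv /= andbT => t0.
    by rewrite !funenegE -!EFinN hm ?D_ge0// mulNr.
  - by move=> k1 k2 y kK1 kK2; rewrite !funenegE rG.
  - exact: measurable_funeneg.
  - by move=> x; exact: funeneg_ge0.
rewrite e1 e2.
have nnp (h : R -> \bar R) : (0 <= \int[leb]_(t in `[0%R, +oo[) funepos h t)%E.
  by apply: integral_ge0 => t _; exact: funepos_ge0.
have nnn (h : R -> \bar R) : (0 <= \int[leb]_(t in `[0%R, +oo[) funeneg h t)%E.
  by apply: integral_ge0 => t _; exact: funeneg_ge0.
move: (nnp (fun t => (G (a_ X t) * D X t)%:E)) (nnn (fun t => (G (a_ X t) * D X t)%:E)).
move: (integral _ _ _) (integral _ _ _) => [a| |] [b| |] //= a0 b0; rewrite ?mulr0.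
- by rewrite mulrBr.
- by rewrite !gt0_muley ?lte_fin//= mulr0.
- by rewrite !gt0_muley ?lte_fin//= mulr0.
- by rewrite !gt0_muley ?lte_fin//= mulr0.
Qed.

End SphericalFunction.

(** * Radial test functions and the spherical transform *)

Section TestFunctions.
Variables (R : realType) (X : rankOneSpace R).
Local Notation g := (lie_alg X).
Local Notation ex := (@lie_exp R X).
Local Notation K := (@maxK R X).
Local Notation C := (Cplx R).
Let cG : connected [set: X] := @Defs.group_connected R X.

Lemma ip_Adj_expand x (V : g) : ip (Adj x V) (Adj x V) =
  \sum_i \sum_j (crd i V * crd j V) * ip (Adj x (bas i)) (Adj x (bas j)).
Proof.
have ipS (W : g) (u : 'I_(\dim {:g}) -> g) : ip W (\sum_i u i) = \sum_i ip W (u i).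
  by apply: (big_morph (ip W)); [move=> *; exact: ip_addr|exact: ip_zeror].
have AV : Adj x V = \sum_i crd i V *: Adj x (bas i).
  by rewrite {1}(crdE V) linear_sum; apply: eq_bigr => i _; rewrite linearZ.
rewrite {1}AV ipC ipS; apply: eq_bigr => i _.
rewrite ip_scaler ipC AV ipS mulr_sumr; apply: eq_bigr => j _.
by rewrite ip_scaler mulrA.
Qed.

(** In coordinates tau(x exp Y) is a quadratic polynomial in the smooth coordinates of Ad(exp Y) on
    the basis, with coefficients that depend on x only. *)
Lemma smooth_tau x : exists2 d : R, 0 < d & forall k, Ck_on k [set Y : g | `|Y| < d] (fun Y => tau (x * ex Y)%g).
Proof.
have [d d0 hd] := Ad_smooth (lie_expP X); exists d => // k.
have oU : open [set Y : g | `|Y| < d].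
  rewrite (_ : [set Y : g | _] = ball 0 d); first exact: ball_open.
  by apply/seteqP; split => p; rewrite -ball_normE /= sub0r normrN.
rewrite (_ : (fun Y => _) = (fun Y => \sum_(p <- eb X) \sum_i \sum_j
   (crd i (Adj (ex Y) p.1) * crd j (Adj (ex Y) p.1)) * ip (Adj x (bas i)) (Adj x (bas j)))); last first.
  by apply/funext => Y; apply: eq_bigr => p _; rewrite AdjM ip_Adj_expand.
do 3 (apply: Ck_on_sum => // ?).
by apply: Ck_onM => //; [apply: Ck_onM => //; exact: hd|exact: Ck_on_cst].
Qed.

Variables (kap mu : {measure set (Borel X) -> \bar R}).
Hypothesis kapP : is_haar_K kap.
Hypothesis muP : is_invariant_measure kap mu.
Hypothesis cK : compact K.

Definition radial_fun (F : R -> R) (x : X) : C := ofR (F (tau x)).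

Lemma radial_fun_smooth F : smooth1 F -> smooth_fun (radial_fun F).
Proof.
move=> sF x; have [d d0 hd] := smooth_tau x.
have oU : open_nbhs (0 : g) [set Y : g | `|Y| < d].
  split; last by rewrite /= normr0.
  rewrite (_ : [set Y : g | _] = ball 0 d); first exact: ball_open.
  by apply/seteqP; split => p; rewrite -ball_normE /= sub0r normrN.
split; exists [set Y : g | `|Y| < d]; split=> // k.
  by apply: (Ck_on_comp1 oU.1 sF); exact: hd.
by rewrite (_ : (fun Y => _) = cst 0)//; exact: Ck_on_cst.
Qed.

Lemma radial_fun_compact F M : 0 < M -> (forall y, Tt X M <= y -> F y = 0) -> compactly_supported (radial_fun F).
Proof.
move=> M0 FM; eexists; first exact: (bounded_KAK_compact cK (T := M)).
move=> x; have [k1 [k2 [k1K k2K xE]]] := sradius_decomposition kapP muP cK x.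
have [rM|Mr] := leP (sradius x) M.
  by case; exists k1, (sradius x), k2; split=> //; rewrite sradius_ge0.
by move=> _; rewrite /radial_fun FM// (tau_sradius kapP muP cK) ltW// Tt_lt// ltW.
Qed.

Lemma radial_fun_radial F : radial (radial_fun F).
Proof. by move=> k1 k2 x kK1 kK2; rewrite /radial_fun tau_Kr// tau_Kl. Qed.

Lemma a_measurable : measurable_fun [set: R] (a_ X : R -> Borel X).
Proof.
apply: (@measurability _ _ R (Borel X) setT (a_ X) (@open X)) => //.
move=> _ [U oU <-]; rewrite setTI; apply: open_measurable.
by move/continuousP: (@a_continuous R X); exact.
Qed.

Lemma Rintegral_half_line (h : R -> R) :
  \int[@lebesgue_measure R]_(t in `[0, +oo[) h t = \int[@lebesgue_measure R]_t (if 0 <= t then h t else 0).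
Proof.
rewrite Rintegral_mkcond; apply: eq_Rintegral => t _.
by rewrite patchE mem_setE in_itv /= andbT.
Qed.

Lemma sradius_a t : 0 <= t -> sradius (a_ X t) = t.
Proof.
move=> t0; have := sradiusE (maxK1 X) t0 (maxK1 X).
by rewrite mul1g mulg1.
Qed.

Lemma sradius_K k1 k2 y : K k1 -> K k2 -> sradius (k1 * y * k2)%g = sradius y.
Proof.
move=> k1K k2K; have [h1 [h2 [h1K h2K yE]]] := sradius_decomposition kapP muP cK y.
rewrite {1}yE !mulgA -(mulgA _ h2) sradiusE ?sradius_ge0//; exact: maxKM.
Qed.

Lemma sph_sradius l x : sph kap (ofR l) x = Complex (sphi kap l (sradius x)) 0.
Proof.
rewrite (radialE kapP muP cK (G := sph kap (ofR l)) x); last by move=> *; exact: (sph_radial kapP muP cK).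
by rewrite (sph_a kapP muP cK)// sradius_ge0.
Qed.

Lemma sphi_measurable l : measurable_fun [set: R] (sphi kap l).
Proof. by apply: continuous_measurable_fun; exact: derive_continuous (dsphi kapP cK l). Qed.

Lemma Rintegral_sph (G : X -> R) l : (forall k1 k2 y, K k1 -> K k2 -> G (k1 * y * k2)%g = G y) ->
  measurable_fun [set: Borel X] (G : Borel X -> R) ->
  \int[mu]_x (G x * sphi kap l (sradius x)) = c0 muP * hat (sphi kap) (D X) (fun t => G (a_ X t)) l.
Proof.
move=> rG mG; rewrite (polar_radial_Rintegral kapP muP (G := fun x => G x * sphi kap l (sradius x))).
- rewrite Rintegral_half_line /hat /tr; congr (_ * _); apply: eq_Rintegral => t _.
  rewrite /Dp /kern; case: ifP => t0; last by rewrite mulr0 mul0r.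
  by rewrite sradius_a// ger0_norm// mulrAC.
- by move=> k1 k2 y kK1 kK2; rewrite (rG _ _ _ kK1 kK2) (sradius_K _ kK1 kK2).
- apply: measurable_funM => //; apply: measurableT_comp (sphi_measurable l) _.
  exact: sradius_measurable kapP muP cK.
Qed.

Lemma sph_transform_hat (f : X -> C) l : radial f ->
  measurable_fun [set: Borel X] (fun x : Borel X => re (f x)) ->
  measurable_fun [set: Borel X] (fun x : Borel X => im (f x)) ->
  sph_transform kap mu f l = Complex (c0 muP * hat (sphi kap) (D X) (fun t => re (f (a_ X t))) l)
                                     (c0 muP * hat (sphi kap) (D X) (fun t => im (f (a_ X t))) l).
Proof.
move=> rf mre mim; rewrite /sph_transform /cintegral.
rewrite -(Rintegral_sph l (G := fun x => re (f x)))//; last by move=> *; rewrite rf.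
rewrite -(Rintegral_sph l (G := fun x => im (f x)))//; last by move=> *; rewrite rf.
by congr Complex; apply: eq_Rintegral => x _; rewrite sph_sradius; case: (f x) => u v; rewrite /re /im /=; ring.
Qed.

Lemma pcoef_le (a b : R) : 0 < a -> exists P : R, forall t : R, a <= t <= b -> pcoef X t <= P.
Proof.
move=> a0; exists (\sum_(p <- nbs X) p.2 * expR (p.2 * b) / Defs.sinh (p.2 * a)) => t /andP[ta tb].
rewrite /pcoef !big_seq; apply: ler_sum => p /nbs_gt0/andP[p0 _].
have t0 : 0 < t by exact: lt_le_trans ta.
apply: ler_pM.
- by rewrite mulr_ge0 ?(ltW p0)// ltW// coshr_gt0.
- by rewrite invr_ge0 ltW// sinh_gt0// mulr_gt0.
- rewrite ler_pM2l// /coshr.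
  have : expR (- (p.2 * t)) <= expR (p.2 * t) by rewrite ler_expR ge0_cp// mulr_ge0// ltW.
  have : expR (p.2 * t) <= expR (p.2 * b) by rewrite ler_expR ler_pM2l.
  by lra.
- by rewrite lef_pV2 ?posrE ?sinh_gt0 ?mulr_gt0// sinh_le// ler_pM2l.
Qed.

Lemma dTt_le (t u : R) : t <= u -> dTt X t <= dTt X u.
Proof.
move=> tu; rewrite /dTt; apply: ler_sum => p _; have [p0|/ltW p0] := leP 0 p.2.
  apply: ler_wpM2l => //; have h : 2 * p.2 * t <= 2 * p.2 * u by rewrite ler_wpM2l// mulr_ge0.
  by rewrite lerB// ler_expR// lerN2.
apply: ler_wnM2l => //; have h : 2 * p.2 * u <= 2 * p.2 * t by rewrite ler_wnM2l// mulr_ge0_le0.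
by rewrite lerB// ler_expR// lerN2.
Qed.

Lemma Tt_lip (a b : R) : 0 < a -> exists m M, [/\ 0 < m, 0 < M & forall t u : R,
  a <= t -> t <= u -> u <= b -> m * (u - t) <= Tt X u - Tt X t <= M * (u - t)].
Proof.
move=> a0; exists (dTt X a), (dTt X (Num.max a b)); split; first exact: dTt_gt0.
  by rewrite dTt_gt0// lt_max a0.
move=> t u aT tu ub.
have [x] := @MVT_segment R (Tt X) (dTt X) t u tu (fun x _ => is_derive_Tt X x) (continuous_subspaceT (@Tt_continuous R X)).
rewrite in_itv /= => /andP[tx xu] ->.
have ut : 0 <= u - t by rewrite subr_ge0.
apply/andP; split; apply: ler_wpM2r => //; apply: dTt_le; first exact: le_trans aT tx.
by rewrite le_max (le_trans xu ub) orbT.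
Qed.

Lemma int1_half_line (h : R -> R) : measurable_fun [set: R] h -> (forall t, 0 <= t -> 0 <= h t) ->
  (\int[@lebesgue_measure R]_(t in `[0%R, +oo[) (h t)%:E < +oo)%E -> int1 (fun t => if 0 <= t then h t else 0).
Proof.
move=> mh h0 hoo; apply/integrableP; split.
  by apply/measurable_EFinP; exact: half_line_measurable.
apply: le_lt_trans hoo; rewrite [X in (_ <= X)%E]integral_mkcond.
rewrite (_ : (fun t => `|_|)%E = (fun t => (h t)%:E) \_ `[0, +oo[)//; apply/funext => t.
rewrite patchE mem_setE in_itv /= andbT; case: ifP => t0; last by rewrite normr0.
by rewrite ger0_norm// h0.
Qed.

(** |G| <= G^2 + 1, where the support of G restricts the summand 1 to t <= M. *)
Lemma Rprofile_int1 (G : X -> R) (M : R) : (forall k1 k2 y, K k1 -> K k2 -> G (k1 * y * k2)%g = G y) ->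
  measurable_fun [set: Borel X] (G : Borel X -> R) -> (\int[mu]_x ((G x) ^+ 2)%:E < +oo)%E ->
  (forall x, M < sradius x -> G x = 0) -> int1 (fun t => G (a_ X t) * Dp (D X) t).
Proof.
move=> rG mG G2 GM; have c00 := c0_gt0 muP.
have mGa : measurable_fun [set: R] (fun t => G (a_ X t)) by exact: (measurableT_comp mG a_measurable).
have mD : measurable_fun [set: R] (D X) by apply: continuous_measurable_fun; exact: D_continuous.
have i2 : int1 (fun t => if 0 <= t then G (a_ X t) ^+ 2 * D X t else 0).
  apply: int1_half_line; first by apply: measurable_funM => //; exact: measurable_funX.
    by move=> t t0; rewrite mulr_ge0 ?sqr_ge0 ?D_ge0.
  move: G2; rewrite (polar_radial kapP muP (G := fun x => ((G x) ^+ 2)%:E)).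
  - under eq_integral do rewrite -EFinM.
    by case: (integral _ _ _) => [x| |]//; rewrite ?ltry ?ltNyy// gt0_muley ?lte_fin.
  - by move=> k1 k2 y kK1 kK2; rewrite rG.
  - by apply/measurable_EFinP; exact: measurable_funX.
  - by move=> x; rewrite lee_fin sqr_ge0.
have mDp : measurable_fun [set: R] (Dp (D X)) by exact: half_line_measurable.
have i1 : int1 (fun t => if t <= M then Dp (D X) t else 0).
  apply: (@int1_itv _ 0 M).
  - rewrite (_ : (fun t => _) = Dp (D X) \_ `]-oo, M]).
      by apply/measurable_restrict => //; rewrite setTI; exact: measurable_funTS.
    by apply/funext => t; rewrite patchE mem_setE in_itv.
  - have [B DB] := @continuous_bounded R (D X) 0 M (@D_continuous R X).
    by exists B => t /andP[t0 tM]; rewrite tM /Dp t0 DB// t0.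
  - by move=> t; rewrite /Dp; case: ifP => //; case: ifP => // t0 tM; rewrite tM.
apply: (int1_le _ (int1D i2 i1)); first exact: measurable_funM.
move=> t; rewrite /Dp; case: ifP => t0; last by rewrite mulr0 normr0.
have D0 := D_ge0 X t0.
have [tM|Mt] := leP t M; last by rewrite GM ?sradius_a// mul0r normr0.
rewrite normrM (ger0_norm D0) [leRHS]ger0_norm; last by rewrite addr_ge0// mulr_ge0 ?sqr_ge0.
rewrite -[X in _ + X]mul1r -mulrDl ler_wpM2r//.
rewrite -(real_normK (num_real (G _))); have := sqr_ge0 (`|G (a_ X t)| - 1); have := normr_ge0 (G (a_ X t)).
by move: `|_| => y; nra.
Qed.

End TestFunctions.

Section ComplexProducts.
Variable R : realType.
Local Notation C := (Cplx R).
Implicit Types z w : C.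

Lemma reM z w : re (z * w) = re z * re w - im z * im w.
Proof. by case: z; case: w. Qed.

Lemma imM z w : im (z * w) = re z * im w + im z * re w.
Proof. by case: z; case: w. Qed.

Lemma re_ofR (x : R) : re (ofR x) = x. Proof. by []. Qed.

Lemma im_ofR (x : R) : im (ofR x) = 0. Proof. by []. Qed.

Lemma re_Complex (x y : R) : re (Complex x y : C) = x. Proof. by []. Qed.

Lemma im_Complex (x y : R) : im (Complex x y : C) = y. Proof. by []. Qed.

Lemma cexp_imaginary (x : R) : cexp (ImUnit R * ofR x) = Complex (cos x) (sin x).
Proof.
have e1 : re (ImUnit R * ofR x) = 0 by rewrite reM /= mul0r mulr0 subrr.
have e2 : im (ImUnit R * ofR x) = x by rewrite imM /= mul0r mul1r add0r.
by rewrite /cexp e1 e2 expR0 !mul1r.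
Qed.

Lemma Cplx_eta z : z = Complex (re z) (im z). Proof. by case: z. Qed.

Lemma measurable_invX2 : measurable_fun [set: R] (fun x : R => x ^- 2).
Proof.
apply: measurable_isolated_discontinuities => l.
have : \forall y \near l, y != l -> y != 0.
  have [->|l0] := eqVneq l 0; first by exists 1 => //= y _.
  have : \forall y \near l, `|l - y| < `|l| by apply: (nbhsx_ballx l _ _); rewrite normr_gt0.
  by apply: filterS => y h _; apply: contraTneq h => ->; rewrite subr0 ltxx.
apply: filterS => y h /h y0; apply: cvgV; first by rewrite expf_neq0.
exact: exprn_continuous.
Qed.

End ComplexProducts.

Lemma Rintegral_eq0 d (T : measurableType d) (R : realType) (m : {measure set T -> \bar R}) (A : set T) (g : T -> R) :
  (forall x, g x = 0) -> \int[m]_(x in A) g x = 0.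
Proof. by move=> g0; rewrite /Rintegral integral0_eq// => x _; rewrite g0. Qed.

(** The indicator of the lifted set is radial, so the polar formula computes its measure from the
    null set on the half-line. *)
Lemma lift_negligible (R : realType) (X : rankOneSpace R) (kap mu : {measure set (Borel X) -> \bar R}) (N : set R) :
  is_haar_K kap -> is_invariant_measure kap mu -> compact (@maxK R X) ->
  (@lebesgue_measure R).-negligible N -> mu.-negligible ([set x | N (sradius x)] : set (Borel X)).
Proof.
move=> kapP muP cK [N' [mN' N'0 NN']].
have mB : measurable ([set x | N' (sradius x)] : set (Borel X)).
  rewrite -[X in measurable X]setTI; exact: (sradius_measurable kapP muP cK).
exists [set x | N' (sradius x)]; split=> //; last by move=> x; exact: NN'.
have memE (y : X) : (y \in [set x | N' (sradius x)]) = (sradius y \in N') by apply/idP/idP; rewrite !inE.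
have := polar_radial kapP muP (G := fun x => (\1_([set x | N' (sradius x)] : set (Borel X)) x)%:E).
rewrite integral_indic// setIT => -> //; last 2 first.
- by move=> k1 k2 y kK1 kK2; rewrite !indicE !memE (sradius_K kapP muP cK).
- by apply/measurable_EFinP; exact: measurable_indic.
rewrite (_ : integral _ _ _ = 0%E) ?mule0//.
have mN : measurable_fun [set: R] (fun t : R => \1_N' t * D X t).
  by apply: measurable_funM; [exact: measurable_indic|apply: continuous_measurable_fun; exact: D_continuous].
transitivity (\int[@lebesgue_measure R]_(t in `[0%R, +oo[) (\1_N' t * D X t)%:E)%E.
  apply: eq_integral => t; rewrite inE /= in_itv /= andbT => t0.
  by rewrite !indicE memE (sradius_a X t0).
rewrite (@ae_eq_integral _ _ R lebesgue_measure `[0%R, +oo[ (cst 0%E)) ?integral0//.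
  by apply/measurable_EFinP; exact: measurable_funTS.
exists N'; split=> // t /=; apply: contra_notP => nt _; rewrite indicE.
by rewrite memNset// mul0r.
Qed.

(** * Pointwise convergence *)

Section Pointwise.
Variables (R : realType) (X : rankOneSpace R).
Local Notation K := (@maxK R X).
Local Notation C := (Cplx R).
Local Notation leb := (@lebesgue_measure R).
Variables (kap mu : {measure set (Borel X) -> \bar R}) (cfun : C -> C) (c s : R).
Hypothesis kapP : is_haar_K kap.
Hypothesis muP : is_invariant_measure kap mu.
Hypothesis cP : is_c_function kap cfun.
Hypothesis invP : is_inversion_constant kap mu cfun c.
Hypothesis s12 : 1 / 2 < s.
Hypothesis cK : compact K.

(** [sph_transform] is c0 times [hat], so the constant of the polar formula is absorbed into the
    density. *)
Let dens (l : R) : R := c0 muP * cabs (cfun (ofR l)) ^- 2.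
Local Notation phi := (sphi kap).
Local Notation ht := (hat phi (D X)).
Local Notation wd := (wp dens).

Lemma dens_ge0 l : 0 <= dens l.
Proof. by rewrite mulr_ge0 ?(ltW (c0_gt0 muP))// invr_ge0 sqr_ge0. Qed.

Lemma dens_measurable : measurable_fun [set: R] dens.
Proof.
apply: measurable_funM => //.
have mc : measurable_fun [set: R] (fun l : R => cabs (cfun (ofR l))).
  by apply: measurable_isolated_discontinuities => l; exact: (meromorphic_continuous l cP.1).
exact: (measurableT_comp (@measurable_invX2 R) mc).
Qed.

Lemma inversion_test F : test (Tt X) F -> forall t, 0 <= t ->
  F (Tt X t) = c * \int[leb]_l (ht (fun t => F (Tt X t)) l * wd l * kern phi l t).
Proof.
move=> [sF [M M0 FM]] t t0.
have [c00 inv] := invP.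
have := inv (radial_fun F) (radial_fun_smooth sF) (radial_fun_compact kapP muP cK M0 FM) (@radial_fun_radial _ _ F) (a_ X t).
move=> /(congr1 (@re R)); rewrite reM re_ofR im_ofR mul0r subr0 => E.
have mre : measurable_fun [set: Borel X] (fun x : Borel X => re (@radial_fun R X F x)).
  apply: Borel_continuous => x; apply: (@cvg_comp _ _ _ (@tau R X) F _ (nbhs (tau x))); first exact: tau_continuous.
  exact: smooth1_continuous.
have mim : measurable_fun [set: Borel X] (fun x : Borel X => im (@radial_fun R X F x)) by exact: measurable_cst.
move: E; rewrite {1}/radial_fun re_ofR tau_a => ->.
congr (_ * _); rewrite /cintegral re_Complex Rintegral_half_line; apply: eq_Rintegral => l _.
rewrite /wp /kern; case: ifP => l0; last by rewrite mulr0 mul0r.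
rewrite (sph_transform_hat kapP muP cK _ (@radial_fun_radial _ _ F) mre mim) (sph_sradius kapP muP cK).
rewrite (sradius_a X t0) (ger0_norm t0) /dens.
have -> : (fun t => re (radial_fun F (a_ X t))) = (fun t => F (Tt X t)) by apply/funext => u; rewrite /radial_fun tau_a.
by rewrite !reM !imM !re_ofR !im_ofR !re_Complex !im_Complex; ring.
Qed.

Let s12' : 2^-1 < s. Proof. by move: s12; rewrite div1r. Qed.

Let inv_ae := @inversion_ae R (rho X) c s phi (sphi1 kap) (sphi2 kap) (pcoef X) (D X) (Tt X) dens
  (rho_gt0 X) invP.1 s12' (dsphi kapP cK) (dsphi1 kapP cK) (sphi_ode kapP muP cK) (pcoef_ge0 X)
  (@pcoef_le R X) (sphi_le1 kapP muP cK) (sphi1_le kapP muP cK) (sphi0 kapP) (sphi_lcontinuous kapP cK)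
  (@D_continuous R X) (D_gt0 X) (D_ge0 X) (D_le X) (@Tt_continuous R X) (Tt_lt X) (@Tt_lip R X)
  dens_ge0 dens_measurable inversion_test.

Let hk_bound := @hat_kern_bound R (rho X) c s phi (sphi1 kap) (sphi2 kap) (pcoef X) (D X) (Tt X) dens
  (rho_gt0 X) invP.1 s12' (dsphi kapP cK) (dsphi1 kapP cK) (sphi_ode kapP muP cK) (pcoef_ge0 X)
  (@pcoef_le R X) (sphi_le1 kapP muP cK) (sphi1_le kapP muP cK) (sphi0 kapP) (sphi_lcontinuous kapP cK)
  (@D_continuous R X) (D_gt0 X) (D_ge0 X) (D_le X) (@Tt_continuous R X) (Tt_lt X) (@Tt_lip R X)
  dens_ge0 dens_measurable inversion_test.

Let ht_measurable := @hat_measurable R (rho X) phi (sphi1 kap) (D X)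
  (rho_gt0 X) (dsphi kapP cK) (sphi_le1 kapP muP cK) (sphi1_le kapP muP cK) (sphi_lcontinuous kapP cK).

Let kernm := @kern_measurable R (rho X) phi (sphi1 kap)
  (rho_gt0 X) (dsphi kapP cK) (sphi1_le kapP muP cK) (sphi_lcontinuous kapP cK).

Lemma compact_support_sradius (f : X -> C) : compactly_supported f -> exists M : R, forall x, M < sradius x -> f x = 0.
Proof.
move=> [A cA fA].
have /compact_bounded[B [_ tB]] : compact (@tau R X @` A).
  by apply: continuous_compact => //; apply: continuous_subspaceT; exact: tau_continuous.
have [t t0 Bt] := Tt_unbounded X (B + 1).
exists t => x tx; apply: fA => Ax.
have := tB (B + 1) ltac:(lra) _ (ex_intro2 _ _ x Ax erefl).
have := Tt_lt X (ltW t0) tx; rewrite -(tau_sradius kapP muP cK); have := ler_norm (tau x).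
by move=> h1 h2 /= h3; lra.
Qed.

Lemma profile_int1 (f : X -> C) (part : C -> R) :
  (forall z, part z ^+ 2 <= cabs z ^+ 2) -> part 0 = 0 ->
  radial f -> square_integrable mu f -> compactly_supported f ->
  measurable_fun [set: Borel X] (fun x : Borel X => part (f x)) ->
  int1 (fun t => part (f (a_ X t)) * Dp (D X) t).
Proof.
move=> part2 part0 rf [mre mim f2] cf mf; have [M fM] := compact_support_sradius cf.
have mcabs : measurable_fun [set: Borel X] (fun x : Borel X => cabs (f x) ^+ 2).
  rewrite (_ : (fun x => _) = (fun x => re (f x) ^+ 2 + im (f x) ^+ 2)); last by apply/funext => x; rewrite cabsE2.
  by apply: measurable_funD; exact: measurable_funX.
apply: (Rprofile_int1 kapP muP (G := fun x => part (f x)) (M := M)) => //.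
- by move=> k1 k2 y kK1 kK2; rewrite rf.
- apply: le_lt_trans f2; apply: ge0_le_integral => //.
  + by move=> x _; rewrite lee_fin sqr_ge0.
  + by apply/measurable_EFinP; exact: measurable_funX.
  + by apply/measurable_EFinP.
  + by move=> x _; rewrite lee_fin.
- by move=> x /fM ->.
Qed.

Variable f : X -> C.
Hypothesis fS : radial_sobolev kap mu cfun s f.
Hypothesis fc : compactly_supported f.
Let h1 t := re (f (a_ X t)).
Let h2 t := im (f (a_ X t)).

Let rf : radial f. Proof. by case: fS. Qed.
Let mre : measurable_fun [set: Borel X] (fun x : Borel X => re (f x)). Proof. by case: fS => _ []. Qed.
Let mim : measurable_fun [set: Borel X] (fun x : Borel X => im (f x)). Proof. by case: fS => _ []. Qed.

Lemma h1_int1 : int1 (fun t => h1 t * Dp (D X) t).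
Proof.
by case: fS => _ f2 _; apply: profile_int1 => // z; rewrite cabsE2 lerDl sqr_ge0.
Qed.

Lemma h2_int1 : int1 (fun t => h2 t * Dp (D X) t).
Proof.
by case: fS => _ f2 _; apply: profile_int1 => // z; rewrite cabsE2 lerDr sqr_ge0.
Qed.

Lemma transformE l : sph_transform kap mu f l = Complex (c0 muP * ht h1 l) (c0 muP * ht h2 l).
Proof. exact: sph_transform_hat. Qed.

(** To be applied to the real and imaginary profiles [h1] and [h2]: the Sobolev integral of f is c0
    times that of the sum of the two squared transforms. *)
Lemma sobolev_int1 (h : R -> R) : int1 (fun t => h t * Dp (D X) t) ->
  (forall l, ht h l ^+ 2 <= ht h1 l ^+ 2 + ht h2 l ^+ 2) ->
  int1 (fun l => sob (rho X) s l * ht h l ^+ 2 * wd l).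
Proof.
move=> ih hle; have c00 := c0_gt0 muP; have [_ _ fs] := fS.
have sob0 l : 0 <= sob (rho X) s l by rewrite ltW// sob_gt0// rho_gt0.
have mq (u : R -> R) : measurable_fun [set: R] u ->
    measurable_fun [set: R] (fun l => sob (rho X) s l * u l * dens l).
  by move=> mu'; apply: measurable_funM dens_measurable; apply: measurable_funM mu'; exact: sob_measurable.
have q0 l : 0 <= sob (rho X) s l * ht h l ^+ 2 * dens l.
  by rewrite mulr_ge0 ?dens_ge0// mulr_ge0 ?sqr_ge0.
rewrite (_ : (fun l => _) = (fun l => if 0 <= l then sob (rho X) s l * ht h l ^+ 2 * dens l else 0)); last first.
  by apply/funext => l; rewrite /wp; case: ifP => // _; rewrite mulr0.
have m1 := measurable_funX 2 (ht_measurable h1_int1).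
have m2 := measurable_funX 2 (ht_measurable h2_int1).
apply: int1_half_line => //; first by apply: mq; apply: measurable_funX; exact: ht_measurable.
pose q l := sob (rho X) s l * (ht h1 l ^+ 2 + ht h2 l ^+ 2) * dens l.
have q0' l : 0 <= q l by rewrite mulr_ge0 ?dens_ge0// mulr_ge0// addr_ge0 ?sqr_ge0.
have mq' : measurable_fun [set: R] q by apply: mq; exact: measurable_funD.
apply: (@le_lt_trans _ _ (\int[leb]_(l in `[0%R, +oo[) (q l)%:E)%E).
  apply: ge0_le_integral => //.
  - by move=> l _; rewrite lee_fin.
  - by apply/measurable_EFinP; apply: measurable_funTS; apply: mq; apply: measurable_funX; exact: ht_measurable.
  - by apply/measurable_EFinP; exact: measurable_funTS.
  - by move=> l _; rewrite lee_fin /q ler_wpM2r ?dens_ge0// ler_wpM2l.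
move: fs; rewrite (_ : (fun l => _) = (fun l => (c0 muP)%:E * (q l)%:E)%E); last first.
  apply/funext => l; rewrite transformE cabsE2 re_Complex im_Complex -EFinM /q /sob /dens; congr EFin.
  by ring.
rewrite ge0_integralZl//; last 3 first.
- by apply/measurable_EFinP; exact: measurable_funTS.
- by move=> l _; rewrite lee_fin.
- by rewrite lee_fin ltW.
by case: (integral _ _ _) => [x| |]//; rewrite ?ltry ?ltNyy// gt0_muley ?lte_fin.
Qed.

Lemma h1_sobolev : int1 (fun l => sob (rho X) s l * ht h1 l ^+ 2 * wd l).
Proof. by apply: sobolev_int1 h1_int1 _ => l; rewrite lerDl sqr_ge0. Qed.

Lemma h2_sobolev : int1 (fun l => sob (rho X) s l * ht h2 l ^+ 2 * wd l).
Proof. by apply: sobolev_int1 h2_int1 _ => l; rewrite lerDr sqr_ge0. Qed.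

Lemma hat_kern_int1 h t : 0 < t -> int1 (fun t => h t * Dp (D X) t) ->
  int1 (fun l => sob (rho X) s l * ht h l ^+ 2 * wd l) -> int1 (fun l => ht h l * wd l * kern phi l t).
Proof.
move=> t0 ih iS; have [M hM] := hk_bound t t0 ih iS.
apply/integrableP; split.
  apply/measurable_EFinP; apply: measurable_funM (kernm t).
  by apply: measurable_funM (ht_measurable ih) _; exact: half_line_measurable dens_measurable.
by apply: le_lt_trans (hM t _) _; rewrite ?lexx ?ltry.
Qed.

(** Away from radius 0 the integrands [A h1] and [A h2] are absolutely integrable, which allows the
    complex integral to be split into four real ones. *)
Lemma schrodingerE (a y : R) x : 0 < sradius x ->
  let A h l := ht h l * wd l * kern phi l (sradius x) in
  let m l := (l ^+ 2 + rho X ^+ 2) `^ (a / 2) in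
  schrodinger kap mu cfun a c f y x =
  Complex (c * (\int[leb]_l (A h1 l * cos (y * m l)) - \int[leb]_l (A h2 l * sin (y * m l))))
          (c * (\int[leb]_l (A h1 l * sin (y * m l)) + \int[leb]_l (A h2 l * cos (y * m l)))).
Proof.
move=> x0 A m; have i1 := hat_kern_int1 x0 h1_int1 h1_sobolev; have i2 := hat_kern_int1 x0 h2_int1 h2_sobolev.
have mm : measurable_fun [set: R] m.
  by apply: (measurableT_comp (measurable_powR (a / 2))); exact: measurable_funD.
have osc (g : R -> R) B : continuous g -> (forall u, `|g u| <= 1) -> int1 B -> int1 (fun l => B l * g (y * m l)).
  move=> cg g1 iB; apply: int1M => //.
  by apply: (measurableT_comp (continuous_measurable_fun cg)); exact: measurable_funM.
have cosb u : `|cos u| <= 1 :> R by exact: cos_max.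
have sinb u : `|sin u| <= 1 :> R by exact: sin_max.
have oc := osc _ _ (@continuous_cos R) cosb; have os := osc _ _ (@continuous_sin R) sinb.
rewrite /schrodinger [LHS]Cplx_eta reM imM re_ofR im_ofR mul0r subr0 mul0r addr0 /cintegral re_Complex im_Complex.
have EB := RintegralB measurableT (oc _ i1) (os _ i2).
have ED := RintegralD measurableT (os _ i1) (oc _ i2).
rewrite -EB -ED.
congr (Complex (_ * _) (_ * _)); rewrite Rintegral_half_line; apply: eq_Rintegral => l _.
  rewrite /A /wp /kern; case: ifP => l0; last by rewrite !mulr0 !mul0r subrr.
  rewrite transformE (sph_sradius kapP muP cK) cexp_imaginary !(reM, imM, re_ofR, im_ofR, re_Complex, im_Complex).
  by rewrite (ger0_norm (ltW x0)) /dens /m; ring.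
rewrite /A /wp /kern; case: ifP => l0; last by rewrite !mulr0 !mul0r addr0.
rewrite transformE (sph_sradius kapP muP cK) cexp_imaginary !(reM, imM, re_ofR, im_ofR, re_Complex, im_Complex).
by rewrite (ger0_norm (ltW x0)) /dens /m; ring.
Qed.

Lemma schrodinger_cvg (a : R) x : 0 < sradius x ->
  h1 (sradius x) = inv_hat c phi (D X) dens h1 (sradius x) ->
  h2 (sradius x) = inv_hat c phi (D X) dens h2 (sradius x) ->
  (fun y : R => schrodinger kap mu cfun a c f y x) @ 0^' --> f x.
Proof.
move=> x0 e1 e2; pose A h l := ht h l * wd l * kern phi l (sradius x).
pose m l := (l ^+ 2 + rho X ^+ 2) `^ (a / 2).
have i1 : int1 (A h1) := hat_kern_int1 x0 h1_int1 h1_sobolev.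
have i2 : int1 (A h2) := hat_kern_int1 x0 h2_int1 h2_sobolev.
have mm : measurable_fun [set: R] m.
  by apply: (measurableT_comp (measurable_powR (a / 2))); exact: measurable_funD.
have cosb u : `|cos u| <= 1 :> R by exact: cos_max.
have sinb u : `|sin u| <= 1 :> R by exact: sin_max.
have lc B (iB : int1 B) := oscillatory_cvg iB mm (@continuous_cos R) cosb.
have ls B (iB : int1 B) := oscillatory_cvg iB mm (@continuous_sin R) sinb.
have c1 (B : R -> R) : (fun l => B l * cos 0) = B by apply/funext => l; rewrite cos0 mulr1.
have s1 (B : R -> R) : (fun l => B l * sin 0) = cst 0 by apply/funext => l; rewrite sin0 mulr0.
have I0 : \int[leb]_l (cst 0 l : R) = 0 by rewrite /Rintegral integral0.
have fx : f x = Complex (h1 (sradius x)) (h2 (sradius x)).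
  by rewrite (radialE kapP muP cK (G := f) x)// [LHS]Cplx_eta.
have lim : (fun y : R => schrodinger kap mu cfun a c f y x) @ (0 : R) --> f x.
  rewrite (_ : (fun y => _) = (fun y =>
    Complex (c * (\int[leb]_l (A h1 l * cos (y * m l)) - \int[leb]_l (A h2 l * sin (y * m l))))
            (c * (\int[leb]_l (A h1 l * sin (y * m l)) + \int[leb]_l (A h2 l * cos (y * m l)))))); last first.
    by apply/funext => y; rewrite schrodingerE.
  rewrite fx e1 e2 /inv_hat; apply: cvg_Complex; (apply: cvgM; first exact: cvg_cst).
    rewrite -[X in _ --> X]subr0 -[X in _ --> _ - X]I0 -(s1 (A h2)) -[X in _ --> (\int[_]_l X l - _)]c1.
    by apply: cvgB; [exact: lc|exact: ls].
  rewrite -[X in _ --> X]add0r -[X in _ --> X + _]I0 -(s1 (A h1)) -[X in _ --> (_ + \int[_]_l X l)]c1.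
  by apply: cvgD; [exact: ls|exact: lc].
by apply: cvg_trans lim; apply: cvg_app; exact: cvg_within.
Qed.

(** The exceptional points have radius 0, or a radius at which the inversion of [h1] or of [h2]
    fails. *)
Lemma ae_cvg (a : R) : {ae mu, forall x : Borel X,
  (fun y : R => schrodinger kap mu cfun a c f y x) @ 0^' --> f x}.
Proof.
have ae0 : leb.-negligible [set (0 : R)] by apply/negligibleP => //; exact: lebesgue_measure_set1.
have ae1 := inv_ae h1_int1 h1_sobolev; have ae2 := inv_ae h2_int1 h2_sobolev.
have := lift_negligible kapP muP cK (negligibleU ae0 (negligibleU ae1 ae2)).
apply: negligibleS => x /= nx.
have [r0|r0] := eqVneq (sradius x) 0; first by left.
have rp : 0 < sradius x by rewrite lt_neqAle eq_sym r0 sradius_ge0.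
right; apply: contrapT => /not_orP[/contrapT e1 /contrapT e2]; apply: nx.
by apply: schrodinger_cvg => //; [exact: e1|exact: e2].
Qed.

End Pointwise.

Theorem theoremA (R : realType) (X : rankOneSpace R)
    (kap mu : {measure set (Borel X) -> \bar R})
    (cfun : Cplx R -> Cplx R) (c a s : R) (f : X -> Cplx R) :
  is_haar_K kap ->
  is_invariant_measure kap mu ->
  is_c_function kap cfun ->
  is_inversion_constant kap mu cfun c ->
  1 < a ->
  1 / 2 < s ->
  radial_sobolev kap mu cfun s f ->
  compactly_supported f ->
  {ae mu, forall x : Borel X,
    (fun t : R => schrodinger kap mu cfun a c f t x) @ 0^' --> f x}.
Proof.
move=> kapP muP cP invP _ s12 fS fc.
(* The zero function is treated apart, since compactness of K will come from a point where f does
   not vanish. *)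
have [f0|] := pselect (forall x, f x = 0).
  have T0 l : sph_transform kap mu f l = 0.
    by rewrite /sph_transform /cintegral !Rintegral_eq0// => x; rewrite f0 mul0r.
  apply: aeW => x; rewrite f0 (_ : (fun t => _) = cst 0); first exact: cvg_cst.
  apply/funext => t; rewrite /schrodinger /cintegral !Rintegral_eq0 ?mulr0// => l; rewrite T0 !mul0r//.
move=> /existsNP[x0 fx0].
(* By right invariance f is nonzero on x0 K, so x0 K lies in the compact set outside which f
   vanishes; as K is closed, it is compact. *)
have cK : compact (@maxK R X).
  have [A cA fA] := fc.
  have cL : compact ((fun x => x0^-1 * x)%g @` A).
    by apply: continuous_compact => //; apply: continuous_subspaceT; exact: mulgl_continuous.
  apply: (subclosed_compact (@maxK_closed R X) cL) => k kK; exists (x0 * k)%g; last by rewrite mulKg.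
  apply: contrapT => /fA fxk; apply: fx0; have [rf _ _] := fS.
  by rewrite -(rf 1%g k x0 (maxK1 X) kK) mul1g.
exact: (ae_cvg kapP muP cP invP s12 cK fS fc).
Qed.
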